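(* Assume the standing assumptions, $\alpha_0<0$, and that $(\alpha_n)$ is generic. Then every $\Psi\in L^2(\mathbb R^3)$ is a scattering state of $H_{\alpha(t)}$: for every $R>0$, $$\lim_{t\to\infty}\frac1t\int_0^t\big\|F(|\vec x|\le R)\,U(\tau,0)\Psi\big\|^2\,d\tau=0,$$ where $F(|\vec x|\le R)$ denotes multiplication by the characteristic function of the ball $\{|\vec x|\le R\}$.
   Context: Let $H_0=-\Delta$ on $L^2(\mathbb R^3)$, $U_0(t)=e^{-iH_0t}$ with kernel $U_0(t;\vec x)=(4\pi it)^{-3/2}e^{i|\vec x|^2/(4t)}$. For $\lambda>0$, $\mathcal G^\lambda(\vec x)=e^{-\sqrt\lambda|\vec x|}/(4\pi|\vec x|)$. For $a\in\mathbb R$, $H_a$ is the point interaction at the origin of strength $a$: domain $\{\Psi\in L^2(\mathbb R^3):\exists q\in\mathbb C,\ \Psi-q\mathcal G^\lambda\in H^2(\mathbb R^3),\ (\Psi-q\mathcal G^\lambda)(0)=(a+\sqrt\lambda/(4\pi))q\}$, $(H_a+\lambda)\Psi=(H_0+\lambda)(\Psi-q\mathcal G^\lambda)$. Standing assumptions: $\alpha:\mathbb R\to\mathbb R$ continuous and $T$-periodic, $\omega=2\pi/T$, $\alpha(t)=\sum_n\alpha_ne^{-in\omega t}$, $(\alpha_n)\in\ell^1(\mathbb Z)$, $\alpha_n=\overline{\alpha_{-n}}$, $\alpha(0)<0$. Dynamics: $H_{\alpha(t)}$ generates a unitary propagator $U(t,s)$ on $L^2(\mathbb R^3)$ solving $i\partial_t\Psi_t=H_{\alpha(t)}\Psi_t$;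 explicitly $U(t,0)\Psi_0=U_0(t)\Psi_0+i\int_0^tq(\tau)U_0(t-\tau;\cdot)d\tau$, where $q$ is the unique solution of $q(t)+4\sqrt{\pi i}\int_0^t\frac{\alpha(\tau)q(\tau)}{\sqrt{t-\tau}}d\tau=4\sqrt{\pi i}\int_0^t\frac{(U_0(\tau)\Psi_0)(0)}{\sqrt{t-\tau}}d\tau$. Genericity: with $\tilde\alpha=(\alpha_1,\alpha_2,\dots)\in\ell^1(\mathbb N)$ and the shift $(\mathcal Ta)_n=a_{n+1}$ on $\ell^1(\mathbb N)$, $(\alpha_n)$ is generic if $e_1=(1,0,0,\dots)$ lies in the $\ell^1(\mathbb N)$-closure of the linear span of $\{\mathcal T^n\tilde\alpha:n\ge0\}$. *)

(* Defs.v *)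
From HB Require Import structures.
From mathcomp Require Import all_boot all_order all_algebra.
From mathcomp Require Import all_classical all_reals all_analysis.
From mathcomp Require Import complex.
Set Implicit Arguments. Unset Strict Implicit. Unset Printing Implicit Defensive.
Import Order.TTheory GRing.Theory Num.Theory.
Import numFieldNormedType.Exports.
Local Open Scope classical_set_scope.
Local Open Scope ring_scope.

Section Defs.
Variable R : realType.

Definition pt := ((R * R) * R)%type.
Definition leb3 : set pt -> \bar R :=
  ((@lebesgue_measure R \x @lebesgue_measure R) \x @lebesgue_measure R)%E.
Definition leb1 : set R -> \bar R := @lebesgue_measure R.

Definition ptsub (x y : pt) : pt :=
  ((x.1.1 - y.1.1, x.1.2 - y.1.2), x.2 - y.2).
Definition nrm2 (x : pt) : R := x.1.1 ^+ 2 + x.1.2 ^+ 2 + x.2 ^+ 2.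
Definition nrm (x : pt) : R := Num.sqrt (nrm2 x).

Definition C := R[i].
Definition cre (z : C) : R := complex.Re z.
Definition cim (z : C) : R := complex.Im z.
Definition cR (r : R) : C := Complex r 0.
Definition iC : C := Complex 0 1.
Definition cabs2 (z : C) : R := cre z ^+ 2 + cim z ^+ 2.
Definition cabs (z : C) : R := Num.sqrt (cabs2 z).
Definition expi (th : R) : C := Complex (cos th) (sin th).

Definition cint3 (D : set pt) (f : pt -> C) : C :=
  Complex (Rintegral leb3 D (fun x => cre (f x))) (Rintegral leb3 D (fun x => cim (f x))).
Definition cint1 (D : set R) (f : R -> C) : C :=
  Complex (Rintegral leb1 D (fun x => cre (f x))) (Rintegral leb1 D (fun x => cim (f x))).

Definition L2 (f : pt -> C) : Prop :=
  measurable_fun setT (fun x => cre (f x)) /\ measurable_fun setT (fun x => cim (f x)) /\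
  (\int[leb3]_(x in setT) (cabs2 (f x))%:E < +oo)%E.
Definition norm2 (f : pt -> C) : R := Rintegral leb3 setT (fun x => cabs2 (f x)).

Definition ccvg_right0 (F : R -> C) (l : C) : Prop :=
  (cre (F e) @[e --> 0^'+] --> cre l) /\ (cim (F e) @[e --> 0^'+] --> cim l).
Definition ccvg_seq (u : nat -> C) (l : C) : Prop :=
  (cre (u N) @[N --> \oo] --> cre l) /\ (cim (u N) @[N --> \oo] --> cim l).

(** Principal branches: (4 pi i t)^(-3/2) = (4 pi t)^(-3/2) e^{-3 i pi/4}
    and sqrt(pi i) = sqrt(pi) e^{i pi/4}, for t > 0. *)
Definition c32 (t : R) : C := cR ((4 * pi * t) `^ (- (3 / 2))) * expi (- (3 * pi / 4)).
Definition sqrtpii : C := cR (Num.sqrt pi) * expi (pi / 4).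

Definition U0ker (t : R) (x : pt) : C := c32 t * expi (nrm2 x / (4 * t)).
(** (U_0(t) Psi)(x) = int U_0(t; x - y) Psi(y) dy  (for Psi integrable). *)
Definition U0app (t : R) (Psi : pt -> C) (x : pt) : C :=
  cint3 setT (fun y => U0ker t (ptsub x y) * Psi y).

(** Gaussian e^{-|x-b|^2}; the linear span of these is dense in L^2(R^3). *)
Definition gauss (b : pt) (x : pt) : C := cR (expR (- nrm2 (ptsub x b))).
Definition pairing (g h : pt -> C) : C := cint3 setT (fun x => g x * h x).

Definition fourier_partial (a : int -> C) (w t : R) (N : nat) : C :=
  \sum_(k < (2 * N).+1)
     a (k%:Z - N%:Z) * expi (- ((k%:Z - N%:Z)%:~R * w * t)).
Definition abs_partial (a : int -> C) (N : nat) : R :=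
  \sum_(k < (2 * N).+1) cabs (a (k%:Z - N%:Z)).

(** Genericity: e_1 lies in the l^1(N)-closure of span{T^n alpha~ : n >= 0},
    where alpha~ = (alpha_1, alpha_2, ...). Coordinates of l^1(N) are indexed
    here by k = 0,1,2,... (k-th coordinate of alpha~ is alpha_{k+1}). *)
Definition generic (a : int -> C) : Prop :=
  forall eps : R, 0 < eps ->
    exists (N : nat) (c : nat -> C), forall M : nat,
      \sum_(k < M) cabs (((k : nat) == 0%N)%:R - \sum_(j < N) c j * a (k + j + 1)%N%:Z) <= eps.

Definition origin : pt := ((0, 0), 0).
Definition volterra (alpha : R -> R) (Psi0 : pt -> C) (q : R -> C) : Prop :=
  forall s : R, 0 <= s ->
    q s + 4%:R * sqrtpii *
      cint1 `[0, s] (fun tau => cR (alpha tau) * q tau / cR (Num.sqrt (s - tau)))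
    = 4%:R * sqrtpii *
      cint1 `[0, s] (fun tau => U0app tau Psi0 origin / cR (Num.sqrt (s - tau))).

Definition duhamel_trunc (q : R -> C) (t eps : R) (x : pt) : C :=
  cint1 `[0, t - eps] (fun tau => q tau * U0ker (t - tau) x).

(** U : R -> (pt -> C) -> (pt -> C), U t = U(t,0), is the propagator of
    H_{alpha(t)}: for t >= 0 it is a linear isometry of L^2(R^3) (functions
    modulo a.e. equality), U(0,0) = id, and for Gaussian initial data it is
    given by the explicit formula
      U(t,0)Psi0 = U_0(t)Psi0 + i int_0^t q(tau) U_0(t - tau; .) dtau,
    q the solution of the Volterra equation, where the tau-integral is
    understood as the limit eps -> 0+ of int_0^{t-eps}, in the weak
    (distributional) sense, tested against Gaussians. *)
Definition is_propagator (alpha : R -> R) (U : R -> (pt -> C) -> (pt -> C)) : Prop :=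
  (forall t Psi, 0 <= t -> L2 Psi -> L2 (U t Psi)) /\
      (forall t Psi Phi (c : C), 0 <= t -> L2 Psi -> L2 Phi ->
         {ae leb3, forall x, U t (fun y => Psi y + c * Phi y) x = U t Psi x + c * U t Phi x}) /\
      (forall t Psi Phi, 0 <= t -> L2 Psi -> L2 Phi ->
         {ae leb3, forall x, Psi x = Phi x} -> {ae leb3, forall x, U t Psi x = U t Phi x}) /\
      (forall t Psi, 0 <= t -> L2 Psi -> norm2 (U t Psi) = norm2 Psi) /\
      (forall Psi, L2 Psi -> {ae leb3, forall x, U 0 Psi x = Psi x}) /\
      (forall (t : R) (b : pt) (q : R -> C), 0 < t ->
         {within `[0, +oo[, continuous (fun s => cre (q s))} ->
         {within `[0, +oo[, continuous (fun s => cim (q s))} ->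
         volterra alpha (gauss b) q ->
         forall g : pt,
           ccvg_right0
             (fun eps => pairing (gauss g)
                (fun x => U0app t (gauss b) x + iC * duhamel_trunc q t eps x))
             (pairing (gauss g) (U t (gauss b)))).

End Defs.

(* Main.v *)
(** For a Gaussian initial state the charge [q] solves an Abel-type Volterra
    equation.  Damping it by [e^{-st}] and taking Fourier transforms couples the
    energies [E + n w].  For positive energies the sign of an imaginary part
    controls the symbol, genericity of [alpha] carries this control down through
    every window of length [w], and at very negative energies the symbol
    dominates: this is a lower bound uniform in [s -> 0], so [q] is square
    integrable on the half line.  The heat-regularised propagator at [y] is the
    free one plus the convolution of [q] with a kernel whose time Fourier
    transform is [O(1/|y|)] (Kato smoothing), hence [||F(|x| <= Rad) U(t,0) gauss||^2]
    is integrable in [t].  Gaussians span a dense subspace and [U(t,0)] is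
    isometric, so for every state this quantity is an integrable function of time
    up to an arbitrarily small constant, and its time averages vanish. *)
Require Import Defs.
From HB Require Import structures.
From mathcomp Require Import all_boot all_order all_algebra.
From mathcomp Require Import all_classical all_reals all_analysis.
From mathcomp Require Import measurable_realfun complex ring lra zify.
Import Order.TTheory GRing.Theory Num.Theory.
Import numFieldNormedType.Exports.
Import HBNNSimple.
Set Implicit Arguments. Unset Strict Implicit. Unset Printing Implicit Defensive.
Local Open Scope classical_set_scope.
Local Open Scope ring_scope.

(** Three obstacles shape the proof. The lower bound concerns integrable functions, while the charge
    is at the outset only known to grow at most exponentially; the damping rates at which it stays
    bounded are shown to have infimum [0], because the bound at one rate reaches slightly smaller
    rates. The propagator is described only on Gaussians of width one, and weakly, against Gaussians
    of the same width, whereas the local estimate needs arbitrarily narrow heat kernels; narrower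
    Gaussians are obtained as limits of combinations of translates, one coordinate at a time.
    Nothing makes [U t Psi] measurable in [t], so decay is expressed through a measurable integrable
    majorant. The descent in energy is one-sided: genericity approximates [1] by [p * alpha + r]
    with only positive frequencies in [p] and [r], so each energy is expressed through higher ones.
    It stops after finitely many windows, since below a fixed negative level the squared symbol
    outweighs the supremum of [alpha^2]. The loss [|y|^(-2)] in Kato smoothing is harmless because
    it is locally integrable in three dimensions. *)

Local Notation mfun := (measurable_fun setT).

Ltac pos := by repeat first
  [ done | apply: mulr_ge0 | apply: mulr_gt0 | apply: addr_ge0 | apply: divr_gt0 | apply: divr_ge0
  | apply: exprn_gt0 | apply: exprn_ge0 | rewrite invr_gt0 | rewrite invr_ge0 | rewrite sqrtr_gt0
  | apply: addr_gt0 | exact: sqrtr_ge0 | exact: expR_gt0 | exact: expR_ge0 | exact: sqr_ge0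
  | exact: pi_gt0 | exact: pi_ge0 | exact: ltr0n | exact: ler0n | exact: normr_ge0 | apply: ltW ].

Lemma le_of_eq {d} {T : porderType d} (x y : T) : x = y -> (x <= y)%O.
Proof. by move->. Qed.

(** * Complex numbers through their real and imaginary parts *)

Section ComplexNumbers.
Variable R : realType.
Implicit Types (z w : R[i]) (r s : R).

Lemma cP z w : cre z = cre w -> cim z = cim w -> z = w.
Proof. by case: z w => a b [c e] /= -> ->. Qed.
Lemma creD z w : cre (z + w) = cre z + cre w. Proof. by case: z w => a b []. Qed.
Lemma cimD z w : cim (z + w) = cim z + cim w. Proof. by case: z w => a b []. Qed.
Lemma creN z : cre (- z) = - cre z. Proof. by case: z. Qed.
Lemma cimN z : cim (- z) = - cim z. Proof. by case: z. Qed.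
Lemma creM z w : cre (z * w) = cre z * cre w - cim z * cim w.
Proof. by case: z w => a b []. Qed.
Lemma cimM z w : cim (z * w) = cre z * cim w + cim z * cre w.
Proof. by case: z w => a b []. Qed.
Lemma cre_cR r : cre (cR r) = r. Proof. by []. Qed.
Lemma cim_cR r : cim (cR r) = 0. Proof. by []. Qed.
Lemma cre_conj z : cre (conjc z) = cre z. Proof. by case: z. Qed.
Lemma cim_conj z : cim (conjc z) = - cim z. Proof. by case: z. Qed.
Lemma cre_expi r : cre (expi r) = cos r. Proof. by []. Qed.
Lemma cim_expi r : cim (expi r) = sin r. Proof. by []. Qed.
Lemma cre0 : cre (0 : R[i]) = 0. Proof. by []. Qed.
Lemma cim0 : cim (0 : R[i]) = 0. Proof. by []. Qed.
Lemma cre1 : cre (1 : R[i]) = 1. Proof. by []. Qed.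
Lemma cim1 : cim (1 : R[i]) = 0. Proof. by []. Qed.
Lemma cre_iC : cre (iC R) = 0. Proof. by []. Qed.
Lemma cim_iC : cim (iC R) = 1. Proof. by []. Qed.
Definition creE := (creD, creN, creM, cre_cR, cre_conj, cre_expi, cre0, cre1, cre_iC).
Definition cimE := (cimD, cimN, cimM, cim_cR, cim_conj, cim_expi, cim0, cim1, cim_iC).
Lemma cR0 : cR 0 = 0 :> R[i]. Proof. by []. Qed.
Lemma cR1 : cR 1 = 1 :> R[i]. Proof. by []. Qed.
Lemma cRD r s : cR (r + s) = cR r + cR s.
Proof. by apply: cP; rewrite !(creE, cimE) ?addr0. Qed.
Lemma cRN r : cR (- r) = - cR r.
Proof. by apply: cP; rewrite !(creE, cimE) ?oppr0. Qed.
Lemma cRB r s : cR (r - s) = cR r - cR s.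
Proof. by rewrite cRD cRN. Qed.
Lemma cRM r s : cR (r * s) = cR r * cR s.
Proof. by apply: cP; rewrite !(creE, cimE) /=; ring. Qed.
Lemma cR_inj r s : cR r = cR s -> r = s. Proof. by case. Qed.
Lemma cR_eq0 r : (cR r == 0) = (r == 0).
Proof. by apply/eqP/eqP => [[]|->]. Qed.
Lemma cRV r : cR r^-1 = (cR r)^-1.
Proof.
have [->|r0] := eqVneq r 0; first by rewrite cR0 !invr0.
have r0' : cR r != 0 by rewrite cR_eq0.
by apply: (mulfI r0'); rewrite mulfV// -cRM mulfV.
Qed.
Lemma cRX r n : cR (r ^+ n) = cR r ^+ n.
Proof. by elim: n => [//|n IH]; rewrite !exprS cRM IH. Qed.
Lemma cR_nat n : cR n%:R = n%:R :> R[i].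
Proof. by elim: n => [//|n IH]; rewrite -!natr1 cRD IH. Qed.
Lemma cR_sum I (l : seq I) (P : pred I) (F : I -> R) :
  cR (\sum_(i <- l | P i) F i) = \sum_(i <- l | P i) cR (F i).
Proof. by apply: big_morph; [exact: cRD|]. Qed.
Lemma cabs2E z : cabs2 z = cabs z ^+ 2.
Proof. by rewrite sqr_sqrtr// addr_ge0 ?sqr_ge0. Qed.
Lemma cabs2_ge0 z : 0 <= cabs2 z. Proof. by rewrite addr_ge0 ?sqr_ge0. Qed.
Lemma cabs_ge0 z : 0 <= cabs z. Proof. exact: sqrtr_ge0. Qed.
#[local] Hint Extern 0 (is_true (0 <= cabs _)) => solve [exact: cabs_ge0] : core.
#[local] Hint Extern 0 (is_true (0 <= cabs2 _)) => solve [exact: cabs2_ge0] : core.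
Lemma cabs_normc z : cabs z = Normc.normc z. Proof. by case: z. Qed.
Lemma cabsM z w : cabs (z * w) = cabs z * cabs w.
Proof. by rewrite !cabs_normc Normc.normcM. Qed.
Lemma cabs2M z w : cabs2 (z * w) = cabs2 z * cabs2 w.
Proof. by rewrite !cabs2E cabsM exprMn. Qed.
Lemma cabsD z w : cabs (z + w) <= cabs z + cabs w.
Proof. by rewrite !cabs_normc le_normcD. Qed.
Lemma cabsN z : cabs (- z) = cabs z.
Proof. by rewrite /cabs /cabs2 creN cimN !sqrrN. Qed.
Lemma cabs2N z : cabs2 (- z) = cabs2 z.
Proof. by rewrite !cabs2E cabsN. Qed.
Lemma cabsB z w : cabs (z - w) <= cabs z + cabs w.
Proof. by rewrite -(cabsN w) cabsD. Qed.
Lemma cabs_distC z w : cabs (z - w) = cabs (w - z).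
Proof. by rewrite -cabsN opprB. Qed.
Lemma cabs_cR r : cabs (cR r) = `|r|.
Proof. by rewrite /cabs /cabs2 /= expr0n addr0 sqrtr_sqr. Qed.
Lemma cabs_cRp r : 0 <= r -> cabs (cR r) = r.
Proof. by move=> r0; rewrite cabs_cR ger0_norm. Qed.
Lemma cabs2_cR r : cabs2 (cR r) = r ^+ 2.
Proof. by rewrite /cabs2 /= expr0n addr0. Qed.
Lemma cabs_conj z : cabs (conjc z) = cabs z.
Proof. by rewrite /cabs /cabs2 cre_conj cim_conj sqrrN. Qed.
Lemma cabs2_conj z : cabs2 (conjc z) = cabs2 z.
Proof. by rewrite !cabs2E cabs_conj. Qed.
Lemma cabs0 : cabs (0 : R[i]) = 0.
Proof. by rewrite -cR0 cabs_cR normr0. Qed.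
Lemma cabs1 : cabs (1 : R[i]) = 1.
Proof. by rewrite -cR1 cabs_cR normr1. Qed.
Lemma cabs20 : cabs2 (0 : R[i]) = 0.
Proof. by rewrite cabs2E cabs0 expr0n. Qed.
Lemma cabs_iC : cabs (iC R) = 1.
Proof. by rewrite /cabs /cabs2 /= expr0n expr1n add0r sqrtr1. Qed.
Lemma cabs_eq0 z : (cabs z == 0) = (z == 0).
Proof.
apply/eqP/eqP => [|->]; last exact: cabs0.
by rewrite cabs_normc => /Normc.eq0_normc.
Qed.
Lemma cabsV z : cabs z^-1 = (cabs z)^-1.
Proof. by rewrite !cabs_normc Normc.normcV. Qed.
Lemma cabs2V z : cabs2 z^-1 = (cabs2 z)^-1.
Proof. by rewrite !cabs2E cabsV exprVn. Qed.
Lemma cabs_sum I (l : seq I) (P : pred I) (F : I -> R[i]) :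
  cabs (\sum_(i <- l | P i) F i) <= \sum_(i <- l | P i) cabs (F i).
Proof.
elim/big_ind2 : _ => [|a x b y ax by_|//]; first by rewrite cabs0.
by apply: le_trans (cabsD _ _) _; apply: lerD.
Qed.
Lemma cabs2D z w : cabs2 (z + w) <= 2 * cabs2 z + 2 * cabs2 w.
Proof.
rewrite /cabs2 !creD !cimD.
have := sqr_ge0 (cre z - cre w); have := sqr_ge0 (cim z - cim w).
by nra.
Qed.
Lemma cabs2B z w : cabs2 (z - w) <= 2 * cabs2 z + 2 * cabs2 w.
Proof. by rewrite -(cabs2N w) cabs2D. Qed.
Lemma cre_le_cabs z : `|cre z| <= cabs z.
Proof. by rewrite -sqrtr_sqr ler_wsqrtr// lerDl sqr_ge0. Qed.
Lemma cim_le_cabs z : `|cim z| <= cabs z.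
Proof. by rewrite -sqrtr_sqr ler_wsqrtr// lerDr sqr_ge0. Qed.
Lemma cabs_le_reim z : cabs z <= `|cre z| + `|cim z|.
Proof.
rewrite -[leRHS]ger0_norm ?addr_ge0// -sqrtr_sqr ler_wsqrtr//.
rewrite sqrrD !real_normK ?num_real// /cabs2.
by rewrite lerD2r lerDl mulrn_wge0// mulr_ge0.
Qed.
Lemma cabs_expi r : cabs (expi r) = 1.
Proof. by rewrite /cabs /cabs2 /= cos2Dsin2 sqrtr1. Qed.
Lemma expi0 : expi 0 = 1 :> R[i].
Proof. by apply: cP; rewrite /= ?cos0 ?sin0. Qed.
Lemma expiD r s : expi (r + s) = expi r * expi s.
Proof. by apply: cP; rewrite !(creE, cimE) ?cosD ?sinD//; ring. Qed.
Lemma conj_expi r : conjc (expi r) = expi (- r).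
Proof. by apply: cP; rewrite !(creE, cimE) ?cosN ?sinN. Qed.
Lemma mulcconj z : z * conjc z = cR (cabs2 z).
Proof. by apply: cP; rewrite !(creE, cimE) /cabs2; ring. Qed.
Lemma conjcM z w : conjc (z * w) = conjc z * conjc w.
Proof. by apply: cP; rewrite !(creE, cimE); ring. Qed.
Lemma iC2 : iC R * iC R = -1.
Proof. by apply: cP; rewrite !(creE, cimE) /=; ring. Qed.
Definition cexp z : R[i] := cR (expR (cre z)) * expi (cim z).
Lemma cexpD z w : cexp (z + w) = cexp z * cexp w.
Proof. by rewrite /cexp creD cimD expRD expiD cRM; ring. Qed.
Lemma cabs_cexp z : cabs (cexp z) = expR (cre z).
Proof. by rewrite cabsM cabs_expi mulr1 cabs_cRp ?expR_ge0. Qed.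
Lemma cexp0 : cexp 0 = 1.
Proof. by rewrite /cexp expR0 expi0 mulr1. Qed.
Lemma cexp_cR r : cexp (cR r) = cR (expR r).
Proof. by rewrite /cexp /= expi0 mulr1. Qed.
Lemma cexp_im r : cexp (iC R * cR r) = expi r.
Proof. by rewrite /cexp !(creE, cimE) !mul0r mulr0 subrr expR0 cR1 !mul1r add0r. Qed.
End ComplexNumbers.
#[global] Hint Extern 0 (is_true (0 <= cabs _)) => solve [exact: cabs_ge0] : core.
#[global] Hint Extern 0 (is_true (0 <= cabs2 _)) => solve [exact: cabs2_ge0] : core.

(** * Measurability of complex-valued functions *)

Section ComplexIntegral.
Variable R : realType.
Context {d} {T : measurableType d}.
Implicit Types (f g : T -> R[i]) (r : T -> R).

Definition cmeas f := mfun (fun x => cre (f x)) /\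
  mfun (fun x => cim (f x)).
Lemma cmeas_eq f g : f =1 g -> cmeas f -> cmeas g.
Proof. by move=> /funext ->. Qed.
Lemma cmeasD f g : cmeas f -> cmeas g -> cmeas (fun x => f x + g x).
Proof.
move=> [fr fi] [gr gi]; split.
  by under eq_fun do rewrite creD; exact: measurable_funD.
by under eq_fun do rewrite cimD; exact: measurable_funD.
Qed.
Lemma cmeasN f : cmeas f -> cmeas (fun x => - f x).
Proof.
move=> [fr fi]; split.
  by under eq_fun do rewrite creN; exact: measurableT_comp.
by under eq_fun do rewrite cimN; exact: measurableT_comp.
Qed.
Lemma cmeasB f g : cmeas f -> cmeas g -> cmeas (fun x => f x - g x).
Proof. by move=> mf mg; apply: cmeasD => //; exact: cmeasN. Qed.
Lemma cmeasM f g : cmeas f -> cmeas g -> cmeas (fun x => f x * g x).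
Proof.
move=> [fr fi] [gr gi]; split.
  by under eq_fun do rewrite creM; apply: measurable_funB; exact: measurable_funM.
by under eq_fun do rewrite cimM; apply: measurable_funD; exact: measurable_funM.
Qed.
Lemma cmeas_conj f : cmeas f -> cmeas (fun x => conjc (f x)).
Proof.
move=> [fr fi]; split.
  by under eq_fun do rewrite cre_conj.
by under eq_fun do rewrite cim_conj; exact: measurableT_comp.
Qed.
Lemma cmeas_cst c : cmeas (fun=> c).
Proof. by []. Qed.
Lemma cmeas_cR r : mfun r -> cmeas (fun x => cR (r x)).
Proof. by []. Qed.
Lemma cmeas_expi r : mfun r -> cmeas (fun x => expi (r x)).
Proof.
move=> mr; split => /=; apply: measurableT_comp => //; apply: continuous_measurable_fun.
  exact: continuous_cos.
exact: continuous_sin.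
Qed.
Lemma cmeas_cexp f : cmeas f -> cmeas (fun x => cexp (f x)).
Proof.
move=> [mr mi]; apply: cmeasM; last exact: cmeas_expi.
by apply: cmeas_cR; apply: measurableT_comp.
Qed.
Lemma cmeas_sum I (l : seq I) (F : I -> T -> R[i]) :
  (forall i, cmeas (F i)) -> cmeas (fun x => \sum_(i <- l) F i x).
Proof.
move=> mF; elim: l => [|i l IH].
  by apply: cmeas_eq (cmeas_cst 0) => x; rewrite big_nil.
by apply: cmeas_eq (cmeasD (mF i) IH) => x; rewrite big_cons.
Qed.
Lemma cmeas_cabs2 f : cmeas f -> mfun (fun x => cabs2 (f x)).
Proof. by move=> [fr fi]; apply: measurable_funD; exact: measurable_funX. Qed.
Lemma mfun_sqrt : measurable_fun [set: R] (@Num.sqrt R).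
Proof. by apply: continuous_measurable_fun; exact: sqrt_continuous. Qed.
Lemma cmeas_cabs f : cmeas f -> mfun (fun x => cabs (f x)).
Proof.
by move=> mf; apply: (measurableT_comp mfun_sqrt); exact: cmeas_cabs2.
Qed.
End ComplexIntegral.
Lemma cmeas_comp {R : realType} {d d'} {T : measurableType d}
  {T' : measurableType d'} (f : T' -> R[i]) (g : T -> T') :
  cmeas f -> mfun g -> cmeas (fun x => f (g x)).
Proof. by move=> [fr fi] mg; split; [apply: (measurableT_comp fr)|apply: (measurableT_comp fi)]. Qed.

Ltac meas_atom := fail.
Ltac meas := by repeat first
  [ done | meas_atom | exact: measurable_cst | exact: measurable_id | exact: cmeas_cst
  | apply: cmeasB | apply: cmeasD | apply: cmeasM | apply: cmeas_cR | apply: cmeas_expi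
  | apply: cmeas_cabs2 | apply: cmeas_cabs
  | apply: measurable_funB | apply: measurable_funD | apply: measurable_funM | apply: measurable_funX
  | apply: measurable_fun_pair | apply: (measurableT_comp (@measurable_expR _)) ].
Ltac side := solve [ by [] | meas | by move=> *; pos ].

(** * Integrals of nonnegative real functions *)

Section NonnegativeIntegral.
Variable R : realType.
Context {d} {T : measurableType d} (mu : {measure set T -> \bar R}).
Implicit Types f g : T -> R.

Definition nint f : \bar R := (\int[mu]_x (f x)%:E)%E.
Lemma eq_nint f g : f =1 g -> nint f = nint g.
Proof. by move=> /funext ->. Qed.

Lemma EFin_ge0 f : (forall x, 0 <= f x) -> forall x, [set: T] x -> (0 <= (f x)%:E)%E.
Proof. by move=> f0 x _; rewrite lee_fin. Qed.
Lemma EFin_meas f : mfun f -> mfun (fun x => (f x)%:E).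
Proof. by move=> mf; exact/measurable_EFinP. Qed.

Lemma nint_ge0 f : (forall x, 0 <= f x) -> (0 <= nint f)%E.
Proof. by move=> f0; apply: integral_ge0; exact: EFin_ge0. Qed.
Lemma le_nint f g : mfun f -> mfun g ->
  (forall x, 0 <= f x) -> (forall x, f x <= g x) -> (nint f <= nint g)%E.
Proof.
move=> /EFin_meas mf /EFin_meas mg /EFin_ge0 f0 fg; apply: ge0_le_integral => //.
by move=> x _; rewrite lee_fin.
Qed.

Lemma nintD f g : mfun f -> mfun g ->
  (forall x, 0 <= f x) -> (forall x, 0 <= g x) ->
  nint (fun x => f x + g x) = (nint f + nint g)%E.
Proof.
move=> /EFin_meas mf /EFin_meas mg /EFin_ge0 f0 /EFin_ge0 g0.
by rewrite /nint -ge0_integralD.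
Qed.
Lemma nintZ k f : 0 <= k -> mfun f -> (forall x, 0 <= f x) ->
  nint (fun x => k * f x) = (k%:E * nint f)%E.
Proof.
move=> k0 /EFin_meas mf /EFin_ge0 f0.
by rewrite /nint -ge0_integralZl.
Qed.

Lemma nint_sum I (l : seq I) (F : I -> T -> R) :
  (forall i, mfun (F i)) -> (forall i x, 0 <= F i x) ->
  nint (fun x => \sum_(i <- l) F i x) = (\sum_(i <- l) nint (F i))%E.
Proof.
move=> mF F0; elim: l => [|i l IH].
  rewrite big_nil (eq_nint (g := fun=> 0)); first exact: integral0.
  by move=> x; rewrite big_nil.
rewrite big_cons -IH -nintD//; first by apply: eq_nint => x; rewrite big_cons.
  exact: measurable_sum.
by move=> x; rewrite sumr_ge0.
Qed.

(** Most regularisations below, whether by a Gaussian weight, a damping or a cut-off, are removed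
    through this form of Fatou's lemma: a bound uniform in the parameter survives the pointwise
    limit. *)
Lemma nint_fatou (f_ : nat -> T -> R) f (B : \bar R) :
  (forall n, mfun (f_ n)) -> (forall n x, 0 <= f_ n x) ->
  (forall x, f_ n x @[n --> \oo] --> f x) ->
  (forall n, nint (f_ n) <= B)%E -> (nint f <= B)%E.
Proof.
move=> mf f0 ff fB.
have -> : nint f = (\int[mu]_x limn_einf (fun n => (f_ n x)%:E))%E.
  apply: eq_integral => x _; apply/esym.
  have : (f_ n x)%:E @[n --> \oo] --> (f x)%:E.
    by apply: cvg_EFin (ff x); exact: nearW.
  by move/cvg_limn_einf_sup => [].
apply: le_trans (fatou _ _ _ _) _ => //.
- by move=> n; exact/measurable_EFinP.
- by move=> n x _; rewrite lee_fin.
rewrite limn_einf_lim; apply: lime_le; first exact: is_cvg_einfs.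
by apply: nearW => n; apply: ge_ereal_inf; exists (nint (f_ n)) => //; exists n => //=.
Qed.

End NonnegativeIntegral.
Arguments eq_nint {R d T mu} [f] g.

(** * The integral of complex-valued functions *)

Section ComplexIntegrals.
Variable R : realType.
Context {d} {T : measurableType d} (mu : {measure set T -> \bar R}).
Implicit Types (f g : T -> R[i]) (r : T -> R).

Definition cint f : R[i] := Complex (Rintegral mu setT (fun x => cre (f x)))
  (Rintegral mu setT (fun x => cim (f x))).
Definition cL1 f := cmeas f /\ (nint mu (fun x => cabs (f x)) < +oo)%E.
Lemma eq_cint f g : f =1 g -> cint f = cint g.
Proof. by move=> /funext ->. Qed.
Lemma eq_cL1 f g : f =1 g -> cL1 f -> cL1 g.
Proof. by move=> /funext ->. Qed.
Lemma cL1_dom f r : cmeas f -> mfun r ->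
  (forall x, cabs (f x) <= r x) -> (nint mu r < +oo)%E -> cL1 f.
Proof.
move=> mf mr fr rlt; split=> //; apply: le_lt_trans rlt.
by apply: le_nint => //; meas.
Qed.

Lemma integrable_nint r : mfun r ->
  (nint mu (fun x => `|r x|%R) < +oo)%E -> mu.-integrable setT (EFin \o r).
Proof.
move=> mr rlt; apply/integrableP; split; first exact/measurable_EFinP.
by [].
Qed.
Lemma cL1_re f : cL1 f -> mu.-integrable setT (EFin \o (fun x => cre (f x))).
Proof.
move=> [[mr mi] lt]; apply: integrable_nint => //; apply: le_lt_trans lt.
apply: le_nint => //; [exact: measurableT_comp|exact: cmeas_cabs|].
by move=> x; exact: cre_le_cabs.
Qed.

Lemma cL1_im f : cL1 f -> mu.-integrable setT (EFin \o (fun x => cim (f x))).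
Proof.
move=> [[mr mi] lt]; apply: integrable_nint => //; apply: le_lt_trans lt.
apply: le_nint => //; [exact: measurableT_comp|exact: cmeas_cabs|].
by move=> x; exact: cim_le_cabs.
Qed.
Lemma cL1D f g : cL1 f -> cL1 g -> cL1 (fun x => f x + g x).
Proof.
move=> [mf ff] [mg gg].
apply: (cL1_dom (r := fun x => cabs (f x) + cabs (g x))).
- exact: cmeasD.
- meas.
- by move=> x; exact: cabsD.
by rewrite nintD//; [exact: lte_add_pinfty|exact: cmeas_cabs..].
Qed.

Lemma cL1_bM f g (k : R) : cL1 f -> cmeas g -> (forall x, cabs (g x) <= k) ->
  cL1 (fun x => g x * f x).
Proof.
move=> [mf ff] mg gk.
apply: (cL1_dom (r := fun x => `|k| * cabs (f x))).
- exact: cmeasM.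
- meas.
- by move=> x; rewrite cabsM ler_pM// (le_trans (gk x))// ler_norm.
by rewrite nintZ//; [exact: lte_mul_pinfty|exact: cmeas_cabs].
Qed.

Lemma cL1_Mb f g (k : R) : cL1 f -> cmeas g -> (forall x, cabs (g x) <= k) ->
  cL1 (fun x => f x * g x).
Proof.
by move=> a b c; apply: eq_cL1 (cL1_bM a b c) => x; rewrite mulrC.
Qed.
Lemma cL1Z f c : cL1 f -> cL1 (fun x => c * f x).
Proof. by move=> lf; apply: (cL1_bM (k := cabs c)) => //; meas. Qed.
Lemma cL1N f : cL1 f -> cL1 (fun x => - f x).
Proof. by move=> lf; apply: eq_cL1 (cL1Z (-1) lf) => x; rewrite mulN1r. Qed.
Lemma cL1B f g : cL1 f -> cL1 g -> cL1 (fun x => f x - g x).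
Proof. by move=> lf lg; apply: cL1D => //; exact: cL1N. Qed.
Lemma cL10 : cL1 (fun=> 0).
Proof.
split; first by meas.
by rewrite (eq_nint (fun=> 0)) ?/nint ?integral0// => x; rewrite cabs0.
Qed.
Lemma cL1_sum I (l : seq I) (F : I -> T -> R[i]) : (forall i, cL1 (F i)) ->
  cL1 (fun x => \sum_(i <- l) F i x).
Proof.
move=> LF; elim: l => [|i l IH].
  by apply: eq_cL1 cL10 => x; rewrite big_nil.
by apply: eq_cL1 (cL1D (LF i) IH) => x; rewrite big_cons.
Qed.
Lemma cL1_conj f : cL1 f -> cL1 (fun x => conjc (f x)).
Proof.
move=> [mf ff]; split; first exact: cmeas_conj.
by under eq_nint do rewrite cabs_conj.
Qed.
Lemma cL1_cR r : mfun r -> (forall x, 0 <= r x) ->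
  (nint mu r < +oo)%E -> cL1 (fun x => cR (r x)).
Proof.
move=> mr r0 rlt; apply: (cL1_dom (r := r)) => //.
by move=> x; rewrite cabs_cRp.
Qed.
Lemma cintD f g : cL1 f -> cL1 g -> cint (fun x => f x + g x) = cint f + cint g.
Proof.
move=> lf lg; apply: cP; rewrite /cint /= -?RintegralD//.
- by apply: eq_Rintegral => x _; exact: creD.
- exact: cL1_re.
- exact: cL1_re.
- by apply: eq_Rintegral => x _; exact: cimD.
- exact: cL1_im.
- exact: cL1_im.
Qed.

Lemma cintZ f c : cL1 f -> cint (fun x => c * f x) = c * cint f.
Proof.
move=> lf; have re := cL1_re lf; have im := cL1_im lf.
have reZ k : mu.-integrable setT (EFin \o (fun x => k * cre (f x))).
  exact: (integrableZl measurableT k re).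
have imZ k : mu.-integrable setT (EFin \o (fun x => k * cim (f x))).
  exact: (integrableZl measurableT k im).
apply: cP; rewrite (creM, cimM) /cint /= -!RintegralZl//.
  by rewrite -RintegralB//; apply: eq_Rintegral => x _; exact: creM.
by rewrite -RintegralD//; apply: eq_Rintegral => x _; exact: cimM.
Qed.

Lemma cintN f : cL1 f -> cint (fun x => - f x) = - cint f.
Proof.
by move=> lf; rewrite -mulN1r -cintZ//; apply: eq_cint => x; rewrite mulN1r.
Qed.
Lemma cintB f g : cL1 f -> cL1 g -> cint (fun x => f x - g x) = cint f - cint g.
Proof. by move=> lf lg; rewrite cintD ?cintN//; exact: cL1N. Qed.
Lemma cint0 : cint (fun=> 0) = 0.
Proof. by apply: cP; rewrite /cint /= Rintegral_cst// mul0r. Qed.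
Lemma cint_sum I (l : seq I) (F : I -> T -> R[i]) : (forall i, cL1 (F i)) ->
  cint (fun x => \sum_(i <- l) F i x) = \sum_(i <- l) cint (F i).
Proof.
move=> LF; elim: l => [|i l IH].
  rewrite [RHS]big_nil -[RHS]cint0; apply: eq_cint => x; exact: big_nil.
rewrite big_cons -IH -cintD//; last exact: cL1_sum.
by apply: eq_cint => x; rewrite big_cons.
Qed.
Lemma cint_conj f : cL1 f -> cint (fun x => conjc (f x)) = conjc (cint f).
Proof.
move=> lf; apply: cP; rewrite (cre_conj, cim_conj) /cint /=.
  by apply: eq_Rintegral => x _; exact: cre_conj.
rewrite -mulN1r -RintegralZl//; last exact: cL1_im.
by apply: eq_Rintegral => x _; rewrite cim_conj mulN1r.
Qed.
Lemma nint_Rintegral r : mfun r -> (forall x, 0 <= r x) ->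
  (nint mu r < +oo)%E -> (Rintegral mu setT r)%:E = nint mu r.
Proof.
move=> mr r0 rlt; rewrite /Rintegral fineK// ge0_fin_numE//; exact: nint_ge0.
Qed.

Lemma cint_cR r : cint (fun x => cR (r x)) = cR (Rintegral mu setT r).
Proof. by apply: cP; rewrite /cint /= ?Rintegral_cst ?mul0r. Qed.

(* Rotating by the conjugate phase of the integral makes it real. *)
Lemma cabs_cint f : cL1 f -> ((cabs (cint f))%:E <= nint mu (fun x => cabs (f x)))%E.
Proof.
move=> lf; have [I0|I0] := eqVneq (cint f) 0.
  by rewrite I0 cabs0 nint_ge0.
set I := cint f; have aI : cabs I != 0 by rewrite cabs_eq0.
pose c := conjc I / cR (cabs I).
have cc : cabs c = 1 by rewrite cabsM cabsV cabs_conj cabs_cRp// mulfV.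
have cI : c * I = cR (cabs I).
  rewrite mulrAC [_ * I]mulrC mulcconj cabs2E -cRV -cRM.
  by rewrite expr2 mulfK.
have lcf := cL1Z c lf.
have -> : cabs I = Rintegral mu setT (fun x => cre (c * f x)).
  by have := cintZ c lf; rewrite cI => /(congr1 (@cre R)).
have mc : mfun (fun x => cabs (c * f x)) by apply: cmeas_cabs; case: lcf.
rewrite (eq_nint (fun x => cabs (c * f x))); last first.
  by move=> x; rewrite cabsM cc mul1r.
rewrite -nint_Rintegral//; last by case: lcf.
rewrite lee_fin le_Rintegral//; first exact: cL1_re.
  apply: integrable_nint => //; case: lcf => _; apply: le_lt_trans.
  by apply: le_nint => //; [exact: measurableT_comp|move=> x; rewrite ger0_norm].
by move=> x _; apply: le_trans (cre_le_cabs _); exact: ler_norm.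
Qed.

Lemma cabs_cint_le f r (k : R) : cmeas f -> mfun r ->
  (forall x, cabs (f x) <= r x) -> (nint mu r <= k%:E)%E -> cabs (cint f) <= k.
Proof.
move=> mf mr fr rk; rewrite -lee_fin; apply: le_trans rk.
apply: (@le_trans _ _ (nint mu (fun x => cabs (f x)))).
  have [lt|] := ltP (nint mu (fun x => cabs (f x))) +oo%E.
    by apply: cabs_cint.
  by rewrite leye_eq => /eqP ->; rewrite leey.
by apply: le_nint => //; meas.
Qed.

End ComplexIntegrals.

(** * Convergence of complex sequences *)

Section ComplexConvergence.
Variable R : realType.
Implicit Types (u v : nat -> R[i]) (l : R[i]).

Lemma cvg0_le {I} {F : set_system I} {FF : Filter F} (v w : I -> R) :
  (forall n, `|v n| <= w n) -> w n @[n --> F] --> 0 -> v n @[n --> F] --> 0.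
Proof.
move=> vw w0; apply: (@squeeze_cvgr _ _ _ _ (fun n => - w n) w) => //.
  by apply: nearW => n; rewrite -ler_norml.
by rewrite -oppr0; exact: cvgN.
Qed.
Lemma cvg_sub0 {I} {F : set_system I} {FF : Filter F} (v : I -> R) (l : R) :
  (v n - l) @[n --> F] --> 0 -> v n @[n --> F] --> l.
Proof.
move=> /(cvgD (cvg_cst l)); rewrite addr0; apply: cvg_trans.
by apply: near_eq_cvg; apply: nearW => n /=; rewrite addrC subrK.
Qed.

Lemma cvg_sub0r {I} {F : set_system I} {FF : Filter F} (v : I -> R) (l : R) :
  v n @[n --> F] --> l -> (v n - l) @[n --> F] --> 0.
Proof. by move=> vl; rewrite -(subrr l); apply: cvgB => //; exact: cvg_cst. Qed.
Lemma ccvgP u l : ccvg_seq u l <-> cabs (u n - l) @[n --> \oo] --> 0.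
Proof.
split => [[ur ui]|ul].
  apply: (cvg0_le (w := fun n => `|cre (u n) - cre l| + `|cim (u n) - cim l|)).
    move=> n; rewrite ger0_norm//; apply: le_trans (cabs_le_reim _) _.
    by rewrite creD cimD creN cimN.
  have -> : (0 : R) = `|0 : R| + `|0 : R| by rewrite normr0 addr0.
  by apply: cvgD; apply: cvg_norm; exact: cvg_sub0r.
split; apply: cvg_sub0; apply: cvg0_le ul => n.
  by rewrite -creN -creD cre_le_cabs.
by rewrite -cimN -cimD cim_le_cabs.
Qed.

Lemma ccvg_le u l (w : nat -> R) : (forall n, cabs (u n - l) <= w n) ->
  w n @[n --> \oo] --> 0 -> ccvg_seq u l.
Proof.
by move=> uw w0; apply/ccvgP; apply: cvg0_le w0 => n; rewrite ger0_norm.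
Qed.
Lemma ccvg_cst l : ccvg_seq (fun=> l) l.
Proof. by split; exact: cvg_cst. Qed.
Lemma ccvgD u v l m : ccvg_seq u l -> ccvg_seq v m -> ccvg_seq (fun n => u n + v n) (l + m).
Proof.
move=> [ur ui] [vr vi]; split; rewrite (creD, cimD).
  by under eq_fun do rewrite creD; exact: cvgD.
by under eq_fun do rewrite cimD; exact: cvgD.
Qed.
Lemma ccvgM u v l m : ccvg_seq u l -> ccvg_seq v m -> ccvg_seq (fun n => u n * v n) (l * m).
Proof.
move=> [ur ui] [vr vi]; split; rewrite (creM, cimM).
  by under eq_fun do rewrite creM; apply: cvgB; exact: cvgM.
by under eq_fun do rewrite cimM; apply: cvgD; exact: cvgM.
Qed.
Lemma ccvgZ u c l : ccvg_seq u l -> ccvg_seq (fun n => c * u n) (c * l).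
Proof. by apply: ccvgM; exact: ccvg_cst. Qed.
Lemma ccvgN u l : ccvg_seq u l -> ccvg_seq (fun n => - u n) (- l).
Proof.
by move=> /(ccvgZ (-1)); rewrite mulN1r; under eq_fun do rewrite mulN1r.
Qed.
Lemma ccvgB u v l m : ccvg_seq u l -> ccvg_seq v m -> ccvg_seq (fun n => u n - v n) (l - m).
Proof. by move=> a b; apply: ccvgD => //; exact: ccvgN. Qed.
Lemma ccvg_uniq u l m : ccvg_seq u l -> ccvg_seq u m -> l = m.
Proof.
move=> [ar ai] [br bi]; apply: cP.
  exact: (cvg_unique _ ar br).
exact: (cvg_unique _ ai bi).
Qed.
Lemma ccvg_eq u v l : u =1 v -> ccvg_seq u l -> ccvg_seq v l.
Proof. by move=> /funext ->. Qed.
Lemma ccvg_cR (u : nat -> R) (l : R) : u n @[n --> \oo] --> l -> ccvg_seq (fun n => cR (u n)) (cR l).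
Proof. by move=> ul; split => //=; exact: cvg_cst. Qed.
Lemma ccvg_cabs u l : ccvg_seq u l -> cabs (u n) @[n --> \oo] --> cabs l.
Proof.
move=> /ccvgP ul; apply: cvg_sub0; apply: cvg0_le ul => n.
rewrite ler_norml; apply/andP; split.
  rewrite lerNl opprB lerBlDl cabs_distC; apply: le_trans (cabsD _ _).
  by rewrite addrC subrK.
by rewrite lerBlDl; apply: le_trans (cabsD _ _); rewrite addrC subrK.
Qed.
Lemma ccvg_cabs2 u l : ccvg_seq u l -> cabs2 (u n) @[n --> \oo] --> cabs2 l.
Proof.
move=> /ccvg_cabs ul; under eq_fun do rewrite cabs2E.
by rewrite cabs2E !expr2; under eq_fun do rewrite expr2; exact: cvgM.
Qed.
Lemma ccvg_expi (u : nat -> R) (l : R) : u n @[n --> \oo] --> l -> ccvg_seq (fun n => expi (u n)) (expi l).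
Proof.
by move=> ul; split; [apply: (cvg_comp _ _ ul (@continuous_cos R l))|
  apply: (cvg_comp _ _ ul (@continuous_sin R l))].
Qed.
Lemma ccvg_cexp u l : ccvg_seq u l -> ccvg_seq (fun n => cexp (u n)) (cexp l).
Proof.
move=> [ur ui]; apply: ccvgM; last exact: ccvg_expi.
by apply: ccvg_cR; apply: (cvg_comp _ _ ur (@continuous_expR R (cre l))).
Qed.
End ComplexConvergence.

(** * Dominated convergence for complex integrands *)

Section ComplexDominated.
Variable R : realType.
Context {d} {T : measurableType d} (mu : {measure set T -> \bar R}).

Lemma cmeas_lim (f_ : nat -> T -> R[i]) f : (forall n, cmeas (f_ n)) ->
  (forall x, ccvg_seq (fun n => f_ n x) (f x)) -> cmeas f.
Proof.
move=> mf ff; split.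
  by apply: (measurable_fun_cvg (h := fun n x => cre (f_ n x))) => [n|x _]; [case: (mf n)|case: (ff x)].
by apply: (measurable_fun_cvg (h := fun n x => cim (f_ n x))) => [n|x _]; [case: (mf n)|case: (ff x)].
Qed.
Lemma Rintegral_dct (f_ : nat -> T -> R) f (g : T -> R) :
  (forall n, mfun (f_ n)) -> (forall x, f_ n x @[n --> \oo] --> f x) ->
  mfun g -> (nint mu g < +oo)%E -> (forall n x, `|f_ n x| <= g x) ->
  Rintegral mu setT (f_ n) @[n --> \oo] --> Rintegral mu setT f.
Proof.
move=> mf ff mg glt fg.
have g0 : T -> nat -> forall x, 0 <= g x by move=> _ n x; apply: le_trans (fg n x).
have ig : mu.-integrable setT (EFin \o g).
  by apply: integrable_nint => //; rewrite (eq_nint g)// => x; rewrite ger0_norm// (g0 x 0%N).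
have mf' : mfun f by apply: (measurable_fun_cvg (h := f_)) => // x _; exact: ff.
have dom := @dominated_cvg _ T R mu setT measurableT (fun n x => (f_ n x)%:E) (EFin \o f) (EFin \o g).
have iF : mu.-integrable setT (EFin \o f).
  apply: (le_integrable measurableT _ _ ig); first exact/measurable_EFinP.
  move=> x _; rewrite /= lee_fin (ger0_norm (g0 x 0%N x)) -(cvg_lim _ (cvg_norm (ff x)))//.
  apply: limr_le; first by apply/cvg_ex; exists `|f x|; exact: cvg_norm.
  by apply: nearW => n; exact: fg.
apply: fine_cvg; rewrite fineK; last exact: integrable_fin_num.
apply: dom => //.
- by move=> n; exact/measurable_EFinP.
- by move=> x _; apply: cvg_EFin (ff x); exact: nearW.
- by move=> n x _; rewrite lee_fin.
Qed.

Lemma cint_dct (f_ : nat -> T -> R[i]) f (g : T -> R) :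
  (forall n, cmeas (f_ n)) -> (forall x, ccvg_seq (fun n => f_ n x) (f x)) ->
  mfun g -> (nint mu g < +oo)%E -> (forall n x, cabs (f_ n x) <= g x) ->
  ccvg_seq (fun n => cint mu (f_ n)) (cint mu f).
Proof.
move=> mf ff mg glt fg; split => /=.
  apply: Rintegral_dct glt _ => //; first by move=> n; case: (mf n).
    by move=> x; case: (ff x).
  by move=> n x; apply: le_trans (fg n x); exact: cre_le_cabs.
apply: Rintegral_dct glt _ => //; first by move=> n; case: (mf n).
  by move=> x; case: (ff x).
by move=> n x; apply: le_trans (fg n x); exact: cim_le_cabs.
Qed.

Lemma cL1_dct (f_ : nat -> T -> R[i]) f (g : T -> R) :
  (forall n, cmeas (f_ n)) -> (forall x, ccvg_seq (fun n => f_ n x) (f x)) ->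
  mfun g -> (nint mu g < +oo)%E -> (forall n x, cabs (f_ n x) <= g x) ->
  cL1 mu f.
Proof.
move=> mf ff mg glt fg; apply: (cL1_dom (r := g)) => //; first exact: cmeas_lim ff.
move=> x; have /cvgP cv := ccvg_cabs (ff x).
rewrite -(cvg_lim _ (ccvg_cabs (ff x)))//; apply: limr_le => //.
by apply: nearW.
Qed.

Lemma nint_dct (f_ : nat -> T -> R) (g : T -> R) :
  (forall n, mfun (f_ n)) -> (forall n x, 0 <= f_ n x) ->
  (forall x, f_ n x @[n --> \oo] --> 0) ->
  mfun g -> (nint mu g < +oo)%E -> (forall n x, f_ n x <= g x) ->
  forall e : R, 0 < e -> \forall n \near \oo, (nint mu (f_ n) <= e%:E)%E.
Proof.
move=> mf f0 ff mg glt fg e e0.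
have := @Rintegral_dct f_ (fun=> 0) g mf ff mg glt.
rewrite Rintegral_cst// mul0r => /(_ _)/cvgr0Pnorm_le.
move=> /(_ _ e e0) H; near=> n.
have fin : (nint mu (f_ n) < +oo)%E by apply: le_lt_trans glt; exact: le_nint.
rewrite -nint_Rintegral// lee_fin; apply: le_trans (ler_norm _) _.
near: n; apply: H => n x; by rewrite ger0_norm.
Unshelve. all: by end_near. Qed.

End ComplexDominated.

(** * Products of sigma-finite measures *)

Section ProductMeasure.
Variable R : realType.
Context {d1 d2} {T1 : measurableType d1} {T2 : measurableType d2}.
Variables (m1 : {sigma_finite_measure set T1 -> \bar R})
  (m2 : {sigma_finite_measure set T2 -> \bar R}).

(** A named copy of the product measure that carries its own measure and sigma-finiteness
    structures, so that products can be iterated and used wherever a sigma-finite measure is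
    expected. *)
Definition prodm : set (T1 * T2) -> \bar R := (m1 \x m2)%E.

HB.instance Definition _ := isMeasure.Build _ _ _ prodm
  (@measure0 _ _ _ (m1 \x m2)%E) (@measure_ge0 _ _ _ (m1 \x m2)%E)
  (@measure_semi_sigma_additive _ _ _ (m1 \x m2)%E).

Let prodm_sigma_finite : sigma_finite setT prodm.
Proof.
have /sigma_finiteP[F [TF ndF Foo]] := sigma_finiteT m1.
have /sigma_finiteP[G [TG ndG Goo]] := sigma_finiteT m2.
(* Both exhaustions increase, so the rectangles with equal indices already cover the product. *)
exists (fun n => F n `*` G n).
  rewrite -setXTT TF TG predeqE => -[x y]; split.
    move=> [/= [n _ Fnx] [k _ Gky]]; exists (maxn n k) => //; split.
    - by move: x Fnx; exact/subsetPset/ndF/leq_maxl.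
    - by move: y Gky; exact/subsetPset/ndG/leq_maxr.
  by move=> [n _ []/= ? ?]; split; exists n.
move=> k; have [? ?] := Foo k; have [? ?] := Goo k.
split; first exact: measurableX.
by rewrite /prodm product_measure1E// lte_mul_pinfty// ge0_fin_numE.
Qed.

HB.instance Definition _ := Measure_isSigmaFinite.Build _ _ _ prodm prodm_sigma_finite.
End ProductMeasure.

(** * Tonelli and Fubini theorems for complex integrands *)

Section FubiniComplex.
Variable R : realType.
Context {d1 d2} {T1 : measurableType d1} {T2 : measurableType d2}.
Variables (m1 : {sigma_finite_measure set T1 -> \bar R})
  (m2 : {sigma_finite_measure set T2 -> \bar R}).
Local Notation m12 := (prodm m1 m2).
Implicit Types (f : T1 * T2 -> R[i]) (r : T1 * T2 -> R).

Lemma mfun_nint1 r : mfun r -> (forall z, 0 <= r z) ->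
  mfun (fun x => nint m2 (fun y => r (x, y))).
Proof.
move=> mr r0.
have := @measurable_fun_fubini_tonelli_F _ _ T1 T2 R m2 (fun z => (r z)%:E).
by apply; [exact/measurable_EFinP|move=> z; rewrite lee_fin].
Qed.
Lemma mfun_nint2 r : mfun r -> (forall z, 0 <= r z) ->
  mfun (fun y => nint m1 (fun x => r (x, y))).
Proof.
move=> mr r0.
have := @measurable_fun_fubini_tonelli_G _ _ T1 T2 R m1 (fun z => (r z)%:E).
by apply; [exact/measurable_EFinP|move=> z; rewrite lee_fin].
Qed.

Lemma nint_prod1 r : mfun r -> (forall z, 0 <= r z) ->
  nint m12 r = (\int[m1]_x nint m2 (fun y => r (x, y)))%E.
Proof.
move=> mr r0; apply: (fubini_tonelli1 (fun z => (r z)%:E)).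
  exact/measurable_EFinP.
by [].
Qed.
Lemma nint_prod2 r : mfun r -> (forall z, 0 <= r z) ->
  nint m12 r = (\int[m2]_y nint m1 (fun x => r (x, y)))%E.
Proof.
move=> mr r0; apply: (fubini_tonelli2 (fun z => (r z)%:E)).
  exact/measurable_EFinP.
by [].
Qed.

Lemma nint_tonelli r : mfun r -> (forall z, 0 <= r z) ->
  (\int[m1]_x nint m2 (fun y => r (x, y)) = \int[m2]_y nint m1 (fun x => r (x, y)))%E.
Proof. by move=> mr r0; rewrite -nint_prod1// nint_prod2. Qed.
Lemma nint_tensor (a : T1 -> R) (b : T2 -> R) :
  mfun a -> mfun b ->
  (forall x, 0 <= a x) -> (forall y, 0 <= b y) ->
  nint m12 (fun z => a z.1 * b z.2) = (nint m1 a * nint m2 b)%E.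
Proof.
move=> ma mb a0 b0; rewrite nint_prod1 => [||z]; last by pos.
  under eq_integral => x _ do rewrite /= nintZ// muleC.
  rewrite ge0_integralZl//.
  - by rewrite muleC.
  - exact/measurable_EFinP.
  - by move=> x _; rewrite lee_fin.
  - exact: nint_ge0.
apply: measurable_funM; first exact: measurableT_comp.
exact: measurableT_comp.
Qed.

Lemma cL1_prod f : cmeas f ->
  (\int[m1]_x nint m2 (fun y => cabs (f (x, y))) < +oo)%E -> cL1 m12 f.
Proof.
move=> mf flt; split=> //; rewrite nint_prod1//; meas.
Qed.
Lemma cL1_prod_dom f (a : T1 -> R) (b : T2 -> R) : cmeas f ->
  mfun a -> mfun b ->
  (forall x, 0 <= a x) -> (forall y, 0 <= b y) ->
  (nint m1 a < +oo)%E -> (nint m2 b < +oo)%E ->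
  (forall x y, cabs (f (x, y)) <= a x * b y) -> cL1 m12 f.
Proof.
move=> mf ma mb a0 b0 alt blt fab.
apply: (cL1_dom (r := fun z => a z.1 * b z.2)) => //.
- apply: measurable_funM; first exact: measurableT_comp.
  exact: measurableT_comp.
- by move=> [x y]; exact: fab.
rewrite nint_tensor// lte_mul_pinfty//; first exact: nint_ge0.
by rewrite ge0_fin_numE//; exact: nint_ge0.
Qed.

Lemma cmeas_sec1 f x : cmeas f -> cmeas (fun y => f (x, y)).
Proof. move=> mf; exact: (cmeas_comp mf (pair1_measurable x)). Qed.
Lemma cmeas_sec2 f y : cmeas f -> cmeas (fun x => f (x, y)).
Proof. move=> mf; exact: (cmeas_comp mf (pair2_measurable y)). Qed.
Let mF (r : T1 * T2 -> R) : mfun r ->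
  mfun (fun x => Rintegral m2 setT (fun y => r (x, y))).
Proof.
move=> mr; apply: (measurableT_comp (fine_measurable measurableT)).
have mr' : mfun (EFin \o r) by exact/measurable_EFinP.
(* The positive and negative parts have partial integrals that are measurable by Tonelli. *)
have -> : (fun x => \int[m2]_y (r (x, y))%:E)%E =
  (fun x => fubini_F m2 (EFin \o r)^\+%E x - fubini_F m2 (EFin \o r)^\-%E x)%E.
  apply/funext=> x; rewrite [LHS]integralE.
  by congr (_ - _)%E; apply: eq_integral => y _; rewrite ?funeposE ?funenegE.
apply: emeasurable_funB; apply: measurable_fun_fubini_tonelli_F => //.
  exact: measurable_funepos.
exact: measurable_funeneg.
Qed.

Let mG (r : T1 * T2 -> R) : mfun r ->
  mfun (fun y => Rintegral m1 setT (fun x => r (x, y))).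
Proof.
move=> mr; apply: (measurableT_comp (fine_measurable measurableT)).
have mr' : mfun (EFin \o r) by exact/measurable_EFinP.
have -> : (fun y => \int[m1]_x (r (x, y))%:E)%E =
  (fun y => fubini_G m1 (EFin \o r)^\+%E y - fubini_G m1 (EFin \o r)^\-%E y)%E.
  apply/funext=> x; rewrite [LHS]integralE.
  by congr (_ - _)%E; apply: eq_integral => y _; rewrite ?funeposE ?funenegE.
apply: emeasurable_funB; apply: measurable_fun_fubini_tonelli_G => //.
  exact: measurable_funepos.
exact: measurable_funeneg.
Qed.

Lemma cmeas_cint1 f : cmeas f -> cmeas (fun x => cint m2 (fun y => f (x, y))).
Proof. by move=> [mr mi]; split; [apply: mF mr|apply: mF mi]. Qed.
Lemma cmeas_cint2 f : cmeas f -> cmeas (fun y => cint m1 (fun x => f (x, y))).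
Proof. by move=> [mr mi]; split; [apply: mG mr|apply: mG mi]. Qed.
Lemma cabs_cint_nint {d} {T : measurableType d} (mu : {measure set T -> \bar R})
  (g : T -> R[i]) : cmeas g -> ((cabs (cint mu g))%:E <= nint mu (fun x => cabs (g x)))%E.
Proof.
move=> mg; have [lt|] := ltP (nint mu (fun x => cabs (g x))) +oo%E.
  exact: cabs_cint.
by rewrite leye_eq => /eqP ->; rewrite leey.
Qed.

Lemma cL1_cint1 f : cL1 m12 f -> cL1 m1 (fun x => cint m2 (fun y => f (x, y))).
Proof.
move=> [mf flt]; split; first exact: cmeas_cint1.
move: flt; rewrite (nint_prod1 (r := fun z => cabs (f z)) (cmeas_cabs mf))//.
apply: le_lt_trans; apply: ge0_le_integral => //.
- by move=> x _; rewrite lee_fin.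
- by apply/measurable_EFinP/cmeas_cabs/cmeas_cint1.
- exact: (mfun_nint1 (r := fun z => cabs (f z)) (cmeas_cabs mf)).
- by move=> x _; apply: cabs_cint_nint; exact: cmeas_sec1.
Qed.

Lemma cL1_cint2 f : cL1 m12 f -> cL1 m2 (fun y => cint m1 (fun x => f (x, y))).
Proof.
move=> [mf flt]; split; first exact: cmeas_cint2.
move: flt; rewrite (nint_prod2 (r := fun z => cabs (f z)) (cmeas_cabs mf))//.
apply: le_lt_trans; apply: ge0_le_integral => //.
- by move=> x _; rewrite lee_fin.
- by apply/measurable_EFinP/cmeas_cabs/cmeas_cint2.
- exact: (mfun_nint2 (r := fun z => cabs (f z)) (cmeas_cabs mf)).
- by move=> x _; apply: cabs_cint_nint; exact: cmeas_sec2.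
Qed.

Let RF1 (r : T1 * T2 -> R) : m12.-integrable setT (EFin \o r) ->
  Rintegral m1 setT (fun x => Rintegral m2 setT (fun y => r (x, y))) = Rintegral m12 setT r.
Proof.
move=> ir; have mr : mfun r.
  by case/integrableP : ir => /measurable_EFinP.
rewrite {1 3}/Rintegral -[in RHS](@integral12_prod_meas1 _ _ T1 T2 R m1 m2)//; congr fine.
apply: ae_eq_integral => //.
- by apply/measurable_EFinP; exact: mF.
- exact: (measurable_fubini_F ir).
(* Only almost every section is integrable; on those sections the integral is finite and [fine]
   loses nothing. *)
have := ae_integrable1 ir; apply: filterS => x ix _ /=.
by rewrite /Rintegral fineK//; exact: integrable_fin_num.
Qed.

Let RF2 (r : T1 * T2 -> R) : m12.-integrable setT (EFin \o r) ->
  Rintegral m2 setT (fun y => Rintegral m1 setT (fun x => r (x, y))) = Rintegral m12 setT r.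
Proof.
move=> ir; have mr : mfun r.
  by case/integrableP : ir => /measurable_EFinP.
rewrite {1 3}/Rintegral -[in RHS](@integral21_prod_meas1 _ _ T1 T2 R m1 m2)//; congr fine.
apply: ae_eq_integral => //.
- by apply/measurable_EFinP; exact: mG.
- exact: (measurable_fubini_G ir).
have := ae_integrable2 ir; apply: filterS => x ix _ /=.
by rewrite /Rintegral fineK//; exact: integrable_fin_num.
Qed.

Lemma cint_prod1 f : cL1 m12 f ->
  cint m1 (fun x => cint m2 (fun y => f (x, y))) = cint m12 f.
Proof.
move=> lf; apply: cP; rewrite /cint /=.
  by apply: (RF1 (r := fun z => cre (f z))); exact: cL1_re.
by apply: (RF1 (r := fun z => cim (f z))); exact: cL1_im.
Qed.
Lemma cint_prod2 f : cL1 m12 f ->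
  cint m2 (fun y => cint m1 (fun x => f (x, y))) = cint m12 f.
Proof.
move=> lf; apply: cP; rewrite /cint /=.
  by apply: (RF2 (r := fun z => cre (f z))); exact: cL1_re.
by apply: (RF2 (r := fun z => cim (f z))); exact: cL1_im.
Qed.

Lemma cFubini f : cL1 m12 f ->
  cint m1 (fun x => cint m2 (fun y => f (x, y))) =
  cint m2 (fun y => cint m1 (fun x => f (x, y))).
Proof. by move=> lf; rewrite cint_prod1// cint_prod2. Qed.
Lemma cL1_tensor (f : T1 -> R[i]) (g : T2 -> R[i]) : cL1 m1 f -> cL1 m2 g ->
  cL1 m12 (fun z => f z.1 * g z.2).
Proof.
move=> [mf flt] [mg glt].
apply: (cL1_prod_dom (a := fun x => cabs (f x)) (b := fun x => cabs (g x))) => //.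
- by apply: cmeasM; [apply: (cmeas_comp mf)|apply: (cmeas_comp mg)].
- meas.
- meas.
- by move=> x y; rewrite cabsM.
Qed.

Lemma cint_tensor (f : T1 -> R[i]) (g : T2 -> R[i]) : cL1 m1 f -> cL1 m2 g ->
  cint m12 (fun z => f z.1 * g z.2) = cint m1 f * cint m2 g.
Proof.
move=> lf lg; rewrite -cint_prod1; last exact: cL1_tensor.
rewrite mulrC -cintZ//; apply: eq_cint => x /=.
by rewrite cintZ// mulrC.
Qed.

End FubiniComplex.

(** * Lebesgue measure on the line and in space, and its invariances *)

Definition lam (R : realType) : set R -> \bar R := @lebesgue_measure R.

Section LebesgueOnReals.
Variable R : realType.

Let lam0 : @lam R set0 = 0%E.
Proof. meas. Qed.
Let lam_ge0 A : (0 <= @lam R A)%E.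
Proof. meas. Qed.
Let lam_sigma : semi_sigma_additive (@lam R).
Proof. exact: (@measure_semi_sigma_additive _ (measurableTypeR R) R lebesgue_measure). Qed.

HB.instance Definition _ := isMeasure.Build _ _ _ (@lam R) lam0 lam_ge0 lam_sigma.

Let lam_sigma_finite : sigma_finite setT (@lam R).
Proof. exact: (@sigma_finiteT _ (measurableTypeR R) R lebesgue_measure). Qed.

HB.instance Definition _ := Measure_isSigmaFinite.Build _ _ _ (@lam R) lam_sigma_finite.

Definition lam3 : {sigma_finite_measure set (R * R * R)%type -> \bar R} :=
  prodm (prodm (@lam R) (@lam R)) (@lam R).

Local Notation mR := (measurableTypeR R).

(** [lebesgue_measure] lives on [measurableTypeR R], while [lam] is a measure on [R] itself. Pushing
    forward along the identity identifies the integrals of nonnegative functions, and the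
    decomposition into positive and negative parts gives the rest. *)
Lemma leb_integral (D : set R) (f : R -> \bar R) : measurable D -> mfun f ->
  (\int[lebesgue_measure]_(x in D) f x = \int[@lam R]_(x in D) f x)%E.
Proof.
move=> mD mf.
suff H g : mfun g -> (forall x, 0 <= g x)%E ->
    (\int[lebesgue_measure]_(x in D) g x = \int[@lam R]_(x in D) g x)%E.
  rewrite integralE [RHS]integralE; congr (_ - _)%E; apply: H => //.
    exact: measurable_funepos.
  exact: measurable_funeneg.
move=> mg g0.
have := @ge0_integral_pushforward _ _ mR R R (id : mR -> R)
  (@measurable_id _ mR setT) lebesgue_measure D g mD (measurable_funTS mg).
by move=> /(_ _)/esym; apply => x _.
Qed.

Local Notation mR3 := (mR * mR * mR)%type.
Let l2 : {measure set (mR * mR) -> \bar R} := (@lebesgue_measure R \x @lebesgue_measure R)%E.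
Let l3 : {measure set mR3 -> \bar R} := (l2 \x @lebesgue_measure R)%E.
Let p2 : set (R * R) -> \bar R := l2.
HB.instance Definition _ := isMeasure.Build _ (R * R)%type R p2
  (@measure0 _ _ _ l2) (@measure_ge0 _ _ _ l2) (@measure_semi_sigma_additive _ _ _ l2).
Let p3 : set (R * R * R) -> \bar R := l3.
HB.instance Definition _ := isMeasure.Build _ (R * R * R)%type R p3
  (@measure0 _ _ _ l3) (@measure_ge0 _ _ _ l3) (@measure_semi_sigma_additive _ _ _ l3).
Let p2E A : measurable A -> p2 A = prodm (@lam R) (@lam R) A.
Proof.
move=> mA; apply/esym/(@product_measure_unique _ _ R R R (@lam R) (@lam R) p2) => //.
move=> B C mB mC; exact: (@product_measure1E _ _ mR mR R lebesgue_measure lebesgue_measure).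
Qed.

Let p3E A : measurable A -> p3 A = lam3 A.
Proof.
move=> mA; apply/esym/(@product_measure_unique _ _ (R * R)%type R R (prodm (@lam R) (@lam R)) (@lam R) p3) => //.
move=> B C mB mC; apply: (@etrans _ _ (p2 B * @lam R C)%E); last by rewrite (p2E mB).
exact: (@product_measure1E _ _ (mR * mR)%type mR R l2 lebesgue_measure).
Qed.
Lemma leb3_integral (D : set (pt R)) (f : pt R -> \bar R) : measurable D -> mfun f ->
  (@integral _ mR3 R (@leb3 R) D f = \int[lam3]_(x in D) f x)%E.
Proof.
move=> mD mf.
have H g : mfun g -> (forall x, 0 <= g x)%E ->
    (@integral _ mR3 R (@leb3 R) D g = \int[p3]_(x in D) g x)%E.
  move=> mg g0.
  have /(_ _)/esym := @ge0_integral_pushforward _ _ mR3 (R * R * R)%type R (id : mR3 -> (R * R * R)%type)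
    (@measurable_id _ mR3 setT) l3 D g mD (measurable_funTS mg).
  by apply => x _.
have H' g : (\int[p3]_(x in D) g x = \int[lam3]_(x in D) g x)%E.
  by apply: eq_measure_integral => A mA _; exact: p3E.
rewrite integralE [RHS]integralE !H ?H'//.
  exact: measurable_funeneg.
exact: measurable_funepos.
Qed.

(** Two measurable structures on the triple product occur: this version matches the integral in
    [L2], while [leb3_integral] serves [cint3] and [norm2]. *)
Lemma leb3_integral_prod (f : pt R -> \bar R) :
  (@integral _ (R * R * R)%type R (@leb3 R) setT f = \int[lam3]_x f x)%E.
Proof.
by apply: (@eq_measure_integral _ (R * R * R)%type R setT lam3 p3) => A mA _; exact: p3E.
Qed.
Lemma leb3_Rintegral (D : set (pt R)) (f : pt R -> R) : measurable D -> mfun f ->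
  @Rintegral _ mR3 R (@leb3 R) D f = Rintegral lam3 D f.
Proof.
by move=> mD mf; congr fine; apply: leb3_integral => //; exact/measurable_EFinP.
Qed.

Lemma cint3E (f : pt R -> R[i]) : cmeas f -> cint3 setT f = cint lam3 f.
Proof.
move=> [mr mi]; apply: cP.
  exact: (leb3_Rintegral measurableT mr).
exact: (leb3_Rintegral measurableT mi).
Qed.
Lemma cint1E (D : set R) (f : R -> R[i]) : measurable D -> cmeas f ->
  cint1 D f = cint (@lam R) (fun t => cR (\1_D t) * f t).
Proof.
move=> mD [mr mi].
have H (g : R -> R) : mfun g ->
    fine (\int[lebesgue_measure]_(x in D) (g x)%:E)%E = Rintegral (@lam R) setT (fun t => \1_D t * g t).
  move=> mg; rewrite leb_integral//; last exact/measurable_EFinP.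
  rewrite -/(Rintegral (@lam R) D g) Rintegral_mkcond; apply: eq_Rintegral => x _.
  by rewrite /patch indicE; case: ifP; rewrite ?mul1r ?mul0r.
apply: cP; rewrite /cint1 /cint /cre /cim /=.
  rewrite [LHS]H//; apply: eq_Rintegral => x _.
  by rewrite -[LHS]/(_ * cre (f x)) -[RHS]/(cre _) !(creE, cimE) mul0r subr0.
rewrite [LHS]H//; apply: eq_Rintegral => x _.
by rewrite -[LHS]/(_ * cim (f x)) -[RHS]/(cim _) !(creE, cimE) mul0r addr0.
Qed.

Lemma nint_leb (f : R -> R) : mfun f -> (forall x, 0 <= f x) ->
  (\int[lebesgue_measure]_x (f x)%:E)%E = nint (@lam R) f.
Proof.
by move=> mf f0; apply: leb_integral => //; exact/measurable_EFinP.
Qed.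
(** The pushforward by a translation gives every interval []a, b]] its length, and Lebesgue measure
    is determined by these values. Scaling is treated in the same way below. *)
Lemma nint_shift (f : R -> R) (c : R) : mfun f -> (forall x, 0 <= f x) ->
  nint (@lam R) (fun x => f (x + c)) = nint (@lam R) f.
Proof.
move=> mf f0.
have mf' : mfun (fun x => (f x)%:E) by exact/measurable_EFinP.
have mc : mfun (fun x : R => x + c) by meas.
have := @ge0_integral_pushforward _ _ R R R (fun x => x + c) mc (@lam R) setT (fun x => (f x)%:E) measurableT mf'.
rewrite preimage_setT => /(_ _)/esym; rewrite /nint => -> //; last by move=> x _; rewrite lee_fin.
apply: eq_measure_integral => A mA _; apply/esym.
apply: (@lebesgue_measure_unique R (pushforward lebesgue_measure (fun x : measurableTypeR R => (x + c) : measurableTypeR R))) => //.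
move=> _ [[a b]] _ <-.
rewrite -[RHS]/(lebesgue_measure ((fun x => x + c) @^-1` `]a, b]%classic)).
rewrite (_ : _ @^-1` _ = `](a - c), (b - c)]%classic); last first.
  by apply/seteqP; split => x /=; rewrite !in_itv /= ltrBlDr lerBrDr.
by rewrite !lebesgue_measure_itv /= !lte_fin ltrD2r; case: ifP => // _;
  rewrite -!EFinB; congr (_%:E); ring.
Qed.

Lemma nint_opp (f : R -> R) : mfun f -> (forall x, 0 <= f x) ->
  nint (@lam R) (fun x => f (- x)) = nint (@lam R) f.
Proof.
move=> mf f0.
have mf' : mfun (fun x => (f x)%:E) by exact/measurable_EFinP.
have mc : mfun (fun x : R => - x) by exact: measurable_funN.
have := @ge0_integral_pushforward _ _ R R R (fun x => - x) mc (@lam R) setT (fun x => (f x)%:E) measurableT mf'.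
rewrite preimage_setT => /(_ _)/esym; rewrite /nint => -> //; last by move=> x _; rewrite lee_fin.
by apply: eq_measure_integral => A mA _; exact: lebesgue_measureN.
Qed.

Lemma nint_scale (f : R -> R) (c : R) : 0 < c -> mfun f -> (forall x, 0 <= f x) ->
  (c%:E * nint (@lam R) (fun x => f (c * x)%R) = nint (@lam R) f)%E.
Proof.
move=> c0 mf f0.
have mf' : mfun (fun x => (f x)%:E) by exact/measurable_EFinP.
have mc : mfun (fun x : R => c * x) by meas.
have := @ge0_integral_pushforward _ _ R R R (fun x => c * x) mc (@lam R) setT (fun x => (f x)%:E) measurableT mf'.
rewrite preimage_setT => /(_ _)/esym; rewrite /nint => -> //; last by move=> x _; rewrite lee_fin.
have := @ge0_integral_mscale _ R R (pushforward (@lam R) (fun x => c * x)) setT measurableT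
  (NngNum (ltW c0)) (fun x => (f x)%:E).
move=> /(_ _ mf') /= <-; last by move=> x _; rewrite lee_fin.
apply: eq_measure_integral => A mA _; apply/esym.
apply: (@lebesgue_measure_unique R (mscale (NngNum (ltW c0)) (pushforward lebesgue_measure (fun x : measurableTypeR R => (c * x) : measurableTypeR R)))) => //.
move=> _ [[a b]] _ <-.
rewrite -[RHS]/(c%:E * lebesgue_measure ((fun x => (c * x)%R) @^-1` `]a, b]%classic))%E.
rewrite (_ : _ @^-1` _ = `](a / c), (b / c)]%classic); last first.
  by apply/seteqP; split => x /=; rewrite !in_itv /= ltr_pdivrMr// ler_pdivlMr// mulrC.
rewrite !lebesgue_measure_itv /= !lte_fin ltr_pM2r ?invr_gt0//.
case: ifP => _; rewrite ?mule0// -!EFinB -EFinM; congr (_%:E); field.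
by rewrite gt_eqF.
Qed.

Lemma mfun_lam_itv (i : interval R) : measurable [set` i].
Proof. meas. Qed.
End LebesgueOnReals.

(** * Derivatives of complex-valued functions of a real variable *)

Section ComplexDerivative.
Variable R : realType.
Implicit Types (f g : R -> R[i]) (t : R) (l m : R[i]).

Definition cder f t l := is_derive t 1 (fun s => cre (f s)) (cre l) /\
  is_derive t 1 (fun s => cim (f s)) (cim l).
Lemma cder_eq f t l m : l = m -> cder f t l -> cder f t m.
Proof. by move=> ->. Qed.
Lemma cder_cst c t : cder (fun=> c) t 0.
Proof. by split; exact: is_derive_cst. Qed.
Lemma cder_cR (r : R -> R) t (s : R) : is_derive t 1 r s -> cder (fun x => cR (r x)) t (cR s).
Proof. by move=> rs; split => //; exact: is_derive_cst. Qed.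
Lemma cderD f g t l m : cder f t l -> cder g t m -> cder (fun s => f s + g s) t (l + m).
Proof.
move=> [fr fi] [gr gi]; split; rewrite (creD, cimD).
  by under eq_fun do rewrite creD; exact: is_deriveD.
by under eq_fun do rewrite cimD; exact: is_deriveD.
Qed.
Lemma cderM f g t l m : cder f t l -> cder g t m ->
  cder (fun s => f s * g s) t (l * g t + f t * m).
Proof.
move=> [fr fi] [gr gi]; split; rewrite !(creE, cimE).
  under eq_fun do rewrite creM.
  apply: is_derive_eq (is_deriveB (is_deriveM fr gr) (is_deriveM fi gi)) _.
  by rewrite /GRing.scale /=; ring.
under eq_fun do rewrite cimM.
apply: is_derive_eq (is_deriveD (is_deriveM fr gi) (is_deriveM fi gr)) _.
by rewrite /GRing.scale /=; ring.
Qed.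
Lemma cderZ f c t l : cder f t l -> cder (fun s => c * f s) t (c * l).
Proof.
move=> fl; apply: cder_eq (cderM (cder_cst c t) fl).
by rewrite mul0r add0r.
Qed.
Lemma cder_cexp f t l : cder f t l -> cder (fun s => cexp (f s)) t (l * cexp (f t)).
Proof.
move=> [fr fi].
have er : is_derive t 1 (fun s => expR (cre (f s))) (expR (cre (f t)) * cre l).
  exact: (is_derive1_comp (is_derive_expR _) fr).
have ec : is_derive t 1 (fun s => cos (cim (f s))) (- sin (cim (f t)) * cim l).
  exact: (is_derive1_comp (is_derive_cos _) fi).
have es : is_derive t 1 (fun s => sin (cim (f s))) (cos (cim (f t)) * cim l).
  exact: (is_derive1_comp (is_derive_sin _) fi).
have e2 : cder (fun s => expi (cim (f s))) t (iC R * cR (cim l) * expi (cim (f t))).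
  split; rewrite !(creE, cimE).
    by apply: is_derive_eq ec _; ring.
  by apply: is_derive_eq es _; ring.
apply: cder_eq (cderM (cder_cR er) e2); rewrite /cexp.
have -> : l = cR (cre l) + iC R * cR (cim l).
  by apply: cP; rewrite !(creE, cimE); ring.
by rewrite !(creE, cimE) !cRM !mul0r !mulr0 !subr0 ?mul1r ?addr0 ?add0r; ring.
Qed.

Lemma cder_zero f : (forall t, cder f t 0) -> forall t s, f t = f s.
Proof.
move=> f0 t s; apply: cP.
  by apply: (@is_derive_0_is_cst R (fun x => cre (f x))) => x; case: (f0 x).
by apply: (@is_derive_0_is_cst R (fun x => cim (f x))) => x; case: (f0 x).
Qed.
Lemma cder_uniq f t l m : cder f t l -> cder f t m -> l = m.
Proof.
move=> [fr fi] [gr gi]; apply: cP.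
  by rewrite -(@derive_val _ _ _ _ _ _ _ fr) -(@derive_val _ _ _ _ _ _ _ gr).
by rewrite -(@derive_val _ _ _ _ _ _ _ fi) -(@derive_val _ _ _ _ _ _ _ gi).
Qed.

Context {d} {T : measurableType d} (mu : {measure set T -> \bar R}).

Lemma cder_cint (f f' : R -> T -> R[i]) (G : T -> R) (a u v : R) : u < a < v ->
  (forall t, cL1 mu (f t)) ->
  (forall t y, u < t < v -> cder (f^~ y) t (f' t y)) ->
  mfun G -> (nint mu G < +oo)%E ->
  (forall t y, u < t < v -> cabs (f' t y) <= G y) ->
  cder (fun t => cint mu (f t)) a (cint mu (f' a)).
Proof.
move=> auv lf df mG Glt fG.
have G0 y : 0 <= G y by apply: le_trans (fG a y auv).
have iG : mu.-integrable setT (EFin \o G).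
  by apply: integrable_nint => //; rewrite (eq_nint G)// => x; rewrite ger0_norm.
have aI : `]u, v[%classic a by [].
have D (g g' : R -> T -> R) : (forall t, mu.-integrable setT (EFin \o g t)) ->
    (forall t y, u < t < v -> is_derive t 1 (g^~ y) (g' t y)) ->
    (forall t y, u < t < v -> `|g' t y| <= G y) ->
    is_derive a 1 (fun t => Rintegral mu setT (g t)) (Rintegral mu setT (g' a)).
  move=> ig dg gG.
  have dE t y : u < t < v -> partial1of2 g t y = g' t y.
    by move=> tuv; rewrite partial1of2E; have := dg t y tuv => h; rewrite derive_val.
  have dd x y : `]u, v[%classic x -> [set: T] y -> derivable (g^~ y) x 1.
    by rewrite /= in_itv /= => xuv _; have [] := dg x y xuv.
  have ub x y : `]u, v[%classic x -> [set: T] y -> `|partial1of2 g x y| <= G y.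
    by rewrite /= in_itv /= => xuv _; rewrite dE// gG.
  apply: DeriveDef.
    exact: (derivable_under_integral measurableT aI (fun x _ => ig x) dd G0 iG ub).
  rewrite -derive1E (differentiation_under_integral measurableT aI (fun x _ => ig x) dd G0 iG ub).
  by apply: eq_Rintegral => y _; exact: dE.
split.
  apply: (D (fun t y => cre (f t y)) (fun t y => cre (f' t y))).
  - by move=> t; exact: cL1_re.
  - by move=> t y tuv; case: (df t y tuv).
  - by move=> t y tuv; apply: le_trans (fG t y tuv); exact: cre_le_cabs.
apply: (D (fun t y => cim (f t y)) (fun t y => cim (f' t y))).
- by move=> t; exact: cL1_im.
- by move=> t y tuv; case: (df t y tuv).
- by move=> t y tuv; apply: le_trans (fG t y tuv); exact: cim_le_cabs.
Qed.

End ComplexDerivative.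

(** * Real Gaussians and translation invariance of the integral *)

Section RealGaussian.
Variable R : realType.
Local Notation lam := (@lam R).

Definition rgauss (a x : R) := expR (- (a * x ^+ 2)).
Lemma rgauss_ge0 a x : 0 <= rgauss a x. Proof. exact: expR_ge0. Qed.
Lemma mfun_rgauss a : mfun (rgauss a).
Proof.
apply: measurableT_comp => //; apply: measurableT_comp => //.
meas.
Qed.
Lemma nint_rgauss a : 0 < a -> nint lam (rgauss a) = (Num.sqrt (pi / a))%:E.
Proof.
move=> a0; have sa0 : 0 < Num.sqrt a by pos.
have sa1 : Num.sqrt a != 0 by rewrite gt_eqF.
have /= := nint_scale sa0 (@measurable_gauss_fun R) (@gauss_fun_ge0 R).
rewrite -(nint_leb (@measurable_gauss_fun R) (@gauss_fun_ge0 R)) integralT_gauss.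
rewrite (eq_nint (rgauss a)); last first.
  by move=> x; rewrite /gauss_fun /rgauss exprMn sqr_sqrtr// ltW.
move=> /(congr1 (fun y => (Num.sqrt a)^-1%:E * y)%E).
rewrite muleA -EFinM mulVf// mul1e => ->; rewrite -EFinM; congr EFin.
by rewrite sqrtrM ?pi_ge0// sqrtrV ?ltW// mulrC.
Qed.

Lemma nint_rgauss_lty a : 0 < a -> (nint lam (rgauss a) < +oo)%E.
Proof. by move=> a0; rewrite nint_rgauss// ltry. Qed.
(** Half of the exponent absorbs the polynomial, by [1 + a / 2 * k^2 <= e^(a / 2 * k^2)]. All
    derivatives of Gaussians met below are dominated in this way. *)
Lemma one_sqr_rgauss (a k : R) : 0 < a ->
  (1 + k ^+ 2) * rgauss a k <= (1 + 2 / a) * rgauss (a / 2) k.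
Proof.
move=> a0; have -> : rgauss a k = rgauss (a / 2) k * rgauss (a / 2) k.
  by rewrite /rgauss -expRD; congr expR; field.
rewrite mulrA ler_wpM2r ?rgauss_ge0//.
rewrite {1}/rgauss expRN ler_pdivrMr ?expR_gt0//.
apply: (@le_trans _ _ ((1 + 2 / a) * (1 + a / 2 * k ^+ 2))).
  rewrite -subr_ge0 (_ : _ - _ = 2 / a + a / 2 * k ^+ 2); last by field; rewrite gt_eqF.
  by rewrite addr_ge0//; [|apply: mulr_ge0; last exact: sqr_ge0]; rewrite ltW// divr_gt0.
by rewrite ler_wpM2l ?expR_ge1Dx// addr_ge0// divr_ge0// ltW.
Qed.

(** From [(k + 2 h)^2 >= 0] one gets [(k + h)^2 >= k^2 / 2 - h^2]. This yields one integrable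
    majorant for all translates by less than [1], as differentiation under the integral requires. *)
Lemma rgauss_shift (a k h : R) : 0 < a -> -1 < h < 1 ->
  rgauss a (k + h) <= expR a * rgauss (a / 2) k.
Proof.
move=> a0 /andP[h1 h2]; rewrite /rgauss -expRD ler_expR.
have : (1 - h) * (1 + h) >= 0 by rewrite mulr_ge0; lra.
have := sqr_ge0 (k + 2 * h).
have : 0 <= a by pos.
by nra.
Qed.

Definition gdom (M a k : R) := M * rgauss (a / 2) k.
Lemma mfun_gdom M a : mfun (gdom M a).
Proof. by apply: measurable_funM => //; exact: mfun_rgauss. Qed.
Lemma nint_gdom M a : 0 <= M -> 0 < a -> (nint lam (gdom M a) < +oo)%E.
Proof.
move=> M0 a0; rewrite nintZ//; last first.
- by move=> x; exact: rgauss_ge0.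
- exact: mfun_rgauss.
by rewrite nint_rgauss ?divr_gt0// -EFinM ltry.
Qed.
(** Invariance for nonnegative integrands extends to integrable ones by writing a real function [r]
    as [(|r| + r) - |r|]. *)
Lemma cint_preserving (phi : R -> R) (f : R -> R[i]) : mfun phi ->
  (forall g : R -> R, mfun g -> (forall x, 0 <= g x) ->
    nint lam (fun x => g (phi x)) = nint lam g) ->
  cL1 lam f -> cL1 lam (fun x => f (phi x)) /\ cint lam (fun x => f (phi x)) = cint lam f.
Proof.
move=> mp pres lf.
have lfp : cL1 lam (fun x => f (phi x)).
  split; first by apply: (cmeas_comp _ mp); case: lf.
  by rewrite (pres (fun x => cabs (f x)))//; [case: lf|apply: cmeas_cabs; case: lf].
split => //.
have H (r : R -> R) : lam.-integrable setT (EFin \o r) -> lam.-integrable setT (EFin \o (r \o phi)) ->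
    Rintegral lam setT (fun x => r (phi x)) = Rintegral lam setT r.
  move=> ir irp.
  have mr : mfun r by case/integrableP : ir => /measurable_EFinP.
  have D s : lam.-integrable setT (EFin \o s) ->
      Rintegral lam setT s = fine (nint lam (fun x => `|s x| + s x)) - fine (nint lam (fun x => `|s x|)).
    move=> is_; have ias : lam.-integrable setT (EFin \o (fun x => `|s x|)).
      exact: (integrable_abse is_).
    rewrite -[fine (nint _ _)]/(Rintegral lam setT (fun x => `|s x| + s x)).
    rewrite -[X in _ - X]/(Rintegral lam setT (fun x => `|s x|)).
    by rewrite RintegralD// addrC addKr.
  rewrite D// [RHS]D//; congr (fine _ - fine _).
    apply: (pres (fun x => `|r x| + r x)).
      by apply: measurable_funD => //; exact: measurableT_comp.
    by move=> x; have := ler_norm (- r x); rewrite normrN; lra.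
  by apply: (pres (fun x => `|r x|)) => //; exact: measurableT_comp.
apply: cP; rewrite /cint /=.
  by apply: (H (fun x => cre (f x))); [exact: cL1_re|exact: (cL1_re lfp)].
by apply: (H (fun x => cim (f x))); [exact: cL1_im|exact: (cL1_im lfp)].
Qed.

Lemma shift_cint (f : R -> R[i]) (c : R) : cL1 lam f ->
  cL1 lam (fun x => f (x + c)) /\ cint lam (fun x => f (x + c)) = cint lam f.
Proof.
move=> lf; apply: cint_preserving => //; first by meas.
by move=> g mg g0; exact: nint_shift.
Qed.
Lemma opp_cint (f : R -> R[i]) : cL1 lam f ->
  cL1 lam (fun x => f (- x)) /\ cint lam (fun x => f (- x)) = cint lam f.
Proof.
move=> lf; apply: cint_preserving => //.
by move=> g mg g0; exact: nint_opp.
Qed.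

(* Translation invariance makes the integral of a derivative vanish. *)
Lemma cint_derivative (f f' : R -> R[i]) (M a : R) : 0 < a -> 0 <= M -> cL1 lam f ->
  (forall k, cder f k (f' k)) ->
  (forall k, cabs (f' k) <= M * ((1 + k ^+ 2) * rgauss a k)) -> cint lam f' = 0.
Proof.
move=> a0 M0 lf df fM.
have lfs (c : R) := (shift_cint c lf).1.
pose M' := M * ((1 + 2 / a) * expR (a / 2)).
have M'0 : 0 <= M'.
  pos.
have a2 : 0 < a / 2 by pos.
have H : cder (fun t => cint lam (fun k => f (k + t))) 0 (cint lam (fun k => f' (k + 0))).
  apply: (@cder_cint R _ _ lam (fun t k => f (k + t)) (fun t k => f' (k + t))
    (gdom M' (a / 2)) 0 (-1) 1) => //.
  - by rewrite ltrN10 ltr01.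
  - move=> t y _; have [dr di] := df (y + t).
    have sh : is_derive t (1 : R) (fun s => y + s) 1.
      by apply: is_derive_eq (is_deriveD (is_derive_cst y t 1) (is_derive_id t 1)) _; exact: add0r.
    split.
      by have := is_derive1_comp dr sh; rewrite mulr1.
    by have := is_derive1_comp di sh; rewrite mulr1.
  - exact: mfun_gdom.
  - exact: nint_gdom.
  move=> t y t1; apply: le_trans (fM _) _.
  rewrite /gdom /M' -[leRHS]mulrA ler_wpM2l//.
  apply: le_trans (one_sqr_rgauss _ a0) _.
  rewrite -[leRHS]mulrA ler_wpM2l ?addr_ge0 ?divr_ge0 ?(ltW a0)//.
  exact: rgauss_shift.
have -> : f' = (fun k => f' (k + 0)) by apply/funext => k; rewrite addr0.
apply: (cder_uniq H).
have -> : (fun t => cint lam (fun k => f (k + t))) = (fun=> cint lam f).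
  by apply/funext => t; rewrite (shift_cint t lf).2.
exact: cder_cst.
Qed.
End RealGaussian.

(** * Gaussian integrals with a complex parameter *)

Section ComplexGaussian.
Variable R : realType.
Local Notation lam := (@lam R).
Implicit Types z : R[i].

Definition egauss z (x k : R) : R[i] := cexp (- z * cR (k ^+ 2) + iC R * cR (x * k)).
Lemma cabs_egauss z x k : cabs (egauss z x k) = rgauss (cre z) k.
Proof.
rewrite cabs_cexp /rgauss; congr expR; rewrite !(creE, cimE) /=; ring.
Qed.

Lemma cmeas_egauss z x : cmeas (egauss z x).
Proof.
apply: cmeas_cexp; apply: cmeasD; apply: cmeasM; try exact: cmeas_cst.
  meas.
meas.
Qed.
Lemma cL1_egauss z x : 0 < cre z -> cL1 lam (egauss z x).
Proof.
move=> z0; split; first exact: cmeas_egauss.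
under eq_nint do rewrite cabs_egauss; exact: nint_rgauss_lty.
Qed.

Lemma cL1_poly_egauss z x (p : R -> R[i]) (M : R) : 0 < cre z -> 0 <= M -> cmeas p ->
  (forall k, cabs (p k) <= M * (1 + k ^+ 2)) -> cL1 lam (fun k => p k * egauss z x k).
Proof.
move=> z0 M0 mp pM.
apply: (cL1_dom (r := gdom (M * (1 + 2 / cre z)) (cre z))).
- by apply: cmeasM => //; exact: cmeas_egauss.
- exact: mfun_gdom.
- move=> k; rewrite cabsM cabs_egauss /gdom -mulrA.
  apply: le_trans (ler_wpM2l M0 (one_sqr_rgauss k z0)); rewrite mulrA.
  by rewrite ler_wpM2r ?rgauss_ge0.
by apply: nint_gdom => //; rewrite mulr_ge0// addr_ge0// divr_ge0// ltW.
Qed.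

Lemma cder_sqr (k : R) : cder (fun k : R => cR (k ^+ 2)) k (cR (2 * k)).
Proof.
apply: cder_cR; apply: is_derive_eq (is_deriveX 2 (is_derive_id k 1)) _.
by rewrite /GRing.scale /= expr1 mulr1 mulr_natl.
Qed.
Lemma cder_lin (c k : R) : cder (fun k : R => cR (c * k)) k (cR c).
Proof.
apply: cder_cR; apply: is_derive_eq (is_deriveZ c (is_derive_id k 1)) _.
by rewrite /GRing.scale /= mulr1.
Qed.
Lemma cder_linr (c k : R) : cder (fun k : R => cR (k * c)) k (cR c).
Proof. by have := cder_lin c k; under [X in cder X]eq_fun do rewrite mulrC. Qed.
Lemma cder_egauss_k z x k :
  cder (egauss z x) k ((- 2 * z * cR k + iC R * cR x) * egauss z x k).
Proof.
apply: cder_eq (cder_cexp (cderD (cderZ (- z) (cder_sqr k)) (cderZ (iC R) (cder_lin x k)))).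
by rewrite cRM cR_nat; congr (_ * _); ring.
Qed.

Lemma norm_le_one_sqr (k : R) : `|k| <= 1 + k ^+ 2.
Proof. by rewrite -(real_normK (num_real k)); have := sqr_ge0 (`|k| - 1); nra. Qed.
(** The integral of the [k]-derivative of [egauss z x] is zero. Likewise [cint_k2_egauss] comes from
    the derivative of [k * egauss z 0 k]. The two identities are the differential equations, in [x]
    and in [z], behind the closed forms below. *)
Lemma cint_k_egauss z x : 0 < cre z ->
  2 * z * cint lam (fun k => cR k * egauss z x k) = iC R * cR x * cint lam (egauss z x).
Proof.
move=> z0.
have M0 : 0 <= 2 * cabs z + `|x| by pos.
have l1 : cL1 lam (fun k => cR k * egauss z x k).
  apply: (@cL1_poly_egauss _ _ _ 1) => //; first by meas.
  by move=> k; rewrite mul1r cabs_cR norm_le_one_sqr.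
have := cint_derivative z0 M0 (cL1_egauss x z0) (cder_egauss_k z x).
have -> : (fun k => (- 2 * z * cR k + iC R * cR x) * egauss z x k) =
  (fun k => (- 2 * z) * (cR k * egauss z x k) + (iC R * cR x) * egauss z x k).
  by apply/funext => k; ring.
rewrite cintD; [|exact: cL1Z|exact/cL1Z/cL1_egauss].
rewrite !cintZ//; last exact: cL1_egauss.
move=> H; apply/eqP; rewrite -subr_eq0 -oppr_eq0 opprB; apply/eqP; rewrite -[RHS]H; first by ring.
move=> k; rewrite mulrDl; apply: le_trans (cabsD _ _) _.
rewrite !(cabsM _ (egauss _ _ _)) !cabs_egauss !cabsM cabs_iC mul1r !cabs_cR cabsN.
have -> : cabs (2 : R[i]) = 2 by rewrite -cR_nat cabs_cRp.
have k1 : `|k| <= 1 + k ^+ 2 := norm_le_one_sqr k.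
have k2 : 1 <= 1 + k ^+ 2 by rewrite lerDl sqr_ge0.
rewrite -mulrDl [leRHS]mulrA; apply: ler_wpM2r; first exact: rgauss_ge0.
rewrite [leRHS]mulrDl; apply: lerD; first by rewrite ler_wpM2l// mulr_ge0.
by rewrite ler_peMr.
Qed.

Lemma cint_k2_egauss z : 0 < cre z ->
  2 * z * cint lam (fun k => cR (k ^+ 2) * egauss z 0 k) = cint lam (egauss z 0).
Proof.
move=> z0.
have M0 : 0 <= 1 + 2 * cabs z by pos.
have l1 : cL1 lam (fun k => cR k * egauss z 0 k).
  apply: (@cL1_poly_egauss _ _ _ 1) => //; first by meas.
  by move=> k; rewrite mul1r cabs_cR norm_le_one_sqr.
have l2 : cL1 lam (fun k => cR (k ^+ 2) * egauss z 0 k).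
  apply: (@cL1_poly_egauss _ _ _ 1) => //; first by meas.
  by move=> k; rewrite mul1r cabs_cR ger0_norm ?sqr_ge0// lerDr.
have dk k : cder (fun k => cR k * egauss z 0 k) k
    (egauss z 0 k + (- 2 * z) * (cR (k ^+ 2) * egauss z 0 k)).
  apply: cder_eq (cderM (cder_cR (is_derive_id k 1)) (cder_egauss_k z 0 k)).
  by rewrite cR0 cR1 cRX; ring.
have := cint_derivative z0 M0 l1 dk.
rewrite cintD; [|exact: cL1_egauss|exact: cL1Z].
rewrite !cintZ//.
move=> H; apply/eqP; rewrite -subr_eq0 -oppr_eq0 opprB; apply/eqP; rewrite -[RHS]H; first by ring.
move=> k; apply: le_trans (cabsD _ _) _.
rewrite [X in _ + cabs X]mulrA !(cabsM _ (egauss _ _ _)) !cabs_egauss !cabsM !cabs_cR cabsN ger0_norm ?sqr_ge0//.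
have -> : cabs (2 : R[i]) = 2 by rewrite -cR_nat cabs_cRp.
rewrite -[X in X + _ <= _]mul1r -mulrDl [leRHS]mulrA; apply: ler_wpM2r; first exact: rgauss_ge0.
have := sqr_ge0 k; have := cabs_ge0 z; nra.
Qed.

Definition gauss0 z := cint lam (egauss z 0).
(** As a function of [x] the integral solves [F' = - x / (2 z) * F], so its product with
    [e^(x^2 / (4 z))] is constant. *)
Lemma egauss_closed z x : 0 < cre z ->
  cint lam (egauss z x) = gauss0 z * cexp (- cR (x ^+ 2) / (4 * z)).
Proof.
move=> z0; have zn0 : z != 0 by apply: contraTneq z0 => ->; rewrite cre0 ltxx.
have n2 : (2 : R[i]) != 0 by [].
have dF (t : R) : cder (fun t => cint lam (egauss z t)) t (- cR t / (2 * z) * cint lam (egauss z t)).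
  have := @cder_cint R _ _ lam (fun t k => egauss z t k)
    (fun t k => iC R * (cR k * egauss z t k)) (gdom (1 + 2 / cre z) (cre z)) t (t - 1) (t + 1).
  have lt1 : cL1 lam (fun k => cR k * egauss z t k).
    apply: (@cL1_poly_egauss _ _ _ 1) => //; first by meas.
    by move=> k; rewrite mul1r cabs_cR norm_le_one_sqr.
  rewrite cintZ//.
  have -> : cint lam (fun k => cR k * egauss z t k) = iC R * cR t / (2 * z) * cint lam (egauss z t).
    apply: (mulfI (mulf_neq0 n2 zn0)); rewrite cint_k_egauss//; field.
    by [].
  move=> H; apply: cder_eq (H _ _ _ _ _ _).
  - by rewrite mulrA mulrA mulrA iC2; field; rewrite zn0.
  - by rewrite ltrBlDr !ltrDl ltr01.
  - by move=> s; exact: cL1_egauss.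
  - move=> s y _; apply: cder_eq (cder_cexp (cderD (cder_cst _ s) (cderZ (iC R) (cder_linr y s)))).
    by rewrite /egauss; ring.
  - exact: mfun_gdom.
  - by apply: nint_gdom => //; rewrite addr_ge0// divr_ge0// ltW.
  move=> s y _; rewrite mulrA (cabsM _ (egauss _ _ _)) cabs_egauss !cabsM cabs_iC mul1r cabs_cR.
  apply: le_trans (one_sqr_rgauss y z0).
  by rewrite ler_wpM2r ?rgauss_ge0 ?norm_le_one_sqr.
pose Q (t : R) := cint lam (egauss z t) * cexp (cR (t ^+ 2) / (4 * z)).
have dQ t : cder Q t 0.
  have d2 : cder (fun t => cR (t ^+ 2) / (4 * z)) t (cR (2 * t) / (4 * z)).
    by have := cderM (cder_sqr t) (cder_cst (4 * z)^-1 t); rewrite mulr0 addr0.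
  apply: cder_eq (cderM (dF t) (cder_cexp d2)).
  rewrite cRM cR_nat; field.
  by [].
have := cder_zero dQ x 0; rewrite /Q expr0n /= cR0 mul0r cexp0 mulr1 -/(gauss0 z) => <-.
by rewrite -mulrA -cexpD mulNr subrr cexp0 mulr1.
Qed.

Lemma gauss0_real (r : R) : 0 < r -> gauss0 (cR r) = cR (Num.sqrt (pi / r)).
Proof.
move=> r0; rewrite /gauss0.
have -> : egauss (cR r) 0 = (fun k => cR (rgauss r k)).
  apply/funext => k; rewrite /egauss mul0r cR0 mulr0 addr0 mulNr -cRM -cRN.
  exact: cexp_cR.
by rewrite cint_cR /Rintegral -/(nint lam (rgauss r)) nint_rgauss.
Qed.

(** Squaring avoids the choice of a branch of the square root. Along the vertical line through [z]
    the function [Z * gauss0 Z ^ 2] has zero derivative, and on the real axis it equals [pi]. *)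
Lemma gauss0_sqr z : 0 < cre z -> z * (gauss0 z * gauss0 z) = cR pi.
Proof.
move=> z0; set r := cre z.
pose Z (s : R) : R[i] := cR r + iC R * cR s.
have Zre s : cre (Z s) = r by rewrite /Z !(creE, cimE); ring.
have Z0 s : Z s != 0.
  by apply: contraTneq z0 => /(congr1 (@cre R)); rewrite Zre cre0 -/r => ->; rewrite ltxx.
have n2 : (2 : R[i]) != 0 by [].
have dZ s : cder Z s (iC R).
  apply: cder_eq (cderD (cder_cst (cR r) s) (cderZ (iC R) (cder_cR (is_derive_id s 1)))).
  by rewrite cR1 add0r mulr1.
have dF s : cder (fun s => gauss0 (Z s)) s (- iC R / (2 * Z s) * gauss0 (Z s)).
  have := @cder_cint R _ _ lam (fun t k => egauss (Z t) 0 k)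
    (fun t k => - iC R * (cR (k ^+ 2) * egauss (Z t) 0 k)) (gdom (1 + 2 / r) r) s (s - 1) (s + 1).
  have l2 : cL1 lam (fun k => cR (k ^+ 2) * egauss (Z s) 0 k).
    apply: (@cL1_poly_egauss _ _ _ 1); rewrite ?Zre//; first by meas.
    by move=> k; rewrite mul1r cabs_cR ger0_norm ?sqr_ge0// lerDr.
  rewrite cintZ//.
  have -> : cint lam (fun k => cR (k ^+ 2) * egauss (Z s) 0 k) = gauss0 (Z s) / (2 * Z s).
    apply: (mulfI (mulf_neq0 n2 (Z0 s))); rewrite cint_k2_egauss ?Zre// -/(gauss0 _); field.
    by [].
  move=> H; apply: cder_eq (H _ _ _ _ _ _).
  - by ring.
  - by rewrite ltrBlDr !ltrDl ltr01.
  - by move=> t; apply: cL1_egauss; rewrite Zre.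
  - move=> t y _.
    have e1 := cderM (cderZ (-1) (dZ t)) (cder_cst (cR (y ^+ 2)) t).
    have := cder_cexp (cderD e1 (cder_cst (iC R * cR (0 * y)) t)).
    have -> : (fun s0 => cexp (-1 * Z s0 * cR (y ^+ 2) + iC R * cR (0 * y))) = (fun s0 => egauss (Z s0) 0 y).
      by apply/funext => s0; rewrite /egauss mulN1r.
    by apply: cder_eq; rewrite /egauss (mulN1r (Z t)); ring.
  - exact: mfun_gdom.
  - by apply: nint_gdom => //; rewrite addr_ge0// divr_ge0// ltW.
  move=> t y _; rewrite mulrA (cabsM _ (egauss _ _ _)) cabs_egauss !cabsM cabsN cabs_iC mul1r cabs_cR Zre.
  rewrite ger0_norm ?sqr_ge0//; apply: le_trans (one_sqr_rgauss y z0).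
  by rewrite ler_wpM2r ?rgauss_ge0// lerDr.
pose Q s := Z s * (gauss0 (Z s) * gauss0 (Z s)).
have dQ s : cder Q s 0.
  apply: cder_eq (cderM (dZ s) (cderM (dF s) (dF s))).
  by field; rewrite Z0.
have zE : z = Z (cim z) by apply: cP; rewrite /Z !(creE, cimE) /r; ring.
have -> : z * (gauss0 z * gauss0 z) = Q (cim z) by rewrite /Q -zE.
rewrite (cder_zero dQ (cim z) 0) /Q.
have -> : Z 0 = cR r by rewrite /Z cR0 mulr0 addr0.
by rewrite gauss0_real// -!cRM -expr2 sqr_sqrtr ?divr_ge0 ?pi_ge0 ?ltW// mulrC divfK ?gt_eqF.
Qed.

Lemma cabs_gauss0 z : 0 < cre z -> cabs (gauss0 z) = Num.sqrt (pi / cabs z).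
Proof.
move=> z0; have zn0 : z != 0 by apply: contraTneq z0 => ->; rewrite cre0 ltxx.
have cz : cabs z != 0 by rewrite cabs_eq0.
have := congr1 (@cabs R) (gauss0_sqr z0); rewrite !cabsM cabs_cR ger0_norm ?pi_ge0// => H.
by rewrite -H mulrAC mulfV// mul1r -expr2 sqrtr_sqr ger0_norm.
Qed.
Lemma cabs_cint_egauss z x : 0 < cre z -> cabs (cint lam (egauss z x)) <= Num.sqrt (pi / cabs z).
Proof.
move=> z0; rewrite egauss_closed// cabsM cabs_gauss0// ler_piMr ?sqrtr_ge0//.
rewrite cabs_cexp -expR0 ler_expR.
have -> : - cR (x ^+ 2) / (4 * z) = cR (- (x ^+ 2 / (4 * cabs2 z))) * conjc z.
  have zn0 : z != 0 by apply: contraTneq z0 => ->; rewrite cre0 ltxx.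
  rewrite cRN cRM cRV cRM -mulcconj cR_nat; field.
  by rewrite conjc_eq0 zn0.
rewrite !(creE, cimE) mul0r subr0 mulNr oppr_le0 mulr_ge0 ?(ltW z0)//.
by rewrite divr_ge0 ?sqr_ge0// mulr_ge0.
Qed.

End ComplexGaussian.

Ltac meas_atom ::= first [exact: mfun_rgauss | exact: cmeas_egauss].

(** * An abstract Plancherel inequality for superpositions *)

Section PlancherelBound.
Variable R : realType.
Context {d1 d2} {X : measurableType d1} {K : measurableType d2}.
Variables (muX : {sigma_finite_measure set X -> \bar R})
  (muK : {sigma_finite_measure set K -> \bar R}).
Variables (e : X -> K -> R[i]) (rho : nat -> X -> R) (N : nat -> K -> K -> R) (L : R).
Hypothesis me : cmeas (fun z : X * K => e z.1 z.2).
Hypothesis e1 : forall x k, cabs (e x k) <= 1.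
Hypothesis mrho : forall n, mfun (rho n).
Hypothesis rho0 : forall n x, 0 <= rho n x.
Hypothesis rhoL1 : forall n, (nint muX (rho n) < +oo)%E.
Hypothesis rho_lim : forall x, rho n x @[n --> \oo] --> (1 : R).
Hypothesis mN : forall n, mfun (fun z : K * K => N n z.1 z.2).
Hypothesis N0 : forall n k l, 0 <= N n k l.
Hypothesis N_sym : forall n k l, N n k l = N n l k.
Hypothesis NE : forall n k l,
  cint muX (fun x => cR (rho n x) * (e x k * conjc (e x l))) = cR (N n k l).
Hypothesis N_le : forall n k, (nint muK (N n k) <= L%:E)%E.
Hypothesis L0 : 0 <= L.

Variable w : K -> R[i].
Hypothesis lw : cL1 muK w.
Let phi x := cint muK (fun k => w k * e x k).
Let mwe : cmeas (fun z : X * K => w z.2 * e z.1 z.2).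
Proof. by apply: cmeasM => //; apply: (cmeas_comp _ measurable_snd); case: lw. Qed.

Lemma cmeas_superposition : cmeas phi.
Proof. exact: (cmeas_cint1 muK (f := fun z => w z.2 * e z.1 z.2)). Qed.
Let W := fine (nint muK (fun k => cabs (w k))).
Let WE : W%:E = nint muK (fun k => cabs (w k)).
Proof.
by rewrite /W fineK// ge0_fin_numE ?nint_ge0//; case: lw.
Qed.
Lemma cabs_superposition x : cabs (phi x) <= W.
Proof.
apply: (cabs_cint_le (r := fun k => cabs (w k))) => //.
- exact: (cmeas_sec1 (f := fun z => w z.2 * e z.1 z.2)).
- by apply: cmeas_cabs; case: lw.
- by move=> k; rewrite cabsM ler_piMr.
- by rewrite WE.
Qed.

Let lwe x : cL1 muK (fun k => w k * e x k).
Proof.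
apply: (cL1_Mb (k := 1)) => //.
by apply: (cmeas_sec1 (f := fun z => e z.1 z.2)).
Qed.
(** [N n] is the Gram kernel of the family [e] under the weight [rho n]. Expanding [|phi|^2] and
    integrating in [x] first leaves the quadratic form of [N n] in [w]; the inequality
    [2 |w k| |w l| <= |w k|^2 + |w l|^2] and the row bound [L] estimate it, and Fatou removes the
    weight. *)
Lemma nint_superposition_le :
  (nint muX (fun x => cabs2 (phi x)) <= L%:E * nint muK (fun k => cabs2 (w k)))%E.
Proof.
have mw : cmeas w by case: lw.
have mphi := cmeas_superposition.
have mrphi n : mfun (fun x => rho n x * cabs2 (phi x)) by meas.
have W0 : 0 <= W by rewrite -lee_fin WE nint_ge0.
apply: (nint_fatou (f_ := fun n x => rho n x * cabs2 (phi x))) => //.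
- by move=> n x; rewrite mulr_ge0.
- move=> x; rewrite -[X in _ --> X]mul1r; apply: cvgM => //; exact: cvg_cst.
move=> n.
(* The integrand of the squared superposition; the integrable weight [rho n] makes the triple
   integral absolutely convergent. *)
pose F (z : X * (K * K)) := cR (rho n z.1) *
  ((w z.2.1 * e z.1 z.2.1) * conjc (w z.2.2 * e z.1 z.2.2)).
have m1 : mfun (fun z : X * (K * K) => (z.1, z.2.1)).
  by apply: measurable_fun_pair => //; exact: measurableT_comp.
have m2 : mfun (fun z : X * (K * K) => (z.1, z.2.2)).
  by apply: measurable_fun_pair => //; exact: measurableT_comp.
have mF : cmeas F.
  apply: cmeasM; first by apply: cmeas_cR; exact: measurableT_comp.
  apply: cmeasM; first exact: (cmeas_comp mwe m1).
  by apply: cmeas_conj; exact: (cmeas_comp mwe m2).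
have mcw : mfun (fun k => cabs (w k)) by meas.
have mcw2 : mfun (fun k => cabs2 (w k)) by meas.
have lF : cL1 (prodm muX (prodm muK muK)) F.
  apply: (cL1_prod_dom (a := rho n) (b := fun z => cabs (w z.1) * cabs (w z.2))) => //.
  - by apply: measurable_funM; [exact: (measurableT_comp mcw measurable_fst)|exact: (measurableT_comp mcw measurable_snd)].
  - by move=> z; rewrite mulr_ge0.
  - by rewrite (nint_tensor _ _ (a := fun k => cabs (w k)) (b := fun k => cabs (w k)))// -WE -EFinM ltry.
  move=> x [k l] /=; rewrite cabsM cabs_cRp// ler_wpM2l//.
  by rewrite cabsM cabs_conj !cabsM ler_pM ?mulr_ge0// ler_piMr.
have E1 x : cR (rho n x * cabs2 (phi x)) = cint (prodm muK muK) (fun z => F (x, z)).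
  pose f k := w k * e x k; pose g k := conjc (f k).
  have lg : cL1 muK g by apply: cL1_conj; exact: lwe.
  have lt : cL1 (prodm muK muK) (fun z => f z.1 * g z.2) by apply: cL1_tensor => //; exact: lwe.
  rewrite cRM -mulcconj -[RHS]/(cint (prodm muK muK) (fun z => cR (rho n x) * (f z.1 * g z.2))).
  rewrite (cintZ _ lt) (cint_tensor (lwe x) lg) /g cint_conj//; exact: lwe.
have fin : (nint muX (fun x => (rho n x * cabs2 (phi x))%R) < +oo)%E.
  apply: (@le_lt_trans _ _ (nint muX (fun x => (W ^+ 2) * rho n x))).
    apply: le_nint => //; first by meas.
      by move=> x; rewrite mulr_ge0.
    move=> x; rewrite mulrC ler_wpM2r// cabs2E ler_pXn2r// ?nnegrE//.
    exact: cabs_superposition.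
  by rewrite nintZ ?sqr_ge0//; apply: lte_mul_pinfty => //; rewrite lee_fin sqr_ge0.
pose G (z : K * K) := (w z.1 * conjc (w z.2)) * cR (N n z.1 z.2).
have E2 : cR (Rintegral muX setT (fun x => rho n x * cabs2 (phi x))) = cint (prodm muK muK) G.
  rewrite -cint_cR (eq_cint _ E1) (cFubini lF); apply: eq_cint => -[k l].
  rewrite /G /= -NE -cintZ; last first.
    apply: (cL1_Mb (k := 1)); first exact: cL1_cR.
      apply: cmeasM; first exact: (cmeas_sec2 k me).
      by apply: cmeas_conj; exact: (cmeas_sec2 l me).
    by move=> x; rewrite cabsM cabs_conj mulr_ile1.
  by apply: eq_cint => x; rewrite /F /= conjcM; ring.
have mG : cmeas G.
  apply: cmeasM; last by meas.
  apply: cmeasM; first exact: (cmeas_comp mw).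
  by apply: cmeas_conj; exact: (cmeas_comp mw).
have E3 : nint muX (fun x => rho n x * cabs2 (phi x)) = (cabs (cint (prodm muK muK) G))%:E.
  rewrite -E2 -nint_Rintegral//; last by move=> x; rewrite mulr_ge0.
  by rewrite cabs_cRp// Rintegral_ge0// => x _; rewrite mulr_ge0.
rewrite E3; apply: le_trans (cabs_cint_nint _ mG) _.
have m1w : mfun (fun z : K * K => cabs2 (w z.1)) by exact: (measurableT_comp mcw2).
have m2w : mfun (fun z : K * K => cabs2 (w z.2)) by exact: (measurableT_comp mcw2).
have mA : mfun (fun z : K * K => 2^-1 * cabs2 (w z.1) * N n z.1 z.2).
  meas.
have mB : mfun (fun z : K * K => 2^-1 * cabs2 (w z.2) * N n z.1 z.2).
  meas.
apply: (@le_trans _ _ (nint (prodm muK muK) (fun z => 2^-1 * cabs2 (w z.1) * N n z.1 z.2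
    + 2^-1 * cabs2 (w z.2) * N n z.1 z.2))).
  apply: le_nint => //; first by meas.
    meas.
  move=> [k l] /=; rewrite !cabsM cabs_conj cabs_cRp// -mulrDl ler_wpM2r// !cabs2E.
  have := sqr_ge0 (cabs (w k) - cabs (w l)); nra.
rewrite nintD//; [|by move=> z; rewrite !mulr_ge0..].
rewrite nint_prod1//; last by move=> z; rewrite !mulr_ge0.
rewrite [X in (_ + X)%E]nint_prod2//; last by move=> z; rewrite !mulr_ge0.
have H : (\int[muK]_k nint muK (fun l => (2^-1 * cabs2 (w k) * N n k l)%R) <=
    (2^-1 * L)%:E * nint muK (fun k => cabs2 (w k)))%E.
  apply: (@le_trans _ _ (nint muK (fun k => (2^-1 * L) * cabs2 (w k)))); last first.
    by rewrite nintZ// mulr_ge0.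
  apply: ge0_le_integral => //.
  - by move=> k _; apply: nint_ge0 => l; rewrite !mulr_ge0.
  - by apply: (mfun_nint1 muK mA) => z; rewrite !mulr_ge0.
  - by apply/measurable_EFinP; meas.
  move=> k _; rewrite nintZ//; last 2 first.
  - pos.
  - exact: (measurableT_comp (mN n) (pair1_measurable k)).
  rewrite (_ : 2^-1 * L * _ = 2^-1 * cabs2 (w k) * L); last by ring.
  by rewrite [leRHS]EFinM lee_wpmul2l// lee_fin mulr_ge0.
have -> : (\int[muK]_y nint muK (fun x => (2^-1 * cabs2 (w (x, y).2) * N n (x, y).1 (x, y).2)%R)
    = \int[muK]_k nint muK (fun l => (2^-1 * cabs2 (w k) * N n k l)%R))%E.
  by apply: eq_integral => k _ /=; apply: eq_nint => l; rewrite N_sym.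
apply: le_trans (leeD H H) _.
rewrite -ge0_muleDl ?lee_fin ?mulr_ge0// -EFinD lee_wpmul2r ?nint_ge0//.
by rewrite lee_fin -mulrDl -mulr2n -[2^-1 *+ 2]mulr_natr mulVf ?mul1r.
Qed.
End PlancherelBound.

(** * The Fourier transform on the line and Plancherel's identity *)

Section Plancherel1.
Variable R : realType.
Local Notation lam := (@lam R).

Definition epsn (n : nat) : R := n.+1%:R^-1.
Lemma epsn_gt0 n : 0 < epsn n. Proof. pos. Qed.
Lemma epsn_cvg : epsn n @[n --> \oo] --> (0 : R).
Proof. exact: cvg_harmonic. Qed.
Lemma rgauss_epsn_cvg x : rgauss (epsn n) x @[n --> \oo] --> (1 : R).
Proof.
have h : - (epsn n * x ^+ 2) @[n --> \oo] --> (0 : R).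
  have -> : (0 : R) = - (0 * x ^+ 2) by rewrite mul0r oppr0.
  by apply: cvgN; apply: cvgM; [exact: epsn_cvg|exact: cvg_cst].
by rewrite -(@expR0 R); apply: (cvg_comp _ _ h (@continuous_expR R 0)).
Qed.

Lemma egauss_real (a x k : R) : egauss (cR a) x k = cR (rgauss a k) * expi (x * k).
Proof.
by rewrite /egauss cexpD cexp_im mulNr -cRM -cRN cexp_cR.
Qed.
Lemma cint_rgauss_expi (a x : R) : 0 < a ->
  cint lam (fun k => cR (rgauss a k) * expi (x * k)) =
  cR (Num.sqrt (pi / a) * rgauss (4 * a)^-1 x).
Proof.
move=> a0; under eq_cint do rewrite -egauss_real.
rewrite egauss_closed// gauss0_real// [RHS]cRM; congr (_ * _).
have -> : - cR (x ^+ 2) / (4 * cR a) = cR (- ((4 * a)^-1 * x ^+ 2)).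
  by rewrite -(cR_nat R 4) -cRM -cRV -cRN -cRM; congr cR; ring.
exact: cexp_cR.
Qed.

(** The Fourier transform of the Gaussian weight [rgauss (epsn n)], at [k - l]: an approximate
    identity of total mass [2 pi]. *)
Definition Nker (n : nat) (k l : R) := Num.sqrt (pi / epsn n) * rgauss (4 * epsn n)^-1 (k - l).
Lemma Nker_ge0 n k l : 0 <= Nker n k l.
Proof. pos. Qed.
Lemma Nker_sym n k l : Nker n k l = Nker n l k.
Proof. by rewrite /Nker /rgauss -opprB sqrrN. Qed.
Lemma mfun_Nker n : mfun (fun z : R * R => Nker n z.1 z.2).
Proof.
apply: measurable_funM => //; apply: (measurableT_comp (mfun_rgauss _)).
meas.
Qed.
Lemma nint_Nker n k : nint lam (Nker n k) = (2 * pi)%:E.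
Proof.
have e0 := epsn_gt0 n; have e4 : 0 < (4 * epsn n)^-1 by pos.
rewrite (eq_nint (fun l : R => Num.sqrt (pi / epsn n) * rgauss (4 * epsn n)^-1 (l + - k))); last first.
  by move=> l; rewrite Nker_sym.
rewrite (nint_shift (f := fun l : R => Num.sqrt (pi / epsn n) * rgauss (4 * epsn n)^-1 l)); last first.
- by move=> l; rewrite mulr_ge0 ?sqrtr_ge0 ?rgauss_ge0.
- meas.
rewrite nintZ ?sqrtr_ge0//; [|side|side].
rewrite nint_rgauss// -EFinM; congr EFin.
rewrite -sqrtrM ?divr_ge0 ?pi_ge0 ?ltW//.
have -> : pi / epsn n * (pi / (4 * epsn n)^-1) = (2 * pi) ^+ 2 :> R.
  by field; rewrite gt_eqF// mulrn_wgt0// gt_eqF.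
by rewrite sqrtr_sqr ger0_norm// mulr_ge0 ?pi_ge0.
Qed.

Lemma Nker_int n k l :
  cint lam (fun x => cR (rgauss (epsn n) x) * (expi (x * k) * conjc (expi (x * l)))) = cR (Nker n k l).
Proof.
rewrite /Nker -cint_rgauss_expi ?epsn_gt0//; apply: eq_cint => x.
by rewrite conj_expi -expiD; congr (_ * expi _); ring.
Qed.
Lemma cmeas_expi_mul : cmeas (fun z : R * R => expi (z.1 * z.2)).
Proof. meas. Qed.

(** Unnormalised and with the sign [+] in the exponent, so that multiplying [u] by
    [expi (n * w * t)] replaces the energy [E] by [E + n * w]. *)
Definition ft (u : R -> R[i]) (E : R) := cint lam (fun t => u t * expi (E * t)).
Lemma cmeas_ft u : cL1 lam u -> cmeas (ft u).
Proof.
by move=> lu; exact: (@cmeas_superposition R _ _ R R lam (fun x k => expi (x * k)) cmeas_expi_mul u lu).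
Qed.

Lemma cabs_ft u E : cL1 lam u -> cabs (ft u E) <= fine (nint lam (fun t => cabs (u t))).
Proof.
move=> lu; apply: (@cabs_superposition R _ _ R R lam (fun x k => expi (x * k)) cmeas_expi_mul _ u lu) => x k.
by rewrite cabs_expi.
Qed.
Lemma plancherel_le u : cL1 lam u ->
  (nint lam (fun E => cabs2 (ft u E)) <= (2 * pi)%:E * nint lam (fun t => cabs2 (u t)))%E.
Proof.
move=> lu; apply: (nint_superposition_le (muX := lam) (muK := lam) (e := fun x k => expi (x * k))
  (rho := fun n => rgauss (epsn n)) (N := Nker) (L := 2 * pi)) => //.
- meas.
- by move=> x k; rewrite cabs_expi.
- by move=> n; meas.
- by move=> n x; exact: rgauss_ge0.
- by move=> n; exact: nint_rgauss_lty (epsn_gt0 n).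
- exact: rgauss_epsn_cvg.
- exact: mfun_Nker.
- exact: Nker_ge0.
- exact: Nker_sym.
- exact: Nker_int.
- by move=> n k; rewrite nint_Nker.
- by rewrite mulr_ge0 ?pi_ge0.
Qed.

Definition Mker (n : nat) (k l : R) := Num.sqrt (pi / epsn n) * rgauss (8 * epsn n)^-1 (k - l).
(** Half of the exponent is spent on [e^(-x) <= 1 / x], which gives the small factor [epsn n]; the
    other half remains as the kernel [Mker], whose mass does not depend on [n]. *)
Lemma Nker_far n (k l : R) (del : R) : 0 < del -> del <= `|k - l| ->
  Nker n k l <= 8 * epsn n / del ^+ 2 * Mker n k l.
Proof.
move=> d0 dkl; have e0 := epsn_gt0 n.
rewrite /Nker /Mker mulrCA ler_wpM2l ?sqrtr_ge0//.
set a := (8 * epsn n)^-1; have a0 : 0 < a by pos.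
have -> : (4 * epsn n)^-1 = 2 * a by rewrite /a; field; rewrite gt_eqF.
have -> : rgauss (2 * a) (k - l) = rgauss a (k - l) * rgauss a (k - l).
  by rewrite /rgauss -expRD; congr expR; ring.
rewrite ler_wpM2r ?rgauss_ge0// {1}/rgauss expRN.
have ex := expR_ge1Dx (a * (k - l) ^+ 2).
have dd : del ^+ 2 <= (k - l) ^+ 2.
  by rewrite -(real_normK (num_real (k - l))) ler_pXn2r ?nnegrE// ltW.
have -> : 8 * epsn n / del ^+ 2 = (a * del ^+ 2)^-1.
  by rewrite /a; field; rewrite !gt_eqF// exprn_gt0.
rewrite lef_pV2 ?posrE ?expR_gt0 ?mulr_gt0 ?exprn_gt0//.
apply: le_trans ex; apply: (@le_trans _ _ (a * (k - l) ^+ 2)); first by rewrite ler_wpM2l// ltW.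
by rewrite lerDr.
Qed.

Lemma Mker_ge0 n k l : 0 <= Mker n k l.
Proof. pos. Qed.
Lemma Mker_le n k l : Mker n k l <= Num.sqrt (pi / epsn n).
Proof.
rewrite ler_piMr ?sqrtr_ge0// /rgauss -expR0 ler_expR oppr_le0 mulr_ge0 ?sqr_ge0//.
pos.
Qed.

Lemma mfun_Mker n k : mfun (Mker n k).
Proof.
apply: measurable_funM => //; apply: (measurableT_comp (mfun_rgauss _)).
meas.
Qed.
Lemma nint_Mker n k : nint lam (Mker n k) = (Num.sqrt 8 * pi)%:E.
Proof.
have e0 := epsn_gt0 n; have e4 : 0 < (8 * epsn n)^-1 by pos.
rewrite (eq_nint (fun l : R => Num.sqrt (pi / epsn n) * rgauss (8 * epsn n)^-1 (l + - k))); last first.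
  by move=> l; rewrite /Mker /rgauss -opprB sqrrN.
rewrite (nint_shift (f := fun l : R => Num.sqrt (pi / epsn n) * rgauss (8 * epsn n)^-1 l)); last first.
- by move=> l; rewrite mulr_ge0 ?sqrtr_ge0 ?rgauss_ge0.
- meas.
rewrite nintZ ?sqrtr_ge0//; [|side|side].
rewrite nint_rgauss// -EFinM; congr EFin.
rewrite -sqrtrM ?divr_ge0 ?pi_ge0 ?ltW//.
have -> : pi / epsn n * (pi / (8 * epsn n)^-1) = 8 * pi ^+ 2 :> R.
  by field; rewrite gt_eqF// mulrn_wgt0// gt_eqF.
by rewrite sqrtrM// sqrtr_sqr ger0_norm// pi_ge0.
Qed.

Definition ccont_at (u : R -> R[i]) t := forall e : R, 0 < e ->
  exists2 del : R, 0 < del & forall s, `|s - t| < del -> cabs (u s - u t) <= e.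
(** Here [u] may be unbounded, like the Abel kernel near [0]. Continuity at [t] controls the
    neighbourhood of [t]; away from it [Nker_far] leaves a small factor, applied to the integrable
    [u s] with the supremum of [Mker], and to the constant [u t] with its mass. *)
Lemma Nker_conv_cvg u t : cL1 lam u -> ccont_at u t ->
  ccvg_seq (fun n => cint lam (fun s => u s * cR (Nker n t s))) (cR (2 * pi) * u t).
Proof.
move=> lu cu; have mu_ : cmeas u by case: lu.
have p0 : 0 <= 2 * pi :> R by rewrite mulr_ge0 ?pi_ge0.
have mN n : mfun (Nker n t).
  exact: (measurableT_comp (mfun_Nker n) (pair1_measurable t)).
have lN n : cL1 lam (fun s => cR (Nker n t s)).
  apply: cL1_cR => //; first by move=> x; exact: Nker_ge0.
  by rewrite nint_Nker ltry.
have NB n s : cabs (cR (Nker n t s)) <= Num.sqrt (pi / epsn n).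
  rewrite cabs_cRp ?Nker_ge0// /Nker ler_piMr ?sqrtr_ge0//.
  rewrite /rgauss -expR0 ler_expR oppr_le0 mulr_ge0 ?sqr_ge0// invr_ge0 mulr_ge0// ltW//.
  exact: epsn_gt0.
have luN n : cL1 lam (fun s => u s * cR (Nker n t s)).
  by apply: (cL1_Mb lu _ (NB n)); meas.
have E n : cint lam (fun s => u s * cR (Nker n t s)) - cR (2 * pi) * u t =
    cint lam (fun s => (u s - u t) * cR (Nker n t s)).
  have -> : cR (2 * pi) = cint lam (fun s => cR (Nker n t s)).
    by rewrite cint_cR /Rintegral -/(nint lam (Nker n t)) nint_Nker.
  rewrite mulrC -cintZ// -cintB//; last exact: cL1Z.
  by apply: eq_cint => s; ring.
apply/ccvgP; apply/cvgrPdist_le => /= eps eps0.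
have e4 : 0 < eps / (4 * pi) by rewrite divr_gt0// mulr_gt0// pi_gt0.
have [del d0 Hd] := cu _ e4.
set W := fine (nint lam (fun t => cabs (u t))).
have WE : W%:E = nint lam (fun t => cabs (u t)).
  by rewrite /W fineK// ge0_fin_numE ?nint_ge0//; case: lu.
have W0 : 0 <= W by rewrite -lee_fin WE nint_ge0.
(* The far contribution: the supremum of [Mker] grows like [epsn^(-1/2)], so the term with [W] is of
   order [sqrt epsn]; the term with [u t] is of order [epsn]. *)
pose B (n : nat) := 8 / del ^+ 2 * (Num.sqrt pi * W * Num.sqrt (epsn n) + cabs (u t) * (Num.sqrt 8 * pi) * epsn n).
have B0 : B n @[n --> \oo] --> (0 : R).
  have -> : (0 : R) = 8 / del ^+ 2 * (Num.sqrt pi * W * Num.sqrt 0 + cabs (u t) * (Num.sqrt 8 * pi) * 0).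
    by rewrite sqrtr0 !mulr0 addr0 mulr0.
  apply: cvgM; first exact: cvg_cst.
  apply: cvgD; (apply: cvgM; first exact: cvg_cst); last exact: epsn_cvg.
  by apply: (cvg_comp _ _ epsn_cvg (@sqrt_continuous R 0)).
have e2 : 0 < eps / 2 by pos.
have [n0 _ Hn0] := (cvgrPdist_le _ _).1 B0 _ e2.
exists n0 => // n n0n; have {Hn0} /= := Hn0 n n0n; rewrite sub0r normrN => Bn.
rewrite sub0r normrN ger0_norm// E.
have en0 := epsn_gt0 n.
have mcu : mfun (fun s => cabs (u s)) by meas.
pose S := Num.sqrt (pi / epsn n).
pose r s := eps / (4 * pi) * Nker n t s + 8 * epsn n / del ^+ 2 * (S * cabs (u s) + cabs (u t) * Mker n t s).
have p8 : 0 <= 8 * epsn n / del ^+ 2 by pos.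
have mM := mfun_Mker n t.
have m1 : mfun (fun s => S * cabs (u s)) by meas.
have m2 : mfun (fun s => cabs (u t) * Mker n t s) by meas.
have S0 : 0 <= S by pos.
apply: (cabs_cint_le (r := r)).
- by apply: cmeasM; [apply: cmeasB => //; exact: cmeas_cst|exact: cmeas_cR].
- apply: measurable_funD; apply: measurable_funM => //; meas.
- move=> s; rewrite cabsM cabs_cRp ?Nker_ge0// /r.
  have [near|far] := ltP `|s - t| del.
    apply: ler_wpDr; last by rewrite ler_wpM2r ?Nker_ge0// Hd.
    pos.
  apply: ler_wpDl; first by rewrite mulr_ge0 ?Nker_ge0// ltW.
  have /(Nker_far n d0) H : del <= `|t - s| by rewrite distrC.
  apply: (@le_trans _ _ ((cabs (u s) + cabs (u t)) * (8 * epsn n / del ^+ 2 * Mker n t s))).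
    by rewrite ler_pM ?Nker_ge0// cabsB.
  rewrite mulrCA ler_wpM2l// mulrDl lerD2r mulrC ler_wpM2r//.
  exact: Mker_le.
rewrite nintD//; last 4 first.
- meas.
- meas.
- by move=> s; rewrite mulr_ge0 ?Nker_ge0// ltW.
- by move=> s; rewrite mulr_ge0// addr_ge0// mulr_ge0// Mker_ge0.
rewrite (@nintZ _ _ _ lam (eps / (4 * pi)) (Nker n t)) ?(ltW e4)//; last by move=> s; exact: Nker_ge0.
rewrite (@nintZ _ _ _ lam (8 * epsn n / del ^+ 2))//; last 2 first.
- meas.
- by move=> s; rewrite addr_ge0// mulr_ge0// Mker_ge0.
rewrite nintD//; last 2 first.
- by move=> s; rewrite mulr_ge0.
- by move=> s; rewrite mulr_ge0// Mker_ge0.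
rewrite (@nintZ _ _ _ lam S (fun s => cabs (u s)))// (@nintZ _ _ _ lam (cabs (u t)) (Mker n t))//; last by move=> s; exact: Mker_ge0.
rewrite nint_Nker nint_Mker -WE -!(EFinM, EFinD) lee_fin.
have -> : eps / (4 * pi) * (2 * pi) = eps / 2.
  have : pi != 0 :> R by rewrite gt_eqF// pi_gt0.
  by move: (@pi R) => p p0'; field.
rewrite [leRHS](_ : eps = eps / 2 + eps / 2); last by field.
rewrite lerD2l; apply: le_trans (ler_norm _) _; apply: le_trans Bn.
apply: le_of_eq; congr (`|_|); rewrite /B /S.
have sE : epsn n = Num.sqrt (epsn n) * Num.sqrt (epsn n) by rewrite -expr2 sqr_sqrtr// ltW.
have -> : Num.sqrt (pi / epsn n) = Num.sqrt pi / Num.sqrt (epsn n) :> R.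
  by rewrite sqrtrM ?pi_ge0// sqrtrV// ltW.
have s0 : Num.sqrt (epsn n) != 0 by rewrite gt_eqF// sqrtr_gt0.
rewrite {1}sE; set q := Num.sqrt (epsn n) in sE s0 *.
by rewrite sE; field; rewrite s0 gt_eqF.
Qed.

Lemma ft_inverse_reg u n t : cL1 lam u ->
  cint lam (fun E => (ft u E * cR (rgauss (epsn n) E)) * expi (t * - E)) =
  cint lam (fun s => u s * cR (Nker n t s)).
Proof.
move=> lu; have mu_ : cmeas u by case: lu.
pose F (z : R * R) := (u z.2 * expi (z.1 * z.2)) * (cR (rgauss (epsn n) z.1) * expi (t * - z.1)).
have mF : cmeas F.
  apply: cmeasM; apply: cmeasM.
  - exact: (cmeas_comp mu_ measurable_snd).
  - meas.
  - by apply: cmeas_cR; apply: (measurableT_comp (mfun_rgauss _)).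
  - by apply: cmeas_expi; apply: measurable_funM => //; apply: measurableT_comp.
have lF : cL1 (prodm lam lam) F.
  apply: (cL1_prod_dom (a := rgauss (epsn n)) (b := fun s => cabs (u s))) => //.
  - meas.
  - meas.
  - by move=> x; exact: rgauss_ge0.
  - exact: nint_rgauss_lty (epsn_gt0 n).
  - by case: lu.
  by move=> x y; rewrite !cabsM !cabs_expi !mulr1 cabs_cRp ?rgauss_ge0// mulrC.
transitivity (cint lam (fun E => cint lam (fun s => F (E, s)))).
  apply: eq_cint => E; rewrite /F /ft /= -mulrA mulrC -cintZ.
    by apply: eq_cint => s; ring.
  by apply: (cL1_Mb (k := 1) lu) => [|x]; [apply: cmeas_expi; exact: measurable_funM|rewrite cabs_expi].
rewrite (cFubini lF); apply: eq_cint => s; rewrite /F /=.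
rewrite /Nker -cint_rgauss_expi ?epsn_gt0// -cintZ.
  rewrite -[LHS](opp_cint _).2.
    apply: eq_cint => E; rewrite /rgauss sqrrN !mulNr opprK.
    rewrite mulrACA -mulrA; congr (_ * _).
    by rewrite -expiD; congr (_ * expi _); ring.
  have := cL1_cint1 lF => _.
  apply: (cL1_bM (k := cabs (u s)) (f := fun E => cR (rgauss (epsn n) E) * expi (t * - E))).
  - apply: (cL1_Mb (k := 1)) => [||x]; last by rewrite cabs_expi.
      apply: cL1_cR; [exact: mfun_rgauss|move=> x; exact: rgauss_ge0|].
      exact: nint_rgauss_lty (epsn_gt0 n).
    meas.
  - meas.
  - by move=> x; rewrite cabsM cabs_expi mulr1.
apply: (cL1_Mb (k := 1)) => [||x]; last by rewrite cabs_expi.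
  apply: cL1_cR; [exact: mfun_rgauss|move=> x; exact: rgauss_ge0|].
  exact: nint_rgauss_lty (epsn_gt0 n).
meas.
Qed.

Lemma mfun_ind_neq0 : mfun (fun t : R => \1_[set t : R | t != 0] t : R).
Proof.
apply: measurable_indic; rewrite (_ : [set t | t != 0] = ~` [set 0 : R]).
  by apply: measurableC; meas.
by apply/seteqP; split=> t /=; [move/eqP|move=> /eqP].
Qed.
Lemma ae_neq0 (f : R -> R) : mfun f -> (forall t, 0 <= f t) ->
  nint lam f = nint lam (fun t => \1_[set t | t != 0] t * f t).
Proof.
move=> mf f0; rewrite /nint; apply: ae_eq_integral => //.
- exact/measurable_EFinP.
- apply/measurable_EFinP; apply: measurable_funM => //.
  exact: mfun_ind_neq0.
exists [set 0]; split; [exact: measurable_set1|exact: lebesgue_measure_set1|].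
move=> t /= H; apply: contrapT => t0; apply: H => _.
by rewrite indicE mem_set ?mul1r//=; apply/eqP.
Qed.

(** The Gaussian-regularised inverse transforms of [ft u] converge to [2 pi * u t] at each [t != 0],
    and [plancherel_le] bounds their norms by that of [ft u]; Fatou concludes. The point [0] is
    exempted because functions supported on a half line jump or blow up there. *)
Lemma plancherel_ge u : cL1 lam u -> (forall t, t != 0 -> ccont_at u t) ->
  ((2 * pi)%:E * nint lam (fun t => cabs2 (u t)) <= nint lam (fun E => cabs2 (ft u E)))%E.
Proof.
move=> lu cu; have mu_ : cmeas u by case: lu.
have p2 : 0 < 2 * pi :> R by rewrite mulr_gt0// pi_gt0.
have mu2 : mfun (fun t => cabs2 (u t)) by meas.
have mft := cmeas_ft lu.
have mft2 : mfun (fun E => cabs2 (ft u E)) by meas.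
pose w n E := ft u E * cR (rgauss (epsn n) E).
set W := fine (nint lam (fun t => cabs (u t))).
have lw n : cL1 lam (w n).
  apply: (cL1_bM (k := W)) => //; last by move=> x; exact: cabs_ft.
  apply: cL1_cR; [exact: mfun_rgauss|move=> x; exact: rgauss_ge0|].
  exact: nint_rgauss_lty (epsn_gt0 n).
pose v n t := cint lam (fun s => u s * cR (Nker n t s)).
have vE n t : v n t = ft (fun E => w n (- E)) t.
  rewrite /v -ft_inverse_reg// /ft -[RHS](opp_cint _).2.
    by apply: eq_cint => E; rewrite opprK.
  have [lwo _] := opp_cint (lw n).
  apply: (cL1_Mb (k := 1) lwo) => [|x]; last by rewrite cabs_expi.
  meas.
have lwo n : cL1 lam (fun E => w n (- E)) by exact: (opp_cint (lw n)).1.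
have mv n : cmeas (v n).
  by apply: (cmeas_eq _ (cmeas_ft (lwo n))) => t; rewrite vE.
have I (n : nat) : (nint lam (fun t => cabs2 (v n t)) <= (2 * pi)%:E * nint lam (fun E => cabs2 (ft u E)))%E.
  under eq_nint do rewrite vE.
  apply: le_trans (plancherel_le (lwo n)) _; apply: lee_wpmul2l; first by rewrite lee_fin ltW.
  rewrite (nint_opp (f := fun E => cabs2 (w n E)))//; last by meas.
  apply: le_nint => //; first by meas.
  move=> E; rewrite cabs2M cabs2_cR ler_piMr//.
  rewrite expr_le1 ?rgauss_ge0//.
  by rewrite /rgauss -expR0 ler_expR oppr_le0 mulr_ge0 ?sqr_ge0// ltW// epsn_gt0.
pose ind (t : R) : R := \1_[set t | t != 0] t.
have mind : mfun ind.
  exact: mfun_ind_neq0.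
have ind0 t : 0 <= ind t by [].
have ind1 t : ind t <= 1 by rewrite /ind indicE lern1 leq_b1.
have F : (nint lam (fun t => (ind t * ((2 * pi) ^+ 2 * cabs2 (u t)))%R) <= (2 * pi)%:E * nint lam (fun E => cabs2 (ft u E)))%E.
  apply: (nint_fatou (f_ := fun n t => ind t * cabs2 (v n t))).
  - by move=> n; apply: measurable_funM => //; exact: cmeas_cabs2.
  - by move=> n x; rewrite mulr_ge0.
  - move=> t; have [->|t0] := eqVneq t 0.
      have -> : ind 0 = 0 by rewrite /ind indicE memNset//= eqxx.
      by under eq_fun do rewrite mul0r; rewrite mul0r; exact: cvg_cst.
    apply: cvgM; first exact: cvg_cst.
    rewrite -cabs2_cR -cabs2M; apply: ccvg_cabs2.
    exact: Nker_conv_cvg (cu t t0).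
  move=> n; apply: le_trans (I n); apply: le_nint => //.
  - meas.
  - meas.
  - by move=> x; rewrite mulr_ge0.
  - by move=> x; rewrite ler_piMl.
rewrite -ae_neq0 in F; [|exact: measurable_funM|by move=> t; rewrite mulr_ge0 ?sqr_ge0].
rewrite nintZ ?sqr_ge0// in F.
have pE : ((2 * pi) ^+ 2)%:E = ((2 * pi)%:E * (2 * pi)%:E)%E :> \bar R by [].
rewrite pE -muleA in F.
by rewrite -(@lee_pmul2l _ (2 * pi)%:E)// lte_fin.
Qed.
End Plancherel1.

(** * Cauchy-Schwarz inequality and Schur test *)

Section KernelEstimates.
Variable R : realType.

(** The optimal choice is [l = I / A]. When [I = 0] the claim is that [G] is nonnegative: for
    negative [G] the choice [l = sqrt (- G / A) / 2] would make the right side negative. *)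
Lemma sqr_le_of_young (I A G : R) : 0 <= I -> 0 < A ->
  (forall l, 0 < l -> I <= 2^-1 * (l * A + G / l)) -> I ^+ 2 <= A * G.
Proof.
move=> I0 A0 H; have [->|In0] := eqVneq I 0.
  rewrite expr0n/=; rewrite leNgt; apply/negP => AG.
  have G0 : G < 0 by rewrite -(pmulr_rlt0 _ A0).
  have l0 : 0 < 1 / 2 * Num.sqrt (- G / A) by rewrite mulr_gt0// sqrtr_gt0 divr_gt0// oppr_gt0.
  have /le_trans/(_ (H _ l0)) := I0; rewrite pmulr_rge0 ?invr_gt0// => /(mulr_ge0 (ltW l0)).
  set l := 1 / 2 * _.
  have -> : l * (l * A + G / l) = l ^+ 2 * A + G.
    by field; rewrite gt_eqF.
  rewrite /l exprMn sqr_sqrtr; last by rewrite divr_ge0 ?oppr_ge0// ltW.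
  rewrite (_ : _ + G = 3 / 4 * G); first by rewrite pmulr_rge0 ?divr_gt0// leNgt G0.
  by field; rewrite gt_eqF.
have Ip : 0 < I by rewrite lt_def In0.
have l0 : 0 < I / A by pos.
have := H _ l0; rewrite (_ : _ * (_ + _) = 2^-1 * (I + A * G / I)); last first.
  by field; rewrite !gt_eqF.
move=> h; have : I <= A * G / I by lra.
by rewrite ler_pdivlMr// -expr2.
Qed.

Lemma cauchy_schwarz_weight {d} {T : measurableType d} (mu : {measure set T -> \bar R})
    (f : T -> R[i]) (a g : T -> R) (A : R) :
  cmeas f -> mfun a -> mfun g ->
  (forall x, 0 <= a x) -> (forall x, 0 <= g x) -> (forall x, cabs (f x) <= a x * g x) ->
  0 < A -> (nint mu a <= A%:E)%E ->
  ((cabs2 (cint mu f))%:E <= A%:E * nint mu (fun x => (a x * g x ^+ 2)%R))%E.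
Proof.
move=> mf ma mg a0 g0 fag A0 aA.
have mag : mfun (fun x => a x * g x ^+ 2).
  meas.
have ag0 x : 0 <= a x * g x ^+ 2 by pos.
have [G|Goo] := ltP (nint mu (fun x => a x * g x ^+ 2)) +oo%E; last first.
  have -> : nint mu (fun x => a x * g x ^+ 2) = +oo%E by apply/eqP; rewrite -leye_eq.
  by rewrite gt0_muley ?lte_fin// leey.
have GE : (fine (nint mu (fun x => a x * g x ^+ 2)))%:E = nint mu (fun x => a x * g x ^+ 2).
  by rewrite fineK// ge0_fin_numE// nint_ge0.
move: GE; set G' := fine _ => GE.
rewrite -GE -EFinM lee_fin cabs2E; apply: sqr_le_of_young => // l l0.
apply: (@cabs_cint_le _ _ _ mu f (fun x => 2^-1 * (l * a x) + 2^-1 * (l^-1 * (a x * g x ^+ 2)))) => //.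
- meas.
- move=> x; apply: le_trans (fag x) _.
  have -> : 2^-1 * (l * a x) + 2^-1 * (l^-1 * (a x * g x ^+ 2)) =
    a x * g x + a x * (2^-1 * l^-1 * (l - g x) ^+ 2) by field; rewrite gt_eqF.
  by rewrite lerDl mulr_ge0// mulr_ge0 ?sqr_ge0// mulr_ge0// invr_ge0 ltW.
rewrite nintD//; last 4 first.
- meas.
- meas.
- by move=> x; rewrite !mulr_ge0// ltW.
- by move=> x; rewrite mulr_ge0// mulr_ge0// invr_ge0 ltW.
rewrite (@nintZ _ _ _ mu 2^-1 (fun x => l * a x))//; last 2 first.
- meas.
- by move=> x; rewrite mulr_ge0// ltW.
rewrite (@nintZ _ _ _ mu 2^-1 (fun x => l^-1 * (a x * g x ^+ 2)))//; last 2 first.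
- meas.
- by move=> x; rewrite mulr_ge0// invr_ge0 ltW.
rewrite (@nintZ _ _ _ mu l a) ?(ltW l0)// (@nintZ _ _ _ mu l^-1 (fun x => a x * g x ^+ 2)) ?invr_ge0 ?(ltW l0)// -GE.
rewrite mulrDr EFinD mulrA; apply: leeD; last first.
  by rewrite -!EFinM lee_fin [X in _ <= 2^-1 * X]mulrC.
rewrite muleA -EFinM [leRHS]EFinM lee_wpmul2l// lee_fin mulr_ge0// ltW//.
Qed.

(** For fixed [x], Cauchy-Schwarz is applied to the weight [a (x, y)] of mass at most [A1]; Tonelli
    then uses the mass [A2] of the columns. *)
Lemma schur_test {d1 d2} {X : measurableType d1} {Y : measurableType d2}
    (mX : {sigma_finite_measure set X -> \bar R}) (mY : {sigma_finite_measure set Y -> \bar R})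
    (F : X * Y -> R[i]) (a : X * Y -> R) (g : Y -> R) (A1 A2 : R) :
  cmeas F -> mfun a -> mfun g ->
  (forall z, 0 <= a z) -> (forall y, 0 <= g y) ->
  (forall x y, cabs (F (x, y)) <= a (x, y) * g y) -> 0 < A1 -> 0 <= A2 ->
  (forall x, nint mY (fun y => a (x, y)) <= A1%:E)%E ->
  (forall y, nint mX (fun x => a (x, y)) <= A2%:E)%E ->
  (nint mX (fun x => cabs2 (cint mY (fun y => F (x, y)))) <=
    (A1 * A2)%:E * nint mY (fun y => (g y ^+ 2)%R))%E.
Proof.
move=> mF ma mg a0 g0 Fag A10 A20 H1 H2.
have mag : mfun (fun z => A1 * (a z * g z.2 ^+ 2)).
  by do 2 apply: measurable_funM => //; apply: measurable_funX; exact: (measurableT_comp mg).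
have ag0 z : 0 <= A1 * (a z * g z.2 ^+ 2) by pos.
apply: (@le_trans _ _ (\int[mX]_x nint mY (fun y => (A1 * (a (x, y) * g y ^+ 2))%R))%E).
  apply: ge0_le_integral => //.
  - by move=> x _; rewrite lee_fin.
  - by apply/measurable_EFinP; apply: cmeas_cabs2; exact: cmeas_cint1.
  - exact: (mfun_nint1 mY mag ag0).
  move=> x _; rewrite nintZ ?(ltW A10)//; last 2 first.
  - apply: measurable_funM; first exact: (measurableT_comp ma (pair1_measurable x)).
    meas.
  - by move=> y; rewrite mulr_ge0 ?sqr_ge0.
  apply: cauchy_schwarz_weight => //; first exact: cmeas_sec1.
  exact: (measurableT_comp ma (pair1_measurable x)).
rewrite (nint_tonelli mX mY mag ag0).
rewrite -nintZ ?mulr_ge0 ?(ltW A10)//; last 2 first.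
- meas.
- by move=> y; rewrite sqr_ge0.
apply: ge0_le_integral => //.
- by move=> y _; apply: nint_ge0 => x; exact: (ag0 (x, y)).
- exact: (mfun_nint2 mX mag ag0).
- by apply/measurable_EFinP; apply: measurable_funM => //; meas.
move=> y _ /=.
rewrite (eq_nint (fun x => (A1 * g y ^+ 2) * a (x, y))); last by move=> x; ring.
rewrite nintZ ?mulr_ge0 ?sqr_ge0 ?(ltW A10)//; last exact: (measurableT_comp ma (pair2_measurable y)).
rewrite mulrAC [leRHS]EFinM lee_wpmul2l// lee_fin mulr_ge0 ?sqr_ge0// ltW//.
Qed.
End KernelEstimates.

(** * Convolution on the line and sequential continuity *)

Section Convolution.
Variable R : realType.
Local Notation lam := (@lam R).
Implicit Types u v : R -> R[i].

Definition L1n u : R := fine (nint lam (fun t => cabs (u t))).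
Lemma L1nE u : cL1 lam u -> (L1n u)%:E = nint lam (fun t => cabs (u t)).
Proof. by move=> [_ lu]; rewrite fineK// ge0_fin_numE// nint_ge0. Qed.
Lemma L1n_ge0 u : 0 <= L1n u.
Proof. by rewrite fine_ge0// nint_ge0. Qed.
Definition cconv u v t := cint lam (fun s => u s * v (t - s)).

Lemma mfun_subr_pair : mfun (fun z : R * R => z.1 - z.2).
Proof. meas. Qed.
Lemma mfun_subl_pair : mfun (fun z : R * R => z.2 - z.1).
Proof. meas. Qed.
Lemma cmeas_subl v t : cmeas v -> cmeas (fun s : R => v (t - s)).
Proof. by move=> mv; apply: (cmeas_comp mv); apply: measurable_funB. Qed.

Lemma cmeas_conv u v : cmeas u -> cmeas v -> cmeas (cconv u v).
Proof.
move=> cu cv; apply: (cmeas_cint1 lam (f := fun z : R * R => u z.2 * v (z.1 - z.2))).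
apply: cmeasM; first exact: (cmeas_comp cu).
exact: (cmeas_comp cv mfun_subr_pair).
Qed.
Lemma cL1_conv_bounded u v k t : cL1 lam u -> cmeas v -> (forall s, cabs (v s) <= k) ->
  cL1 lam (fun s => u s * v (t - s)).
Proof. by move=> lu cv vk; apply: (cL1_Mb lu (k := k)) => //; exact: cmeas_subl. Qed.

Lemma conv_bounded u v k t : cL1 lam u -> cmeas v -> (forall s, cabs (v s) <= k) ->
  cabs (cconv u v t) <= k * L1n u.
Proof.
move=> lu cv vk; have k0 : 0 <= k by apply: le_trans (cabs_ge0 _) (vk 0).
have mu_ : cmeas u by case: lu.
apply: (cabs_cint_le (r := fun s => k * cabs (u s))).
- by apply: cmeasM => //; exact: cmeas_subl.
- meas.
- by move=> s; rewrite cabsM mulrC ler_wpM2r.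
by rewrite nintZ//; [rewrite -L1nE// EFinM|exact: cmeas_cabs].
Qed.

Lemma convC_bounded u v k t : cL1 lam u -> cmeas v -> (forall s, cabs (v s) <= k) ->
  cconv u v t = cint lam (fun s => v s * u (t - s)).
Proof.
move=> lu cv vk; have l := cL1_conv_bounded t lu cv vk.
have [l1 e1] := shift_cint t l; have [_ e2] := opp_cint l1.
rewrite /cconv -e1 -e2; apply: eq_cint => s.
by rewrite mulrC (_ : t - (- s + t) = s) 1?[- s + t]addrC//; ring.
Qed.

Lemma convBr u v v' k k' t : cL1 lam u -> cmeas v -> (forall s, cabs (v s) <= k) ->
  cmeas v' -> (forall s, cabs (v' s) <= k') ->
  cconv u (fun s => v s - v' s) t = cconv u v t - cconv u v' t.
Proof.
move=> lu cv vk cv' vk'.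
rewrite /cconv -(cintB (cL1_conv_bounded t lu cv vk) (cL1_conv_bounded t lu cv' vk')).
by apply: eq_cint => s; rewrite mulrBr.
Qed.

Lemma cL1_conv_prod u v : cL1 lam u -> cL1 lam v ->
  cL1 (prodm lam lam) (fun z => u z.1 * v (z.2 - z.1)).
Proof.
move=> lu lv; have cu : cmeas u by case: lu. have cv : cmeas v by case: lv.
have cF : cmeas (fun z : R * R => u z.1 * v (z.2 - z.1)).
  apply: cmeasM; first exact: (cmeas_comp cu).
  exact: (cmeas_comp cv mfun_subl_pair).
apply: cL1_prod => //.
have mcv : mfun (fun t => cabs (v t)) by meas.
have mcu : mfun (fun t => cabs (u t)) by meas.
have -> : (\int[lam]_x nint lam (fun y => (cabs (u (x, y).1 * v ((x, y).2 - (x, y).1)))%R) =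
   nint lam (fun s => (L1n v * cabs (u s))%R))%E.
  apply: eq_integral => s _ /=.
  rewrite (eq_nint (fun t : R => cabs (u s) * cabs (v (t + - s)))); last by move=> t; rewrite cabsM.
  rewrite (@nintZ _ _ _ lam (cabs (u s)) (fun t => cabs (v (t - s))))//; last first.
    by apply: (measurableT_comp mcv); apply: measurable_funD.
  by rewrite (nint_shift (f := fun t => cabs (v t)))// -L1nE// -EFinM mulrC.
rewrite nintZ ?L1n_ge0//; apply: lte_mul_pinfty => //; first by rewrite lee_fin L1n_ge0.
by case: lu.
Qed.

Lemma cL1_conv u v : cL1 lam u -> cL1 lam v -> cL1 lam (cconv u v).
Proof. by move=> lu lv; exact: (cL1_cint2 (cL1_conv_prod lu lv)). Qed.
Lemma cL1_expi u (E : R) : cL1 lam u -> cL1 lam (fun t => u t * expi (E * t)).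
Proof.
move=> lu; apply: (cL1_Mb (k := 1) lu) => [|x]; last by rewrite cabs_expi.
meas.
Qed.

Lemma cint_conv u v : cL1 lam u -> cL1 lam v -> cint lam (cconv u v) = cint lam u * cint lam v.
Proof.
move=> lu lv; rewrite -(cFubini (cL1_conv_prod lu lv)).
transitivity (cint lam (fun s => cint lam v * u s)).
  apply: eq_cint => s /=; have [l e] := shift_cint (- s) lv.
  by rewrite (cintZ _ l) e mulrC.
by rewrite cintZ// mulrC.
Qed.

Lemma ft_conv u v k E : cL1 lam u -> cL1 lam v -> (forall s, cabs (v s) <= k) ->
  ft (cconv u v) E = ft u E * ft v E.
Proof.
move=> lu lv vk; have cv : cmeas v by case: lv.
have lu' := cL1_expi E lu; have lv' := cL1_expi E lv.
rewrite /ft -(cint_conv lu' lv'); apply: eq_cint => t.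
rewrite /cconv mulrC -(cintZ _ (cL1_conv_bounded t lu cv vk)); apply: eq_cint => s.
rewrite mulrACA -expiD mulrC; congr (_ * expi _); ring.
Qed.

Lemma ccont_seq u t :
  (forall s : nat -> R, s n @[n --> \oo] --> t -> ccvg_seq (fun n => u (s n)) (u t)) ->
  ccont_at u t.
Proof.
move=> H e e0; apply: contrapT => N.
have B n : exists s : R, `|s - t| < epsn R n /\ ~~ (cabs (u s - u t) <= e).
  apply: contrapT => Nn; apply: N; exists (epsn R n); first exact: epsn_gt0.
  move=> s st; apply: contrapT => us; apply: Nn; exists s; split => //.
  exact/negP.
pose s n := projT1 (cid (B n)).
have sP n : `|s n - t| < epsn R n /\ ~~ (cabs (u (s n) - u t) <= e) by exact: projT2 (cid (B n)).
have st : s n @[n --> \oo] --> t.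
  apply/cvgrPdist_lt => d d0; have [n0 _ Hn] := (cvgrPdist_lt _ _).1 (@epsn_cvg R) d d0.
  exists n0 => // n n0n; rewrite distrC; apply: lt_trans (sP n).1 _.
  by have := Hn n n0n; rewrite /= sub0r normrN ger0_norm// ltW// epsn_gt0.
have /ccvgP/cvgrPdist_le/(_ _ e0)[n0 _ Hn] := H _ st.
have /= := Hn n0 (leqnn _); rewrite sub0r normrN ger0_norm// => h.
by have := (sP n0).2; rewrite h.
Qed.

Lemma ccont_seqP u t (s : nat -> R) : ccont_at u t ->
  s n @[n --> \oo] --> t -> ccvg_seq (fun n => u (s n)) (u t).
Proof.
move=> cu /cvgrPdist_lt st; apply/ccvgP; apply/cvgrPdist_le => e e0.
have [d d0 Hd] := cu _ e0; have [n0 _ Hn] := st _ d0; exists n0 => // n n0n.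
by rewrite sub0r normrN ger0_norm//; apply: Hd; rewrite distrC; exact: (Hn n n0n).
Qed.
End Convolution.

(** * Exponentials on the half line *)

Section HalfLine.
Variable R : realType.
Local Notation lam := (@lam R).

Lemma negligible_set1 (a : R) : lam.-negligible [set a].
Proof. by exists [set a]; split; [exact: measurable_set1|exact: lebesgue_measure_set1|]. Qed.
Lemma nint_eq_ne (a : R) (f g : R -> R) : mfun f -> mfun g ->
  (forall t, t != a -> f t = g t) -> nint lam f = nint lam g.
Proof.
move=> mf mg fg; rewrite /nint; apply: ae_eq_integral => //; [exact/measurable_EFinP..|].
apply: negligibleS (negligible_set1 a) => t /= H; apply: contrapT => t0; apply: H => _.
by rewrite fg//; apply/eqP.
Qed.

Lemma cint_eq_ne (a : R) (f g : R -> R[i]) : cmeas f -> cmeas g ->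
  (forall t, t != a -> f t = g t) -> cint lam f = cint lam g.
Proof.
move=> [f1 f2] [g1 g2] fg; rewrite /cint; congr Complex; rewrite /Rintegral; congr fine.
- by apply: (nint_eq_ne f1 g1 (a := a)) => t ta; rewrite fg.
- by apply: (nint_eq_ne f2 g2 (a := a)) => t ta; rewrite fg.
Qed.
Lemma cder_continuous (F : R -> R[i]) (f : R -> R[i]) : (forall t, cder F t (f t)) ->
  continuous (fun t => cre (F t)) /\ continuous (fun t => cim (F t)).
Proof.
move=> dF; split=> t; apply/differentiable_continuous/derivable1_diffP; by case: (dF t) => -[].
Qed.

Lemma cint_FTC (F f g : R -> R[i]) (a b : R) : a < b -> (forall t, cder F t (f t)) ->
  (forall t, cder f t (g t)) ->
  cint lam (fun t => cR (\1_`[a, b] t) * f t) = F b - F a.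
Proof.
move=> ab dF df; have [c1 c2] := cder_continuous df; have [C1 C2] := cder_continuous dF.
have mf : cmeas f by split; apply: continuous_measurable_fun.
rewrite -cint1E//.
have H (r s : R -> R) : (forall t : R, is_derive t 1 r (s t)) -> continuous s -> continuous r ->
    Rintegral (@leb1 R) `[a, b] s = r b - r a.
  move=> dr cs cr; rewrite /Rintegral (continuous_FTC2 ab (F := r)) ?EFinB//.
  - by apply: continuous_subspaceT.
  - split; first by [].
    + by apply: cvg_at_right_filter; exact: cr.
    + by apply: cvg_at_left_filter; exact: cr.
  - by move=> x _; rewrite derive1E; have [_ ->] := dr x.
apply: cP.
  by rewrite creD creN; exact: (H (fun t => cre (F t)) (fun t => cre (f t)) (fun t => proj1 (dF t)) c1 C1).
by rewrite cimD cimN; exact: (H (fun t => cim (F t)) (fun t => cim (f t)) (fun t => proj2 (dF t)) c2 C2).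
Qed.

(** The Heaviside function with value [0] at [0], in agreement with the value of the Abel kernel
    [k0] there. *)
Definition hv (t : R) : R := (0 < t)%R%:R.
Lemma hv_ge0 t : 0 <= hv t. Proof. exact: ler0n. Qed.
Lemma hv1 t : 0 < t -> hv t = 1. Proof. by rewrite /hv => ->. Qed.
Lemma hv0 t : t <= 0 -> hv t = 0. Proof. by rewrite /hv leNgt => /negbTE ->. Qed.
Lemma mfun_hv : mfun hv.
Proof.
rewrite (_ : hv = \1_`]0, +oo[); first by meas.
by apply/funext => t; rewrite /hv indicE mem_setE in_itv/= andbT.
Qed.
Definition rexp (a t : R) := hv t * expR (- (a * t)).
Lemma rexp_ge0 a t : 0 <= rexp a t. Proof. pos. Qed.
Lemma mfun_rexp a : mfun (rexp a).
Proof.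
apply: measurable_funM; first exact: mfun_hv.
by apply: measurableT_comp => //; apply: measurableT_comp => //; meas.
Qed.
Lemma nint_rexp_le a : 0 < a -> (nint lam (fun t => (0 <= t)%R%:R * expR (- (a * t)))%R <= a^-1%:E)%E.
Proof.
move=> a0; have := @integral_exponential_pdf R _ a0.
rewrite (nint_leb (measurable_exponential_pdf a)); last by move=> x; apply: exponential_pdf_ge0; exact: ltW.
move=> e1.
have -> : nint lam (fun t => (0 <= t)%R%:R * expR (- (a * t)))%R = nint lam (fun t => a^-1 * exponential_pdf a t)%R.
  apply: eq_nint => t; have [t0|t0] := leP 0 t.
    by rewrite exponential_pdfE// /= mulNr mul1r mulrA mulVf ?mul1r// gt_eqF.
  by rewrite lt0_exponential_pdf// mulr0 mul0r.
rewrite nintZ ?invr_ge0 ?(ltW a0)//; last 2 first.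
- exact: measurable_exponential_pdf.
- by move=> x; apply: exponential_pdf_ge0; exact: ltW.
by rewrite e1 mule1.
Qed.

Definition exz (z : R[i]) t := cR (hv t) * cexp (- z * cR t).
Lemma cabs_exz z t : cabs (exz z t) = rexp (cre z) t.
Proof.
by rewrite cabsM cabs_cRp ?hv_ge0// cabs_cexp !creE !cimE mulr0 subr0 mulNr.
Qed.

Lemma cder_cexpl (w : R[i]) t : cder (fun t : R => cexp (w * cR t)) t (w * cexp (w * cR t)).
Proof.
apply: cder_cexp; apply: cder_eq (cderZ w (cder_cR (is_derive_id t 1))); by rewrite mulr1.
Qed.
Lemma cmeas_cexpl (w : R[i]) : cmeas (fun t : R => cexp (w * cR t)).
Proof. by apply: cmeas_cexp; apply: cmeasM; [exact: cmeas_cst|exact: cmeas_cR]. Qed.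

Lemma cmeas_exz z : cmeas (exz z).
Proof. apply: cmeasM; [apply: cmeas_cR; exact: mfun_hv|exact: cmeas_cexpl]. Qed.
Lemma mfun_hvc : mfun (fun t : R => (0 <= t)%R%:R : R).
Proof.
rewrite (_ : (fun _ => _) = \1_`[0, +oo[); first by meas.
by apply/funext => t; rewrite indicE mem_setE in_itv/= andbT.
Qed.

Lemma mfun_hvc_exp a : mfun (fun t : R => (0 <= t)%R%:R * expR (- (a * t)) : R).
Proof.
apply: measurable_funM; first exact: mfun_hvc.
by apply: measurableT_comp => //; apply: measurableT_comp => //; meas.
Qed.
Lemma nint_rexp_lty a : 0 < a -> (nint lam (rexp a) < +oo)%E.
Proof.
move=> a0; apply: le_lt_trans (ltry a^-1); apply: le_trans (nint_rexp_le a0).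
apply: le_nint.
- exact: mfun_rexp.
- exact: mfun_hvc_exp.
- exact: rexp_ge0.
by move=> t; rewrite ler_wpM2r ?expR_ge0// /hv ler_nat; case: ltgtP.
Qed.

Lemma cL1_exz z : 0 < cre z -> cL1 lam (exz z).
Proof.
move=> z0; apply: (cL1_dom (r := rexp (cre z))).
- exact: cmeas_exz.
- exact: mfun_rexp.
- by move=> t; rewrite cabs_exz.
- exact: nint_rexp_lty.
Qed.

Lemma cint_exz z : 0 < cre z -> cint lam (exz z) = z^-1.
Proof.
move=> z0.
have zn0 : z != 0 by apply: contraTneq z0 => ->; rewrite ltxx.
pose F t := - z^-1 * cexp (- z * cR t).
have dF t : cder F t (cexp (- z * cR t)).
  apply: cder_eq (cderZ _ (cder_cexpl (- z) t)).
  by rewrite mulrA mulrNN mulVf ?mul1r.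
(* The integrals over [[0, n + 1]] converge to the version that equals [1] at [0]; it differs from
   [exz z] at one point only. *)
pose g t := cR (0 <= t)%R%:R * cexp (- z * cR t).
have mg : cmeas g by apply: cmeasM; [apply: cmeas_cR; exact: mfun_hvc|exact: cmeas_cexpl].
have -> : cint lam (exz z) = cint lam g.
  apply: (cint_eq_ne (a := 0) (cmeas_exz z) mg) => t t0.
  by rewrite /exz /g /hv lt_neqAle eq_sym t0.
pose f_ (n : nat) t := cR (\1_`[(0 : R), n.+1%:R] t) * cexp (- z * cR t).
have I n : cint lam (f_ n) = z^-1 - z^-1 * cexp (- z * cR n.+1%:R).
  rewrite (cint_FTC (F := F) (g := fun t => - z * cexp (- z * cR t)))//; last by move=> t; exact: cder_cexpl.
  by rewrite /F cR0 mulr0 cexp0 mulr1 opprK mulNr addrC.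
have L1 : ccvg_seq (fun n => cint lam (f_ n)) (cint lam g).
  apply: (@cint_dct _ _ _ lam f_ g (fun t => (0 <= t)%R%:R * expR (- (cre z * t)))).
  - move=> n; apply: cmeasM; last exact: cmeas_cexpl.
    meas.
  - move=> t; apply/ccvgP; apply/cvgrPdist_le => e e0.
    exists (Num.truncn `|t|) => // n /= tn.
    suff -> : f_ n t = g t by rewrite subrr cabs0 subrr normr0 ltW.
    rewrite /f_ /g; congr (cR _ * _); rewrite indicE mem_setE in_itv/=.
    have : t <= n.+1%:R.
      apply: le_trans (ler_norm _) _; apply/ltW; apply: lt_le_trans (truncnS_gt _) _.
      by rewrite ler_nat ltnS.
    by move=> ->; rewrite andbT.
  - exact: mfun_hvc_exp.
  - by apply: le_lt_trans (nint_rexp_le z0) _; exact: ltry.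
  - move=> n t; rewrite cabsM cabs_cexp !creE cim_cR mulr0 subr0 mulNr.
    rewrite ler_wpM2r ?expR_ge0// cabs_cRp//.
    by rewrite indicE mem_setE in_itv/=; case: (0 <= t) => //=; rewrite lern1 leq_b1.
have L2 : ccvg_seq (fun n => cint lam (f_ n)) (z^-1).
  apply: (ccvg_le (w := fun n => cabs z^-1 * (cre z)^-1 * epsn R n)).
    move=> n; rewrite I addrAC subrr add0r cabsN cabsM.
    rewrite -mulrA ler_wpM2l// cabs_cexp !creE cim_cR mulr0 subr0 mulNr expRN.
    rewrite /epsn -invfM lef_pV2 ?posrE ?expR_gt0 ?mulr_gt0//.
    by apply: le_trans (expR_ge1Dx _); rewrite lerDr.
  rewrite -[X in _ --> X](mulr0 (cabs z^-1 * (cre z)^-1)); apply: cvgM; [exact: cvg_cst|exact: epsn_cvg].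
exact: ccvg_uniq L1 L2.
Qed.

Lemma nint_rexp a : 0 < a -> nint lam (rexp a) = a^-1%:E.
Proof.
move=> a0; have : cint lam (exz (cR a)) = (cR a)^-1 by exact: cint_exz.
rewrite (@eq_cint _ _ _ lam _ (fun t => cR (rexp a t))); last first.
  by move=> t; rewrite /exz -cRN -cRM cexp_cR -cRM mulNr.
rewrite cint_cR -cRV => /cR_inj <-; rewrite nint_Rintegral//.
- exact: mfun_rexp.
- exact: rexp_ge0.
- exact: nint_rexp_lty.
Qed.
End HalfLine.

(** * The Abel kernel and its Laplace transform *)

Section AbelKernel.
Variable R : realType.
Local Notation lam := (@lam R).

(** [Num.sqrt] is [0] on the negative axis and the inverse of [0] is [0], so this kernel [t^(-1/2)]
    is already cut off to [t > 0]. *)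
Definition k0 (t : R) : R := (Num.sqrt t)^-1.
Lemma k0_ge0 t : 0 <= k0 t. Proof. pos. Qed.
Lemma k0_0 t : t <= 0 -> k0 t = 0.
Proof. by move=> t0; rewrite /k0 ler0_sqrtr// invr0. Qed.
Lemma mfun_invr_ge0 {d} {T : measurableType d} (f : T -> R) :
  mfun f -> (forall x, 0 <= f x) -> mfun (fun x => (f x)^-1).
Proof.
move=> mf f0; rewrite (_ : (fun _ => _) = (fun x => f x `^ (-1))).
  exact: (measurableT_comp (measurable_powR (-1))).
by apply/funext => x; rewrite powR_inv1.
Qed.

Lemma mfun_k0 : mfun k0.
Proof. by apply: mfun_invr_ge0; [exact: mfun_sqrt|move=> x; exact: sqrtr_ge0]. Qed.
Lemma cmeasV {d} {T : measurableType d} (f : T -> R[i]) : cmeas f -> cmeas (fun x => (f x)^-1).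
Proof.
move=> mf; apply: (@cmeas_eq _ _ _ (fun x => conjc (f x) * cR (cabs2 (f x))^-1)).
  move=> x; have [->|f0] := eqVneq (f x) 0.
    by rewrite cabs20 !invr0 cR0 mulr0.
  rewrite cRV -mulcconj invfM mulrCA divff ?mulr1//.
  by apply: contra_neq f0 => /(congr1 conjc); rewrite conjcK => ->; apply: cP; rewrite ?creE ?cimE ?oppr0.
apply: cmeasM; first exact: cmeas_conj.
apply: cmeas_cR; apply: mfun_invr_ge0 => [|x]; [exact: cmeas_cabs2|exact: cabs2_ge0].
Qed.

Lemma creV (w : R[i]) : cre w^-1 = cre w / cabs2 w.
Proof.
have [->|w0] := eqVneq w 0; first by [].
have : w * w^-1 = 1 by rewrite divff.
case: w w0 => a b w0; case: (_^-1) => x y [] e1 e2.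
have n0 : a ^+ 2 + b ^+ 2 != 0.
  apply: contraNneq w0 => /eqP; rewrite paddr_eq0 ?sqr_ge0// !sqrf_eq0 => /andP[/eqP-> /eqP->].
  by [].
rewrite /cabs2 /cre /cim /=; apply: (canRL (mulfK n0)).
have : a * (a * x - b * y) + b * (a * y + b * x) = a * 1 + b * 0 by rewrite e1 e2.
rewrite mulr1 mulr0 addr0 => h; rewrite -[RHS]h; ring.
Qed.

Lemma nint_cauchy_lty : (nint lam (fun x => (1 + x ^+ 2)^-1)%R < +oo)%E.
Proof.
have m1 : mfun (fun x : R => (1 + x ^+ 2)^-1).
  apply: mfun_invr_ge0 => [|x]; last by rewrite addr_ge0 ?sqr_ge0.
  meas.
pose h (x : R) : R := \1_`[0, +oo[ x * (1 + x ^+ 2)^-1.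
have mh : mfun h by meas.
have h0 x : 0 <= h x by rewrite mulr_ge0// invr_ge0 addr_ge0 ?sqr_ge0.
have hE : (nint lam h <= (pi / 2)%:E)%E.
  rewrite -(integral0y_oneDsqr R) -nint_leb//.
  rewrite [leRHS]integral_mkcond /=; apply: ge0_le_integral => //.
  - by move=> x _; rewrite lee_fin.
  - by apply/measurable_EFinP.
  - apply: (measurable_restrictT _ _).1 => //; apply/measurable_EFinP; apply: measurable_funTS.
    exact: m1.
  move=> x _; rewrite patchE /h indicE; case: ifP => _; rewrite ?mul1r ?mul0r//.
apply: (@le_lt_trans _ _ (nint lam (fun x => h x + h (- x)))).
  apply: le_nint => //.
  - by apply: measurable_funD => //; apply: (measurableT_comp mh).
  - by move=> x; rewrite invr_ge0 addr_ge0 ?sqr_ge0.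
  move=> x; rewrite /h !indicE !mem_setE !in_itv/= !andbT sqrrN -mulrDl ler_peMl//.
    by rewrite invr_ge0 addr_ge0 ?sqr_ge0.
  by rewrite oppr_ge0; have [x0|x0] := leP 0 x; [rewrite lerDl ler0n|rewrite (ltW x0) add0r].
rewrite nintD//; last by apply: (measurableT_comp mh).
rewrite nint_opp//; apply: lte_add_pinfty; apply: le_lt_trans hE _; exact: ltry.
Qed.

Lemma nint_resolvent_lty (a : R) : 0 < a -> (nint lam (fun x => (a + x ^+ 2)^-1)%R < +oo)%E.
Proof.
move=> a0.
have m (b : R) : 0 < b -> mfun (fun x : R => (b + x ^+ 2)^-1).
  move=> b0; apply: mfun_invr_ge0 => [|x]; last by rewrite addr_ge0 ?sqr_ge0// ltW.
  meas.
have p (b : R) x : 0 < b -> 0 < b + x ^+ 2 by move=> b0; rewrite ltr_wpDr ?sqr_ge0.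
apply: (@le_lt_trans _ _ (nint lam (fun x => (1 + a^-1) * (1 + x ^+ 2)^-1))).
  apply: le_nint => //.
  - exact: m.
  - by apply: measurable_funM => //; exact: m.
  - by move=> x; rewrite invr_ge0 ltW// p.
  move=> x; rewrite ler_pdivlMr ?p// mulrC ler_pdivrMr ?p//.
  rewrite mulrDl mul1r mulrDr mulVf ?gt_eqF//.
  have : 0 <= a^-1 * x ^+ 2 by rewrite mulr_ge0 ?sqr_ge0// invr_ge0 ltW.
  lra.
rewrite nintZ ?addr_ge0 ?invr_ge0 ?(ltW a0)//; last 2 first.
- exact: m.
- by move=> x; rewrite invr_ge0 ltW// p.
apply: lte_mul_pinfty => //; [|exact: nint_cauchy_lty].
pos.
Qed.

Definition kexp (a t : R) := k0 t * expR (- (a * t)).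
Lemma kexp_ge0 a t : 0 <= kexp a t. Proof. pos. Qed.
Lemma mfun_kexp a : mfun (kexp a).
Proof.
apply: measurable_funM; first exact: mfun_k0.
by apply: measurableT_comp => //; apply: measurableT_comp => //; meas.
Qed.
Lemma nint_rgauss_k0 t : 0 < t -> nint lam (rgauss t) = (Num.sqrt pi * k0 t)%:E.
Proof.
by move=> t0; rewrite nint_rgauss// sqrtrM ?pi_ge0// sqrtrV// ltW.
Qed.

Lemma mfun_rexp_rgauss a : mfun (fun z : R * R => rexp a z.1 * rgauss z.1 z.2).
Proof.
apply: measurable_funM; first exact: (measurableT_comp (mfun_rexp a)).
apply: measurableT_comp => //; apply: measurableT_comp => //; apply: measurable_funM => //.
meas.
Qed.
(** [sqrt pi * t^(-1/2)] is the integral over [x] of [e^(- t x^2)]. Exchanging the two integrations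
    turns the Laplace transform of the Abel kernel into an integral of resolvents. [Kz_resolvent] is
    the complex version, from which the sign of the real part can be read off. *)
Lemma nint_kexp_eq a : 0 < a ->
  ((Num.sqrt pi)%:E * nint lam (kexp a) = nint lam (fun x => (a + x ^+ 2)^-1)%R)%E.
Proof.
move=> a0; have F0 (z : R * R) : 0 <= rexp a z.1 * rgauss z.1 z.2 by pos.
rewrite -nintZ ?sqrtr_ge0//; last 2 first.
- exact: mfun_kexp.
- exact: kexp_ge0.
transitivity (\int[lam]_t nint lam (fun x => (rexp a (t, x).1 * rgauss (t, x).1 (t, x).2)%R))%E.
  apply: eq_integral => t _ /=; have [t0|t0] := leP t 0.
    rewrite /kexp k0_0// mul0r mulr0 (eq_nint (fun x => 0)) ?/nint ?integral0//.
    by move=> x; rewrite /rexp hv0// !mul0r.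
  rewrite nintZ ?rexp_ge0//; [|side|side].
  by rewrite nint_rgauss_k0// -EFinM /rexp hv1// /kexp; congr EFin; ring.
rewrite (nint_tonelli lam lam (mfun_rexp_rgauss a) F0); apply: eq_integral => x _ /=.
rewrite (eq_nint (rexp (a + x ^+ 2))).
  by rewrite nint_rexp// ltr_wpDr ?sqr_ge0.
move=> t; rewrite /rexp /rgauss -mulrA -expRD; congr (_ * expR _); ring.
Qed.

Lemma nint_kexp_lty a : 0 < a -> (nint lam (kexp a) < +oo)%E.
Proof.
move=> a0; have := nint_resolvent_lty a0; rewrite -nint_kexp_eq//.
have p0 : 0 < Num.sqrt pi :> R by rewrite sqrtr_gt0 pi_gt0.
rewrite ltNge leye_eq => h; rewrite ltNge leye_eq; apply: contra h => /eqP ->.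
by rewrite gt0_muley ?lte_fin.
Qed.
Definition kz (z : R[i]) t := cR (k0 t) * cexp (- z * cR t).
Lemma cabs_kz z t : cabs (kz z t) = kexp (cre z) t.
Proof.
by rewrite cabsM cabs_cRp ?k0_ge0// cabs_cexp !creE !cimE mulr0 subr0 mulNr.
Qed.
Lemma cmeas_kz z : cmeas (kz z).
Proof. apply: cmeasM; [apply: cmeas_cR; exact: mfun_k0|exact: cmeas_cexpl]. Qed.
Lemma cL1_kz z : 0 < cre z -> cL1 lam (kz z).
Proof.
move=> z0; split; first exact: cmeas_kz.
by rewrite (eq_nint (kexp (cre z))) ?nint_kexp_lty// => t; rewrite cabs_kz.
Qed.
(** The Laplace transform of [t^(-1/2)], that is [sqrt (pi / z)] with positive real part. The square
    comes from [Kz_sqr] and the branch from [cre_Kz_ge0]. *)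
Definition Kz z := cint lam (kz z).

Lemma Kz_resolvent z : 0 < cre z ->
  cR (Num.sqrt pi) * Kz z = cint lam (fun x => (z + cR (x ^+ 2))^-1).
Proof.
move=> z0.
pose F (w : R * R) := exz z w.1 * cR (rgauss w.1 w.2).
have mF : cmeas F.
  apply: cmeasM; first exact: (cmeas_comp (cmeas_exz z)).
  apply: cmeas_cR; apply: measurableT_comp => //; apply: measurableT_comp => //.
  meas.
have lF : cL1 (prodm lam lam) F.
  apply: cL1_prod => //; rewrite (_ : (\int[_]_x _)%E = (Num.sqrt pi)%:E * nint lam (kexp (cre z)))%E.
    by apply: lte_mul_pinfty; rewrite ?lee_fin ?sqrtr_ge0 ?nint_kexp_lty.
  rewrite nint_kexp_eq//.
  have F0 (w : R * R) : 0 <= rexp (cre z) w.1 * rgauss w.1 w.2 by pos.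
  transitivity (\int[lam]_t nint lam (fun x => (rexp (cre z) (t, x).1 * rgauss (t, x).1 (t, x).2)%R))%E.
    by apply: eq_integral => t _; apply: eq_nint => x; rewrite cabsM cabs_exz cabs_cRp ?rgauss_ge0.
  rewrite (nint_tonelli lam lam (mfun_rexp_rgauss _) F0); apply: eq_integral => x _ /=.
  rewrite (eq_nint (rexp (cre z + x ^+ 2))).
    by rewrite nint_rexp// ltr_wpDr ?sqr_ge0.
  move=> t; rewrite /rexp /rgauss -mulrA -expRD; congr (_ * expR _); ring.
rewrite /Kz -cintZ; last exact: cL1_kz.
transitivity (cint lam (fun t => cint lam (fun x => F (t, x)))).
  apply: eq_cint => t; rewrite /F /=; have [t0|t0] := leP t 0.
    rewrite /kz k0_0// mul0r mulr0 (@eq_cint _ _ _ lam _ (fun=> 0)) ?cint0// => x.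
    by rewrite /exz hv0// !mul0r.
  rewrite cintZ; last first.
    apply: cL1_cR; [exact: mfun_rgauss|move=> x; exact: rgauss_ge0|exact: nint_rgauss_lty].
  rewrite cint_cR /Rintegral -/(nint lam (rgauss t)) nint_rgauss_k0//= /kz /exz hv1// cR1 mul1r cRM mulrA; exact: mulrC.
rewrite (cFubini lF); apply: eq_cint => x; rewrite /F /=.
rewrite -cint_exz ?creE ?ltr_wpDr ?sqr_ge0//; apply: eq_cint => t.
rewrite /exz -mulrA; congr (_ * _).
rewrite /rgauss -cexp_cR -cexpD; congr cexp; rewrite cRN cRM; ring.
Qed.

Lemma cre_Kz_ge0 z : 0 < cre z -> 0 <= cre (Kz z).
Proof.
move=> z0; have p0 : 0 < Num.sqrt pi :> R by rewrite sqrtr_gt0 pi_gt0.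
rewrite -(pmulr_rge0 _ p0) (_ : _ * _ = cre (cR (Num.sqrt pi) * Kz z)).
  rewrite Kz_resolvent//; apply: Rintegral_ge0 => x _.
  by rewrite creV divr_ge0 ?cabs2_ge0// creE addr_ge0 ?sqr_ge0// ltW.
by rewrite creM cim_cR mul0r subr0.
Qed.

(** The Beta integral [B(1/2, 1/2)], whose value is [pi]. *)
Definition beta0 : R := fine (nint lam (fun s => k0 s * k0 (1 - s))).
Lemma mfun_k0k0 t : mfun (fun s => k0 s * k0 (t - s)).
Proof.
apply: measurable_funM; first exact: mfun_k0.
by apply: (measurableT_comp mfun_k0); apply: measurable_funB.
Qed.
Lemma k0k0_ge0 t s : 0 <= k0 s * k0 (t - s). Proof. pos. Qed.
Lemma k0_le2 s : 2^-1 <= s -> k0 s <= 2.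
Proof.
move=> s2; rewrite -[leRHS]invrK lef_pV2 ?posrE ?invr_gt0//; last first.
  by rewrite sqrtr_gt0; lra.
rewrite -(@ler_pXn2r _ 2) ?nnegrE ?sqrtr_ge0 ?invr_ge0// sqr_sqrtr; last lra.
apply: le_trans s2; lra.
Qed.

Lemma nint_k0k0_lty : (nint lam (fun s => (k0 s * k0 (1 - s))%R) < +oo)%E.
Proof.
have mk := mfun_kexp 1.
have mk' : mfun (fun s : R => kexp 1 (1 - s)).
  by apply: (measurableT_comp mk); apply: measurable_funB.
apply: (@le_lt_trans _ _ (nint lam (fun s => (2 * expR 1) * (kexp 1 s + kexp 1 (1 - s))))).
  apply: le_nint => //.
  - exact: mfun_k0k0.
  - meas.
  - exact: k0k0_ge0.
  move=> s; have [s0|s0] := leP s 0.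
    by rewrite k0_0// mul0r mulr_ge0// addr_ge0 ?kexp_ge0.
  have [s1|s1] := leP 1 s.
    by rewrite (@k0_0 (1 - s)) ?subr_le0// mulr0 mulr_ge0// addr_ge0 ?kexp_ge0.
  have H r : r < 1 -> k0 r <= expR 1 * kexp 1 r.
    move=> r1; rewrite /kexp mulrCA ler_peMr ?k0_ge0// -expRD -[X in X <= _]expR0 ler_expR; lra.
  have [s2|s2] := leP 2^-1 s.
    rewrite -mulrA ler_pM ?k0_ge0 ?k0_le2//; apply: le_trans (H _ _) _; first by lra.
    by rewrite ler_wpM2l ?expR_ge0// lerDr kexp_ge0.
  rewrite mulrC -mulrA ler_pM ?k0_ge0 ?k0_le2//; first by lra.
  apply: le_trans (H _ s1) _.
  by rewrite ler_wpM2l ?expR_ge0// lerDl kexp_ge0.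
rewrite nintZ//; [|side|side].
apply: lte_mul_pinfty => //; rewrite nintD//; [|by move=> s; exact: kexp_ge0..].
have l1 : (nint lam (kexp 1) < +oo)%E by exact: nint_kexp_lty.
apply: lte_add_pinfty; first exact: l1.
suff -> : nint lam (fun s => kexp 1 (1 - s)) = nint lam (kexp 1) by [].
rewrite -[RHS](nint_opp mk); last by move=> s; exact: kexp_ge0.
rewrite -[RHS](@nint_shift _ (fun s => kexp 1 (- s)) (-1)).
- by apply: eq_nint => s; congr kexp; ring.
- by apply: (measurableT_comp mk).
- by move=> s; exact: kexp_ge0.
Qed.

Lemma beta0E : beta0%:E = nint lam (fun s => (k0 s * k0 (1 - s))%R).
Proof. by rewrite fineK// ge0_fin_numE ?nint_k0k0_lty// nint_ge0// => s; exact: k0k0_ge0. Qed.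
(** Substitute [s = t * s']: the two factors [t^(-1/2)] cancel the Jacobian, so the convolution
    square of the Abel kernel is constant on the half line. *)
Lemma nint_k0k0 t : nint lam (fun s => (k0 s * k0 (t - s))%R) = (hv t * beta0)%:E.
Proof.
have [t0|t0] := leP t 0.
  rewrite hv0// mul0r (eq_nint (fun=> 0)) ?/nint ?integral0// => s.
  have [s0|s0] := leP s 0; first by rewrite k0_0 ?mul0r.
  by rewrite (@k0_0 (t - s)) ?mulr0//; lra.
rewrite hv1// mul1r beta0E -(nint_scale t0 (mfun_k0k0 t) (k0k0_ge0 t)).
rewrite -nintZ ?(ltW t0)//; last 2 first.
- apply: (measurableT_comp (mfun_k0k0 t)); meas.
- by move=> x; exact: k0k0_ge0.
apply: eq_nint => s; rewrite -[X in k0 (X - _)]mulr1 -mulrBr /k0 !sqrtrM ?(ltW t0)// !invfM.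
rewrite -{1}(sqr_sqrtr (ltW t0)).
have n0 : Num.sqrt t != 0 by rewrite gt_eqF// sqrtr_gt0.
by move: (Num.sqrt s)^-1 (Num.sqrt (1 - s))^-1 (Num.sqrt t) n0 => x y r r0; field.
Qed.

Lemma kz_cconv z t : 0 < cre z -> cconv (kz z) (kz z) t = cR beta0 * exz z t.
Proof.
move=> z0; transitivity (cint lam (fun s => cexp (- z * cR t) * cR (k0 s * k0 (t - s)))).
  apply: eq_cint => s; rewrite /kz mulrACA -cRM mulrC -cexpD -mulrDr -cRD; congr (cexp (_ * cR _) * _); ring.
rewrite cintZ; last first.
  apply: cL1_cR; [exact: mfun_k0k0|move=> s; exact: k0k0_ge0|].
  by rewrite nint_k0k0 ltry.
rewrite cint_cR /Rintegral -/(nint lam (fun s => (k0 s * k0 (t - s))%R)) nint_k0k0 /= cRM /exz; ring.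
Qed.

(** The convolution square of [kz z] is [beta0 * exz z]; integrating both sides gives the square of
    the transform without any choice of branch. *)
Lemma Kz_sqr z : 0 < cre z -> z * (Kz z * Kz z) = cR beta0.
Proof.
move=> z0; have zn0 : z != 0 by apply: contraTneq z0 => ->; rewrite ltxx.
rewrite /Kz -(cint_conv (cL1_kz z0) (cL1_kz z0)).
have -> : cint lam (cconv (kz z) (kz z)) = cint lam (fun t => cR beta0 * exz z t).
  by apply: eq_cint => t; exact: kz_cconv.
rewrite (cintZ _ (cL1_exz z0)) cint_exz//.
by rewrite mulrCA divff ?mulr1.
Qed.

(** The L1 norm of the damped Abel kernel, equal to [sqrt (beta0 / a)] by [kn_sqr]. It is small for
    strong damping, which makes the Volterra operator a contraction. *)
Definition kn (a : R) : R := fine (nint lam (kexp a)).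
Lemma knE a : 0 < a -> (kn a)%:E = nint lam (kexp a).
Proof. by move=> a0; rewrite fineK// ge0_fin_numE ?nint_kexp_lty// nint_ge0// => t; exact: kexp_ge0. Qed.
Lemma kn_gt0 a : 0 < a -> 0 < kn a.
Proof.
move=> a0; rewrite -lte_fin knE//; apply: (@lt_le_trans _ _ ((a + 1)^-1)%:E).
  by rewrite lte_fin invr_gt0 addr_gt0.
rewrite -nint_rexp ?addr_gt0//; apply: le_nint.
- exact: mfun_rexp.
- exact: mfun_kexp.
- exact: rexp_ge0.
move=> t; have [t0|t0] := leP t 0; first by rewrite /rexp hv0// mul0r kexp_ge0.
rewrite /rexp hv1// mul1r /kexp mulrDl mul1r opprD expRD mulrC ler_wpM2r ?expR_ge0//.
rewrite /k0 expRN lef_pV2 ?posrE ?expR_gt0 ?sqrtr_gt0//.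
apply: le_trans (expR_ge1Dx t); have := sqr_ge0 (Num.sqrt t - 1).
have := sqr_sqrtr (ltW t0); have := sqrtr_ge0 t; nra.
Qed.

Lemma Kz_real a : 0 < a -> Kz (cR a) = cR (kn a).
Proof.
move=> a0; rewrite /Kz (@eq_cint _ _ _ lam _ (fun t => cR (kexp a t))).
  by rewrite cint_cR.
by move=> t; rewrite /kz /kexp cRM -cexp_cR cRN cRM mulNr.
Qed.
Lemma kn_sqr a : 0 < a -> a * kn a ^+ 2 = beta0.
Proof.
by move=> a0; have := @Kz_sqr (cR a) a0; rewrite Kz_real// -!cRM => /cR_inj <-; rewrite expr2.
Qed.

Lemma beta0_gt0 : 0 < beta0.
Proof. by rewrite -(kn_sqr (@ltr01 R)) mul1r exprn_gt0// kn_gt0. Qed.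
Lemma Kz_neq0 z : 0 < cre z -> Kz z != 0.
Proof.
move=> z0; apply: contraTneq beta0_gt0 => k; have := Kz_sqr z0.
by rewrite k !mulr0 => /(congr1 (@cre R)); rewrite creE /= => <-; rewrite ltxx.
Qed.

Lemma cabs2_Kz z : 0 < cre z -> cabs2 (Kz z) * cabs z = beta0.
Proof.
move=> z0; have := congr1 (@cabs R) (Kz_sqr z0).
by rewrite !cabsM cabs_cRp ?(ltW beta0_gt0)// cabs2E expr2 mulrC.
Qed.

(* For z = s - iE the square of Kz z is a positive multiple of s + iE, so Kz z
   lies in the sector |Im| <= Re. *)
Lemma Kz_sector (s E : R) (K : R[i]) : 0 < s -> K = Kz (cR s - iC R * cR E) ->
  `|cim K| <= cre K /\ (0 <= E -> 0 <= cim K).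
Proof.
move=> s0; set z := cR s - iC R * cR E => KE.
have zr : cre z = s by rewrite /z !creE cim_cR mulr0 mul0r subrr subr0.
have zi : cim z = - E by rewrite /z !cimE !creE mul0r add0r mul1r add0r.
have z0 : 0 < cre z by rewrite zr.
have K0 : 0 <= cre K by rewrite KE; exact: cre_Kz_ge0.
have := Kz_neq0 z0; have := Kz_sqr z0; rewrite -KE; move: K0; case: K {KE} => a b /= a0 e Kn0.
have e1 := congr1 (@cre R) e; have e2 := congr1 (@cim R) e.
move: e1 e2; rewrite !creM !cimM zr zi /= => e1 e2.
have B0 := beta0_gt0.
have ab : b ^+ 2 <= a ^+ 2.
  have : s * (a * a - b * b) + E * (a * b + b * a) = beta0 by rewrite -e1; ring.
  have : s * (a * b + b * a) = E * (a * a - b * b) by lra.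
  set X := a * a - b * b; set Y := a * b + b * a => h1 h2.
  have h3 : (s ^+ 2 + E ^+ 2) * X = s * beta0.
    rewrite mulrDl -h2 !expr2 -!mulrA -h1; ring.
  have h4 : 0 < (s ^+ 2 + E ^+ 2) * X by rewrite h3 mulr_gt0.
  have h5 : 0 < s ^+ 2 + E ^+ 2 by rewrite ltr_wpDr ?sqr_ge0// exprn_gt0.
  have : 0 < X by rewrite -(pmulr_rgt0 _ h5).
  rewrite /X !expr2; lra.
split; first by rewrite -ler_sqr ?nnegrE// real_normK ?num_real.
move=> E0; have a1 : 0 < a.
  rewrite lt_def a0 andbT; apply: contra_neqN Kn0 => /eqP a00; move: ab; rewrite a00 expr0n/=.
  move=> b0; have /eqP : b ^+ 2 = 0 by apply/eqP; rewrite eq_le b0 sqr_ge0.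
  by rewrite sqrf_eq0 => /eqP ->.
have : 0 <= s * (2 * a) * b.
  have -> : s * (2 * a) * b = E * (a * a - b * b) by lra.
  by rewrite mulr_ge0// subr_ge0 -!expr2.
by rewrite pmulr_rge0// !mulr_gt0.
Qed.
End AbelKernel.

Ltac meas_atom ::= first [exact: mfun_rgauss | exact: cmeas_egauss | exact: mfun_hv
  | exact: mfun_rexp | exact: mfun_kexp | exact: mfun_k0].

(** * Parseval's identity and trigonometric multipliers *)

Section FourierL2.
Variable R : realType.
Local Notation lam := (@lam R).
Implicit Types u f g : R -> R[i].

Definition N2 f : \bar R := nint lam (fun E => cabs2 (f E)).
Definition cL2 f := cmeas f /\ (N2 f < +oo)%E.
Definition n2 f : R := fine (N2 f).
Lemma N2_ge0 f : (0 <= N2 f)%E.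
Proof. by apply: nint_ge0 => x; exact: cabs2_ge0. Qed.
Lemma n2E f : cL2 f -> (n2 f)%:E = N2 f.
Proof. by move=> [_ l]; rewrite fineK// ge0_fin_numE// N2_ge0. Qed.
Lemma n2_ge0 f : 0 <= n2 f. Proof. by rewrite fine_ge0// N2_ge0. Qed.
Lemma cL2_Mb f g (k : R) : cL2 f -> cmeas g -> (forall x, cabs (g x) <= k) ->
  cL2 (fun x => g x * f x) /\ (N2 (fun x => (g x * f x)%R) <= (k ^+ 2)%:E * N2 f)%E.
Proof.
move=> [mf lf] mg gk; have k0 : 0 <= k by apply: le_trans (cabs_ge0 _) (gk 0).
have H : (N2 (fun x => (g x * f x)%R) <= (k ^+ 2)%:E * N2 f)%E.
  rewrite /N2 -nintZ ?sqr_ge0//; last by meas.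
  apply: le_nint.
  - meas.
  - meas.
  - pos.
  move=> x; rewrite cabs2M ler_wpM2r ?cabs2_ge0// cabs2E.
  by rewrite ler_pXn2r ?nnegrE ?cabs_ge0.
split => //; split; first exact: cmeasM.
by apply: le_lt_trans H _; apply: lte_mul_pinfty; rewrite ?lee_fin ?sqr_ge0.
Qed.

Lemma young_cabs (l : R) (z w : R[i]) : 0 < l ->
  cabs (z * w) <= 2^-1 * l * cabs2 z + 2^-1 * l^-1 * cabs2 w.
Proof.
move=> l0; rewrite cabsM !cabs2E.
have -> : 2^-1 * l * cabs z ^+ 2 + 2^-1 * l^-1 * cabs w ^+ 2 =
  cabs z * cabs w + 2^-1 * l^-1 * (l * cabs z - cabs w) ^+ 2 by field; rewrite gt_eqF.
by rewrite lerDl mulr_ge0 ?sqr_ge0// mulr_ge0// invr_ge0 ltW.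
Qed.

Lemma nint_young f g (l : R) : cL2 f -> cL2 g -> 0 < l ->
  (nint lam (fun x => cabs (f x * g x)%R) <= (2^-1 * l * n2 f + 2^-1 * l^-1 * n2 g)%:E)%E.
Proof.
move=> lf lg l0; have [mf _] := lf; have [mg _] := lg.
have m2f := cmeas_cabs2 mf; have m2g := cmeas_cabs2 mg.
have a0 : 0 <= 2^-1 * l by pos.
have b0 : 0 <= 2^-1 * l^-1 by pos.
apply: (@le_trans _ _ (nint lam (fun x => 2^-1 * l * cabs2 (f x) + 2^-1 * l^-1 * cabs2 (g x)))).
  apply: le_nint.
  - meas.
  - meas.
  - pos.
  - by move=> x; exact: young_cabs.
rewrite nintD; first last.
- by move=> x; rewrite mulr_ge0.
- by move=> x; rewrite mulr_ge0.
- meas.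
- meas.
by rewrite (@nintZ _ _ _ lam (2^-1 * l))// (@nintZ _ _ _ lam (2^-1 * l^-1))// -/(N2 f) -/(N2 g) -!n2E// EFinD !EFinM.
Qed.

Lemma cL1_L2M f g : cL2 f -> cL2 g -> cL1 lam (fun x => f x * g x).
Proof.
move=> lf lg; split; first by apply: cmeasM; [case: lf|case: lg].
by apply: le_lt_trans (nint_young lf lg ltr01) _; exact: ltry.
Qed.
Lemma cL2_conj f : cL2 f -> cL2 (fun x => conjc (f x)).
Proof.
move=> [mf lf]; split; first exact: cmeas_conj.
by rewrite /N2; under eq_nint do rewrite cabs2_conj.
Qed.
Lemma n2_conj f : n2 (fun x => conjc (f x)) = n2 f.
Proof. by rewrite /n2 /N2; under eq_nint do rewrite cabs2_conj. Qed.
(** The class on which both Plancherel inequalities are available, hence Parseval's identity. *)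
Definition good u := [/\ cL1 lam u, cL2 u & forall t, t != 0 -> ccont_at u t].

Lemma parseval u : good u -> N2 (ft u) = ((2 * pi)%:E * N2 u)%E.
Proof. by move=> [lu _ cu]; apply/eqP; rewrite eq_le plancherel_le// plancherel_ge. Qed.
Lemma good_cL2_ft u : good u -> cL2 (ft u).
Proof.
move=> gu; split; first by apply: cmeas_ft; case: gu.
rewrite parseval//; apply: lte_mul_pinfty; rewrite ?lee_fin ?mulr_ge0 ?pi_ge0//.
by case: gu => _ [].
Qed.

Lemma ccont_M f g t : ccont_at f t -> ccont_at g t ->
  ccont_at (fun s => f s * g s) t.
Proof.
move=> cf cg; apply: ccont_seq => s st; apply: ccvgM; exact: ccont_seqP st.
Qed.
Lemma ccont_D f g t : ccont_at f t -> ccont_at g t ->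
  ccont_at (fun s => f s + g s) t.
Proof.
move=> cf cg; apply: ccont_seq => s st; apply: ccvgD; exact: ccont_seqP st.
Qed.

Lemma good_Mb u g (k : R) : good u -> cmeas g -> (forall x, cabs (g x) <= k) ->
  (forall t, ccont_at g t) -> good (fun t => g t * u t).
Proof.
move=> [l1 l2 c] mg gk cg; split.
- exact: (cL1_bM (k := k)).
- exact: (cL2_Mb l2 mg gk).1.
- by move=> t t0; apply: ccont_M => //; exact: c.
Qed.

Lemma ccont_cst (c : R[i]) t : ccont_at (fun=> c) t.
Proof. by move=> e e0; exists 1 => // s _; rewrite subrr cabs0 ltW. Qed.
Lemma ftD u v E : cL1 lam u -> cL1 lam v -> ft (fun t => u t + v t) E = ft u E + ft v E.
Proof.
move=> lu lv; rewrite /ft -(cintD (cL1_expi E lu) (cL1_expi E lv)).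
by apply: eq_cint => t; rewrite mulrDl.
Qed.
Lemma ftZ c u E : cL1 lam u -> ft (fun t => c * u t) E = c * ft u E.
Proof.
move=> lu; rewrite /ft -(cintZ _ (cL1_expi E lu)).
by apply: eq_cint => t; rewrite mulrA.
Qed.
(** The frequencies start at [w], not at [0]: by [ft_trig] multiplication by such a polynomial
    expresses the transform at [E] through strictly higher energies. *)
Definition trig (w : R) (N : nat) (c : nat -> R[i]) (t : R) : R[i] :=
  \sum_(j < N) c j * expi (j.+1%:R * w * t).

Lemma cmeas_trig w N c : cmeas (trig w N c).
Proof.
apply: cmeas_sum => j; apply: cmeasM; first by meas.
meas.
Qed.
Lemma cabs_trig w N c t : cabs (trig w N c t) <= \sum_(j < N) cabs (c j).
Proof.
apply: le_trans (cabs_sum _ _ _) _; apply: ler_sum => j _.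
by rewrite cabsM cabs_expi mulr1.
Qed.

Lemma ft_trig w N c u E : cL1 lam u ->
  ft (fun t => trig w N c t * u t) E = \sum_(j < N) c j * ft u (E + j.+1%:R * w).
Proof.
move=> lu.
transitivity (cint lam (fun t => \sum_(j < N) c j * (u t * expi ((E + j.+1%:R * w) * t)))).
  apply: eq_cint => t; rewrite /trig !mulr_suml; apply: eq_bigr => j _.
  rewrite mulrDl expiD; ring.
rewrite cint_sum; last by move=> j; apply: cL1Z; exact: cL1_expi.
apply: eq_bigr => j _; rewrite cintZ//; exact: cL1_expi.
Qed.

Lemma cabs2_sum_le (N : nat) (F : 'I_N -> R[i]) :
  cabs2 (\sum_(j < N) F j) <= N%:R * \sum_(j < N) cabs2 (F j).
Proof.
elim: N F => [|N IH] F; first by rewrite !big_ord0 cabs20 mulr0.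
rewrite !big_ord_recl; set S := \sum_(i < N) F _; set T := \sum_(i < N) cabs2 _.
have h : cabs2 S <= N%:R * T by exact: (IH (fun i => F (lift ord0 i))).
have T0 : 0 <= T by apply: sumr_ge0 => i _; exact: cabs2_ge0.
have [N0|N0] := eqVneq N 0%N.
  have -> : S = 0 by apply: big1 => i _; have := ltn_ord i; rewrite {2}N0.
  by rewrite addr0 {2}N0 mul1r lerDl.
have Np : 0 < N%:R :> R by rewrite ltr0n lt0n.
have : cabs2 (F ord0 + S) <= (1 + N%:R) * cabs2 (F ord0) + (1 + N%:R^-1) * cabs2 S.
  rewrite cabs2E; apply: (@le_trans _ _ ((cabs (F ord0) + cabs S) ^+ 2)).
    by rewrite ler_pXn2r ?nnegrE ?addr_ge0 ?cabs_ge0// cabsD.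
  rewrite !cabs2E; set a := cabs _; set b := cabs _.
  have -> : (1 + N%:R) * a ^+ 2 + (1 + N%:R^-1) * b ^+ 2 = (a + b) ^+ 2 + N%:R^-1 * (N%:R * a - b) ^+ 2.
    by field; rewrite gt_eqF.
  by rewrite lerDl mulr_ge0 ?sqr_ge0// invr_ge0 ltW.
move=> /le_trans; apply.
have -> : N.+1%:R * (cabs2 (F ord0) + T) = (1 + N%:R) * cabs2 (F ord0) + (1 + N%:R) * T.
  by rewrite -natr1 mulrDr [N%:R + 1]addrC.
apply: lerD => //; apply: (@le_trans _ _ ((1 + N%:R^-1) * (N%:R * T))).
  by rewrite ler_wpM2l// addr_ge0// invr_ge0 ltW.
by rewrite mulrA mulrDl mul1r mulVf ?gt_eqF// [N%:R + 1]addrC.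
Qed.
End FourierL2.

(** * The symbol of the charge equation *)

Section Dispersion.
Variable R : realType.
Local Notation lam := (@lam R).

Definition c0 : R[i] := 4%:R * sqrtpii R.
Lemma cos_sin_pi4 : cos (pi / 4) = sin (pi / 4) :> R /\ 2^-1 <= cos (pi / 4) :> R.
Proof.
have h : (pi / 4 + pi / 4 : R) = pi / 2 by field.
have c0' : 0 < cos (pi / 4) :> R.
  by apply: cos_gt0_pihalf; have := pi_gt0 R; lra.
have e1 : cos (pi / 4) ^+ 2 = sin (pi / 4) ^+ 2 :> R.
  by apply/eqP; rewrite -subr_eq0 !expr2 -cosD h cos_pihalf.
have s0 : 0 <= sin (pi / 4) :> R.
  by apply: sin_ge0_pi; have := pi_gt0 R; lra.
have e : cos (pi / 4) = sin (pi / 4) :> R.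
  by apply/eqP; rewrite -(@eqrXn2 _ 2) ?(ltW c0')//; apply/eqP.
split => //; have := cos2Dsin2 (pi / 4 : R); rewrite -e; move: c0'.
set c := cos _ => c1 c2; rewrite -ler_sqr ?nnegrE ?(ltW c1) ?invr_ge0//; lra.
Qed.

Lemma cre_c0 : cre c0 = 4 * Num.sqrt pi * cos (pi / 4).
Proof. by rewrite /c0 /sqrtpii -(cR_nat R 4) !creM cim_cR cim_cR !mul0r !subr0 !cre_cR mulrA. Qed.
Lemma cim_c0 : cim c0 = 4 * Num.sqrt pi * cos (pi / 4).
Proof.
rewrite /c0 /sqrtpii -(cR_nat R 4) !cimM !cim_cR !mul0r !addr0 !cre_cR mulrA.
by rewrite (cos_sin_pi4).1.
Qed.
Lemma cabs_c0 : cabs c0 = 4 * Num.sqrt pi.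
Proof. by rewrite /c0 /sqrtpii -(cR_nat R 4) !cabsM cabs_expi mulr1 !cabs_cRp ?sqrtr_ge0. Qed.
Lemma c0_neq0 : c0 != 0.
Proof. by rewrite -cabs_eq0 cabs_c0 gt_eqF// mulr_gt0// sqrtr_gt0 pi_gt0. Qed.

(** The damping [e^(- s t)] and the Fourier factor [expi (E * t)] combine into
    [e^(- zz s E * t)]. *)
Definition zz (s E : R) : R[i] := cR s - iC R * cR E.
Lemma cre_zz s E : cre (zz s E) = s.
Proof. by rewrite /zz !creE cim_cR mulr0 mul0r subrr subr0. Qed.
Lemma cim_zz s E : cim (zz s E) = - E.
Proof. by rewrite /zz !cimE !creE mul0r add0r mul1r add0r. Qed.
Lemma cabs_zz_ge s E : `|E| <= cabs (zz s E).
Proof. by apply: le_trans (cim_le_cabs _); rewrite cim_zz normrN. Qed.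
Lemma cabs_zz_le s E : 0 <= s -> cabs (zz s E) <= s + `|E|.
Proof. by move=> s0; apply: le_trans (cabs_le_reim _) _; rewrite cre_zz cim_zz normrN ger0_norm. Qed.
Lemma Kz_ft s E : Kz (zz s E) = ft (fun t => cR (kexp s t)) E.
Proof.
apply: eq_cint => t; rewrite /kz /kexp cRM -mulrA; congr (_ * _).
rewrite -cexp_cR -cexp_im -cexpD; congr cexp; rewrite /zz cRN !cRM; ring.
Qed.

(** Transforming the damped equation [u = c0 * (k * (f - alpha u))] and dividing by [c0 * Kz] gives
    [dsp * ft u + ft (alpha u) = ft f]. Up to a constant phase and factor, [dsp] is the square root
    of [zz s E]. *)
Definition dsp s E := (c0 * Kz (zz s E))^-1.
Lemma cmeas_dsp s : 0 < s -> cmeas (dsp s).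
Proof.
move=> s0; apply: cmeasV; apply: cmeasM; first by meas.
apply: (cmeas_eq (fun E => esym (Kz_ft s E))); apply: cmeas_ft.
apply: cL1_cR; [exact: mfun_kexp|exact: kexp_ge0|exact: nint_kexp_lty].
Qed.

Definition D0 : R := (16 * pi * @beta0 R)^-1.
Lemma D0_gt0 : 0 < D0. Proof. by rewrite invr_gt0 !mulr_gt0// ?pi_gt0// beta0_gt0. Qed.
Lemma cabs2_dsp s E : 0 < s -> cabs2 (dsp s E) = D0 * cabs (zz s E).
Proof.
move=> s0; have z0 : 0 < cre (zz s E) by rewrite cre_zz.
have h := cabs2_Kz z0; have b0 := @beta0_gt0 R.
rewrite cabs2V cabs2M (cabs2E c0) cabs_c0 exprMn sqr_sqrtr ?pi_ge0// /D0 -h.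
have k0 : cabs2 (Kz (zz s E)) != 0 by apply: contraTneq b0 => k; rewrite -h k mul0r ltxx.
have zn0 : cabs (zz s E) != 0 by apply: contraTneq b0 => k; rewrite -h k mulr0 ltxx.
have p0 : pi != 0 :> R by rewrite gt_eqF// pi_gt0.
move: (@pi R) (cabs2 _) (cabs _) p0 k0 zn0 => p k z p0 k0 zn0; field.
by rewrite zn0 k0 p0.
Qed.

Lemma cimV (w : R[i]) : cim w^-1 = - cim w / cabs2 w.
Proof.
have [->|w0] := eqVneq w 0; first by rewrite invr0 !cimE oppr0 mul0r.
have n0 : cabs2 w != 0 by rewrite cabs2E sqrf_eq0 cabs_eq0.
have : w^-1 = conjc w * cR (cabs2 w)^-1.
  apply: (mulfI w0); rewrite divff// mulrA mulcconj -cRM divff//.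
by move=> ->; rewrite cimM cim_cR mulr0 add0r cim_conj cre_cR.
Qed.

(** [Kz] has argument in [[- pi / 4, pi / 4]], and in [[0, pi / 4]] when [E >= 0]. The factor [c0]
    turns it by [pi / 4], so [c0 * Kz] lies in the closed upper half plane, and for [E >= 0] it has
    argument at least [pi / 4], where the imaginary part controls the modulus. Inversion reverses
    the sign; the constant [1 / 2] is a lower bound for [cos (pi / 4)]. *)
Lemma cim_dsp s E : 0 < s -> 0 <= - cim (dsp s E) /\
  (0 <= E -> cabs (dsp s E) / 2 <= - cim (dsp s E)).
Proof.
move=> s0; have z0 : 0 < cre (zz s E) by rewrite cre_zz.
have [h1 h2] := Kz_sector s0 (erefl (Kz (zz s E))).
have Kn0 := Kz_neq0 z0.
rewrite cimV mulNr opprK cabsV.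
move: h1 h2 Kn0; set K := Kz _ => h1 h2 Kn0.
have [_ c2] := cos_sin_pi4.
have ci : cim (c0 * K) = 4 * Num.sqrt pi * (cos (pi / 4) * (cre K + cim K)).
  by rewrite cimM cre_c0 cim_c0; ring.
have p0 : 0 < 4 * Num.sqrt pi :> R by rewrite mulr_gt0// sqrtr_gt0 pi_gt0.
have cc0 : 0 <= cos (pi / 4) :> R by apply: le_trans c2; rewrite invr_ge0.
have ri : 0 <= cre K + cim K by move: h1; rewrite ler_norml => /andP[]; lra.
split.
  rewrite divr_ge0 ?cabs2_ge0// ci mulr_ge0 ?(ltW p0)// mulr_ge0//.
move=> E0; have {}h2 := h2 E0.
have k0 : 0 < cabs (c0 * K) by rewrite lt_def cabs_ge0 cabs_eq0 mulf_neq0 ?c0_neq0.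
have e : cabs (c0 * K) / 2 <= cim (c0 * K).
  rewrite ci cabsM cabs_c0 -mulrA ler_wpM2l ?(ltW p0)//.
  apply: (@le_trans _ _ (2^-1 * (cre K + cim K))); last by rewrite ler_wpM2r.
  rewrite mulrC ler_wpM2l//; apply: le_trans (cabs_le_reim _) _.
  rewrite [`|cim K|]ger0_norm// lerD2r ger0_norm//.
  by apply: le_trans (normr_ge0 _) h1.
rewrite ler_pdivlMr; last by rewrite cabs2E exprn_gt0.
apply: le_trans e; rewrite cabs2E expr2 -mulrA [X in _^-1 * X]mulrCA mulrA mulrA.
by rewrite mulrA mulVf ?gt_eqF// mul1r mulrC.
Qed.
End Dispersion.

(** * The lower bound, uniform in the damping *)

Section LowerBound.
Variable R : realType.
Local Notation lam := (@lam R).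
Implicit Types u f g : R -> R[i].
Variables (alpha : R -> R) (w A s0 : R).
Hypothesis malpha : mfun alpha.
Hypothesis calpha : forall t, ccont_at (fun s => cR (alpha s)) t.
Hypothesis alphaA : forall t, `|alpha t| <= A.
Hypothesis w0 : 0 < w.
Hypothesis s00 : 0 < s0.
(* 1 is a uniform limit of p * alpha + r with p and r trigonometric polynomials
   in e^{iwt}, e^{2iwt}, ...; genericity provides this. *)
Hypothesis alpha_generic : forall e : R, 0 < e -> exists N c M b,
  forall t, cabs (1 - trig w N c t * cR (alpha t) - trig w M b t) <= e.

Let A0 : 0 <= A. Proof. by apply: le_trans (alphaA 0). Qed.
Let caA t : cabs (cR (alpha t)) <= A. Proof. by rewrite cabs_cR. Qed.
Let mca : cmeas (fun t => cR (alpha t)). Proof. meas. Qed.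
Let au u t := cR (alpha t) * u t.
Let good_au u : good u -> good (au u).
Proof. by move=> gu; exact: (good_Mb gu mca caA calpha). Qed.
(** In Fourier variables the damped charge equation says that [opy s u] is the transform of the
    damped inhomogeneity. *)
Definition opy s u E := dsp s E * ft u E + ft (au u) E.

Let cmeas_opy s u : 0 < s -> good u -> cmeas (opy s u).
Proof.
move=> s1 gu; apply: cmeasD; last by apply: cmeas_ft; case: (good_au gu).
by apply: cmeasM; [exact: cmeas_dsp|apply: cmeas_ft; case: gu].
Qed.
Lemma N2_ft_mult u g (k : R) : good u -> cmeas g -> (forall x, cabs (g x) <= k) ->
  (N2 (ft (fun t => (g t * u t)%R)) <= (k ^+ 2)%:E * N2 (ft u))%E.
Proof.
move=> gu mg gk; have [l1 l2 _] := gu.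
apply: le_trans (plancherel_le (cL1_bM l1 mg gk)) _.
have [_ H] := cL2_Mb l2 mg gk.
by rewrite parseval// muleCA lee_wpmul2l// lee_fin mulr_ge0// pi_ge0.
Qed.

Lemma cint_abs2 f : cL2 f -> cL1 lam (fun E => cR (cabs2 (f E))) /\
  cint lam (fun E => cR (cabs2 (f E))) = cR (n2 f).
Proof.
move=> [mf lf]; split; last by rewrite cint_cR.
by apply: cL1_cR; [exact: cmeas_cabs2|move=> x; exact: cabs2_ge0|].
Qed.
(** Since [alpha] is real, the pairing is a multiple of the integral of [alpha * |u|^2]. Parseval is
    at hand for norms only, so the imaginary part is extracted by polarisation:
    [|1 + i alpha|^2 = 1 + alpha^2] shows that the squared norm of the transform of
    [(1 + i alpha) u] is the sum of those of [ft u] and [ft (alpha u)], and the cross term must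
    vanish. *)
Lemma im_pairing_zero u : good u ->
  cim (cint lam (fun E => conjc (ft u E) * ft (au u) E)) = 0.
Proof.
move=> gu; have gau := good_au gu.
pose i1 t : R[i] := 1 + iC R * cR (alpha t).
have mi1 : cmeas i1 by meas.
have bi1 t : cabs (i1 t) <= 1 + A.
  by apply: le_trans (cabsD _ _) _; rewrite cabs1 lerD2l cabsM cabs_iC mul1r.
have ci1 t : ccont_at i1 t.
  apply: ccont_D; first exact: ccont_cst.
  by apply: ccont_M => //; exact: ccont_cst.
have gi := good_Mb gu mi1 bi1 ci1.
set x := ft u; set v := ft (au u); set z := ft (fun t => i1 t * u t).
have zE E : z E = x E + iC R * v E.
  have [l1 _ _] := gu; have [l2 _ _] := gau.
  rewrite /z /v -ftZ// -ftD//; last exact: cL1Z.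
  by apply: eq_cint => t; rewrite /i1 /au; ring.
have lx := good_cL2_ft gu; have lv := good_cL2_ft gau; have lz := good_cL2_ft gi.
rewrite -/x -/v in lx lv; rewrite -/z in lz.
have px : N2 x = ((2 * pi)%:E * N2 u)%E := parseval gu.
have pv : N2 v = ((2 * pi)%:E * N2 (au u))%E := parseval gau.
have pz : N2 z = ((2 * pi)%:E * N2 (fun t => (i1 t * u t)%R))%E := parseval gi.
clearbody x v z.
have e1 : n2 z = n2 x + n2 v.
  suff : ((n2 z)%:E = (n2 x)%:E + (n2 v)%:E)%E by rewrite -EFinD => -[].
  rewrite (n2E lx) (n2E lv) (n2E lz) px pv pz.
  rewrite -muleDr ?fin_num_adde_defl//; last first.
    have [_ [mu2 l2] _] := gau; by rewrite ge0_fin_numE// N2_ge0.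
  congr (_ * _)%E; rewrite /N2 -nintD.
  - apply: eq_nint => t; rewrite /au !cabs2M (_ : cabs2 (i1 t) = 1 + cabs2 (cR (alpha t))).
      by rewrite mulrDl mul1r.
    rewrite cabs2_cR /cabs2 /i1 creD cimD creM cimM cre1 cim1 cre_iC cim_iC cre_cR cim_cR; ring.
  - by apply: cmeas_cabs2; case: gu => _ [].
  - by apply: cmeas_cabs2; case: gau => _ [].
  - pos.
  - pos.
have lxv : cL1 lam (fun E => conjc (x E) * v E) by apply: cL1_L2M => //; exact: cL2_conj.
have [a1 b1] := cint_abs2 lx; have [a2 b2] := cint_abs2 lv; have [a3 b3] := cint_abs2 lz.
have lI : cL1 lam (fun E => cR (cim (conjc (x E) * v E))).
  split; first by apply: cmeas_cR; case: lxv => -[].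
  apply: le_lt_trans lxv.2; apply: le_nint.
  - by apply: cmeas_cabs; apply: cmeas_cR; case: lxv => -[].
  - by apply: cmeas_cabs; case: lxv.
  - pos.
  - by move=> E; rewrite cabs_cR cim_le_cabs.
have : cint lam (fun E => cR (cabs2 (z E))) = cint lam (fun E => (cR (cabs2 (x E)) + cR (cabs2 (v E))) - cR 2 * cR (cim (conjc (x E) * v E))).
  apply: eq_cint => E; rewrite zE -!(cRD, cRM, cRB); congr cR.
  rewrite /cabs2 !cimM !creD !cimD !creM !cimM !cre_conj !cim_conj !cre_iC !cim_iC; ring.
rewrite cintB; [|exact: cL1D|exact: cL1Z].
rewrite cintD// cintZ// b1 b2 b3 e1 cint_cR -cRM -cRD -cRB => /cR_inj h.
have : 2 * Rintegral lam setT (fun E => cim (conjc (x E) * v E)) = 0 by lra.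
by move=> /eqP; rewrite mulf_eq0 pnatr_eq0 /= => /eqP.
Qed.

Definition Hi (th : R) f : \bar R := nint lam (fun E => ((th <= E)%R%:R * cabs2 (f E))%R).
Lemma mfun_ge (th : R) : mfun (fun E : R => (th <= E)%R%:R : R).
Proof.
rewrite (_ : (fun _ => _) = \1_`[th, +oo[); first by meas.
by apply/funext => t; rewrite indicE mem_setE in_itv/= andbT.
Qed.

(** A quantitative form of the assertion that [ft u] vanishes above the energy [th] when
    [opy s u = 0]. The threshold [e] depends on [eta] but neither on [u] nor on the damping
    [s <= s0]. *)
Definition highP th := forall eta, 0 < eta -> exists2 e : R, 0 < e & forall s u, 0 < s <= s0 ->
  good u -> (N2 (opy s u) <= e%:E * N2 (ft u))%E -> (Hi th (ft u) <= eta%:E * N2 (ft u))%E.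
(** In the imaginary part of the pairing of [ft u] with [opy s u] the potential drops out, and what
    remains is the integral of the nonnegative density [- im dsp * |ft u|^2]. The level is [w] and
    not [0], because [dsp] degenerates at [E = 0] as [s] tends to [0], whereas above [w] its modulus
    is at least [sqrt (D0 * w)]. *)
Lemma highP_base : highP w.
Proof.
move=> eta eta0; pose c1 := Num.sqrt (D0 R * w) / 2.
have D0p := D0_gt0 R.
have c10 : 0 < c1 by pos.
exists ((c1 * eta) ^+ 2); first by pos.
move=> s u /andP[sp _] gu hy.
set x := ft u in hy *; set y := opy s u in hy; pose v := ft (au u).
have lx : cL2 x by exact: good_cL2_ft.
have lv : cL2 v by apply: good_cL2_ft; exact: good_au.
have my : cmeas y by exact: cmeas_opy.
have ly : cL2 y.
  by split=> //; apply: le_lt_trans hy _; apply: lte_mul_pinfty; rewrite ?lee_fin ?sqr_ge0//; case: lx.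
have lcx := cL2_conj lx.
have lxy := cL1_L2M lcx ly; have lxv := cL1_L2M lcx lv.
have mx : cmeas x by case: lx.
(* [alpha] enters only through the second pairing, whose integral is real; pointwise the sum of the
   two terms depends on the symbol alone. *)
pose h E := - cim (conjc (x E) * y E) + cim (conjc (x E) * v E).
have hE E : h E = - cim (dsp s E) * cabs2 (x E).
  rewrite /h -cimN -cimD (_ : _ + _ = - (dsp s E * cR (cabs2 (x E)))).
    by rewrite cimN cimM cim_cR cre_cR; ring.
  rewrite -mulcconj /y /opy -/x -/v; ring.
have h0 E : 0 <= h E.
  by rewrite hE mulr_ge0 ?cabs2_ge0//; case: (cim_dsp E sp).
have mh : mfun h.
  apply: measurable_funD; first by apply: measurableT_comp => //; case: lxy => -[].
  by case: lxv => -[].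
have lh : cL1 lam (fun E => cR (h E)).
  apply: (cL1_dom (r := fun E => cabs (conjc (x E) * y E) + cabs (conjc (x E) * v E))).
  - meas.
  - by apply: measurable_funD; apply: cmeas_cabs; [case: lxy|case: lxv].
  - move=> E; rewrite cabs_cR /h; apply: le_trans (ler_normD _ _) _.
    by rewrite normrN lerD// cim_le_cabs.
  rewrite nintD; first last.
  - pos.
  - pos.
  - by apply: cmeas_cabs; case: lxv.
  - by apply: cmeas_cabs; case: lxy.
  by apply: lte_add_pinfty; [case: lxy|case: lxv].
have Ih : Rintegral lam setT h = - cim (cint lam (fun E => conjc (x E) * y E)).
  have -> : Rintegral lam setT h = cim (cint lam (fun E => conjc (x E) * v E - conjc (x E) * y E)).
    transitivity (Rintegral lam setT (fun E => cim (conjc (x E) * v E - conjc (x E) * y E))) => //.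
    by apply: eq_Rintegral => E _; rewrite cimD cimN /h addrC.
  by rewrite cintB// cimD cimN im_pairing_zero// add0r.
have nh : (nint lam h <= (c1 * eta * n2 x)%:E)%E.
  rewrite -nint_Rintegral//; last first.
    apply: le_lt_trans lh.2; apply: le_nint => //.
      meas.
    by move=> E; rewrite cabs_cR ler_norm.
  rewrite Ih lee_fin; apply: le_trans (ler_norm _) _; rewrite normrN.
  apply: le_trans (cim_le_cabs _) _; rewrite -lee_fin.
  apply: le_trans (cabs_cint lxy) _.
  (* Young's inequality with parameter [c1 * eta], which balances the two norms because [opy s u]
     has at most [(c1 * eta)^2] times the squared norm of [ft u]. *)
  have l0 : 0 < c1 * eta by pos.
  apply: le_trans (nint_young lcx ly l0) _; rewrite lee_fin n2_conj.
  have : n2 y <= (c1 * eta) ^+ 2 * n2 x by rewrite -lee_fin EFinM !n2E.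
  set l := c1 * eta in l0 * => h1.
  have : 2^-1 * l^-1 * n2 y <= 2^-1 * l^-1 * (l ^+ 2 * n2 x).
    by rewrite ler_wpM2l// mulr_ge0// invr_ge0 ltW.
  have -> : 2^-1 * l^-1 * (l ^+ 2 * n2 x) = 2^-1 * l * n2 x by field; rewrite gt_eqF.
  lra.
have : (c1%:E * Hi w x <= (c1 * eta * n2 x)%:E)%E.
  have mHi : mfun (fun E => (w <= E)%R%:R * cabs2 (x E)).
    by apply: measurable_funM; [exact: mfun_ge|exact: cmeas_cabs2].
  apply: le_trans nh; rewrite -nintZ ?(ltW c10)//; last by move=> E; rewrite mulr_ge0 ?cabs2_ge0.
  apply: le_nint => //.
  - meas.
  - by move=> E; rewrite mulr_ge0 ?(ltW c10)// mulr_ge0 ?cabs2_ge0.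
  move=> E; rewrite hE mulrA ler_wpM2r ?cabs2_ge0//.
  have [wE|wE] := leP w E; last by rewrite mulr0; case: (cim_dsp E sp).
  rewrite mulr1; have E0 : 0 <= E by apply: le_trans wE; exact: ltW.
  apply: le_trans ((cim_dsp E sp).2 E0); rewrite ler_wpM2r//.
  rewrite {1}/cabs cabs2_dsp//.
  rewrite ler_sqrt ?mulr_ge0 ?(ltW D0p) ?cabs_ge0// ler_wpM2l ?(ltW D0p)//.
  by apply: le_trans wE (le_trans (ler_norm _) (cabs_zz_ge s E)).
by move=> h1; rewrite -(@lee_pmul2l _ c1%:E)// ?lte_fin// -n2E// -!EFinM mulrA.
Qed.

Lemma nint_shift_cabs2 f (c : R) : cmeas f -> N2 (fun E => f (E + c)) = N2 f.
Proof.
move=> mf; apply: (nint_shift (f := fun E => cabs2 (f E))) => [|E]; last exact: cabs2_ge0.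
meas.
Qed.
Lemma Hi_shift th f (c : R) : cmeas f ->
  nint lam (fun E => ((th <= E + c)%R%:R * cabs2 (f (E + c)))%R) = Hi th f.
Proof.
move=> mf; apply: (nint_shift (f := fun E => (th <= E)%R%:R * cabs2 (f E))) => [|E].
  by apply: measurable_funM; [exact: mfun_ge|exact: cmeas_cabs2].
pos.
Qed.

Let window th N (c : nat -> R[i]) M (b : nat -> R[i]) g s u E := 3 * cabs2 (ft (fun t => g t * u t) E) +
  (\sum_(j < N) 3 * N%:R * cabs2 (c j) * (2 * cabs2 (opy s u (E + j.+1%:R * w)) +
      2 * (D0 R * (s0 + `|th| + N%:R * w)) * ((th <= E + j.+1%:R * w)%R%:R * cabs2 (ft u (E + j.+1%:R * w)))) +
   \sum_(i < M) 3 * M%:R * cabs2 (b i) * ((th <= E + i.+1%:R * w)%R%:R * cabs2 (ft u (E + i.+1%:R * w)))).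
Let gam N c M b t := 1 - trig w N c t * cR (alpha t) - trig w M b t.

(** In time, [u = (1 - p alpha - r) u + p alpha u + r u]. On the Fourier side the last two terms
    involve only energies [E + j w] with [j >= 1], all at least [th]; there [ft (alpha u)] is
    replaced by [opy s u - dsp * ft u]. The factors [3], [N], [M] and [2] come from squaring
    sums. *)
Lemma window_le th N c M b s u E : 0 < s <= s0 -> good u -> th - w <= E < th ->
  cabs2 (ft u E) <= window th N c M b (gam N c M b) s u E.
Proof.
move=> /andP[sp ss0] gu /andP[E1 E2]; have [l1 _ _] := gu; have [l2 _ _] := good_au gu.
have lt1 : cL1 lam (fun t => trig w N c t * au u t).
  by apply: (cL1_bM l2 (cmeas_trig _ _ _)) => t; exact: cabs_trig.
have lt2 : cL1 lam (fun t => trig w M b t * u t).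
  by apply: (cL1_bM l1 (cmeas_trig _ _ _)) => t; exact: cabs_trig.
have lt3 : cL1 lam (fun t => gam N c M b t * u t).
  apply: (eq_cL1 (f := fun t => u t - trig w N c t * au u t - trig w M b t * u t)).
    by move=> t; rewrite /gam /au; ring.
  by apply: cL1B => //; exact: cL1B.
have -> : ft u E = ft (fun t => gam N c M b t * u t) E +
    (\sum_(j < N) c j * ft (au u) (E + j.+1%:R * w) + \sum_(i < M) b i * ft u (E + i.+1%:R * w)).
  rewrite -ft_trig// -ft_trig// -ftD// -ftD//; last exact: cL1D.
  by apply: eq_cint => t; rewrite /gam /au; ring.
set a1 := ft _ E; set a2 := \sum_(j < N) _; set a3 := \sum_(i < M) _.
have H : cabs2 (a1 + (a2 + a3)) <= 3 * cabs2 a1 + (3 * cabs2 a2 + 3 * cabs2 a3).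
  have -> : a1 + (a2 + a3) = \sum_(j < 3) (nth 0 [:: a1; a2; a3] j) by rewrite !big_ord_recl big_ord0 addr0.
  by apply: le_trans (cabs2_sum_le _) _; rewrite !big_ord_recl big_ord0 addr0 /= !mulrDr.
apply: le_trans H _; rewrite /window lerD2l; apply: lerD.
  apply: (@le_trans _ _ (3 * (N%:R * \sum_(j < N) cabs2 (c j * ft (au u) (E + j.+1%:R * w))))).
    by rewrite ler_wpM2l// cabs2_sum_le.
  rewrite !mulr_sumr; apply: ler_sum => j _; rewrite cabs2M !mulrA ler_wpM2l//.
    pos.
  set E' := E + _.
  have jw : w <= j.+1%:R * w by rewrite ler_peMl ?ler1n// ltW.
  have jN : j.+1%:R * w <= N%:R * w by rewrite ler_wpM2r ?ler_nat ?ltn_ord// ltW.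
  have thE : th <= E' by rewrite /E'; lra.
  rewrite thE mulr1 (_ : ft (au u) E' = opy s u E' - dsp s E' * ft u E'); last by rewrite /opy addrAC subrr add0r.
  apply: le_trans (cabs2B _ _) _; rewrite lerD2l -!mulrA ler_wpM2l// cabs2M mulrA ler_wpM2r ?cabs2_ge0//.
  rewrite cabs2_dsp// ler_wpM2l ?(ltW (D0_gt0 R))//.
  apply: le_trans (cabs_zz_le _ (ltW sp)) _; rewrite -addrA lerD//.
  have : - `|th| <= th by have := ler_norm (- th); rewrite normrN; lra.
  have := ler_norm th.
  by rewrite ler_norml /E'; lra.
apply: (@le_trans _ _ (3 * (M%:R * \sum_(i < M) cabs2 (b i * ft u (E + i.+1%:R * w))))).
  by rewrite ler_wpM2l// cabs2_sum_le.
rewrite !mulr_sumr; apply: ler_sum => j _; rewrite cabs2M !mulrA ler_wpM2r ?cabs2_ge0//.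
have jw : w <= j.+1%:R * w by rewrite ler_peMl ?ler1n// ltW.
by rewrite (_ : th <= _) ?mulr1//; lra.
Qed.

(** The window below [th] is controlled by the uniformly small function [1 - p alpha - r] and by
    finitely many shifts of the part above [th]. The approximation is fixed before the threshold, so
    that its coefficients, collected in [C], can be beaten by applying the hypothesis with
    [eta / (4 C)]. *)
Lemma highP_step th : highP th -> highP (th - w).
Proof.
move=> Hth eta eta0.
have D0p := D0_gt0 R.
(* The term with [z] carries the factor [3], so [eta / 12] makes it a quarter of [eta]; [eg <= 1]
   gives [eg^2 <= eg]. *)
pose eg := Num.min 1 (eta / 12).
have eg0 : 0 < eg by rewrite lt_min ltr01 divr_gt0.
have [N [c [M [b Hg]]]] := alpha_generic eg0.
(* An upper bound for [|dsp|^2] at all energies [E + j w], [j <= N], reached from the window. *)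
pose K := D0 R * (s0 + `|th| + N%:R * w).
have K0 : 0 <= K by rewrite mulr_ge0 ?(ltW D0p)// !addr_ge0 ?(ltW s00)// mulr_ge0// ltW.
pose C1 := \sum_(j < N) 3 * N%:R * cabs2 (c j) * (2 + 2 * K).
pose C2 := \sum_(i < M) 3 * M%:R * cabs2 (b i).
have C10 : 0 <= C1 by apply: sumr_ge0 => j _; rewrite !mulr_ge0 ?cabs2_ge0// addr_ge0// mulr_ge0.
have C20 : 0 <= C2 by apply: sumr_ge0 => j _; rewrite !mulr_ge0 ?cabs2_ge0.
pose C := C1 + C2 + 1.
have Cp : 0 < C by rewrite ltr_wpDl// addr_ge0.
have h4 : 0 < eta / (4 * C) by pos.
have [e1 e10 He] := Hth _ h4.
exists (Num.min e1 (eta / (4 * C))); first by rewrite lt_min e10.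
move=> s u sp gu hy; have sp' : 0 < s by case/andP: sp.
set x := ft u in hy *; set y := opy s u in hy.
have lx : cL2 x by exact: good_cL2_ft.
have mx : cmeas x by case: lx.
have my : cmeas y by exact: cmeas_opy.
have hy1 : (N2 y <= e1%:E * N2 x)%E.
  by apply: le_trans hy _; rewrite lee_wpmul2r ?N2_ge0// lee_fin ge_min lexx.
have hy2 : (N2 y <= (eta / (4 * C))%:E * N2 x)%E.
  by apply: le_trans hy _; rewrite lee_wpmul2r ?N2_ge0// lee_fin ge_min lexx orbT.
have hH := He s u sp gu hy1; rewrite -/x in hH.
pose g := gam N c M b.
have mg : cmeas g.
  apply: cmeasB; last exact: cmeas_trig.
  by apply: cmeasB; [exact: cmeas_cst|apply: cmeasM => //; exact: cmeas_trig].
pose z := ft (fun t => g t * u t).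
have mz : cmeas z by apply: cmeas_ft; apply: (cL1_bM _ mg Hg); case: gu.
have hz : (N2 z <= (eta / 12)%:E * N2 x)%E.
  apply: le_trans (N2_ft_mult gu mg Hg) _; rewrite lee_wpmul2r ?N2_ge0// lee_fin.
  apply: (@le_trans _ _ (eg * 1)); first by rewrite expr2 ler_wpM2l ?(ltW eg0)// ge_min lexx.
  by rewrite mulr1 ge_min lexx orbT.
have hwin E : th - w <= E < th -> cabs2 (x E) <= 3 * cabs2 (z E) +
    (\sum_(j < N) 3 * N%:R * cabs2 (c j) * (2 * cabs2 (y (E + j.+1%:R * w)) +
      2 * K * ((th <= E + j.+1%:R * w)%R%:R * cabs2 (x (E + j.+1%:R * w)))) +
    \sum_(i < M) 3 * M%:R * cabs2 (b i) * ((th <= E + i.+1%:R * w)%R%:R * cabs2 (x (E + i.+1%:R * w)))).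
  exact: (window_le N c M b sp gu).
clearbody z y x K.
have m2 f : cmeas f -> mfun (fun E => cabs2 (f E)) by meas.
have mge f : cmeas f -> mfun (fun E : R => (th <= E)%R%:R * cabs2 (f E)).
  by move=> mf; apply: measurable_funM; [exact: mfun_ge|exact: m2].
have sh (f : R -> R) (d : R) : mfun f -> mfun (fun E : R => f (E + d)).
  by move=> mf; apply: (measurableT_comp mf); apply: measurable_funD.
have q0 (zc : R[i]) : 0 <= cabs2 zc by [].
pose G1 (j : nat) E := 3 * N%:R * cabs2 (c j) * (2 * cabs2 (y (E + j.+1%:R * w)) +
      2 * K * ((th <= E + j.+1%:R * w)%R%:R * cabs2 (x (E + j.+1%:R * w)))).
pose G2 (i : nat) E := 3 * M%:R * cabs2 (b i) * ((th <= E + i.+1%:R * w)%R%:R * cabs2 (x (E + i.+1%:R * w))).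
have mG1 j : mfun (G1 j).
  apply: measurable_funM => //; apply: measurable_funD; apply: measurable_funM => //.
    by apply: (sh (fun E => cabs2 (y E))); exact: m2.
  by apply: (sh (fun E => (th <= E)%R%:R * cabs2 (x E))); exact: mge.
have mG2 j : mfun (G2 j).
  apply: measurable_funM => //.
  by apply: (sh (fun E => (th <= E)%R%:R * cabs2 (x E))); exact: mge.
have K20 : 0 <= 2 * K by pos.
have cj0 (n : nat) (zc : R[i]) : 0 <= 3 * n%:R * cabs2 zc :> R by pos.
have in0 (t : R) (zc : R[i]) : 0 <= (th <= t)%R%:R * cabs2 zc by pos.
have p2 (zc : R[i]) : 0 <= 2 * cabs2 zc by pos.
have pk (t : R) (zc : R[i]) : 0 <= 2 * K * ((th <= t)%R%:R * cabs2 zc) by pos.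
have G10 j E : 0 <= G1 j E by pos.
have G20 j E : 0 <= G2 j E by pos.
have IG1 j : nint lam (G1 j) = ((3 * N%:R * cabs2 (c j))%:E * (2%:E * N2 y + (2 * K)%:E * Hi th x))%E.
  rewrite (nintZ lam (cj0 N (c j))); last 2 first.
  - apply: measurable_funD; apply: measurable_funM => //.
      by apply: (sh (fun E => cabs2 (y E))); exact: m2.
    by apply: (sh (fun E => (th <= E)%R%:R * cabs2 (x E))); exact: mge.
  - by move=> E; apply: addr_ge0.
  rewrite nintD; first last.
  - by [].
  - by [].
  - apply: measurable_funM => //.
    by apply: (sh (fun E => (th <= E)%R%:R * cabs2 (x E))); exact: mge.
  - apply: measurable_funM => //.
    by apply: (sh (fun E => cabs2 (y E))); exact: m2.
  rewrite (@nintZ _ _ _ lam 2)//; last by apply: (sh (fun E => cabs2 (y E))); exact: m2.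
  rewrite (nintZ lam K20); last 2 first.
  - by apply: (sh (fun E => (th <= E)%R%:R * cabs2 (x E))); exact: mge.
  - by [].
  by rewrite Hi_shift// -/(N2 (fun E => y (E + j.+1%:R * w))) nint_shift_cabs2.
have IG2 j : nint lam (G2 j) = ((3 * M%:R * cabs2 (b j))%:E * Hi th x)%E.
  rewrite (nintZ lam (cj0 M (b j))); last 2 first.
  - by apply: (sh (fun E => (th <= E)%R%:R * cabs2 (x E))); exact: mge.
  - by [].
  by rewrite Hi_shift.
pose W E := 3 * cabs2 (z E) + (\sum_(j < N) G1 j E + \sum_(i < M) G2 i E).
have ms1 : mfun (fun E => \sum_(j < N) G1 j E) by apply: measurable_sum.
have ms2 : mfun (fun E => \sum_(j < M) G2 j E) by apply: measurable_sum.
have mz2 := m2 _ mz.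
have : (Hi (th - w) x <= nint lam (fun E => ((th <= E)%R%:R * cabs2 (x E) + W E)%R))%E.
  apply: le_nint.
  - by apply: measurable_funM; [exact: mfun_ge|exact: m2].
  - apply: measurable_funD; first exact: mge.
    meas.
  - by move=> E; rewrite mulr_ge0.
  move=> E; have W0 : 0 <= W E by rewrite addr_ge0 ?mulr_ge0// addr_ge0// sumr_ge0.
  have [E1|E1] := leP th E.
    by rewrite (le_trans _ E1) ?gerBl ?(ltW w0)// lerDl.
  rewrite mul0r add0r; have [E2|E2] := leP (th - w) E; last by rewrite mul0r.
  by rewrite mul1r; apply: hwin; rewrite E2 E1.
have X0 := n2_ge0 x; have XE := n2E lx.
have [HhE Hh0] : (fine (Hi th x))%:E = Hi th x /\ 0 <= fine (Hi th x).
  have h : (0 <= Hi th x)%E by apply: nint_ge0 => E; rewrite mulr_ge0.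
  split; last by rewrite fine_ge0.
  rewrite fineK// ge0_fin_numE//; apply: le_lt_trans hH _; apply: lte_mul_pinfty => //.
  - by pos.
  - by case: lx.
have ly : cL2 y.
  split=> //; apply: le_lt_trans hy1 _; apply: lte_mul_pinfty => //.
  - by pos.
  - by case: lx.
have lz : cL2 z.
  split=> //; apply: le_lt_trans hz _; apply: lte_mul_pinfty => //.
  - pos.
  - by case: lx.
move: HhE Hh0 hH; set H := fine _ => HE H0 hH.
have -> : nint lam (fun E => ((th <= E)%R%:R * cabs2 (x E) + W E)%R) =
    (H + (3 * n2 z + (\sum_(j < N) (3 * N%:R * cabs2 (c j) * (2 * n2 y + 2 * K * H)) +
      \sum_(i < M) (3 * M%:R * cabs2 (b i) * H))))%:E.
  rewrite nintD; first last.
  - by move=> E; rewrite addr_ge0 ?mulr_ge0// addr_ge0// sumr_ge0.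
  - pos.
  - meas.
  - exact: mge.
  rewrite nintD; first last.
  - by move=> E; rewrite addr_ge0// sumr_ge0.
  - by move=> E; rewrite mulr_ge0.
  - meas.
  - meas.
  rewrite nintD//; first last.
  - by move=> E; rewrite sumr_ge0.
  - by move=> E; rewrite sumr_ge0.
  rewrite nint_sum// nint_sum// (@nintZ _ _ _ lam 3)// -/(Hi th x) -/(N2 z) -HE -n2E//.
  rewrite (eq_bigr _ (fun (j : 'I_N) _ => IG1 j)) (eq_bigr _ (fun (j : 'I_M) _ => IG2 j)) -HE -n2E//.
  by rewrite !EFinD -!sumEFin.
rewrite -XE in hy2 hz hH *; rewrite -n2E// -EFinM lee_fin in hy2; rewrite -n2E// -EFinM lee_fin in hz.
rewrite -HE -EFinM lee_fin in hH.
move=> /le_trans; apply; rewrite -EFinM lee_fin.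
have Y0 := n2_ge0 y.
have S1 : \sum_(j < N) (3 * N%:R * cabs2 (c j) * (2 * n2 y + 2 * K * H)) <= C1 * (n2 y + H).
  rewrite mulr_suml; apply: ler_sum => j _; rewrite -[leRHS]mulrA ler_wpM2l ?mulr_ge0//.
  have : 0 <= K * n2 y by pos.
  nra.
have S2 : \sum_(i < M) (3 * M%:R * cabs2 (b i) * H) = C2 * H by rewrite mulr_suml.
rewrite S2.
have eC : eta / (4 * C) * C = eta / 4 by field; rewrite gt_eqF.
have h1 : C * n2 y <= eta / 4 * n2 x.
  by rewrite -eC [X in X * n2 x]mulrC -mulrA ler_wpM2l ?(ltW Cp).
have h2 : C * H <= eta / 4 * n2 x.
  by rewrite -eC [X in X * n2 x]mulrC -mulrA ler_wpM2l ?(ltW Cp).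
have h3 : C1 * n2 y <= C * n2 y by rewrite ler_wpM2r// /C; lra.
have h5 : C * H = C1 * H + C2 * H + H by rewrite /C; ring.
have h6 : 0 <= eta * n2 x by pos.
lra.
Qed.

Lemma highP_all (m : nat) : highP (w - m%:R * w).
Proof.
elim: m => [|m IH]; first by rewrite mul0r subr0; exact: highP_base.
rewrite (_ : w - m.+1%:R * w = w - m%:R * w - w); first exact: highP_step.
by rewrite -natr1; ring.
Qed.
(** If [opy s u] were too small, at most a quarter of the squared norm of [ft u] would lie above
    [- th], by [highP_all]. At most another quarter would lie below, because there
    [dsp * ft u = opy s u - ft (alpha u)] and [|dsp|^2 >= D0 * th]. The two parts cannot make up the
    whole. *)
Lemma lower_bound : exists2 e : R, 0 < e & forall s u, 0 < s <= s0 -> good u ->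
  (e%:E * N2 (ft u) <= N2 (opy s u))%E.
Proof.
have D0p := D0_gt0 R.
(* After [m] windows the level is [- th] with [D0 * th >= 8 A^2 + 8], four times the factor
   [2 A^2 + 2] produced by the right side. *)
have [m Hm] : exists m : nat, (8 * A ^+ 2 + 8) / D0 R <= m%:R * w - w.
  exists (Num.truncn ((8 * A ^+ 2 + 8) / D0 R / w + 1)).+1.
  set r := _ / D0 R; have h := truncnS_gt (r / w + 1); move: h; set n := _.+1%:R => h.
  have : (r / w + 1) * w <= n * w by rewrite ler_wpM2r// ltW.
  by rewrite mulrDl mul1r divfK ?gt_eqF//; lra.
set th := m%:R * w - w in Hm.
have th0 : 0 < th.
  by apply: lt_le_trans Hm; rewrite divr_gt0// ltr_wpDl// mulr_ge0// sqr_ge0.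
have h4 : 0 < 4^-1 :> R by [].
have [e1 e10 He] := highP_all m h4.
exists (Num.min e1 1); first by rewrite lt_min e10 ltr01.
move=> s u sp gu; rewrite leNgt; apply/negP => hy; have sp' : 0 < s by case/andP: sp.
have gau := good_au gu.
have hN : (N2 (opy s u) <= e1%:E * N2 (ft u))%E.
  by apply: le_trans (ltW hy) _; rewrite lee_wpmul2r ?N2_ge0// lee_fin ge_min lexx.
have := He s u sp gu hN; rewrite (_ : w - m%:R * w = - th); last by rewrite /th opprB.
have my : cmeas (opy s u) by exact: cmeas_opy.
have lx : cL2 (ft u) by exact: good_cL2_ft.
have lv : cL2 (ft (au u)) by exact: good_cL2_ft.
have hv : (N2 (ft (au u)) <= (A ^+ 2)%:E * N2 (ft u))%E by exact: (N2_ft_mult gu mca caA).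
have ly : cL2 (opy s u).
  split=> //; apply: le_lt_trans hN _; apply: lte_mul_pinfty; rewrite ?lee_fin ?(ltW e10)//.
  by case: lx.
have hE E : dsp s E * ft u E = opy s u E - ft (au u) E by rewrite /opy addrK.
move: hE hv lv hy hN ly lx my.
move: (ft u) (ft (au u)) (opy s u) => x v y hE hv lv hy hN ly lx my hH.
have [mx _] := lx; have [mv _] := lv.
have mlow : mfun (fun E : R => (1 - (- th <= E)%R%:R) * cabs2 (x E)).
  apply: measurable_funM; last by meas.
  by apply: measurable_funB => //; exact: mfun_ge.
have mhigh : mfun (fun E : R => (- th <= E)%R%:R * cabs2 (x E)).
  by apply: measurable_funM; [exact: mfun_ge|exact: cmeas_cabs2].
have i1 E : 0 <= 1 - (- th <= E)%R%:R :> R by case: (- th <= E)%R; rewrite ?subrr ?subr0.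
pose L := nint lam (fun E : R => (1 - (- th <= E)%R%:R) * cabs2 (x E)).
have XLH : N2 x = (L + Hi (- th) x)%E.
  rewrite /L /Hi -nintD//.
  - by apply: eq_nint => E; rewrite -mulrDl subrK mul1r.
  - by move=> E; rewrite mulr_ge0 ?cabs2_ge0.
  - by move=> E; rewrite mulr_ge0 ?cabs2_ge0.
have hL : ((D0 R * th)%:E * L <= 2%:E * N2 y + 2%:E * N2 v)%E.
  have t0 : 0 <= D0 R * th by rewrite mulr_ge0// ltW.
  rewrite /L -(nintZ lam t0)//; last by move=> E; rewrite mulr_ge0 ?cabs2_ge0.
  have m2y : mfun (fun E => cabs2 (y E)) by meas.
  have m2v : mfun (fun E => cabs2 (v E)) by meas.
  have q0 (zc : R[i]) : 0 <= cabs2 zc by [].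
  rewrite -(@nintZ _ _ _ lam 2 (fun E => cabs2 (y E)))// -(@nintZ _ _ _ lam 2 (fun E => cabs2 (v E)))//.
  rewrite -nintD; first last.
  - by move=> E; rewrite mulr_ge0.
  - by move=> E; rewrite mulr_ge0.
  - meas.
  - meas.
  apply: le_nint.
  - meas.
  - meas.
  - by move=> E; rewrite mulr_ge0// mulr_ge0.
  move=> E; apply: le_trans (cabs2B _ _); rewrite -hE cabs2M mulrA ler_wpM2r//.
  have [E1|E1] := leP (- th) E; first by rewrite subrr mulr0.
  rewrite subr0 mulr1 cabs2_dsp// ler_wpM2l ?(ltW D0p)//.
  by apply: le_trans (cabs_zz_ge s E) => //; rewrite ltr0_norm; lra.
have X0 := n2_ge0 x; have Y0 := n2_ge0 y; have V0 := n2_ge0 v.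
have XE := n2E lx; have YE := n2E ly; have VE := n2E lv.
have L0 : (0 <= L)%E by apply: nint_ge0 => E; rewrite mulr_ge0 ?cabs2_ge0.
have H0 : (0 <= Hi (- th) x)%E by apply: nint_ge0 => E; rewrite mulr_ge0 ?cabs2_ge0.
have LE : (fine L)%:E = L.
  rewrite fineK// ge0_fin_numE//; apply: le_lt_trans lx.2; rewrite XLH.
  by rewrite leeDl.
have HE : (fine (Hi (- th) x))%:E = Hi (- th) x.
  rewrite fineK// ge0_fin_numE//; apply: le_lt_trans lx.2; rewrite XLH.
  by rewrite leeDr.
move: LE HE; set l := fine L; set h := fine (Hi _ x) => LE HE.
rewrite -XE -VE -YE -LE -?HE in hL hv hy XLH hH *.
rewrite -EFinD in XLH; case: XLH => XLH.
rewrite -!EFinM -EFinD lee_fin in hL; rewrite -EFinM lee_fin in hv.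
rewrite -EFinM lte_fin in hy; rewrite -EFinM lee_fin in hH.
have D1 : 8 * A ^+ 2 + 8 <= D0 R * th by rewrite [leRHS]mulrC -ler_pdivrMr.
have l0 : 0 <= l by rewrite -lee_fin LE.
have s1 : (8 * A ^+ 2 + 8) * l <= D0 R * th * l by rewrite ler_wpM2r.
have a0 := sqr_ge0 A.
have y1 : n2 y <= n2 x.
  by apply: le_trans (ltW hy) _; rewrite ler_piMl// ge_min lexx orbT.
have ml : l <= 4^-1 * n2 x.
  rewrite -(@ler_pM2l _ (8 * A ^+ 2 + 8)); last by lra.
  rewrite (_ : _ * (4^-1 * n2 x) = 2 * n2 x + 2 * (A ^+ 2 * n2 x)); last by field.
  lra.
have x00 : n2 x = 0 by apply/eqP; rewrite eq_le X0 andbT; lra.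
by move: hy; rewrite x00 mulr0 ltNge Y0.
Qed.
End LowerBound.

(** * From genericity to uniform trigonometric approximation *)

Section Genericity.
Variable R : realType.
Variables (w : R).

Definition istrig (r : R -> R[i]) := exists M b, forall t, r t = trig w M b t.
Lemma trig_pad M M' b t : (M <= M')%N ->
  trig w M b t = trig w M' (fun i => if (i < M)%N then b i else 0) t.
Proof.
move=> MM; rewrite /trig (big_ord_widen M' (fun j => b j * expi (j.+1%:R * w * t)))//.
by rewrite big_mkcond; apply: eq_bigr => j _; case: ifP => //; rewrite mul0r.
Qed.

Lemma istrigD r s : istrig r -> istrig s -> istrig (fun t => r t + s t).
Proof.
move=> [M [b Hb]] [N [c Hc]]; exists (maxn M N).
exists (fun i => (if (i < M)%N then b i else 0) + (if (i < N)%N then c i else 0)) => t.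
rewrite Hb Hc (trig_pad b t (leq_maxl M N)) (trig_pad c t (leq_maxr M N)) /trig -big_split.
by apply: eq_bigr => j _; rewrite mulrDl.
Qed.
Lemma istrig0 : istrig (fun=> 0).
Proof. by exists 0%N, (fun=> 0) => t; rewrite /trig big_ord0. Qed.

Lemma istrig_sum (I : Type) (l : seq I) (F : I -> R -> R[i]) :
  (forall i, istrig (F i)) -> istrig (fun t => \sum_(i <- l) F i t).
Proof.
move=> H; elim: l => [|i l IH].
  by have [M [b h]] := istrig0; exists M, b => t; rewrite big_nil -h.
by have [M [b h]] := istrigD (H i) IH; exists M, b => t; rewrite big_cons -h.
Qed.
Lemma istrig_mono c n : istrig (fun t => c * expi (n.+1%:R * w * t)).
Proof.
exists n.+1, (fun i => if i == n then c else 0) => t; rewrite /trig.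
rewrite big_ord_recr /= eqxx big1 ?add0r// => j _.
by rewrite ltn_eqF ?mul0r.
Qed.

Lemma istrigZ c r : istrig r -> istrig (fun t => c * r t).
Proof.
move=> [M [b h]]; exists M, (fun i => c * b i) => t; rewrite h /trig mulr_sumr.
by apply: eq_bigr => j _; rewrite mulrA.
Qed.

Variables (a : int -> R[i]) (alpha : R -> R) (B : R).
Hypothesis absB : forall N, abs_partial a N <= B.
Hypothesis falpha : forall t, ccvg_seq (fourier_partial a w t) (cR (alpha t)).
Hypothesis ga : generic a.

Let symsum (V : zmodType) (F : int -> V) L := \sum_(k < (2 * L).+1) F (k%:Z - L%:Z).
Let symsumS (V : zmodType) (F : int -> V) L :
  symsum F L.+1 = F (- L.+1%:Z) + (symsum F L + F L.+1%:Z).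
Proof.
rewrite /symsum (_ : (2 * L.+1).+1 = (2 * L).+3)%N; last by rewrite mulnS.
rewrite big_ord_recl big_ord_recr /= sub0r; congr (_ + (_ + F _)).
  by apply: eq_bigr => k _; congr F; rewrite /bump /= add1n; lia.
by rewrite /bump /= add1n; lia.
Qed.

Let absS L : abs_partial a L <= abs_partial a L.+1.
Proof.
rewrite -[leRHS]/(symsum (fun k => cabs (a k)) L.+1) symsumS -/(abs_partial a L).
by rewrite addrCA lerDl addr_ge0// cabs_ge0.
Qed.
Lemma fourier_cauchy t L n :
  cabs (fourier_partial a w t (L + n) - fourier_partial a w t L) <= abs_partial a (L + n) - abs_partial a L.
Proof.
elim: n => [|n IH]; first by rewrite addn0 !subrr cabs0.
rewrite addnS; pose F (k : int) : R[i] := a k * expi (- (k%:~R * w * t)).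
have eF : fourier_partial a w t (L + n).+1 =
    F (- (L + n).+1%:Z) + (fourier_partial a w t (L + n) + F (L + n).+1%:Z) by exact: symsumS.
have eA : abs_partial a (L + n).+1 = cabs (a (- (L + n).+1%:Z)) + (abs_partial a (L + n) + cabs (a (L + n).+1%:Z)).
  exact: (symsumS (fun k => cabs (a k))).
have nF k : cabs (F k) = cabs (a k) by rewrite cabsM cabs_expi mulr1.
rewrite eF eA; set x := F _; set y := F _; set f := fourier_partial _ _ _ _ in IH *.
set g := fourier_partial _ _ _ _ in IH *.
have -> : x + (f + y) - g = (x + y) + (f - g) by ring.
apply: le_trans (cabsD _ _) _; have := cabsD x y; rewrite /x /y !nF; move: IH; lra.
Qed.

(** The Fourier series is assumed to converge pointwise; absolute summability bounds its increments
    by those of the [t]-independent sums [abs_partial], which makes the convergence uniform. *)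
Lemma fourier_tail (d : R) : 0 < d -> exists L0, forall L t, (L0 <= L)%N ->
  cabs (cR (alpha t) - fourier_partial a w t L) <= d.
Proof.
move=> d0; pose S := [set abs_partial a L | L in [set: nat]].
have hS : has_sup S by split; [exists (abs_partial a 0), 0%N|exists B => _ [L _ <-]].
have [_ [L0 _ <-] hL0] := sup_adherent d0 hS.
have nd L n : abs_partial a L <= abs_partial a (L + n).
  by elim: n => [|n IH]; rewrite ?addn0// addnS; apply: le_trans IH (absS _).
exists L0 => L t L0L.
have H n : cabs (fourier_partial a w t (L + n) - fourier_partial a w t L) <= d.
  apply: le_trans (fourier_cauchy t L n) _.
  have : abs_partial a (L + n) <= sup S by apply: ub_le_sup; [case: hS|exists (L + n)%N].
  have : abs_partial a L0 <= abs_partial a L by rewrite -(subnKC L0L); exact: nd.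
  move: hL0; lra.
have cv : cabs (fourier_partial a w t n - fourier_partial a w t L) @[n --> \oo] -->
    cabs (cR (alpha t) - fourier_partial a w t L).
  by apply: ccvg_cabs; apply: ccvgB => //; exact: ccvg_cst.
apply: (cvgr_to_le cv).
by exists L => // n /= Ln; rewrite -(subnKC Ln); exact: H.
Qed.

Lemma alpha_bounded t : `|alpha t| <= B.
Proof.
rewrite -cabs_cR; have cv := ccvg_cabs (falpha t).
apply: (cvgr_to_le cv); apply: nearW => n.
apply: le_trans (absB n); apply: le_trans (cabs_sum _ _ _) _.
by apply: ler_sum => k _; rewrite cabsM cabs_expi mulr1.
Qed.
(** Multiply [alpha] by the sum of [c j * expi ((j + 1) w t)]. The coefficient of [expi (- m w t)],
    [m >= 0], becomes the sum over [j] of [c j * a (m + j + 1)]: the [m]-th entry of the combination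
    of shifts of the sequence, which genericity brings close to [e_1] in l1. The positive
    frequencies are left over and form the polynomial [r]. *)
Lemma uniform_of_generic (e : R) : 0 < e -> exists N c M b,
  forall t, cabs (1 - trig w N c t * cR (alpha t) - trig w M b t) <= e.
Proof.
move=> e0; have e2 : 0 < e / 2 by pos.
have [N [c Hc]] := ga e2.
pose Cs := \sum_(j < N) cabs (c j).
have Cs0 : 0 <= Cs by apply: sumr_ge0 => j _; exact: cabs_ge0.
have d0 : 0 < e / 2 / (Cs + 1) by rewrite divr_gt0// ltr_wpDl.
have [L0 HL0] := fourier_tail d0.
pose M1 := L0.+1.
(* The [j]-th product uses the partial sum of order [M1 + j], so that after the shift by [j + 1] its
   nonpositive frequencies are [m < M1] for every [j]; [P] collects the positive frequencies and [Q]
   the others. *)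
pose P (j : nat) t : R[i] := \sum_(k < (M1 + 2 * j).+1)
  a (k%:Z - (M1 + j)%N%:Z) * expi (((M1 + 2 * j) - k).+1%:R * w * t).
pose Q (j : nat) t : R[i] := \sum_(m < M1) a (m + j + 1)%N%:Z * expi (- (m%:R * w * t)).
have split_fp j t : expi (j.+1%:R * w * t) * fourier_partial a w t (M1 + j) = P j t + Q j t.
  rewrite /fourier_partial (_ : (2 * (M1 + j)).+1 = ((M1 + 2 * j).+1 + M1)%N); last by lia.
  rewrite big_split_ord /= mulrDr !mulr_sumr; congr (_ + _); apply: eq_bigr => k _.
    rewrite mulrCA -expiD; congr (_ * expi _).
    have kj : (k <= M1 + 2 * j)%N by rewrite -ltnS.
    have h : ((M1 + 2 * j - k).+1%:R : R) = (j.+1%:Z - (k%:Z - (M1 + j)%N%:Z))%:~R.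
      by rewrite pmulrn; congr (_%:~R); lia.
    rewrite h mulrzBr -!pmulrn; ring.
  rewrite mulrCA -expiD; congr (a _ * expi _); first lia.
  have -> : (((M1 + 2 * j).+1 + k)%N%:Z - (M1 + j)%N%:Z)%:~R = j.+1%:R + k%:R :> R.
    by rewrite -natrD [RHS]pmulrn; congr (_%:~R); lia.
  ring.
have cE j : istrig (P j).
  by apply: istrig_sum => k; exact: istrig_mono.
have [M [b Hb]] : istrig (fun t => - 1 * \sum_(j < N) c j * P j t).
  apply: istrigZ; apply: (@istrig_sum _ _ (fun (j : 'I_N) t => c j * P j t)) => j.
  by apply: istrigZ; exact: cE.
exists N, c, M, b => t; rewrite -Hb mulN1r opprK.
pose rest (j : nat) := cR (alpha t) - fourier_partial a w t (M1 + j).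
have -> : 1 - trig w N c t * cR (alpha t) + \sum_(j < N) c j * P j t =
    (1 - \sum_(j < N) c j * Q j t) - \sum_(j < N) c j * (expi (j.+1%:R * w * t) * rest j).
  rewrite /trig mulr_suml -!addrA; congr (_ + _); rewrite -!sumrN -!big_split; apply: eq_bigr => j _ /=.
  rewrite (_ : c j * P j t = c j * (P j t + Q j t) - c j * Q j t); last by ring.
  by rewrite -split_fp /rest; ring.
apply: le_trans (cabsB _ _) _; rewrite [leRHS](_ : e = e / 2 + e / 2); last by field.
apply: lerD.
  have -> : 1 - \sum_(j < N) c j * Q j t =
      \sum_(m < M1) ((nat_of_ord m == 0%N)%:R - \sum_(j < N) c j * a (m + j + 1)%N%:Z) * expi (- (m%:R * w * t)).
    under [RHS]eq_bigr do rewrite mulrBl.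
    rewrite big_split /= sumrN; congr (_ - _).
      rewrite big_ord_recl /= big1 ?addr0; last by move=> m _; rewrite mul0r.
      by rewrite mul1r !mul0r oppr0 expi0.
    under [RHS]eq_bigr do rewrite mulr_suml.
    rewrite exchange_big; apply: eq_bigr => j _; rewrite /Q mulr_sumr.
    by apply: eq_bigr => m _; rewrite mulrA.
  apply: le_trans (cabs_sum _ _ _) _; apply: le_trans (Hc M1); apply: ler_sum => m _.
  by rewrite cabsM cabs_expi mulr1.
apply: le_trans (cabs_sum _ _ _) _.
apply: (@le_trans _ _ (\sum_(j < N) cabs (c j) * (e / 2 / (Cs + 1)))).
  apply: ler_sum => j _; rewrite !cabsM cabs_expi mul1r ler_wpM2l ?cabs_ge0//.
  by apply: HL0; rewrite /M1; lia.
rewrite -mulr_suml -/Cs mulrCA ler_piMr ?(ltW e2)// ler_pdivrMr ?ltr_wpDl//.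
by rewrite mul1r lerDl.
Qed.
End Genericity.

(** * Picard iteration for the strongly damped charge equation *)

Section Picard.
Variable R : realType.
Local Notation lam := (@lam R).

(** With the tail majorant [h], the sequence [v - h] increases and [v + h] decreases, so monotone
    convergence yields the limit together with the rate. *)
Lemma geometric_cvg (v : nat -> R) (M : R) :
  (forall n, `|v n.+1 - v n| <= M * 2^-1 ^+ n) ->
  exists l, v n @[n --> \oo] --> l /\ forall n, `|v n - l| <= 2 * M * 2^-1 ^+ n.
Proof.
move=> H; pose h n : R := 2 * M * 2^-1 ^+ n.
have h2 n : h n.+1 = h n - M * 2^-1 ^+ n by rewrite /h exprS; field.
have M0 : 0 <= M by have := H 0%N; rewrite expr0 mulr1; exact: le_trans.
have h0 : h n @[n --> \oo] --> (0 : R).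
  rewrite -[X in _ --> X](mulr0 (2 * M)); apply: cvgM; first exact: cvg_cst.
  by apply: cvg_expr; rewrite ger0_norm ?invr_ge0// invf_lt1// ltr1n.
have hp n : 0 <= h n by pos.
have inc : nondecreasing_seq (fun n => v n - h n).
  by apply/nondecreasing_seqP => n; have := H n; rewrite ler_norml h2 => /andP[]; lra.
have dec : nonincreasing_seq (fun n => v n + h n).
  by apply/nonincreasing_seqP => n; have := H n; rewrite ler_norml h2 => /andP[]; lra.
have ub n : v n - h n <= v 0%N + h 0%N.
  by have := dec 0%N n (leq0n _) => /=; have := hp n; lra.
have c1 : cvgn (fun n => v n - h n).
  by apply: nondecreasing_is_cvgn => //; exists (v 0%N + h 0%N) => _ [n _ <-].
set l := limn (fun n => v n - h n).
have vl : v n @[n --> \oo] --> l.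
  rewrite -[l]addr0 (_ : v = (fun n => (v n - h n) + h n)); last by apply/funext => n; rewrite subrK.
  exact: cvgD.
exists l; split => // n; rewrite ler_norml; apply/andP; split.
  have : l <= v n + h n.
    have vh : v n + h n @[n --> \oo] --> l + 0 by exact: cvgD.
    rewrite addr0 in vh; apply: (cvgr_to_le vh).
    by exists n => // m /= nm; exact: dec.
  by rewrite -/(h n); lra.
have : v n - h n <= l by exact: (nondecreasing_cvgn_le inc c1).
by rewrite -/(h n); lra.
Qed.

Lemma geometric_ccvg (v : nat -> R[i]) (M : R) :
  (forall n, cabs (v n.+1 - v n) <= M * 2^-1 ^+ n) ->
  exists l, ccvg_seq v l /\ forall n, cabs (v n - l) <= 4 * M * 2^-1 ^+ n.
Proof.
move=> H.
have [a [a1 a2]] : exists l, cre (v n) @[n --> \oo] --> l /\ forall n, `|cre (v n) - l| <= 2 * M * 2^-1 ^+ n.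
  by apply: geometric_cvg => n; rewrite -creN -creD; apply: le_trans (cre_le_cabs _) (H n).
have [b [b1 b2]] : exists l, cim (v n) @[n --> \oo] --> l /\ forall n, `|cim (v n) - l| <= 2 * M * 2^-1 ^+ n.
  by apply: geometric_cvg => n; rewrite -cimN -cimD; apply: le_trans (cim_le_cabs _) (H n).
exists (Complex a b); split; first by split.
move=> n; apply: le_trans (cabs_le_reim _) _; rewrite creD creN cimD cimN.
have := a2 n; have := b2 n; rewrite /cre /cim /=; lra.
Qed.

Lemma cconv_continuous (k g : R -> R[i]) (B : R) : cL1 lam k -> cmeas g ->
  (forall s, cabs (g s) <= B) -> (forall t, t != 0 -> ccont_at g t) ->
  forall t, ccont_at (cconv k g) t.
Proof.
move=> lk mg gB cg t; apply: ccont_seq => s st.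
(* Continuity of [g (t - x)] in [t] can fail only at [x = t]; deleting this null point from the
   integrand gives convergence at every [x]. *)
pose ind (r : R) : R := \1_[set r : R | r - t != 0] r.
have mind : mfun ind.
  rewrite (_ : ind = (fun r : R => \1_[set r : R | r != 0] (r - t))); last by [].
  by apply: (measurableT_comp (@mfun_ind_neq0 R)); apply: measurable_funB.
have mk : cmeas k by case: lk.
have E r : cconv k g r = cint lam (fun x => cR (ind x) * (k x * g (r - x))).
  apply: (cint_eq_ne (a := t)).
  - by apply: cmeasM => //; exact: cmeas_subl.
  - by apply: cmeasM; [exact: cmeas_cR|apply: cmeasM => //; exact: cmeas_subl].
  by move=> x xt; rewrite /ind indicE mem_set ?mul1r//= subr_eq0.
apply: (ccvg_eq (fun n => esym (E (s n)))); rewrite E.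
apply: (@cint_dct _ _ _ lam _ _ (fun x => B * cabs (k x))).
- by move=> n; apply: cmeasM; [exact: cmeas_cR|apply: cmeasM => //; exact: cmeas_subl].
- move=> x; rewrite /ind indicE; have [->|xt] := eqVneq x t.
    by rewrite memNset/= ?subrr ?eqxx//; under eq_fun do rewrite mul0r; rewrite mul0r; exact: ccvg_cst.
  apply: ccvgM; first exact: ccvg_cst.
  apply: ccvgM; first exact: ccvg_cst.
  apply: (ccont_seqP (cg (t - x) _)); first by rewrite subr_eq0 eq_sym.
  by apply: cvgB => //; exact: cvg_cst.
- meas.
- rewrite nintZ//; [|by apply: le_trans (cabs_ge0 _) (gB 0)|exact: cmeas_cabs].
  apply: lte_mul_pinfty => //; last by case: lk.
  by rewrite lee_fin; apply: le_trans (cabs_ge0 _) (gB 0).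
- move=> n x; rewrite !cabsM; apply: (@le_trans _ _ (1 * (cabs (k x) * B))); last by rewrite mul1r mulrC.
  apply: ler_pM; [exact: cabs_ge0|by rewrite mulr_ge0 ?cabs_ge0|
    by rewrite cabs_cRp /ind indicE ?ler0n// lern1 leq_b1|by rewrite ler_wpM2l ?cabs_ge0].
Qed.

Variables (alpha : R -> R) (A : R) (f : R -> R[i]) (F0 : R).
Hypothesis malpha : mfun alpha.
Hypothesis calpha : forall t, ccont_at (fun s => cR (alpha s)) t.
Hypothesis alphaA : forall t, `|alpha t| <= A.
Hypothesis mf : cmeas f.
Hypothesis fF : forall t, cabs (f t) <= F0.
Hypothesis f0 : forall t, t <= 0 -> f t = 0.
Hypothesis cf : forall t, t != 0 -> ccont_at f t.

Let A0 : 0 <= A. Proof. by apply: le_trans (alphaA 0). Qed.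
Let F00 : 0 <= F0. Proof. by apply: le_trans (cabs_ge0 _) (fF 0). Qed.
Let mca : cmeas (fun t => cR (alpha t)). Proof. meas. Qed.
Let caA t : cabs (cR (alpha t)) <= A. Proof. by rewrite cabs_cR. Qed.
Definition ewt (s t : R) : R[i] := cR (expR (- (s * t))).
Lemma cmeas_ewt s : cmeas (ewt s).
Proof.
by apply: cmeas_cR; apply: measurableT_comp => //; apply: measurableT_comp => //; meas.
Qed.
Lemma ccont_ewt s t : ccont_at (ewt s) t.
Proof.
apply: ccont_seq => r rt; apply: ccvg_cR.
have h : - (s * r n) @[n --> \oo] --> - (s * t) by apply: cvgN; apply: cvgM => //; exact: cvg_cst.
exact: (cvg_comp _ _ h (@continuous_expR R _)).
Qed.
Lemma ewtD s r t : ewt (s + r) t = ewt s t * ewt r t.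
Proof. by rewrite /ewt -cRM -expRD; congr (cR (expR _)); ring. Qed.
Lemma ewtB s t r : ewt s (t - r) * ewt s r = ewt s t.
Proof. by rewrite /ewt -cRM -expRD; congr (cR (expR _)); ring. Qed.
Lemma ewt0 t : ewt 0 t = 1.
Proof. by rewrite /ewt mul0r oppr0 expR0. Qed.
Lemma cabs_ewt s t : cabs (ewt s t) = expR (- (s * t)).
Proof. by rewrite cabs_cRp ?expR_ge0. Qed.
Lemma cabs_ewt_le1 s t : 0 <= s -> 0 <= t -> cabs (ewt s t) <= 1.
Proof. by move=> s0 t0; rewrite cabs_ewt -expR0 ler_expR oppr_le0 mulr_ge0. Qed.
Definition kex (s t : R) : R[i] := cR (kexp s t).
Lemma cL1_kex s : 0 < s -> cL1 lam (kex s).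
Proof.
move=> s0; apply: cL1_cR; [exact: mfun_kexp|exact: kexp_ge0|exact: nint_kexp_lty].
Qed.
Lemma cmeas_kex s : cmeas (kex s).
Proof. meas. Qed.
Lemma L1n_kex s : L1n (kex s) = kn s.
Proof. by rewrite /L1n /kn; congr fine; apply: eq_nint => t; rewrite cabs_cRp ?kexp_ge0. Qed.
Lemma kexE s t : kex s t = cR (k0 t) * ewt s t.
Proof. by rewrite /kex /kexp cRM. Qed.
Lemma cabs_ewf s t : 0 <= s -> cabs (ewt s t * f t) <= F0.
Proof.
move=> s0; have [t0|t0] := leP t 0; first by rewrite f0// mulr0 cabs0.
rewrite cabsM; apply: le_trans (fF t); rewrite ler_piMl ?cabs_ge0//.
by rewrite cabs_ewt_le1// ltW.
Qed.

(** The damping is chosen so large that the Volterra operator has norm at most [1 / 2] on bounded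
    functions: [kn s1 ^ 2 = beta0 / s1] and [s1 > 4 (|c0| A)^2 beta0]. *)
Let s1 : R := 4 * (cabs (c0 R) * A) ^+ 2 * @beta0 R + 1.
Let s1p : 0 < s1.
Proof. by rewrite ltr_wpDl// !mulr_ge0 ?cabs_ge0// ltW// beta0_gt0. Qed.
Let contr : cabs (c0 R) * A * kn s1 <= 2^-1.
Proof.
have k0 := kn_gt0 s1p; have c := cabs_ge0 (c0 R).
rewrite -ler_sqr ?nnegrE ?mulr_ge0 ?invr_ge0 ?(ltW k0)// exprMn.
have -> : kn s1 ^+ 2 = @beta0 R / s1 by rewrite -(kn_sqr s1p) mulrC mulKf// gt_eqF.
rewrite mulrA ler_pdivrMr// /s1.
have := sqr_ge0 (cabs (c0 R) * A); have := @beta0_gt0 R; set X := (_ * A) ^+ 2 => b0 x0.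
have -> : 2^-1 ^+ 2 * (4 * X * beta0 R + 1) = X * beta0 R + 4^-1 by field.
by rewrite lerDl invr_ge0.
Qed.

(** The iterates approximate the damped charge [e^(- s1 t) q], for which the Volterra map is a
    contraction on the whole line. *)
Fixpoint picard (n : nat) : R -> R[i] :=
  if n is m.+1 then fun t => c0 R * cconv (kex s1) (fun s => ewt s1 s * f s - cR (alpha s) * picard m s) t
  else fun=> 0.

Let M := cabs (c0 R) * F0 * kn s1.
Let M0 : 0 <= M. Proof. by rewrite !mulr_ge0 ?cabs_ge0// ltW// kn_gt0. Qed.
Let mwf : cmeas (fun s => ewt s1 s * f s).
Proof. by apply: cmeasM => //; exact: cmeas_ewt. Qed.

Let rhsB (u : R -> R[i]) (U : R) s : (forall s, cabs (u s) <= U) ->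
  cabs (ewt s1 s * f s - cR (alpha s) * u s) <= F0 + A * U.
Proof.
move=> uU; apply: le_trans (cabsB _ _) _; apply: lerD; first exact: cabs_ewf (ltW s1p).
by rewrite cabsM ler_pM ?cabs_ge0.
Qed.
Lemma picard_props n : [/\ cmeas (picard n), (forall t, cabs (picard n t) <= 2 * M),
  (forall t, ccont_at (picard n) t) & (forall t, t <= 0 -> picard n t = 0)].
Proof.
elim: n => [|n [m1 b1 c1 z1]].
  split; [exact: cmeas_cst|by move=> t; rewrite cabs0 mulr_ge0|move=> t; exact: ccont_cst|by []].
have mg : cmeas (fun s => ewt s1 s * f s - cR (alpha s) * picard n s).
  by apply: cmeasB => //; exact: cmeasM.
have lk := cL1_kex s1p.
split.
- by apply: cmeasM; [exact: cmeas_cst|apply: cmeas_conv => //; exact: cmeas_kex].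
- move=> t /=; rewrite cabsM.
  have := conv_bounded t lk mg (fun s => rhsB s b1); rewrite L1n_kex => h.
  apply: (@le_trans _ _ (cabs (c0 R) * ((F0 + A * (2 * M)) * kn s1))).
    by rewrite ler_wpM2l ?cabs_ge0.
  have -> : cabs (c0 R) * ((F0 + A * (2 * M)) * kn s1) = M + cabs (c0 R) * A * kn s1 * (2 * M).
    by rewrite /M; ring.
  have : cabs (c0 R) * A * kn s1 * (2 * M) <= 2^-1 * (2 * M) by rewrite ler_wpM2r// mulr_ge0.
  lra.
- move=> t; apply: ccont_M; first exact: ccont_cst.
  apply: (cconv_continuous lk mg (fun s => rhsB s b1)) => r r0.
  apply: ccont_seq => s sr; apply: ccvgB; apply: ccvgM.
  + exact: ccont_seqP (ccont_ewt _ _) sr.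
  + exact: ccont_seqP (cf r0) sr.
  + exact: ccont_seqP (calpha _) sr.
  + exact: ccont_seqP (c1 _) sr.
- move=> t t0 /=; rewrite /cconv (@eq_cint _ _ _ lam _ (fun=> 0)) ?cint0 ?mulr0// => s.
  have [s0|s0] := leP s 0; first by rewrite kexE k0_0// !mul0r.
  by rewrite f0 ?z1 ?mulr0 ?subrr ?mulr0//; lra.
Qed.

Lemma picard_diff n t : cabs (picard n.+1 t - picard n t) <= M * 2^-1 ^+ n.
Proof.
have lk := cL1_kex s1p.
elim: n t => [|n IH] t.
  rewrite expr0 mulr1 subr0 /= cabsM.
  have mg : cmeas (fun s => ewt s1 s * f s - cR (alpha s) * 0).
    by apply: cmeasB => //; apply: cmeasM => //; exact: cmeas_cst.
  have h s : cabs (ewt s1 s * f s - cR (alpha s) * 0) <= F0.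
    by rewrite mulr0 subr0; exact: cabs_ewf (ltW s1p).
  have := conv_bounded t lk mg h; rewrite L1n_kex => h1.
  by rewrite /M -mulrA ler_wpM2l ?cabs_ge0.
have [m1 b1 _ _] := picard_props n; have [m2 b2 _ _] := picard_props n.+1.
have mg1 : cmeas (fun s => ewt s1 s * f s - cR (alpha s) * picard n s).
  by apply: cmeasB => //; exact: cmeasM.
have mg2 : cmeas (fun s => ewt s1 s * f s - cR (alpha s) * picard n.+1 s).
  by apply: cmeasB => //; exact: cmeasM.
rewrite -[picard n.+2 t]/(c0 R * cconv (kex s1) (fun s => ewt s1 s * f s - cR (alpha s) * picard n.+1 s) t).
rewrite -[picard n.+1 t]/(c0 R * cconv (kex s1) (fun s => ewt s1 s * f s - cR (alpha s) * picard n s) t).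
rewrite -mulrBr cabsM -(convBr t lk mg2 (fun s => rhsB s b2) mg1 (fun s => rhsB s b1)).
have h s : cabs (ewt s1 s * f s - cR (alpha s) * picard n.+1 s - (ewt s1 s * f s - cR (alpha s) * picard n s)) <=
    A * (M * 2^-1 ^+ n).
  rewrite (_ : _ - _ = - cR (alpha s) * (picard n.+1 s - picard n s)); last by ring.
  by rewrite cabsM cabsN ler_pM ?cabs_ge0.
have := conv_bounded t lk (cmeasB mg2 mg1) h; rewrite L1n_kex => h1.
apply: (@le_trans _ _ (cabs (c0 R) * (A * (M * 2^-1 ^+ n) * kn s1))).
  by rewrite ler_wpM2l ?cabs_ge0.
have -> : cabs (c0 R) * (A * (M * 2^-1 ^+ n) * kn s1) = cabs (c0 R) * A * kn s1 * (M * 2^-1 ^+ n) by ring.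
by rewrite exprS [leRHS]mulrCA ler_wpM2r// mulr_ge0// exprn_ge0// invr_ge0.
Qed.

Lemma picard_fixpoint : exists s u, [/\ 0 < s /\ cmeas u, (exists B, forall t, cabs (u t) <= B),
  (forall t, ccont_at u t), (forall t, t <= 0 -> u t = 0) &
  forall t, u t = c0 R * cconv (kex s) (fun r => ewt s r * f r - cR (alpha r) * u r) t].
Proof.
have P t := geometric_ccvg (fun n => picard_diff n t).
pose u t := projT1 (cid (P t)).
have [u1 u2] : (forall t, ccvg_seq (fun n => picard n t) (u t)) /\
    forall t n, cabs (picard n t - u t) <= 4 * M * 2^-1 ^+ n.
  by split=> t; case: (projT2 (cid (P t))).
have mu_ : cmeas u.
  by apply: (cmeas_lim _ u1) => n; case: (picard_props n).
have bu t : cabs (u t) <= 2 * M.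
  apply: (cvgr_to_le (ccvg_cabs (u1 t))); apply: nearW => n; by case: (picard_props n).
have lk := cL1_kex s1p.
exists s1, u; split => //.
- by exists (2 * M).
- move=> t e e0; have e3 : 0 < e / 3 by rewrite divr_gt0.
  have h0 : 4 * M * 2^-1 ^+ n @[n --> \oo] --> (0 : R).
    rewrite -[X in _ --> X](mulr0 (4 * M)); apply: cvgM; first exact: cvg_cst.
    by apply: cvg_expr; rewrite ger0_norm ?invr_ge0// invf_lt1// ltr1n.
  have [n _ /(_ n (leqnn n))/=] := (cvgrPdist_le _ _).1 h0 _ e3.
  rewrite sub0r normrN => /(le_trans (ler_norm _)) hn.
  have [_ _ /(_ t _ e3)[d d0 Hd] _] := picard_props n; exists d => // s sd.
  have -> : u s - u t = (picard n s - picard n t) + ((picard n t - u t) - (picard n s - u s)) by ring.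
  apply: le_trans (cabsD _ _) _; have := cabsB (picard n t - u t) (picard n s - u s).
  have := Hd s sd; have := le_trans (u2 t n) hn; have := le_trans (u2 s n) hn; lra.
- move=> t t0; apply: (ccvg_uniq (u1 t)); apply: (ccvg_eq (u := fun=> 0)); last exact: ccvg_cst.
  by move=> n; have [_ _ _ z] := picard_props n; rewrite z.
move=> t; apply: (@ccvg_uniq _ (fun n => picard n.+1 t)).
  by have [h1 h2] := u1 t; split; [rewrite -cvg_shiftS in h1|rewrite -cvg_shiftS in h2].
apply: ccvgZ; apply: (@cint_dct _ _ _ lam _ _ (fun s => (F0 + A * (2 * M)) * cabs (kex s1 s))).
- move=> n; have [m1 _ _ _] := picard_props n; apply: cmeasM; first exact: cmeas_kex.
  by apply: (@cmeas_subl R (fun r => ewt s1 r * f r - cR (alpha r) * picard n r)); apply: cmeasB => //; exact: cmeasM.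
- move=> s; apply: ccvgM; first exact: ccvg_cst.
  by apply: ccvgB; [exact: ccvg_cst|apply: ccvgM; [exact: ccvg_cst|exact: u1]].
- by apply: measurable_funM => //; apply: cmeas_cabs; exact: cmeas_kex.
- rewrite nintZ//; [|side|side].
  apply: lte_mul_pinfty => //; last by case: lk.
  by rewrite lee_fin addr_ge0// mulr_ge0// mulr_ge0.
- move=> n s; rewrite cabsM mulrC ler_wpM2r ?cabs_ge0//.
  by apply: (rhsB (u := picard n)) => r; case: (picard_props n).
Qed.
End Picard.

(** * Square integrability of the charge *)

Section VolterraDecay.
Variable R : realType.
Local Notation lam := (@lam R).
Variables (alpha : R -> R) (A : R) (f : R -> R[i]) (F0 : R).
Hypothesis malpha : mfun alpha.
Hypothesis calpha : forall t, ccont_at (fun s => cR (alpha s)) t.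
Hypothesis alphaA : forall t, `|alpha t| <= A.
Hypothesis mf : cmeas f.
Hypothesis fF : forall t, cabs (f t) <= F0.
Hypothesis f0 : forall t, t <= 0 -> f t = 0.
Hypothesis cf : forall t, t != 0 -> ccont_at f t.
Hypothesis f2 : (N2 f < +oo)%E.
Hypothesis lower : forall s0, 0 < s0 -> exists2 e : R, 0 < e & forall s u, 0 < s <= s0 -> good u ->
  (e%:E * N2 (ft u) <= N2 (opy alpha s u))%E.

Let A0 : 0 <= A. Proof. by apply: le_trans (alphaA 0). Qed.
Let F00 : 0 <= F0. Proof. by apply: le_trans (cabs_ge0 _) (fF 0). Qed.
Let mca : cmeas (fun t => cR (alpha t)). Proof. meas. Qed.
Let caA t : cabs (cR (alpha t)) <= A. Proof. by rewrite cabs_cR. Qed.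
Definition bdd (g : R -> R[i]) := exists B, forall t, cabs (g t) <= B.

Lemma dsp_ft s g E : 0 < s -> cL1 lam g -> bdd g ->
  dsp s E * ft (fun t => c0 R * cconv (kex s) g t) E = ft g E.
Proof.
move=> s0 lg [B gB]; have lk := cL1_kex s0.
rewrite ftZ; last exact: cL1_conv.
rewrite (ft_conv E lk lg gB) /dsp Kz_ft mulrA mulrA mulVf ?mul1r//.
by rewrite mulf_neq0 ?c0_neq0// -Kz_ft Kz_neq0// cre_zz.
Qed.

Let flip (x y : R -> R[i]) t : cL1 lam (fun s => x s * y (t - s)) -> cL1 lam (fun r => y r * x (t - r)).
Proof.
move=> l; have [l1 _] := shift_cint t l; have [l2 _] := opp_cint l1.
apply: (eq_cL1 _ l2) => r; have -> : t - (- r + t) = r by ring.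
by rewrite mulrC [- r + t]addrC.
Qed.
Lemma N2B (x y : R -> R[i]) : cmeas x -> cmeas y ->
  (N2 (fun t => (x t - y t)%R) <= 2%:E * N2 x + 2%:E * N2 y)%E.
Proof.
move=> mx my; have m2x := cmeas_cabs2 mx; have m2y := cmeas_cabs2 my.
have q0 (z : R[i]) : 0 <= cabs2 z by [].
rewrite /N2 -(@nintZ _ _ _ lam 2 (fun E => cabs2 (x E)))// -(@nintZ _ _ _ lam 2 (fun E => cabs2 (y E)))//.
rewrite -nintD; [|side|side|side|side].
apply: le_nint => //.
- meas.
- meas.
- by move=> E; exact: cabs2B.
Qed.

Lemma N2_alpha (x : R -> R[i]) : cmeas x -> (N2 (fun t => (cR (alpha t) * x t)%R) <= (A ^+ 2)%:E * N2 x)%E.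
Proof.
move=> mx; rewrite /N2 -nintZ ?sqr_ge0//; last by meas.
apply: le_nint.
- meas.
- meas.
- pos.
move=> E; rewrite cabs2M ler_wpM2r ?cabs2_ge0// cabs2_cR -(real_normK (num_real (alpha E))).
by rewrite ler_pXn2r ?nnegrE.
Qed.

Lemma N2_eq (x y : R -> R[i]) : x =1 y -> N2 x = N2 y.
Proof. by move=> xy; apply: eq_nint => t; rewrite xy. Qed.
(** The arithmetic of the bootstrap in [weight_extension]: [U], [V], [Rr] and [G] stand for the
    squared norms of [u n], [u' n], [r n] and [g n]. The condition with [e / 2] lets the remainder
    [Rr], which is bounded in terms of [U] itself, be absorbed on the left. *)
Lemma absorb_bound (e A2 c2 D2 Rr V G U Mf Fn AR AU : R) : 0 < e -> 0 <= A2 -> 0 <= c2 -> 0 <= D2 ->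
  0 <= Fn -> 0 <= U -> 0 <= Rr ->
  (4 * A2 + 2 * e) * (c2 * D2 * (2 * (1 + A2))) <= e / 2 ->
  Mf <= Fn -> AR <= A2 * Rr -> Rr <= c2 * D2 * G -> G <= 2 * Mf + 2 * AU -> AU <= A2 * U ->
  U <= 2 * V + 2 * Rr -> e * V <= 2 * Mf + 2 * AR -> U <= (8 / e + 1) * Fn.
Proof.
move=> e0 A20 c20 D20 F0' U0 R0 sm h1 h2 h3 h4 h5 h6 h7.
have D1 : Rr <= c2 * D2 * (2 * (1 + A2)) * (Fn + U).
  apply: le_trans h3 _; rewrite -[leRHS]mulrA.
  apply: ler_wpM2l; first by pos.
  have : 0 <= A2 * Fn by pos.
  lra.
have D3 : (4 * A2 + 2 * e) * Rr <= e / 2 * (Fn + U).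
  apply: le_trans (_ : (4 * A2 + 2 * e) * (c2 * D2 * (2 * (1 + A2)) * (Fn + U)) <= _).
    by rewrite ler_wpM2l// addr_ge0// mulr_ge0// ltW.
  by rewrite mulrA ler_wpM2r// addr_ge0.
have D4 : e * U <= e * (2 * V + 2 * Rr) by rewrite ler_wpM2l// ltW.
rewrite -(ler_pM2l e0) (_ : e * ((8 / e + 1) * Fn) = 8 * Fn + e * Fn); last by field; rewrite gt_eqF.
lra.
Qed.

Section Solution.
Variables (s1 : R) (u1 : R -> R[i]).
Hypothesis s1p : 0 < s1.
Hypothesis mu1 : cmeas u1.
Hypothesis bu1 : bdd u1.
Hypothesis cu1 : forall t, ccont_at u1 t.
Hypothesis zu1 : forall t, t <= 0 -> u1 t = 0.
Hypothesis eu1 : forall t, u1 t = c0 R * cconv (kex s1) (fun r => ewt s1 r * f r - cR (alpha r) * u1 r) t.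

(** The damping is undone: [u1] solves the equation damped at rate [s1], so this is the charge
    itself, known so far only to be [O(e^(s1 t))]. *)
Definition qsol t := ewt (- s1) t * u1 t.
Local Notation q := qsol.
Let X t := f t - cR (alpha t) * q t.
Lemma cmeas_q : cmeas q. Proof. by apply: cmeasM => //; exact: cmeas_ewt. Qed.
Lemma ccont_q t : ccont_at q t.
Proof. apply: ccont_M => //; exact: ccont_ewt. Qed.
Lemma q_neg t : t <= 0 -> q t = 0. Proof. by move=> t0; rewrite /q zu1// mulr0. Qed.
Let cmeas_X : cmeas X.
Proof. by apply: cmeasB => //; apply: cmeasM => //; exact: cmeas_q. Qed.
Let ewt_q t : ewt s1 t * q t = u1 t.
Proof. by rewrite /q mulrA -ewtD subrr ewt0 mul1r. Qed.

Let ewtX t : ewt s1 t * X t = ewt s1 t * f t - cR (alpha t) * u1 t.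
Proof. by rewrite /X mulrBr mulrCA ewt_q. Qed.
Let bX : exists B, forall t, cabs (ewt s1 t * X t) <= B.
Proof.
have [B HB] := bu1; exists (F0 + A * B) => t; rewrite ewtX.
apply: le_trans (cabsB _ _) _; apply: lerD; first exact: (cabs_ewf fF f0 _ (ltW s1p)).
by rewrite cabsM ler_pM ?cabs_ge0.
Qed.

Let ewtk t s : ewt s1 t * (cR (k0 s) * X (t - s)) = kex s1 s * (ewt s1 (t - s) * X (t - s)).
Proof. by rewrite kexE -(ewtB s1 t s); ring. Qed.
Lemma cL1_kX t : cL1 lam (fun s => cR (k0 s) * X (t - s)).
Proof.
have [B HB] := bX.
have l := cL1_conv_bounded t (cL1_kex s1p) (cmeasM (cmeas_ewt s1) cmeas_X) HB.
apply: (eq_cL1 _ (cL1Z (ewt (- s1) t) l)) => s.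
by rewrite -ewtk mulrA -ewtD addNr ewt0 mul1r.
Qed.

Lemma qsol_eq t : q t = c0 R * cint lam (fun s => cR (k0 s) * X (t - s)).
Proof.
rewrite {1}/q eu1 mulrCA; congr (_ * _).
have -> : cconv (kex s1) (fun r => ewt s1 r * f r - cR (alpha r) * u1 r) t =
    ewt s1 t * cint lam (fun s => cR (k0 s) * X (t - s)).
  rewrite -cintZ; last exact: cL1_kX.
  by apply: eq_cint => s; rewrite ewtk ewtX.
by rewrite mulrA -ewtD addNr ewt0 mul1r.
Qed.

Lemma cL1_kXC t : cL1 lam (fun r => X r * cR (k0 (t - r))) /\
  cint lam (fun r => X r * cR (k0 (t - r))) = cint lam (fun s => cR (k0 s) * X (t - s)).
Proof.
have [l1 e1] := shift_cint t (cL1_kX t); have [l2 e2] := opp_cint l1.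
have E r : cR (k0 (- r + t)) * X (t - (- r + t)) = X r * cR (k0 (t - r)).
  have -> : t - (- r + t) = r by ring.
  have -> : - r + t = t - r by ring.
  exact: mulrC.
split; first exact: (eq_cL1 E l2).
by rewrite -e1 -e2; apply: eq_cint => r; rewrite E.
Qed.

Definition wq s t := ewt s t * q t.
Let wf s t := ewt s t * f t.
Lemma cmeas_wq s : cmeas (wq s).
Proof. by apply: cmeasM; [exact: cmeas_ewt|exact: cmeas_q]. Qed.
Let cmeas_wf s : cmeas (wf s). Proof. by apply: cmeasM => //; exact: cmeas_ewt. Qed.
(** The exponential is multiplicative and hence passes through the convolution, so the charge damped
    at any rate solves an equation of the same form. *)
Lemma wq_eq s t : wq s t = c0 R * cconv (kex s) (fun r => wf s r - cR (alpha r) * wq s r) t.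
Proof.
rewrite /wq qsol_eq mulrCA -cintZ; last exact: cL1_kX.
congr (_ * _); apply: eq_cint => r.
by rewrite kexE -(ewtB s t r) /X /wf; ring.
Qed.

Lemma bdd_wq_s1 : bdd (wq s1).
Proof. by have [B H] := bu1; exists B => t; rewrite /wq ewt_q. Qed.
Lemma bdd_wq_le s r : s <= r -> bdd (wq s) -> bdd (wq r).
Proof.
move=> sr [B H]; exists B => t; have [t0|t0] := leP t 0.
  by rewrite /wq q_neg// mulr0 cabs0; apply: le_trans (cabs_ge0 _) (H 0).
apply: le_trans (H t); rewrite (_ : r = (r - s) + s); last by ring.
rewrite /wq ewtD -mulrA cabsM ler_piMl ?cabs_ge0//.
by rewrite cabs_ewt_le1 ?subr_ge0// ltW.
Qed.

Lemma rexp_dom (g : R -> R[i]) (B s : R) : 0 < s -> cmeas g -> (forall t, cabs (g t) <= B * rexp s t) ->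
  cL1 lam g /\ cL2 g.
Proof.
move=> s0 mg gB; have mr := @mfun_rexp R.
have B0 : 0 <= B.
  have r0 : 0 < rexp s 1 by rewrite /rexp hv1// mul1r expR_gt0.
  by rewrite -(pmulr_lge0 _ r0); apply: le_trans (cabs_ge0 _) (gB 1).
split.
  apply: (cL1_dom (r := fun t => B * rexp s t)) => //; first exact: measurable_funM.
  rewrite nintZ//; last by move=> t; exact: rexp_ge0.
  by apply: lte_mul_pinfty => //; exact: nint_rexp_lty.
split => //; apply: (@le_lt_trans _ _ (nint lam (fun t => B ^+ 2 * rexp (2 * s) t))).
  apply: le_nint.
  - exact: cmeas_cabs2.
  - exact: measurable_funM.
  - by move=> t; exact: cabs2_ge0.
  move=> t; rewrite cabs2E; have -> : B ^+ 2 * rexp (2 * s) t = (B * rexp s t) ^+ 2.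
    rewrite exprMn /rexp exprMn (_ : hv t ^+ 2 = hv t).
      by rewrite [expR _ ^+ 2]expr2 -expRD; congr (_ * (_ * expR _)); ring.
    by rewrite /hv; case: (0 < t); rewrite ?expr1n ?expr0n.
  by rewrite ler_pXn2r ?nnegrE ?cabs_ge0// mulr_ge0// rexp_ge0.
rewrite nintZ ?sqr_ge0//; last by move=> t; exact: rexp_ge0.
apply: lte_mul_pinfty; rewrite ?lee_fin ?sqr_ge0//; apply: nint_rexp_lty; exact: mulr_gt0.
Qed.

(** The extra damping [r - s] is an integrable exponential on the half line where the charge
    lives. *)
Lemma bdd_wq_good s r : s < r -> bdd (wq s) -> good (wq r).
Proof.
move=> sr [B H]; have [l1 l2] : cL1 lam (wq r) /\ cL2 (wq r).
  apply: (rexp_dom (B := B) (s := r - s)); rewrite ?subr_gt0//; first exact: cmeas_wq.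
  move=> t; have [t0|t0] := leP t 0; first by rewrite /wq q_neg// mulr0 cabs0 /rexp hv0// mul0r mulr0.
  rewrite /rexp hv1// mul1r -cabs_ewt [wq _ _](_ : _ = ewt (r - s) t * wq s t).
    by rewrite cabsM mulrC ler_wpM2r ?cabs_ge0.
  by rewrite /wq mulrA -ewtD subrK.
split => // t _; apply: ccont_M; [exact: ccont_ewt|exact: ccont_q].
Qed.

Let lwf s : 0 < s -> cL1 lam (wf s).
Proof.
move=> s0; apply: (rexp_dom (B := F0) s0 (cmeas_wf s) _).1 => t.
have [t0|t0] := leP t 0; first by rewrite /wf f0// mulr0 cabs0 /rexp hv0// mul0r mulr0.
by rewrite /rexp hv1// mul1r -cabs_ewt /wf cabsM mulrC ler_wpM2r ?cabs_ge0.
Qed.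
Let N2_dom (g h : R -> R[i]) : cmeas g -> cmeas h -> (forall t, cabs (g t) <= cabs (h t)) -> (N2 g <= N2 h)%E.
Proof.
move=> mg mh gh; apply: le_nint; [exact: cmeas_cabs2|exact: cmeas_cabs2|by move=> t; exact: cabs2_ge0|].
by move=> t; rewrite !cabs2E ler_pXn2r ?nnegrE ?cabs_ge0.
Qed.

Let N2_wf s : 0 <= s -> (N2 (wf s) <= N2 f)%E.
Proof.
move=> s0; apply: N2_dom => // t; have [t0|t0] := leP t 0; first by rewrite /wf f0// mulr0.
by rewrite cabsM ler_piMl ?cabs_ge0// cabs_ewt_le1// ltW.
Qed.
Lemma bdd_sub (g h : R -> R[i]) : bdd g -> bdd h -> bdd (fun t => g t - h t).
Proof. by move=> [B HB] [C HC]; exists (B + C) => t; apply: le_trans (cabsB _ _) _; rewrite lerD. Qed.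
Lemma bdd_alpha (g : R -> R[i]) : bdd g -> bdd (fun t => cR (alpha t) * g t).
Proof. by move=> [B HB]; exists (A * B) => t; rewrite cabsM ler_pM ?cabs_ge0. Qed.
Let ft_sub (g h : R -> R[i]) E : cL1 lam g -> cL1 lam h ->
  ft (fun t => g t - h t) E = ft g E - ft h E.
Proof.
move=> lg lh; rewrite /ft -(cintB (cL1_expi E lg) (cL1_expi E lh)).
by apply: eq_cint => t; rewrite mulrBl.
Qed.

Let p2 : 0 < 2 * pi :> R. Proof. by rewrite mulr_gt0// pi_gt0. Qed.
(** For the damped charge, [opy s (wq s)] is the transform of the damped inhomogeneity. The lower
    bound and Parseval therefore bound it in L2 by [f], with the constant [e] of the lower bound and
    no dependence on the auxiliary rate [r]. *)
Lemma N2_wq_le s0 e s r : (forall s u, 0 < s <= s0 -> good u ->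
    (e%:E * N2 (ft u) <= N2 (opy alpha s u))%E) ->
  bdd (wq r) -> r < s -> 0 < s <= s0 -> (e%:E * N2 (wq s) <= N2 f)%E.
Proof.
move=> low br rs /andP[sp ss0]; have gu := bdd_wq_good rs br; have [l1 [mu2 l2] _] := gu.
have bs : bdd (wq s) by apply: bdd_wq_le br; exact: ltW.
have lau : cL1 lam (fun t => cR (alpha t) * wq s t) by exact: (cL1_bM l1 mca caA).
have lg : cL1 lam (fun t => wf s t - cR (alpha t) * wq s t) by apply: cL1B => //; exact: lwf.
have bg : bdd (fun t => wf s t - cR (alpha t) * wq s t).
  by apply: bdd_sub; [exists F0 => t; exact: (cabs_ewf fF f0 _ (ltW sp))|exact: bdd_alpha].
have := low s _ _ gu; rewrite sp ss0 => /(_ isT).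
have -> : N2 (opy alpha s (wq s)) = N2 (ft (wf s)).
  apply: eq_nint => E; congr cabs2; rewrite /opy.
  have -> : ft (wq s) E = ft (fun t => c0 R * cconv (kex s) (fun r => wf s r - cR (alpha r) * wq s r) t) E.
    by apply: eq_cint => t; rewrite -wq_eq.
  rewrite dsp_ft// ft_sub//; last exact: lwf.
  exact: subrK.
move=> h; have {h} := le_trans h (plancherel_le (lwf sp)).
rewrite parseval// muleCA lee_pmul2l ?lte_fin// => h.
by apply: le_trans h _; apply: N2_wf; exact: ltW.
Qed.

Lemma one_sub_expR_le (x : R) : 0 <= x -> 1 - expR (- x) <= Num.sqrt x.
Proof.
move=> x0; have [x1|x1] := leP x 1.
  have h : x <= Num.sqrt x.
    rewrite -{1}(sqr_sqrtr x0) expr2 ler_piMl ?sqrtr_ge0//.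
    by rewrite -[leRHS]sqrtr1 ler_wsqrtr.
  have := expR_ge1Dx (- x); lra.
have : 1 <= Num.sqrt x by rewrite -[leLHS]sqrtr1 ler_wsqrtr// ltW.
have := expR_gt0 (- x); lra.
Qed.

(** Since [1 - e^(- L r) <= sqrt (L r)], the difference of two damped Abel kernels has no
    singularity left at [0]. *)
Lemma kexp_split (s L r : R) : 0 < L -> kexp s r <= kexp (s + L) r + Num.sqrt L * rexp s r.
Proof.
move=> L0; have [r0|r0] := leP r 0.
  by rewrite /kexp /rexp k0_0// hv0// !mul0r mulr0 addr0.
rewrite /kexp /rexp hv1// mul1r mulrDl opprD expRD.
have : k0 r * (1 - expR (- (L * r))) <= Num.sqrt L.
  have Lr : 0 <= L * r by rewrite mulr_ge0// ltW.
  have s0 : 0 < Num.sqrt r by rewrite sqrtr_gt0.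
  by rewrite /k0 mulrC ler_pdivrMr// -sqrtrM ?(ltW L0)// one_sub_expR_le.
move=> /(ler_wpM2r (expR_ge0 (- (s * r)))); lra.
Qed.

(** The kernel is split into [kexp (s + L)], whose L1 norm is small enough to act as a contraction
    for the supremum norm, and a bounded exponential, which is paired with the L2 norm of [wq s]. *)
Lemma bdd_of_N2 s : 0 < s -> (N2 (wq s) < +oo)%E -> bdd (wq s).
Proof.
move=> sp l2; have c := cabs_ge0 (c0 R).
(* The choice of rate that gave the contraction in the Picard iteration, now as an increment added
   to [s]. *)
pose L := 4 * (cabs (c0 R) * A) ^+ 2 * @beta0 R + 1.
have Lp : 0 < L by rewrite ltr_wpDl// !mulr_ge0// ltW// beta0_gt0.
have sL : 0 < s + L by exact: addr_gt0.
have contr : cabs (c0 R) * A * kn (s + L) <= 2^-1.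
  have k0 := kn_gt0 sL.
  rewrite -ler_sqr ?nnegrE ?mulr_ge0 ?invr_ge0 ?(ltW k0)// exprMn.
  have -> : kn (s + L) ^+ 2 = @beta0 R / (s + L) by rewrite -(kn_sqr sL) mulrC mulKf// gt_eqF.
  rewrite mulrA ler_pdivrMr// /L.
  have := sqr_ge0 (cabs (c0 R) * A); have := @beta0_gt0 R; set Y := (_ * A) ^+ 2 => b0 x0.
  have -> : 2^-1 ^+ 2 * (s + (4 * Y * beta0 R + 1)) = Y * beta0 R + 4^-1 * (s + 1) by field.
  by rewrite lerDl mulr_ge0 ?invr_ge0// addr_ge0// ltW.
pose I2 := n2 (wq s).
have I2E : I2%:E = N2 (wq s) by apply: n2E; split => //; exact: cmeas_wq.
pose a := cabs (c0 R) * (kn s * F0 + A * Num.sqrt L * (2^-1 * (2 * s)^-1 + 2^-1 * I2)).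
have key t S : 0 <= S -> (forall r, r <= t -> cabs (wq s r) <= S) -> cabs (wq s t) <= a + 2^-1 * S.
  move=> S0 HS; rewrite wq_eq cabsM.
  pose rr r := F0 * kexp s r + (A * S * kexp (s + L) r +
     A * Num.sqrt L * (2^-1 * rexp (2 * s) r + 2^-1 * cabs2 (wq s (t - r)))).
  have mk (b : R) := mfun_kexp b; have mr (b : R) := mfun_rexp b.
  have mP : mfun (fun r : R => cabs2 (wq s (t - r))).
    by apply: cmeas_cabs2; apply: (cmeas_subl t); exact: cmeas_wq.
  have h0 : 0 <= 2^-1 :> R by rewrite invr_ge0.
  have aS : 0 <= A * S by exact: mulr_ge0.
  have aL : 0 <= A * Num.sqrt L by rewrite mulr_ge0// sqrtr_ge0.
  have kx (b r : R) := kexp_ge0 b r; have rx (b r : R) := rexp_ge0 b r.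
  have cx (z : R[i]) : 0 <= cabs2 z by exact: cabs2_ge0.
  have m1 : mfun (fun r : R => 2^-1 * rexp (2 * s) r + 2^-1 * cabs2 (wq s (t - r))).
    by apply: measurable_funD; exact: measurable_funM.
  have n1 r : 0 <= 2^-1 * rexp (2 * s) r + 2^-1 * cabs2 (wq s (t - r)) by rewrite addr_ge0// mulr_ge0.
  have H : cabs (cconv (kex s) (fun r => wf s r - cR (alpha r) * wq s r) t) <=
      kn s * F0 + (A * kn (s + L) * S + A * Num.sqrt L * (2^-1 * (2 * s)^-1 + 2^-1 * I2)).
    apply: (cabs_cint_le (r := rr)).
    - apply: cmeasM; first exact: cmeas_kex.
      apply: (@cmeas_subl R (fun r => wf s r - cR (alpha r) * wq s r)).
      by apply: cmeasB => //; apply: cmeasM => //; exact: cmeas_wq.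
    - apply: measurable_funD; first exact: measurable_funM.
      by apply: measurable_funD; exact: measurable_funM.
    - move=> r; rewrite cabsM cabs_cRp//; have [r0|r0] := leP r 0.
        have -> : kexp s r = 0 by rewrite /kexp k0_0 ?mul0r.
        rewrite mul0r; apply: addr_ge0; first exact: mulr_ge0.
        by apply: addr_ge0; exact: mulr_ge0.
      have b1 : cabs (wf s (t - r) - cR (alpha (t - r)) * wq s (t - r)) <= F0 + A * cabs (wq s (t - r)).
        apply: le_trans (cabsB _ _) _; apply: lerD; first exact: (cabs_ewf fF f0 _ (ltW sp)).
        by rewrite cabsM ler_wpM2r ?cabs_ge0.
      apply: le_trans (ler_wpM2l (kx _ _) b1) _.
      have PS : cabs (wq s (t - r)) <= S by apply: HS; rewrite gerBl ltW.
      rewrite mulrDr /rr mulrC lerD2l mulrCA.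
      have h2 := kexp_split s r Lp.
      apply: (@le_trans _ _ (A * ((kexp (s + L) r + Num.sqrt L * rexp s r) * cabs (wq s (t - r))))).
        by rewrite ler_wpM2l// ler_wpM2r ?cabs_ge0.
      rewrite mulrDl mulrDr; apply: lerD.
        by rewrite -mulrA ler_wpM2l// mulrC ler_wpM2r.
      rewrite (_ : A * (Num.sqrt L * rexp s r * cabs (wq s (t - r))) =
        A * Num.sqrt L * (rexp s r * cabs (wq s (t - r)))); last by ring.
      apply: ler_wpM2l => //.
      have -> : rexp (2 * s) r = rexp s r ^+ 2.
        by rewrite /rexp hv1// !mul1r expr2 -expRD; congr expR; ring.
      rewrite cabs2E; have := sqr_ge0 (rexp s r - cabs (wq s (t - r))); nra.
    rewrite nintD; [|side|side|side|side].
    rewrite nintD; [|side|side|side|side].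
    rewrite (nintZ lam F00)// (nintZ lam aS)// (nintZ lam aL)// nintD; [|side|side|side|side].
    rewrite !(nintZ lam h0)// nint_rexp ?mulr_gt0// -(knE sp) -(knE sL).
    have -> : nint lam (fun r : R => cabs2 (wq s (t - r))) = I2%:E.
      rewrite I2E /N2 -[RHS](nint_opp (f := fun r => cabs2 (wq s r))); first last.
      + by move=> r; exact: cx.
      + by apply: cmeas_cabs2; exact: cmeas_wq.
      rewrite -[RHS](@nint_shift _ (fun r => cabs2 (wq s (- r))) (- t)); first last.
      + by move=> r; exact: cx.
      + by apply: cmeas_cabs2; apply: (cmeas_comp (cmeas_wq s)).
      by apply: eq_nint => r; rewrite opprD opprK addrC.
    rewrite -!(EFinM, EFinD) lee_fin le_eqVlt; apply/orP; left; apply/eqP; ring.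
  apply: le_trans (ler_wpM2l c H) _; rewrite /a.
  have : cabs (c0 R) * A * kn (s + L) * S <= 2^-1 * S by rewrite ler_wpM2r.
  have -> : cabs (c0 R) * (kn s * F0 + (A * kn (s + L) * S + A * Num.sqrt L * (2^-1 / (2 * s) + 2^-1 * I2))) =
    cabs (c0 R) * (kn s * F0 + A * Num.sqrt L * (2^-1 / (2 * s) + 2^-1 * I2)) + cabs (c0 R) * A * kn (s + L) * S.
    by ring.
  by rewrite lerD2l.
have [B HB] := bdd_wq_s1.
have B0 : 0 <= B by apply: le_trans (cabs_ge0 _) (HB 0).
exists (2 * a) => t.
(* The supremum over the past of [t] is finite, by the exponential bound on the charge, so
   [sup S <= a + sup S / 2] can be solved; the resulting bound [2 a] does not depend on [t]. *)
pose S := [set cabs (wq s r) | r in [set r | r <= t]].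
have loc r : r <= t -> cabs (wq s r) <= expR ((s1 + s) * `|t|) * B.
  move=> rt; have [r0|r0] := leP r 0.
    by rewrite /wq q_neg// mulr0 cabs0 mulr_ge0 ?expR_ge0.
  rewrite (_ : wq s r = ewt (s - s1) r * wq s1 r); last by rewrite /wq mulrA -ewtD subrK.
  rewrite cabsM ler_pM ?cabs_ge0// cabs_ewt ler_expR.
  have rt' : r <= `|t| by apply: le_trans (ler_norm t).
  have : 0 <= s * r by rewrite mulr_ge0// ltW.
  have : 0 <= s * `|t| by rewrite mulr_ge0// ltW.
  have : s1 * r <= s1 * `|t| by rewrite ler_wpM2l// ltW.
  lra.
have hS : has_sup S.
  split; first by exists (cabs (wq s t)), t => //=.
  by exists (expR ((s1 + s) * `|t|) * B) => _ [r /= rt <-]; exact: loc.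
have up r : r <= t -> cabs (wq s r) <= sup S.
  by move=> rt; apply: ub_le_sup; [case: hS|exists r].
have S0 : 0 <= sup S by apply: le_trans (cabs_ge0 _) (up t (lexx t)).
have : sup S <= a + 2^-1 * sup S.
  apply: ge_sup; first by case: hS.
  by move=> _ [r /= rt <-]; apply: key => // r' rr'; apply: up; exact: le_trans rt.
have := up t (lexx t); lra.
Qed.

(** For [0 <= y <= x] one has [(x - y)^2 <= x^2 - y^2], and the squares of [kn] are explicit. *)
Let kn_diff a b : 0 < a -> a <= b -> 0 <= kn a - kn b /\ (kn a - kn b) ^+ 2 <= @beta0 R * (b - a) / (a * b).
Proof.
move=> ap ab; have bp : 0 < b by apply: lt_le_trans ab.
have ka := kn_gt0 ap; have kb := kn_gt0 bp; have b0 := @beta0_gt0 R.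
have ea : kn a ^+ 2 = @beta0 R / a by rewrite -(kn_sqr ap) mulrC mulKf// gt_eqF.
have eb : kn b ^+ 2 = @beta0 R / b by rewrite -(kn_sqr bp) mulrC mulKf// gt_eqF.
have kba : kn b <= kn a.
  have h : kn b ^+ 2 <= kn a ^+ 2.
    rewrite ea eb; apply: ler_wpM2l; first exact: ltW.
    by rewrite lef_pV2 ?posrE.
  by move: ka kb h; move: (kn a) (kn b) => x y x0 y0; rewrite ler_sqr// nnegrE ltW.
split; first by rewrite subr_ge0.
have -> : @beta0 R * (b - a) / (a * b) = kn a ^+ 2 - kn b ^+ 2.
  by rewrite ea eb; field; rewrite !gt_eqF.
move: ka kb kba; move: (kn a) (kn b) => x y x0 y0 xy.
rewrite -subr_ge0 (_ : _ - _ = 2 * (y * (x - y))); last by ring.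
by rewrite mulr_ge0// mulr_ge0 ?(ltW y0)// subr_ge0.
Qed.

(** A weight [m] that is not an exponential does not commute with the convolution. The slow
    variation of [nn] bounds [m x - m y * e^(- s (x - y))] by [m y * (e^(- s (x - y)) - e^(- s' (x -
    y)))], so the error kernel is dominated by the difference of two Abel kernels, of mass
    [kn s - kn s' <= D], and the Schur test applies. *)
Lemma perturbed_kernel (s s' D : R) (nn : R -> R) : 0 < s -> s <= s' -> 0 < D ->
  kn s - kn s' <= D -> mfun nn -> (forall t, 0 < nn t) ->
  (forall t x, x <= t -> nn t <= nn x /\ nn x * expR (- ((s' - s) * (t - x))) <= nn t) ->
  bdd (fun t => cR (nn t) * ewt s t * X t) ->
  (N2 (fun t => (cR (nn t) * ewt s t * q t - c0 R * cconv (kex s) (fun t => cR (nn t) * ewt s t * X t) t)%R) <=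
    ((cabs (c0 R) * D) ^+ 2)%:E * N2 (fun t => (cR (nn t) * ewt s t * X t)%R))%E.
Proof.
move=> sp ss' Dp kD mnn nn0 nnr bg; have c := cabs_ge0 (c0 R).
have s'p : 0 < s' by apply: lt_le_trans ss'.
set m := fun t => cR (nn t) * ewt s t; set g := fun t => m t * X t.
have mm : cmeas m by apply: cmeasM; [exact: cmeas_cR|exact: cmeas_ewt].
have mg : cmeas g by exact: cmeasM.
pose a (z : R * R) := cabs (c0 R) * (kexp s (z.1 - z.2) - kexp s' (z.1 - z.2)).
have kss x : kexp s' x <= kexp s x.
  have [x0|x0] := leP x 0; first by rewrite /kexp k0_0// !mul0r.
  by rewrite /kexp ler_wpM2l ?k0_ge0// ler_expR lerN2 ler_wpM2r// ltW.
have ma : mfun a.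
  have h b : mfun (fun z : R * R => kexp b (z.1 - z.2)).
    by apply: (measurableT_comp (mfun_kexp b)); exact: mfun_subr_pair.
  by apply: measurable_funM => //; exact: measurable_funB.
have a0 z : 0 <= a z by rewrite mulr_ge0// subr_ge0.
have mdk : mfun (fun x => kexp s x - kexp s' x).
  by apply: measurable_funB; exact: mfun_kexp.
have Ik : (nint lam (fun x => (kexp s x - kexp s' x)%R) <= D%:E)%E.
  have : (nint lam (fun x => (kexp s x - kexp s' x)%R) + (kn s')%:E = (kn s)%:E)%E.
    rewrite (knE s'p) (knE sp) -nintD; first by apply: eq_nint => x; rewrite subrK.
    - exact: mdk.
    - exact: mfun_kexp.
    - by move=> x; rewrite subr_ge0.
    - by move=> x; exact: kexp_ge0.
  case: (nint _ _) => // x; rewrite -EFinD lee_fin => -[] h; by apply: le_trans kD; rewrite -h addrK.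
have cp : 0 < cabs (c0 R) by rewrite lt_def cabs_eq0 c0_neq0 cabs_ge0.
have cD : 0 < cabs (c0 R) * D by rewrite mulr_gt0.
pose F (z : R * R) := c0 R * (cR (k0 (z.1 - z.2)) * (m z.1 - m z.2 * ewt s (z.1 - z.2)) * X z.2).
have rE t : m t * q t - c0 R * cconv (kex s) g t = cint lam (fun x => F (t, x)).
  have [l1 e1] := cL1_kXC t.
  have [B' H'] := bg.
  have l2 := flip (cL1_conv_bounded t (cL1_kex sp) mg H').
  have e2 := convC_bounded t (cL1_kex sp) mg H'.
  have lm := cL1Z (m t) l1.
  rewrite (qsol_eq t) -e1 e2 mulrCA -mulrBr -(cintZ _ l1) -(cintB lm l2) -(cintZ _ (cL1B lm l2)).
  by apply: eq_cint => x; rewrite /F /= /g kexE; ring.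
have mF : cmeas F.
  apply: cmeasM; first exact: cmeas_cst.
  apply: cmeasM; last exact: (cmeas_comp cmeas_X).
  apply: cmeasM.
    by apply: cmeas_cR; apply: (measurableT_comp (@mfun_k0 R)); exact: mfun_subr_pair.
  apply: cmeasB; first exact: (cmeas_comp mm).
  apply: cmeasM; first exact: (cmeas_comp mm).
  by apply: (cmeas_comp (cmeas_ewt s)); exact: mfun_subr_pair.
have bF x y : cabs (F (x, y)) <= a (x, y) * cabs (g y).
  rewrite /F /a /=; have [xy|yx] := leP x y.
    rewrite k0_0 ?subr_le0// cR0 !mul0r mulr0 cabs0 mulr_ge0 ?cabs_ge0//; exact: (a0 (x, y)).
  have [n1 n2] := nnr x y (ltW yx).
  have -> : m x - m y * ewt s (x - y) = cR (nn x - nn y) * ewt s x.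
    by rewrite /m -(ewtB s x y) cRB; ring.
  have -> : cabs (g y) = nn y * expR (- (s * y)) * cabs (X y).
    by rewrite /g /m !cabsM cabs_ewt cabs_cRp// ltW.
  rewrite (cabsM (c0 R)) !(cabsM _ (X y)) (cabsM (cR (k0 _))) (cabsM _ (ewt s x)) cabs_ewt.
  rewrite (cabs_cRp (k0_ge0 _)) cabs_cR ler0_norm ?subr_le0//.
  rewrite /kexp -mulrBr.
  have -> : expR (- (s' * (x - y))) = expR (- (s * (x - y))) * expR (- ((s' - s) * (x - y))).
    by rewrite -expRD; congr expR; ring.
  have -> : expR (- (s * x)) = expR (- (s * (x - y))) * expR (- (s * y)).
    by rewrite -expRD; congr expR; ring.
  move: n2; set E1 := expR (- (s * (x - y))); set E2 := expR (- (s * y)); set E3 := expR (- ((s' - s) * _)) => n2.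
  have -> : cabs (c0 R) * (k0 (x - y) * (E1 - E1 * E3)) * (nn y * E2 * cabs (X y)) =
    cabs (c0 R) * (k0 (x - y) * ((nn y - nn y * E3) * (E1 * E2)) * cabs (X y)) by ring.
  rewrite ler_wpM2l// ler_wpM2r ?cabs_ge0// ler_wpM2l ?k0_ge0// ler_wpM2r ?mulr_ge0 ?expR_ge0//.
  by rewrite opprB lerD2l lerN2.
have I1 t : (nint lam (fun y => a (t, y)) <= (cabs (c0 R) * D)%:E)%E.
  rewrite /a /= (@nintZ _ _ _ lam (cabs (c0 R)))//; first last.
  - by move=> x; rewrite subr_ge0.
  - by apply: (measurableT_comp mdk); apply: measurable_funB.
  rewrite EFinM; apply: lee_wpmul2l; first by rewrite lee_fin.
  apply: le_trans Ik.
  rewrite -[leRHS](nint_opp mdk); last by move=> x; rewrite subr_ge0.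
  rewrite -[leRHS](@nint_shift _ (fun x => kexp s (- x) - kexp s' (- x)) (- t)); first last.
  - by move=> x; rewrite subr_ge0.
  - by apply: (measurableT_comp mdk).
  by apply: le_of_eq; apply: eq_nint => x; rewrite opprB.
have I2 t : (nint lam (fun y => a (y, t)) <= (cabs (c0 R) * D)%:E)%E.
  rewrite /a /= (@nintZ _ _ _ lam (cabs (c0 R)))//; first last.
  - by move=> x; rewrite subr_ge0.
  - by apply: (measurableT_comp mdk); apply: measurable_funB.
  rewrite EFinM; apply: lee_wpmul2l; first by rewrite lee_fin.
  apply: le_trans Ik.
  by rewrite -[leRHS](@nint_shift _ (fun x => kexp s x - kexp s' x) (- t))// => x; rewrite subr_ge0.
have h := @schur_test R _ _ R R lam lam F a (fun x => cabs (g x)) _ _ mF ma (cmeas_cabs mg) a0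
    (fun x => cabs_ge0 _) bF cD (ltW cD) I1 I2.
rewrite expr2 (_ : N2 g = nint lam (fun y => cabs (g y) ^+ 2)); last by apply: eq_nint => t; rewrite cabs2E.
by apply: le_trans h; rewrite (N2_eq rE).
Qed.

(* Replacing the weight e^{-st} by m = e^{-st} / (1 + k e^{2dt}) perturbs the
   convolution equation by a kernel of small L1 norm, so the lower bound still
   controls m * qsol, uniformly in k. *)
Lemma weight_extension (st : R) : 0 < st -> (forall r, st < r -> bdd (wq r)) ->
  exists2 s, 0 < s < st & bdd (wq s).
Proof.
move=> stp Hst; have D0' := @beta0_gt0 R; have c := cabs_ge0 (c0 R).
have [e e0 low] := lower stp.
pose C := (4 * A ^+ 2 + 2 * e) * (2 * cabs (c0 R) ^+ 2 * (1 + A ^+ 2) * (4 * @beta0 R / st ^+ 2)).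
have a2 := sqr_ge0 A; have c2 := sqr_ge0 (cabs (c0 R)).
have C0 : 0 <= C.
  rewrite mulr_ge0 ?addr_ge0 ?mulr_ge0 ?(ltW e0) ?addr_ge0 ?invr_ge0 ?sqr_ge0 ?(ltW D0')//.
(* [d <= st / 2] keeps the new rate [st - d] positive, and [C * d <= e / 2] is the smallness asked
   for in [absorb_bound]. *)
pose d := Num.min (st / 2) (e / 2 / (C + 1)).
have d0 : 0 < d by rewrite lt_min !divr_gt0// ltr_wpDl.
have dst : d <= st / 2 by rewrite ge_min lexx.
have dC : C * d <= e / 2.
  apply: (@le_trans _ _ ((C + 1) * (e / 2 / (C + 1)))).
    rewrite ler_pM ?(ltW d0)//; first by rewrite lerDl.
    by rewrite ge_min lexx orbT.
  by rewrite mulrC divfK// gt_eqF// ltr_wpDl.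
pose s := st - d; pose s' := st + d.
have sp : 0 < s by rewrite /s; lra.
have ss' : s <= s' by rewrite /s /s'; lra.
have s'p : 0 < s' by apply: lt_le_trans ss'.
exists s; first by rewrite sp /s gtrBl.
apply: bdd_of_N2 => //.
have [kd0 kd2] := kn_diff sp ss'.
(* The value comes from [kn_diff] with [s' - s = 2 d], as [s * s' = st^2 - d^2] is at least
   [st^2 / 2]. *)
pose D := Num.sqrt (4 * @beta0 R * d / st ^+ 2).
have D2 : D ^+ 2 = 4 * @beta0 R * d / st ^+ 2.
  by rewrite sqr_sqrtr// divr_ge0 ?sqr_ge0// !mulr_ge0// ?(ltW d0)// ltW.
have Dp : 0 < D by rewrite sqrtr_gt0 divr_gt0 ?exprn_gt0// !mulr_gt0.
have kD : kn s - kn s' <= D.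
  rewrite -ler_sqr ?nnegrE ?(ltW Dp)//; apply: le_trans kd2 _; rewrite D2.
  have -> : s' - s = 2 * d by rewrite /s /s'; ring.
  have -> : 4 * @beta0 R * d / st ^+ 2 = @beta0 R * (2 * d) * (2 / st ^+ 2) by field; rewrite gt_eqF.
  apply: ler_wpM2l; first by rewrite !mulr_ge0// ltW.
  rewrite ler_pdivlMr ?exprn_gt0// mulrC ler_pdivrMr ?mulr_gt0//.
  have -> : s * s' = st ^+ 2 - d ^+ 2 by rewrite /s /s'; ring.
  have : d ^+ 2 <= (st / 2) ^+ 2 by rewrite ler_pXn2r ?nnegrE ?(ltW d0)// divr_ge0// ltW.
  rewrite expr_div_n; have := sqr_ge0 st; lra.
pose k (n : nat) := epsn R n.
have kp n : 0 < k n by exact: epsn_gt0.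
(* This factor is at most [1] and at most [e^(- 2 d t) / k n]. Thus [m n] stays below [e^(- s t)]
   and decays like [e^(- s' t)], a rate at which the charge is already under control. *)
pose nn n t := (1 + k n * expR (2 * d * t))^-1.
have den n t : 0 < 1 + k n * expR (2 * d * t) by rewrite addr_gt0// mulr_gt0// expR_gt0.
have nn0 n t : 0 < nn n t by rewrite invr_gt0.
have nn1 n t : nn n t <= 1 by rewrite invf_le1// lerDl mulr_ge0 ?expR_ge0// ltW.
have nnk n t : nn n t <= (k n)^-1 * expR (- (2 * d * t)).
  rewrite expRN -invfM lef_pV2 ?posrE ?mulr_gt0 ?expR_gt0//; by rewrite lerDr.
have nnr n t r : r <= t -> nn n t <= nn n r /\ nn n r * expR (- (2 * d * (t - r))) <= nn n t.
  move=> rt; split.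
    rewrite lef_pV2 ?posrE// lerD2l ler_wpM2l ?(ltW (kp n))// ler_expR ler_wpM2l//.
    by rewrite mulr_ge0// ltW.
  rewrite expRN -invfM lef_pV2 ?posrE ?mulr_gt0 ?expR_gt0//.
  have -> : expR (2 * d * t) = expR (2 * d * r) * expR (2 * d * (t - r)).
    by rewrite -expRD; congr expR; ring.
  rewrite [leRHS]mulrDl mul1r [k n * _]mulrA.
  by rewrite lerD2r -expR0 ler_expR mulr_ge0 ?subr_ge0// mulr_ge0// ltW.
pose m n t := cR (nn n t) * ewt s t.
have mnn n : mfun (nn n).
  apply: mfun_invr_ge0 => [|x]; last exact: ltW.
  apply: measurable_funD => //; apply: measurable_funM => //.
  by apply: measurableT_comp => //; exact: measurable_funM.
have mm n : cmeas (m n) by apply: cmeasM; [exact: cmeas_cR|exact: cmeas_ewt].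
have cm n t : ccont_at (m n) t.
  apply: ccont_M; last exact: ccont_ewt.
  apply: ccont_seq => r rt; apply: ccvg_cR; apply: cvgV; first by rewrite gt_eqF.
  apply: cvgD; first exact: cvg_cst.
  apply: cvgM; first exact: cvg_cst.
  have h : 2 * d * r n0 @[n0 --> \oo] --> 2 * d * t by apply: cvgM => //; exact: cvg_cst.
  exact: (cvg_comp _ _ h (@continuous_expR R _)).
pose u n t := m n t * q t.
have mu n : cmeas (u n) by apply: cmeasM => //; exact: cmeas_q.
have uk n t : cabs (u n t) <= cabs (cR (k n)^-1 * wq s' t).
  have -> : cabs (u n t) = nn n t * expR (- (s * t)) * cabs (q t).
    by rewrite /u /m !cabsM cabs_ewt cabs_cRp// ltW.
  have -> : cabs (cR (k n)^-1 * wq s' t) = (k n)^-1 * expR (- (s' * t)) * cabs (q t).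
    by rewrite cabsM /wq cabsM cabs_ewt cabs_cRp ?mulrA// invr_ge0 ltW.
  rewrite ler_wpM2r ?cabs_ge0//; apply: le_trans (ler_wpM2r (expR_ge0 _) (nnk n t)) _.
  by rewrite (_ : - (s' * t) = - (2 * d * t) + - (s * t)) ?expRD ?mulrA// /s /s'; ring.
have [B HB] : bdd (wq s') by apply: Hst; rewrite /s' ltrDl.
have gs' : good (wq s').
  apply: (@bdd_wq_good (st + d / 2)); first by rewrite /s' ltrD2l ltr_pdivrMr// ltr_pMr// ltr1n.
  by apply: Hst; rewrite ltrDl divr_gt0.
have bu n : bdd (u n).
  exists ((k n)^-1 * B) => t; apply: le_trans (uk n t) _.
  rewrite cabsM cabs_cRp ?invr_ge0 ?(ltW (kp n))// ler_wpM2l ?invr_ge0 ?(ltW (kp n))//.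
have lu n : cL1 lam (u n).
  have [l _ _] := gs'.
  apply: (cL1_dom (r := fun t => cabs (cR (k n)^-1 * wq s' t))) => //.
    by apply: cmeas_cabs; apply: cmeasM; [exact: cmeas_cst|exact: cmeas_wq].
  by case: (cL1Z (cR (k n)^-1) l).
have l2u n : cL2 (u n).
  have [_ l _] := gs'; split => //.
  have [[mh lh] _] := cL2_Mb l (cmeas_cst (cR (k n)^-1)) (fun=> lexx _).
  by apply: le_lt_trans lh; exact: N2_dom.
pose g n t := m n t * X t.
have gE n t : g n t = m n t * f t - cR (alpha t) * u n t by rewrite /g /X /u; ring.
pose mf' n t := m n t * f t.
have mmf n : cmeas (mf' n) by exact: cmeasM.
have mfw n t : cabs (mf' n t) <= cabs (wf s t).
  rewrite /mf' /m -mulrA cabsM ler_piMl ?cabs_ge0// cabs_cRp//; exact: ltW.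
have lmf n : cL1 lam (mf' n).
  apply: (cL1_dom (r := fun t => cabs (wf s t))) => //; first exact: cmeas_cabs.
  by case: (lwf sp).
have N2mf n : (N2 (mf' n) <= N2 f)%E.
  by apply: le_trans (N2_dom (mmf n) (cmeas_wf s) (mfw n)) _; apply: N2_wf; exact: ltW.
have bmf n : bdd (mf' n).
  exists F0 => t; apply: le_trans (mfw n t) _; exact: (cabs_ewf fF f0 _ (ltW sp)).
have lau n : cL1 lam (fun t => cR (alpha t) * u n t) by exact: (cL1_bM (lu n) mca caA).
have bg n : bdd (g n).
  have [B' H'] := bdd_sub (bmf n) (bdd_alpha (bu n)).
  by exists B' => t; rewrite gE; exact: H'.
have lg n : cL1 lam (g n).
  by apply: (eq_cL1 (fun t => esym (gE n t)) (cL1B (lmf n) (lau n))).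
have mg n : cmeas (g n) by case: (lg n).
pose u' n t := c0 R * cconv (kex s) (g n) t.
have mu' n : cmeas (u' n).
  by apply: cmeasM; [exact: cmeas_cst|apply: cmeas_conv => //; exact: cmeas_kex].
have lu' n : cL1 lam (u' n) by apply: cL1Z; apply: cL1_conv => //; exact: cL1_kex.
have cg n t : t != 0 -> ccont_at (g n) t.
  move=> t0; apply: ccont_M; first exact: cm.
  apply: ccont_seq => r rt; apply: ccvgB; first exact: ccont_seqP (cf t0) rt.
  by apply: ccvgM; [exact: ccont_seqP (calpha t) rt|exact: ccont_seqP (ccont_q t) rt].
have cu' n t : ccont_at (u' n) t.
  apply: ccont_M; first exact: ccont_cst.
  have [B' H'] := bg n; apply: (cconv_continuous (cL1_kex sp) (mg n) H'); exact: cg.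
pose r n t := u n t - u' n t.
have mr n : cmeas (r n) by exact: cmeasB.
have Sr n : (N2 (r n) <= ((cabs (c0 R) * D) ^+ 2)%:E * N2 (g n))%E.
  have ds : s' - s = 2 * d by rewrite /s /s'; ring.
  apply: (perturbed_kernel sp ss' Dp kD (mnn n) (nn0 n) _ (bg n)) => t x xt; rewrite ds; exact: nnr.
have fin2 (x y : \bar R) : (x < +oo)%E -> (y < +oo)%E -> (2%:E * x + 2%:E * y < +oo)%E.
  by move=> hx hy; apply: lte_add_pinfty; exact: lte_mul_pinfty.
have l2f : cL2 f by [].
have Fin n : [/\ cL2 (g n), cL2 (r n) & cL2 (u' n)].
  have lg2 : cL2 (g n).
    split=> //; apply: le_lt_trans (_ : N2 (fun t => (mf' n t - cR (alpha t) * u n t)%R) < +oo)%E.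
      by apply: le_of_eq; apply: eq_nint => t; rewrite gE.
    apply: le_lt_trans (N2B (mmf n) (cmeasM mca (mu n))) _; apply: fin2.
      by apply: le_lt_trans (N2mf n) _.
    apply: le_lt_trans (N2_alpha (mu n)) _; apply: lte_mul_pinfty; rewrite ?lee_fin//.
    by case: (l2u n).
  have lr2 : cL2 (r n).
    split=> //; apply: le_lt_trans (Sr n) _; apply: lte_mul_pinfty; rewrite ?lee_fin ?sqr_ge0//.
    by case: lg2.
  split => //; split => //.
  apply: le_lt_trans (_ : N2 (fun t => (u n t - r n t)%R) < +oo)%E.
    by apply: le_of_eq; apply: eq_nint => t; rewrite /r subKr.
  by apply: le_lt_trans (N2B (mu n) (mr n)) _; apply: fin2; [case: (l2u n)|case: lr2].
have bound n : (N2 (u n) <= ((8 / e + 1) * n2 f)%:E)%E.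
  have [lg2 lr2 lu2] := Fin n.
  have gu : good (u' n) by split => // t _; exact: cu'.
  have lau' : cL1 lam (fun t => cR (alpha t) * u' n t) by exact: (cL1_bM (lu' n) mca caA).
  have lr : cL1 lam (r n) by exact: cL1B.
  have lar : cL1 lam (fun t => cR (alpha t) * r n t) by exact: (cL1_bM lr mca caA).
  have sst : 0 < s <= st by rewrite sp /s gerBl ltW.
  have := low s (u' n) sst gu.
  have -> : N2 (opy alpha s (u' n)) = N2 (ft (fun t => mf' n t - cR (alpha t) * r n t)).
    apply: eq_nint => E; congr cabs2; rewrite /opy dsp_ft//.
    rewrite [RHS]ft_sub//.
    have -> : ft (g n) E = ft (mf' n) E - ft (fun t => cR (alpha t) * u n t) E.
      by rewrite -ft_sub//; apply: eq_cint => t; rewrite gE.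
    have -> : ft (fun t => cR (alpha t) * r n t) E =
        ft (fun t => cR (alpha t) * u n t) E - ft (fun t => cR (alpha t) * u' n t) E.
      by rewrite -ft_sub//; apply: eq_cint => t; rewrite /r mulrBr.
    by rewrite opprB addrA addrAC.
  have lmr : cL1 lam (fun t => mf' n t - cR (alpha t) * r n t) by exact: cL1B.
  move=> h; have {h} := le_trans h (plancherel_le lmr).
  rewrite parseval// muleCA lee_pmul2l ?lte_fin// => h.
  have {h} := le_trans h (N2B (mmf n) (cmeasM mca (mr n))).
  have h1 := N2mf n; have h2 := N2_alpha (mr n); have h3 := Sr n.
  have h4 : (N2 (g n) <= 2%:E * N2 (mf' n) + 2%:E * N2 (fun t => (cR (alpha t) * u n t)%R))%E.
    apply: le_trans (N2B (mmf n) (cmeasM mca (mu n))).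
    by apply: le_of_eq; apply: eq_nint => t; rewrite gE.
  have h5 := N2_alpha (mu n).
  have h6 : (N2 (u n) <= 2%:E * N2 (u' n) + 2%:E * N2 (r n))%E.
    apply: le_trans (_ : N2 (fun t => (u' n t - (- r n t))%R) <= _)%E.
      by apply: le_of_eq; apply: eq_nint => t; rewrite /r opprK addrC subrK.
    apply: le_trans (N2B (mu' n) (cmeasN (mr n))) _.
    rewrite leeD2l// lee_wpmul2l// le_eqVlt; apply/orP; left; apply/eqP.
    by apply: eq_nint => t; rewrite cabs2N.
  have l2mf : cL2 (mf' n) by split=> //; apply: le_lt_trans h1 _.
  have l2ar := (cL2_Mb lr2 mca caA).1; have l2au := (cL2_Mb (l2u n) mca caA).1.
  move: h1 h2 h3 h4 h5 h6.
  rewrite -(n2E lr2) -(n2E lu2) -(n2E lg2) -(n2E (l2u n)) -(n2E l2mf) -(n2E l2f) -(n2E l2ar) -(n2E l2au).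
  rewrite -!(EFinM, EFinD) !lee_fin => h1 h2 h3 h4 h5 h6 h7.
  apply: (absorb_bound e0 a2 c2 (sqr_ge0 D) (n2_ge0 _) (n2_ge0 _) (n2_ge0 (r n)) _ h1 h2 _ h4 h5 h6 h7).
    by apply: le_trans dC; rewrite D2 le_eqVlt; apply/orP; left; apply/eqP; rewrite /C; field; rewrite gt_eqF.
  by rewrite -exprMn.
apply: (@le_lt_trans _ _ ((8 / e + 1) * n2 f)%:E); last exact: ltry.
apply: (@nint_fatou _ _ _ lam (fun n t => cabs2 (u n t))) => //.
- by move=> n; exact: cmeas_cabs2.
move=> t; apply: ccvg_cabs2; rewrite /u /m /wq; apply: ccvgM; last exact: ccvg_cst.
rewrite -[X in ccvg_seq _ X]mul1r -cR1; apply: ccvgM; last exact: ccvg_cst.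
apply: ccvg_cR; rewrite -[X in _ --> X]invr1; apply: cvgV; first exact: oner_neq0.
rewrite -[X in _ --> X]addr0; apply: cvgD; first exact: cvg_cst.
rewrite -[X in _ --> X](mul0r (expR (2 * d * t))); apply: cvgM; [exact: epsn_cvg|exact: cvg_cst].
Qed.

(** The rates at which the damped charge is bounded form an upward closed set, and
    [weight_extension] goes below any positive infimum. *)
Lemma bdd_wq_all s : 0 < s -> bdd (wq s).
Proof.
pose S := [set s | 0 < s /\ bdd (wq s)].
have Ss1 : S s1 by split => //; exact: bdd_wq_s1.
have hS : has_inf S by split; [exists s1|exists 0 => r [/ltW]].
have inf0 : inf S <= 0.
  rewrite leNgt; apply/negP => ip.
  have H r : inf S < r -> bdd (wq r).
    move=> ir; have ri : 0 < r - inf S by rewrite subr_gt0.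
    have [x [x0 bx]] := inf_adherent ri hS; rewrite addrC subrK => xr.
    exact: bdd_wq_le (ltW xr) bx.
  have [r /andP[r0 ri] br] := weight_extension ip H.
  have : inf S <= r by apply: ge_inf; [case: hS|split].
  by rewrite leNgt ri.
move=> s0; have [x [x0 bx]] := inf_adherent s0 hS => xs.
by apply: bdd_wq_le bx; apply: ltW; apply: lt_le_trans xs _; rewrite gerDr.
Qed.

(** The bound of [N2_wq_le] holds with one constant for all rates in []0, 1]], so Fatou lets the
    damping go to zero. *)
Lemma N2_qsol_lty : (N2 q < +oo)%E.
Proof.
have [e e0 low] := lower (@ltr01 R).
apply: (@le_lt_trans _ _ (e^-1%:E * N2 f)%E); last first.
  by apply: lte_mul_pinfty; rewrite ?lee_fin ?invr_ge0 ?(ltW e0).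
apply: (@nint_fatou _ _ _ lam (fun n t => cabs2 (wq (epsn R n) t))) => //.
- by move=> n; apply: cmeas_cabs2; exact: cmeas_wq.
- move=> t; apply: ccvg_cabs2; rewrite -[X in ccvg_seq _ X]mul1r; apply: ccvgM; last exact: ccvg_cst.
  rewrite -cR1 -[X in cR X](@expR0 R); apply: ccvg_cR.
  have h : - (epsn R n * t) @[n --> \oo] --> (0 : R).
    by rewrite -[X in _ --> X]oppr0 -(mul0r t); apply: cvgN; apply: cvgM; [exact: epsn_cvg|exact: cvg_cst].
  exact: (cvg_comp _ _ h (@continuous_expR R _)).
move=> n; have en := epsn_gt0 R n.
have e2 : 0 < epsn R n / 2 by rewrite divr_gt0.
have lt2 : epsn R n / 2 < epsn R n by lra.
have le1 : 0 < epsn R n <= 1 by rewrite en invf_le1// ler1n.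
have h := N2_wq_le low (bdd_wq_all e2) lt2 le1.
rewrite -(@lee_pmul2l _ e%:E)// ?lte_fin// muleA -EFinM divff ?gt_eqF// mul1e.
exact: h.
Qed.
End Solution.

Theorem volterra_solution : exists q : R -> R[i], [/\ cL2 q, (forall t, ccont_at q t),
  (forall t, t <= 0 -> q t = 0) & forall t,
  q t + c0 R * cint lam (fun r => (cR (alpha r) * q r) * cR (k0 (t - r))) =
  c0 R * cint lam (fun r => f r * cR (k0 (t - r)))].
Proof.
have [s1 [u1 [[s1p mu1] bu1 cu1 zu1 eu1]]] := picard_fixpoint malpha calpha alphaA mf fF f0 cf.
exists (qsol s1 u1); split.
- split; first exact: cmeas_q.
  exact: N2_qsol_lty.
- by move=> t; exact: ccont_q.
- by move=> t; exact: q_neg.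
move=> t; rewrite (qsol_eq s1p mu1 bu1 eu1).
have [l1 <-] := cL1_kXC s1p mu1 bu1 t.
have lf : cL1 lam (fun r => f r * cR (k0 (t - r))).
  have mwf : cmeas (fun r => ewt s1 r * f r) by apply: cmeasM => //; exact: cmeas_ewt.
  have l2 := flip (cL1_conv_bounded t (cL1_kex s1p) mwf (fun r => cabs_ewf fF f0 r (ltW s1p))).
  apply: (eq_cL1 _ (cL1Z (ewt (- s1) t) l2)) => r.
  rewrite kexE -(ewtB (- s1) t r) (_ : _ * (_ * _) = (ewt (- s1) (t - r) * ewt s1 (t - r)) *
    (ewt (- s1) r * ewt s1 r) * (f r * cR (k0 (t - r)))); last by ring.
  have e0 x : ewt (- s1) x * ewt s1 x = 1 :> R[i] by rewrite -ewtD addNr ewt0.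
  by rewrite (e0 r) (e0 (t - r)) !mul1r.
have lq : cL1 lam (fun r => cR (alpha r) * qsol s1 u1 r * cR (k0 (t - r))).
  by apply: (eq_cL1 _ (cL1B lf l1)) => r; ring.
rewrite -mulrDr -cintD//; congr (_ * _); apply: eq_cint => r; ring.
Qed.
End VolterraDecay.

(** * Heat and Schroedinger kernels in one dimension *)

Section HeatKernel.
Variable R : realType.
Local Notation lam := (@lam R).

Definition cz (r E : R) : R[i] := Complex r E.
Lemma czE r E : cz r E = cR r + iC R * cR E.
Proof. by apply: cP; rewrite !(creE, cimE) /= !(mul0r, mul1r, subr0, addr0, add0r). Qed.
Lemma cz_neq0 r E : 0 < r -> cz r E != 0.
Proof. by move=> r0; apply: contraTneq r0 => -[-> _]; rewrite ltxx. Qed.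

Lemma gauss0_continuous r E : 0 < r -> ccont_at (fun E => gauss0 (cz r E)) E.
Proof.
move=> r0; apply: ccont_seq => s sE.
apply: (@cint_dct _ _ _ lam (fun n => egauss (cz r (s n)) 0) _ (rgauss r)).
- by move=> n; meas.
- move=> k; apply: ccvg_cexp; apply: ccvgD; last exact: ccvg_cst.
  apply: ccvgM; last exact: ccvg_cst.
  apply: ccvgN; rewrite czE; apply: (ccvg_eq (fun n => esym (czE r (s n)))).
  by apply: ccvgD; [exact: ccvg_cst|apply: ccvgZ; exact: ccvg_cR].
- meas.
- exact: nint_rgauss_lty.
- by move=> n k; rewrite cabs_egauss.
Qed.

Let cre_zww r E (w : R[i]) : cre w = 0 -> cre (cz r E * (w * w)) = - (r * cim w ^+ 2).
Proof. by case: w => a b; rewrite /cre /cim /= => ->; ring. Qed.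

(* [gauss0 z ^ 2 = pi / z] has positive real part, so [cre (gauss0 z)] does not
   vanish; it is positive on the real axis and hence, by continuity, everywhere. *)
Lemma cre_gauss0_gt0 r E : 0 < r -> 0 < cre (gauss0 (cz r E)).
Proof.
move=> r0; pose f E := cre (gauss0 (cz r E)).
have fne x : f x != 0.
  apply/eqP => fx; have := gauss0_sqr (z := cz r x) r0.
  move=> /(congr1 (@cre R)); rewrite (cre_zww _ _ fx) cre_cR => h.
  have := pi_gt0 R; rewrite -h oppr_gt0 ltNge => /negP; apply.
  by rewrite mulr_ge0 ?sqr_ge0// ltW.
have f0 : 0 < f 0.
  have -> : f 0 = cre (gauss0 (cR r)) by [].
  by rewrite gauss0_real//= sqrtr_gt0 divr_gt0 ?pi_gt0.
have cf : continuous f.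
  move=> x; apply/cvgrPdist_le => e e0; have [d d0 H] := gauss0_continuous x r0 e0.
  near=> y; have /H : `|y - x| < d by [].
  apply: le_trans; rewrite distrC; rewrite -[_ - _]/(f y - f x) /f.
  by have := cre_le_cabs (gauss0 (cz r y) - gauss0 (cz r x)); rewrite !creE.
rewrite ltNge; apply/negP => fE.
have [/ltW E0|E0|E0] := ltgtP E 0.
- have [||c _ /eqP] := @IVT R f E 0 0 E0; [exact: continuous_subspaceT| |by rewrite (negPf (fne c))].
  by rewrite ge_min fE /= le_max (ltW f0) orbT.
- have [||c _ /eqP] := @IVT R f 0 E 0 (ltW E0); [exact: continuous_subspaceT| |by rewrite (negPf (fne c))].
  by rewrite ge_min fE orbT /= le_max (ltW f0).
- by move: fE f0; rewrite E0 /f => /le_lt_trans h /h; rewrite ltxx.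
Unshelve. all: end_near. Qed.

(** The squares converge by [gauss0_sqr]. The branch is decided by
    [|g - L| = |g^2 - L^2| / |g + L|], whose denominator is at least [re L > 0] because [g] has
    positive real part. *)
Lemma gauss0_boundary (s : R) : 0 < s ->
  ccvg_seq (fun n => gauss0 (cz (epsn R n) s)) (cR (Num.sqrt (pi / s)) * expi (- (pi / 4))).
Proof.
move=> s0; set L := (X in ccvg_seq _ X).
have p0 := pi_gt0 R.
have LL : L * L = (cR pi / (iC R * cR s)).
  have -> : L * L = cR (pi / s) * (expi (- (pi / 4)) * expi (- (pi / 4))).
    by rewrite /L mulrACA -cRM -expr2 sqr_sqrtr// divr_ge0// ltW.
  have -> : expi (- (pi / 4)) * expi (- (pi / 4)) = - iC R.
    rewrite -expiD (_ : - (pi / 4) - pi / 4 = - (pi / 2)); last by move: (@pi R) => p; field.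
    by apply: cP; rewrite !(creE, cimE) /= ?cosN ?sinN ?cos_pihalf ?sin_pihalf ?oppr0.
  have iCV : (iC R)^-1 = - iC R.
    have i0 : iC R != 0 by rewrite -cabs_eq0 cabs_iC oner_eq0.
    by apply: (mulIf i0); rewrite mulVf// mulNr iC2 opprK.
  by rewrite invfM iCV cRM cRV -mulrA; congr (_ * _); rewrite mulrC.
have L0 : 0 < cre L.
  rewrite /L !(creE, cimE) /= mul0r subr0 cosN mulr_gt0 ?sqrtr_gt0 ?divr_gt0//.
  by have [_ h] := cos_sin_pi4 R; apply: lt_le_trans h.
apply: (ccvg_le (w := fun n => pi / (s ^+ 2 * cre L) * epsn R n)); last first.
  by rewrite -[X in _ --> X](mulr0 (pi / (s ^+ 2 * cre L))); apply: cvgM; [exact: cvg_cst|exact: epsn_cvg].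
move=> n; set z := cz _ s; set g := gauss0 z.
have e0 : 0 < epsn R n by pos.
have gg : g * g = cR pi / z.
  by rewrite -(gauss0_sqr (z := z) e0) mulrAC divff ?mul1r// cz_neq0.
have zs : s <= cabs z.
  by apply: le_trans (cim_le_cabs z); rewrite ler_norm.
have z0 : 0 < cabs z by apply: lt_le_trans zs.
have D : cabs (g - L) * cabs (g + L) = pi * epsn R n / (cabs z * s).
  rewrite -cabsM (_ : (g - L) * (g + L) = g * g - L * L); last by ring.
  rewrite gg LL.
  have zn : z != 0 by exact: cz_neq0.
  have ins : iC R * cR s != 0.
    by rewrite -cabs_eq0 cabsM cabs_iC mul1r cabs_cRp ?(ltW s0)// gt_eqF.
  have frac (p a b : R[i]) : a != 0 -> b != 0 -> p / a - p / b = p * (b - a) / (a * b).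
    by move=> a0 b0; field; rewrite a0 b0.
  rewrite (frac _ _ _ zn ins).
  rewrite !cabsM cabsV !cabsM cabs_iC mul1r !cabs_cRp ?(ltW s0) ?(ltW p0)//.
  rewrite (_ : iC R * cR s - z = - cR (epsn R n)); last by rewrite /z czE opprD addrCA subrr addr0.
  by rewrite cabsN cabs_cRp// ltW.
have gL : cre L <= cabs (g + L).
  apply: le_trans (cre_le_cabs _); apply: le_trans (ler_norm _).
  by rewrite !creE lerDr ltW// cre_gauss0_gt0.
have gL0 : 0 < cabs (g + L) by apply: lt_le_trans gL.
have -> : cabs (g - L) = pi * epsn R n / (cabs z * s) / cabs (g + L) by rewrite -D mulfK// gt_eqF.
have -> : pi * epsn R n / (cabs z * s) / cabs (g + L) = (pi * epsn R n) * (cabs z * s * cabs (g + L))^-1.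
  by rewrite -mulrA -invfM.
have -> : pi / (s ^+ 2 * cre L) * epsn R n = (pi * epsn R n) * (s ^+ 2 * cre L)^-1 by rewrite mulrAC.
apply: ler_wpM2l; first by rewrite mulr_ge0 ?ltW.
rewrite lef_pV2 ?posrE ?mulr_gt0 ?exprn_gt0//; apply: ler_pM.
- exact: sqr_ge0.
- exact: ltW.
- by rewrite expr2 ler_wpM2r// ltW.
- by [].
Qed.

(** Up to the factor [2 pi], the kernel of [e^(- z H_0)] in one dimension: the heat kernel for real
    [z], a smoothed Schroedinger kernel for [z = r + i s]. *)
Definition hz (z : R[i]) (x : R) : R[i] := cint lam (egauss z x).
Lemma hzE z x : 0 < cre z -> hz z x = gauss0 z * cexp (- cR (x ^+ 2) / (4 * z)).
Proof. exact: egauss_closed. Qed.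

Lemma hzN z x : 0 < cre z -> hz z (- x) = hz z x.
Proof. by move=> zp; rewrite !hzE// sqrrN. Qed.
Lemma hz_real (a x : R) : 0 < a -> hz (cR a) x = cR (Num.sqrt (pi / a) * rgauss (4 * a)^-1 x).
Proof.
move=> a0; rewrite -cint_rgauss_expi//; apply: eq_cint => k.
by rewrite egauss_real.
Qed.

Lemma cabs_hz z x : 0 < cre z -> cabs (hz z x) <= Num.sqrt (pi / cabs z).
Proof. exact: cabs_cint_egauss. Qed.
Lemma cabs_hz_le r E x : 0 < r -> cabs (hz (cz r E) x) <= Num.sqrt (pi / r).
Proof.
move=> r0; apply: le_trans (cabs_hz x (z := cz r E) r0) _.
have h : r <= cabs (cz r E) by apply: le_trans (cre_le_cabs (cz r E)); exact: ler_norm.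
rewrite ler_sqrt; last by rewrite divr_ge0 ?pi_ge0// ltW.
by rewrite ler_wpM2l ?pi_ge0// lef_pV2 ?posrE//; apply: lt_le_trans h.
Qed.

(* The free Schroedinger kernel in one dimension. *)
Definition fk (s x : R) : R[i] := cR (Num.sqrt (4 * pi * s))^-1 * expi (- (pi / 4)) * expi (x ^+ 2 / (4 * s)).
Lemma cabs_fk s x : 0 < s -> cabs (fk s x) = (Num.sqrt (4 * pi * s))^-1.
Proof.
move=> s0; rewrite /fk !cabsM !cabs_expi !mulr1 cabs_cRp// invr_ge0 sqrtr_ge0//.
Qed.

Lemma mfun_invr {d} {T : measurableType d} (f : T -> R) :
  mfun f -> mfun (fun x => (f x)^-1).
Proof.
move=> mf; rewrite (_ : (fun _ => _) = (fun x => f x * (f x ^+ 2)^-1)).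
  apply: measurable_funM => //; apply: mfun_invr_ge0 => [|x]; last exact: sqr_ge0.
  meas.
apply/funext => x; have [->|f0] := eqVneq (f x) 0; first by rewrite invr0 mul0r.
by rewrite expr2 invfM mulrA divff// mul1r.
Qed.

Lemma cmeas_fk2 : cmeas (fun z : R * R => fk z.1 z.2).
Proof.
apply: cmeasM.
  apply: cmeasM; last by meas.
  apply: cmeas_cR; apply: mfun_invr_ge0; last by [].
  apply: (measurableT_comp (@mfun_sqrt R)); meas.
apply: cmeas_expi; apply: measurable_funM; first by meas.
by apply: mfun_invr; meas.
Qed.

Lemma cmeas_fk s : cmeas (fk s).
Proof. meas. Qed.
Lemma fk_boundary s x : 0 < s -> ccvg_seq (fun n => cR (2 * pi)^-1 * hz (cz (epsn R n) s) x) (fk s x).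
Proof.
move=> s0; have p0 := pi_gt0 R.
have e0 n : 0 < epsn R n by pos.
apply: (ccvg_eq (fun n => congr1 (fun z => cR (2 * pi)^-1 * z) (esym (hzE x (e0 n : 0 < cre (cz (epsn R n) s)))))).
have -> : fk s x = cR (2 * pi)^-1 * ((cR (Num.sqrt (pi / s)) * expi (- (pi / 4))) * expi (x ^+ 2 / (4 * s))).
  rewrite /fk !mulrA -cRM; congr (cR _ * _ * _).
  rewrite (_ : Num.sqrt (4 * pi * s) = 2 * pi / Num.sqrt (pi / s)).
    by rewrite invf_div mulrC.
  have q0 : 0 < Num.sqrt (pi / s) by pos.
  apply: (mulIf (lt0r_neq0 q0)); rewrite divfK ?lt0r_neq0// -sqrtrM; last by rewrite !mulr_ge0 ?ltW.
  rewrite (_ : _ * (pi / s) = (2 * pi) ^+ 2); first by rewrite sqrtr_sqr ger0_norm// mulr_ge0 ?ltW.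
  by move: (@pi R) => p; field; rewrite lt0r_neq0.
apply: ccvgZ; apply: ccvgM; first exact: gauss0_boundary.
have -> : expi (x ^+ 2 / (4 * s)) = cexp (- cR (x ^+ 2) * (4 * cz 0 s)^-1) .
  rewrite -cexp_im; congr cexp; rewrite czE cR0 add0r.
  have iCV : (iC R)^-1 = - iC R.
    have i0 : iC R != 0 by rewrite -cabs_eq0 cabs_iC oner_eq0.
    by apply: (mulIf i0); rewrite mulVf// mulNr iC2 opprK.
  rewrite !invfM iCV !(cRM, cRV, cR_nat); ring.
apply: ccvg_cexp; apply: ccvgZ.
have nz r : 0 <= r -> (4 * cz r s : R[i]) != 0.
  move=> r0; rewrite mulf_neq0 ?pnatr_eq0//; apply: contraTneq s0 => -[_ ->]; by rewrite ltxx.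
apply: (ccvg_le (w := fun n => epsn R n / (4 * s ^+ 2))); last first.
  by rewrite -[X in _ --> X](mul0r (4 * s ^+ 2)^-1); apply: cvgM; [exact: epsn_cvg|exact: cvg_cst].
move=> n; have zn := nz _ (ltW (e0 n)); have zn0 := nz _ (lexx 0).
have frac (a b : R[i]) : a != 0 -> b != 0 -> a^-1 - b^-1 = (b - a) * (a^-1 * b^-1).
  by move=> a0 b0; field; rewrite a0 b0.
rewrite (frac _ _ zn zn0) !czE cR0 add0r.
have -> : 4 * (iC R * cR s) - 4 * (cR (epsn R n) + iC R * cR s) = - (cR (4 * epsn R n)).
  by rewrite cRM cR_nat; ring.
rewrite -czE !cabsM cabsN !cabsV !cabsM cabs_iC mul1r -!cR_nat !cabs_cRp ?(ltW s0) ?mulr_ge0 ?(ltW (e0 n))//.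
have zs : s <= cabs (cz (epsn R n) s) by apply: le_trans (cim_le_cabs _); rewrite ler_norm.
have -> : epsn R n / (4 * s ^+ 2) = 4 * epsn R n * ((4 * s)^-1 * (4 * s)^-1) by field; rewrite lt0r_neq0.
apply: ler_wpM2l; first by pos.
by rewrite ler_wpM2r ?invr_ge0 ?mulr_ge0 ?(ltW s0)// lef_pV2 ?posrE ?mulr_gt0 ?ler_wpM2l// (lt_le_trans s0).
Qed.

Lemma mfun_rgauss_sub (A g : R) : mfun (fun x : R => rgauss A (x - g)).
Proof. by apply: (measurableT_comp (mfun_rgauss A)); meas. Qed.
Lemma nint_rgauss_sub_lty (k A g : R) : 0 <= k -> 0 < A -> (nint lam (fun x : R => (k * rgauss A (x - g))%R) < +oo)%E.
Proof.
move=> kp A0; rewrite (nintZ lam kp (mfun_rgauss_sub A g)); last by move=> x; exact: expR_ge0.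
rewrite (nint_shift (- g) (mfun_rgauss A)); last by move=> x; exact: expR_ge0.
by rewrite nint_rgauss// -EFinM ltry.
Qed.

Lemma cint_rgauss_egauss A (g b k : R) : 0 < A ->
  cint lam (fun x => cR (rgauss A (x - g)) * expi ((x - b) * k)) =
  cR (Num.sqrt (pi / A) * rgauss (4 * A)^-1 k) * expi ((g - b) * k).
Proof.
move=> A0.
have l0 : cL1 lam (fun x => cR (rgauss A x) * expi (k * x)).
  apply: (cL1_dom (r := rgauss A)); first by apply: cmeasM; [apply: cmeas_cR; exact: mfun_rgauss|apply: cmeas_expi; exact: measurable_funM].
  - meas.
  - by move=> x; rewrite cabsM cabs_expi mulr1 cabs_cRp ?expR_ge0.
  - exact: nint_rgauss_lty.
have [l1 e1] := shift_cint (- g) l0.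
transitivity (cint lam (fun x => expi ((g - b) * k) * (cR (rgauss A (x - g)) * expi (k * (x - g))))).
  apply: eq_cint => x; rewrite mulrCA -expiD; congr (_ * expi _); ring.
by rewrite cintZ// e1 cint_rgauss_expi// mulrC.
Qed.

(** [rgauss A] is a multiple of the heat kernel at time [1 / (4 A)], so this is the semigroup law:
    the times add. *)
Lemma cint_rgauss_hz A z (g b : R) : 0 < A -> 0 < cre z ->
  cL1 lam (fun x => cR (rgauss A (x - g)) * hz z (x - b)) /\
  cint lam (fun x => cR (rgauss A (x - g)) * hz z (x - b)) =
  cR (Num.sqrt (pi / A)) * hz (cR (4 * A)^-1 + z) (g - b).
Proof.
move=> A0 z0.
pose F (p : R * R) := cR (rgauss A (p.1 - g)) * egauss z (p.1 - b) p.2.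
have mF : cmeas F.
  apply: cmeasM.
    apply: cmeas_cR; apply: (measurableT_comp (mfun_rgauss A)); meas.
  apply: cmeas_cexp; apply: cmeasD.
    meas.
  apply: cmeasM; first by meas.
  meas.
have lF : cL1 (prodm lam lam) F.
  apply: (@cL1_prod_dom _ _ _ _ _ lam lam F (fun x : R => rgauss A (x - g)) (rgauss (cre z)) mF).
  - by apply: (measurableT_comp (mfun_rgauss A)); meas.
  - meas.
  - by move=> x; exact: expR_ge0.
  - by move=> x; exact: expR_ge0.
  - rewrite (nint_shift (- g) (mfun_rgauss A)) ?nint_rgauss_lty// => x; exact: expR_ge0.
  - exact: nint_rgauss_lty.
  - by move=> x y; rewrite /F /= cabsM cabs_egauss cabs_cRp// expR_ge0.
have FE x : cint lam (fun k => F (x, k)) = cR (rgauss A (x - g)) * hz z (x - b).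
  by rewrite /F /= cintZ//; exact: cL1_egauss.
split; first by apply: (eq_cL1 FE); exact: cL1_cint1 lF.
rewrite -(eq_cint _ FE) (cFubini lF) -cintZ; last by apply: cL1_egauss; rewrite creE cre_cR addr_gt0// invr_gt0 mulr_gt0.
apply: eq_cint => k.
transitivity (cint lam (fun x => cexp (- z * cR (k ^+ 2)) * (cR (rgauss A (x - g)) * expi ((x - b) * k)))).
  by apply: eq_cint => x; rewrite /F /= /egauss cexpD cexp_im mulrCA.
rewrite cintZ; last first.
  apply: (cL1_dom (r := fun x : R => rgauss A (x - g))).
  - apply: cmeasM; first by apply: cmeas_cR; apply: (measurableT_comp (mfun_rgauss A)); meas.
    meas.
  - by apply: (measurableT_comp (mfun_rgauss A)); meas.
  - by move=> x; rewrite cabsM cabs_expi mulr1 cabs_cRp// expR_ge0.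
  - rewrite (nint_shift (- g) (mfun_rgauss A)) ?nint_rgauss_lty// => x; exact: expR_ge0.
have rg c : cR (rgauss c k) = cexp (- cR c * cR (k ^+ 2)) by rewrite -cRN -cRM cexp_cR /rgauss mulNr.
rewrite cint_rgauss_egauss// [cR (_ * rgauss _ _)]cRM rg /egauss opprD (mulrDl _ _ (cR _)) !cexpD cexp_im; ring.
Qed.

Lemma cL1_rgauss_fk A s (g b : R) : 0 < A -> 0 < s -> cL1 lam (fun x => cR (rgauss A (x - g)) * fk s (x - b)).
Proof.
move=> A0 s0; apply: (cL1_dom (r := fun x : R => (Num.sqrt (4 * pi * s))^-1 * rgauss A (x - g))).
- apply: cmeasM; first by apply: cmeas_cR; apply: (measurableT_comp (mfun_rgauss A)); meas.
  by apply: (cmeas_comp (cmeas_fk s)); meas.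
- by apply: measurable_funM => //; apply: (measurableT_comp (mfun_rgauss A)); meas.
- by move=> x; rewrite cabsM cabs_fk// cabs_cRp ?expR_ge0// mulrC.
by apply: nint_rgauss_sub_lty => //; rewrite invr_ge0 sqrtr_ge0.
Qed.

(** The oscillating kernel has constant modulus in space and is not integrable; its pairing with a
    Gaussian is the limit of [cint_rgauss_hz] as the real part of the time goes to zero. *)
Lemma cint_rgauss_fk A s (g b : R) : 0 < A -> 0 < s ->
  cint lam (fun x => cR (rgauss A (x - g)) * fk s (x - b)) =
  cR (2 * pi)^-1 * (cR (Num.sqrt (pi / A)) * hz (cz (4 * A)^-1 s) (g - b)).
Proof.
move=> A0 s0; have e0 n : 0 < epsn R n by pos.
have A40 : 0 < (4 * A)^-1 by pos.
have mr : mfun (fun x : R => rgauss A (x - g)).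
  by apply: (measurableT_comp (mfun_rgauss A)); meas.
have h1 : ccvg_seq (fun n => cint lam (fun x => cR (rgauss A (x - g)) * (cR (2 * pi)^-1 * hz (cz (epsn R n) s) (x - b))))
   (cint lam (fun x => cR (rgauss A (x - g)) * fk s (x - b))).
  apply: (@cint_dct _ _ _ lam _ _ (fun x => ((2 * pi)^-1 * Num.sqrt (pi / s)) * rgauss A (x - g))).
  - move=> n; apply: (@cmeas_eq _ _ _ (fun x : R => cR (2 * pi)^-1 * (cR (rgauss A (x - g)) * hz (cz (epsn R n) s) (x - b)))).
      by move=> x; rewrite mulrCA.
    apply: cmeasM; first by meas.
    by have [[]] := cint_rgauss_hz g b A0 (e0 n : 0 < cre (cz (epsn R n) s)).
  - by move=> x; apply: ccvgZ; exact: fk_boundary.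
  - meas.
  - by apply: nint_rgauss_sub_lty => //; rewrite mulr_ge0 ?sqrtr_ge0 ?invr_ge0 ?mulr_ge0 ?pi_ge0.
  - move=> n x; rewrite cabsM cabs_cRp ?expR_ge0// mulrC ler_wpM2r ?expR_ge0//.
    rewrite cabsM cabs_cRp ?invr_ge0 ?mulr_ge0 ?pi_ge0// ler_wpM2l ?invr_ge0 ?mulr_ge0 ?pi_ge0//.
    apply: le_trans (cabs_hz _ (e0 n : 0 < cre (cz (epsn R n) s))) _.
    have zs : s <= cabs (cz (epsn R n) s) by apply: le_trans (cim_le_cabs _); rewrite ler_norm.
    rewrite ler_sqrt ?divr_ge0 ?pi_ge0 ?(ltW s0)// ler_wpM2l ?pi_ge0// lef_pV2 ?posrE//.
    exact: lt_le_trans zs.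
apply: (ccvg_uniq h1).
apply: (ccvg_eq (u := fun n => cR (2 * pi)^-1 * (cR (Num.sqrt (pi / A)) * hz (cR (4 * A)^-1 + cz (epsn R n) s) (g - b)))).
  move=> n; have [l <-] := cint_rgauss_hz g b A0 (e0 n : 0 < cre (cz (epsn R n) s)).
  by rewrite -cintZ//; apply: eq_cint => x; rewrite mulrCA.
apply: ccvgZ; apply: ccvgZ.
apply: (@cint_dct _ _ _ lam _ _ (rgauss (4 * A)^-1)).
- by move=> n; meas.
- move=> k; apply: ccvg_cexp; apply: ccvgD; last exact: ccvg_cst.
  apply: ccvgM; last exact: ccvg_cst.
  apply: ccvgN; rewrite -[cz (4 * A)^-1 s]addr0.
  apply: (ccvg_eq (u := fun n => cz (4 * A)^-1 s + cR (epsn R n))).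
    by move=> n; rewrite !czE; ring.
  apply: ccvgD; first exact: ccvg_cst.
  by rewrite -cR0; apply: ccvg_cR; exact: epsn_cvg.
- meas.
- exact: nint_rgauss_lty.
- move=> n k; rewrite cabs_egauss creE cre_cR /rgauss ler_expR lerN2 ler_wpM2r ?sqr_ge0//.
  by rewrite lerDl; exact: (ltW (e0 n)).
Qed.
End HeatKernel.

(** * Free evolution of Gaussians in three dimensions *)

Section FreeEvolution.
Variable R : realType.
Local Notation lam := (@lam R).
Local Notation lam3 := (@lam3 R).

Definition tens3 (f g h : R -> R[i]) (x : pt R) : R[i] := f x.1.1 * g x.1.2 * h x.2.
Lemma mfun_pt1 : mfun (fun x : pt R => x.1.1).
Proof. exact: (measurableT_comp measurable_fst measurable_fst). Qed.
Lemma mfun_pt2 : mfun (fun x : pt R => x.1.2).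
Proof. exact: (measurableT_comp measurable_snd measurable_fst). Qed.
Lemma mfun_pt3 : mfun (fun x : pt R => x.2).
Proof. exact: measurable_snd. Qed.
Lemma cmeas_tens3 f g h : cmeas f -> cmeas g -> cmeas h -> cmeas (tens3 f g h).
Proof.
move=> mf mg mh; apply: cmeasM; last exact: (cmeas_comp mh mfun_pt3).
by apply: cmeasM; [exact: (cmeas_comp mf mfun_pt1)|exact: (cmeas_comp mg mfun_pt2)].
Qed.

Lemma cL1_tens3 f g h : cL1 lam f -> cL1 lam g -> cL1 lam h -> cL1 lam3 (tens3 f g h).
Proof. by move=> lf lg lh; apply: (cL1_tensor (cL1_tensor lf lg) lh). Qed.
Lemma cint_tens3 f g h : cL1 lam f -> cL1 lam g -> cL1 lam h ->
  cint lam3 (tens3 f g h) = cint lam f * cint lam g * cint lam h.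
Proof. by move=> lf lg lh; rewrite -(cint_tensor lf lg) -(cint_tensor (cL1_tensor lf lg) lh). Qed.

Lemma nint_tens3 (f g h : R -> R) : mfun f -> mfun g -> mfun h ->
  (forall x, 0 <= f x) -> (forall x, 0 <= g x) -> (forall x, 0 <= h x) ->
  nint lam3 (fun x => (f x.1.1 * g x.1.2 * h x.2)%R) = (nint lam f * nint lam g * nint lam h)%E.
Proof.
move=> mf mg mh f0 g0 h0; rewrite -(nint_tensor lam lam)//.
rewrite -(nint_tensor (prodm lam lam) lam (a := fun z => f z.1 * g z.2))//.
  by apply: measurable_funM; [exact: (measurableT_comp mf)|exact: (measurableT_comp mg)].
by move=> x; exact: mulr_ge0.
Qed.

Definition hz3 (z : R[i]) (x : pt R) : R[i] := hz z x.1.1 * hz z x.1.2 * hz z x.2.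
Lemma hz_continuous (r x E : R) : 0 < r -> ccont_at (fun E => hz (cz r E) x) E.
Proof.
move=> r0; apply: ccont_seq => s sE.
apply: (@cint_dct _ _ _ lam (fun n => egauss (cz r (s n)) x) _ (rgauss r)).
- by move=> n; meas.
- move=> k; apply: ccvg_cexp; apply: ccvgD; last exact: ccvg_cst.
  apply: ccvgM; last exact: ccvg_cst.
  apply: ccvgN; rewrite czE; apply: (ccvg_eq (fun n => esym (czE r (s n)))).
  by apply: ccvgD; [exact: ccvg_cst|apply: ccvgZ; exact: ccvg_cR].
- meas.
- exact: nint_rgauss_lty.
- by move=> n k; rewrite cabs_egauss.
Qed.

Lemma hz3_continuous (r : R) (x : pt R) (E : R) : 0 < r -> ccont_at (fun E => hz3 (cz r E) x) E.
Proof.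
by move=> r0; apply: ccont_M; [apply: ccont_M|]; exact: hz_continuous.
Qed.
Lemma cmeas_hz2 (r : R) : cmeas (fun p : R * R => hz (cz r p.1) p.2).
Proof.
pose F (q : R * R * R) := egauss (cz r q.1.1) q.1.2 q.2.
suff mF : cmeas F by exact: (cmeas_cint1 lam mF).
apply: cmeas_cexp; apply: cmeasD.
  apply: cmeasM; last by meas.
  apply: cmeasN; split; first by meas.
  exact: mfun_pt1.
apply: cmeasM; first by meas.
by apply: cmeas_cR; apply: measurable_funM; [exact: mfun_pt2|exact: mfun_pt3].
Qed.

Lemma cmeas_hz3 (r : R) : cmeas (fun p : R * pt R => hz3 (cz r p.1) p.2).
Proof.
have h (g : pt R -> R) : mfun g -> cmeas (fun p : R * pt R => hz (cz r p.1) (g p.2)).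
  move=> mg; apply: (cmeas_comp (cmeas_hz2 r) (g := fun p : R * pt R => (p.1, g p.2))).
  by apply: measurable_fun_pair => //; exact: measurableT_comp.
apply: cmeasM; last exact: (h _ mfun_pt3).
by apply: cmeasM; [exact: (h _ mfun_pt1)|exact: (h _ mfun_pt2)].
Qed.

Lemma cabs_hz3_le r E x : 0 < r -> cabs (hz3 (cz r E) x) <= Num.sqrt (pi / r) ^+ 3.
Proof.
move=> r0; rewrite /hz3 !cabsM exprS expr2 mulrA.
by rewrite !ler_pM ?mulr_ge0 ?cabs_ge0 ?cabs_hz_le.
Qed.
Lemma cabs2_hz3_le r E x : 0 < r -> cabs2 (hz3 (cz r E) x) <= pi ^+ 3 / (r * (r ^+ 2 + E ^+ 2)).
Proof.
move=> r0; have p0 := pi_gt0 R.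
have z0 : r <= cabs (cz r E) by apply: le_trans (cre_le_cabs (cz r E)); exact: ler_norm.
have z1 : 0 < cabs (cz r E) by apply: lt_le_trans z0.
have h (y : R) : cabs2 (hz (cz r E) y) <= pi / cabs (cz r E).
  rewrite cabs2E -[leRHS]sqr_sqrtr; last by rewrite divr_ge0 ?ltW.
  by rewrite ler_pXn2r ?nnegrE ?cabs_ge0 ?sqrtr_ge0//; exact: cabs_hz.
apply: (@le_trans _ _ ((pi / cabs (cz r E)) ^+ 3)).
  rewrite /hz3 !cabs2M exprS expr2 mulrA.
  by rewrite !ler_pM ?mulr_ge0 ?cabs2_ge0.
rewrite expr_div_n ler_wpM2l ?exprn_ge0 ?(ltW p0)// lef_pV2 ?posrE ?exprn_gt0//; last first.
  by rewrite mulr_gt0// ltr_wpDr ?sqr_ge0// exprn_gt0.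
have -> : r ^+ 2 + E ^+ 2 = cabs (cz r E) ^+ 2 by rewrite -cabs2E.
by rewrite exprS ler_wpM2r// sqr_ge0.
Qed.

(** [64 = 4^3]: for [r >= 1 / 4] one has [r (r^2 + E^2) >= (1 + E^2) / 64]. The right side is
    integrable in the time variable [E], uniformly in [r]. *)
Lemma cabs2_hz3_quarter r E x : 4^-1 <= r -> cabs2 (hz3 (cz r E) x) <= 64 * pi ^+ 3 * (1 + E ^+ 2)^-1.
Proof.
move=> r4; have r0 : 0 < r by apply: lt_le_trans r4; rewrite invr_gt0.
apply: le_trans (cabs2_hz3_le E x r0) _.
have E0 := sqr_ge0 E; have p0 : 0 <= pi ^+ 3 :> R by rewrite exprn_ge0 ?pi_ge0.
rewrite -[leRHS]mulrA mulrCA ler_wpM2l//.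
have -> : 64 * (1 + E ^+ 2)^-1 = ((1 + E ^+ 2) / 64)^-1 by rewrite invf_div.
have e1 : 0 < 1 + E ^+ 2 by rewrite ltr_wpDr.
rewrite lef_pV2 ?posrE; last by pos.
  have r2 : 16^-1 <= r ^+ 2.
    have : 4^-1 * 4^-1 <= r * r by apply: ler_pM.
    by rewrite expr2; lra.
  apply: (@le_trans _ _ (4^-1 * (16^-1 + E ^+ 2))); first by lra.
  by apply: ler_pM => //; [rewrite addr_ge0// invr_ge0|rewrite lerD2r].
by rewrite mulr_gt0// ltr_wpDr// exprn_gt0.
Qed.

(** The normalisation per coordinate: the unit Gaussian [rgauss 1] is [d1 * hz (1 / 4)], a heat
    kernel at time [1 / 4]. *)
Definition d1 : R := (2 * Num.sqrt pi)^-1.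
Lemma d1E : (2 * pi)^-1 * Num.sqrt (pi / 1) = d1.
Proof.
rewrite divr1 /d1; have p0 := pi_gt0 R; have s0 : 0 < Num.sqrt pi :> R by pos.
rewrite -{1}[pi](@sqr_sqrtr R) ?ltW//; move: (Num.sqrt _) s0 => s s0.
by field; rewrite lt0r_neq0.
Qed.

Lemma cint_gauss_fk s (g b : R) : 0 < s ->
  cint lam (fun x => cR (rgauss 1 (x - g)) * fk s (x - b)) = cR d1 * hz (cz 4^-1 s) (g - b).
Proof.
by move=> s0; rewrite cint_rgauss_fk// mulrA -cRM d1E mulr1.
Qed.
Lemma U0kerE t x : 0 < t -> U0ker t x = tens3 (fk t) (fk t) (fk t) x.
Proof.
move=> t0; rewrite /U0ker /tens3 /fk /c32 /nrm2; have p0 := pi_gt0 R.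
have a0 : 0 <= 4 * pi * t by rewrite !mulr_ge0 ?ltW.
have -> : (4 * pi * t) `^ (- (3 / 2)) = (Num.sqrt (4 * pi * t))^-1 ^+ 3.
  rewrite powRN (_ : 3 / 2 = 2^-1 * 3%:R) ?powRrM ?powR_mulrn ?powR_ge0//; last by rewrite mulrC.
  by rewrite powR12_sqrt// exprVn.
have -> : - (3 * pi / 4) = - (pi / 4) - pi / 4 - pi / 4 :> R by move: (@pi R) => p; field.
rewrite !mulrDl !expiD cRX; ring.
Qed.

Lemma gaussE (b x : pt R) : gauss b x =
  tens3 (fun x => cR (rgauss 1 (x - b.1.1))) (fun x => cR (rgauss 1 (x - b.1.2))) (fun x => cR (rgauss 1 (x - b.2))) x.
Proof.
rewrite /gauss /tens3 /nrm2 /ptsub /= -!cRM /rgauss -!expRD; congr (cR (expR _)).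
by rewrite !mul1r !opprD.
Qed.
Lemma cL1_gauss_fk s (g b : R) : 0 < s -> cL1 lam (fun x => cR (rgauss 1 (x - g)) * fk s (x - b)).
Proof. by move=> s0; exact: cL1_rgauss_fk. Qed.

Lemma cint_gauss_U0ker s (g b : pt R) : 0 < s ->
  cL1 lam3 (fun x => gauss g x * U0ker s (ptsub x b)) /\
  cint lam3 (fun x => gauss g x * U0ker s (ptsub x b)) = cR d1 ^+ 3 * hz3 (cz 4^-1 s) (ptsub g b).
Proof.
move=> s0.
pose h (g b : R) := fun x => cR (rgauss 1 (x - g)) * fk s (x - b).
have E x : tens3 (h g.1.1 b.1.1) (h g.1.2 b.1.2) (h g.2 b.2) x = gauss g x * U0ker s (ptsub x b).
  by rewrite gaussE U0kerE// /tens3 /h /=; ring.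
split; first by apply: (eq_cL1 E); apply: cL1_tens3; exact: cL1_gauss_fk.
rewrite -(eq_cint _ E) cint_tens3; [|exact: cL1_gauss_fk..].
by rewrite /h !cint_gauss_fk// /hz3; ring.
Qed.

Lemma U0kerN (s : R) (x y : pt R) : U0ker s (ptsub x y) = U0ker s (ptsub y x).
Proof.
rewrite /U0ker; congr (_ * expi (_ / _)); rewrite /nrm2 /ptsub /=.
by congr (_ + _ + _); rewrite -sqrrN opprB.
Qed.
Lemma hz3N z (x y : pt R) : 0 < cre z -> hz3 z (ptsub x y) = hz3 z (ptsub y x).
Proof.
move=> z0; rewrite /hz3 /ptsub /=.
by rewrite -(hzN (x.1.1 - _) z0) -(hzN (x.1.2 - _) z0) -(hzN (x.2 - _) z0) !opprB.
Qed.

Lemma U0app_gauss s (b x : pt R) : 0 < s -> U0app s (gauss b) x = cR d1 ^+ 3 * hz3 (cz 4^-1 s) (ptsub x b).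
Proof.
move=> s0; have [l e] := cint_gauss_U0ker b x s0.
have q0 : 0 < 4^-1 :> R by [].
rewrite (@hz3N (cz 4^-1 s)) // -e /U0app.
have E y : U0ker s (ptsub x y) * gauss b y = gauss b y * U0ker s (ptsub y x) by rewrite mulrC U0kerN.
rewrite cint3E; first by apply: eq_cint.
by apply: (cmeas_eq (fun y => esym (E y))); case: l.
Qed.

(** A default value: [0] to a negative power is [0], so at time [0] the kernel formula gives [0] and
    not the identity. This agrees with [hv 0 = 0] in [fgauss]. *)
Lemma U0app_0 (Psi : pt R -> R[i]) x : U0app 0 Psi x = 0.
Proof.
rewrite /U0app -[RHS](cint0 lam3) -(cint3E (cmeas_cst 0)); congr (cint3 _ _); apply/funext => y.
rewrite /U0ker /c32 mulr0 powR0 ?cR0 ?mul0r// oppr_eq0 mulf_eq0 invr_eq0 !pnatr_eq0//.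
Qed.
(** The inhomogeneity of the charge equation, namely the free evolution of the Gaussian at the
    origin, extended by zero to [t <= 0] so that the equation can be posed on the whole line. *)
Definition fgauss (b : pt R) (t : R) : R[i] := cR (hv t) * (cR d1 ^+ 3 * hz3 (cz 4^-1 t) (ptsub (origin R) b)).

Lemma U0app_fgauss b t : 0 <= t -> U0app t (gauss b) (origin R) = fgauss b t.
Proof.
rewrite le_eqVlt => /orP[/eqP<-|t0]; first by rewrite U0app_0 /fgauss /hv ltxx cR0 mul0r.
by rewrite U0app_gauss// /fgauss /hv t0 mul1r.
Qed.
Lemma cmeas_fgauss b : cmeas (fgauss b).
Proof.
apply: cmeasM; first by meas.
apply: cmeasM; first by meas.
exact: (cmeas_comp (cmeas_hz3 4^-1) (measurable_pair2 (ptsub (origin R) b))).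
Qed.

Lemma hv01 (t : R) : 0 <= hv t <= 1. Proof. by rewrite /hv; case: (0 < t); rewrite ?lexx ?ler01. Qed.
Lemma d1_ge0 : 0 <= d1. Proof. pos. Qed.

Lemma cabs_fgauss b t : cabs (fgauss b t) <= d1 ^+ 3 * Num.sqrt (pi / 4^-1) ^+ 3.
Proof.
have /andP[h0 h1] := hv01 t; have q0 : 0 < 4^-1 :> R by [].
rewrite /fgauss cabsM cabs_cRp// -[leRHS]mul1r; apply: ler_pM => //; rewrite cabsM.
rewrite -cRX cabs_cRp ?exprn_ge0 ?d1_ge0// ler_wpM2l ?exprn_ge0 ?d1_ge0//.
exact: cabs_hz3_le.
Qed.
Lemma N2_fgauss b : (N2 (fgauss b) < +oo)%E.
Proof.
have mc : mfun (fun t : R => (1 + t ^+ 2)^-1).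
  by apply: mfun_invr; apply: measurable_funD => //; meas.
have c0 t : 0 <= (1 + t ^+ 2)^-1 :> R by rewrite invr_ge0 addr_ge0 ?sqr_ge0.
pose K := (d1 ^+ 3) ^+ 2 * (64 * pi ^+ 3).
have K0 : 0 <= K by apply: mulr_ge0; [exact: sqr_ge0|rewrite mulr_ge0 ?exprn_ge0 ?pi_ge0].
apply: (@le_lt_trans _ _ (nint lam (fun t => (K * (1 + t ^+ 2)^-1)%R))); last first.
  by rewrite nintZ//; apply: lte_mul_pinfty => //; rewrite ?lee_fin// nint_cauchy_lty.
apply: le_nint; [exact: cmeas_cabs2 (cmeas_fgauss b)|exact: measurable_funM|by move=> t; exact: cabs2_ge0|].
move=> t; have /andP[h0 h1] := hv01 t; rewrite /fgauss cabs2M cabs2_cR cabs2M -cRX cabs2_cR /K.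
have K1 := @cabs2_hz3_quarter 4^-1 t (ptsub (origin R) b) (lexx _).
have hh : hv t ^+ 2 <= 1 by rewrite expr_le1.
rewrite -[leRHS]mul1r; apply: ler_pM => //; first exact: sqr_ge0.
  pos.
by rewrite -[leRHS]mulrA ler_wpM2l ?sqr_ge0.
Qed.

Lemma ccont_near (u v : R -> R[i]) (t d : R) : 0 < d -> (forall s, `|s - t| < d -> u s = v s) ->
  ccont_at v t -> ccont_at u t.
Proof.
move=> d0 uv cv e e0; have [d' d'0 H] := cv e e0; exists (Num.min d d'); first by rewrite lt_min d0.
move=> s; rewrite lt_min => /andP[h1 h2]; rewrite !uv//; first exact: H.
by rewrite subrr normr0.
Qed.
Lemma ccont_hv (t : R) : t != 0 -> ccont_at (fun s => cR (hv s)) t.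
Proof.
move=> t0; apply: (@ccont_near _ (fun=> cR (hv t)) _ `|t|); rewrite ?normr_gt0//; last exact: ccont_cst.
move=> s st; congr cR; rewrite /hv; congr ((nat_of_bool _)%:R); case: (ltgtP 0 t) t0 => // h _.
- by move: st; rewrite (gtr0_norm h) ltr_distl => /andP[]; rewrite subrr => ->.
- by apply: negbTE; rewrite -leNgt; rewrite (ltr0_norm h) in st; have := ler_norm (s - t); lra.
Qed.

Lemma ccont_fgauss b t : t != 0 -> ccont_at (fgauss b) t.
Proof.
move=> t0; apply: ccont_M; first exact: ccont_hv.
apply: ccont_M; first exact: ccont_cst.
by apply: hz3_continuous; rewrite invr_gt0.
Qed.
End FreeEvolution.

Ltac meas_atom ::= first [exact: mfun_rgauss | exact: cmeas_egauss | exact: mfun_hv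
  | exact: mfun_rexp | exact: mfun_kexp | exact: mfun_k0
  | exact: mfun_rgauss_sub | exact: mfun_pt1 | exact: mfun_pt2 | exact: mfun_pt3].

(** * The charge of a Gaussian initial state *)

Section GaussianVolterra.
Variable R : realType.
Local Notation lam := (@lam R).

Lemma ccont_re (q : R -> R[i]) : (forall t, ccont_at q t) ->
  continuous (fun t => cre (q t)) /\ continuous (fun t => cim (q t)).
Proof.
move=> cq; split=> t; apply/cvgrPdist_le => e e0; have [d d0 H] := cq t e e0.
  near=> s; have /H : `|s - t| < d by [].
  rewrite cabs_distC; apply: le_trans.
  by have := cre_le_cabs (q t - q s); rewrite creD creN.
near=> s; have /H : `|s - t| < d by [].
rewrite cabs_distC; apply: le_trans.
by have := cim_le_cabs (q t - q s); rewrite cimD cimN.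
Unshelve. all: end_near. Qed.

Lemma eq_cint1 (D : set R) (f g : R -> R[i]) : (forall t, D t -> f t = g t) -> cint1 D f = cint1 D g.
Proof.
move=> fg; rewrite /cint1; congr Complex; apply: eq_Rintegral => x /set_mem Dx; by rewrite fg.
Qed.

Theorem volterra_gauss (alpha : R -> R) (T : R) (a : int -> R[i]) (b : pt R) :
  continuous alpha -> 0 < T -> (exists B : R, forall N : nat, abs_partial a N <= B) ->
  (forall t : R, ccvg_seq (fourier_partial a (2 * pi / T) t) (cR (alpha t))) -> generic a ->
  exists q, [/\ cL2 q, forall t, ccont_at q t, forall t, t <= 0 -> q t = 0 & volterra alpha (gauss b) q].
Proof.
move=> ca T0 [B aB] fa ga.
have calpha t : ccont_at (fun s => cR (alpha s)) t.
  by apply: ccont_seq => s st; apply: ccvg_cR; apply: continuous_cvg => //; exact: ca.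
have malpha : mfun alpha by exact: continuous_measurable_fun.
have alphaB := alpha_bounded aB fa.
have w0 : 0 < 2 * pi / T by rewrite divr_gt0// mulr_gt0 ?pi_gt0.
have lower (s0 : R) (s00 : 0 < s0) := lower_bound malpha calpha alphaB w0 s00 (uniform_of_generic aB fa ga).
have f0 t : t <= 0 -> fgauss b t = 0 by move=> t0; rewrite /fgauss /hv ltNge t0 cR0 mul0r.
have [q [l2q cq q0 eq]] := volterra_solution malpha calpha alphaB (cmeas_fgauss b) (cabs_fgauss b) f0
  (@ccont_fgauss _ b) (N2_fgauss b) lower.
exists q; split => // s s0; move: (eq s); rewrite -/(c0 R).
have k0V t : cR (k0 (s - t)) = (cR (Num.sqrt (s - t)))^-1 :> R[i] by rewrite -cRV.
have mk : cmeas (fun t : R => cR (k0 (s - t)) : R[i]).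
  by apply: cmeas_cR; apply: (measurableT_comp (@mfun_k0 R)); meas.
have out t : ~~ (0 <= t <= s) -> t <= 0 \/ k0 (s - t) = 0.
  rewrite negb_and -!ltNge => /orP[/ltW|/ltW st]; first by left.
  by right; apply: k0_0; rewrite subr_le0.
(* Outside [[0, s]] the integrand vanishes, on the left through [F] and on the right through [k0],
   so the integral over the interval is the convolution on the line. *)
have restrict (F : R -> R[i]) : cmeas F -> (forall t, t <= 0 -> F t = 0) ->
    cint1 `[0, s] (fun t => F t / cR (Num.sqrt (s - t))) = cint lam (fun t => F t * cR (k0 (s - t))).
  move=> mF F0; rewrite (@eq_cint1 _ _ (fun t => F t * cR (k0 (s - t)))); last by move=> t _; rewrite k0V.
  rewrite cint1E//; last exact: cmeasM.
  apply: eq_cint => t; rewrite indicE; have [ts|ts] := boolP (t \in _); first by rewrite mul1r.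
  have : ~~ (0 <= t <= s) by apply: contra ts; rewrite inE /= in_itv /=.
  by move=> /out[/F0 ->|->]; rewrite ?cR0 ?mul0r ?mulr0.
rewrite -(restrict (fun t => cR (alpha t) * q t)); first last.
- by move=> t /q0 ->; rewrite mulr0.
- by apply: cmeasM; [exact: cmeas_cR|case: l2q].
rewrite -(restrict (fgauss b)); first last.
- exact: f0.
- exact: cmeas_fgauss.
move=> ->; congr (_ * _); apply: eq_cint1 => t /=; rewrite in_itv /= => /andP[t0 _].
by rewrite U0app_fgauss.
Qed.
End GaussianVolterra.

(** * Narrowing Gaussians by linear combinations and limits *)

Section GaussianClass.
Variable R : realType.
Local Notation lam := (@lam R).

Lemma sin_near0 (h : R) : 0 <= h -> `|sin h| <= h /\ `|h - sin h| <= h ^+ 3.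
Proof.
have cs : continuous (@sin R) by exact: continuous_sin.
have sin_le (x : R) : 0 <= x -> `|sin x| <= x.
  rewrite le_eqVlt => /orP[/eqP<-|x0]; first by rewrite sin0 normr0.
  have [|c _] := @MVT R sin cos 0 x x0 (fun y _ => is_derive_sin y); first exact: continuous_subspaceT.
  rewrite sin0 !subr0 => ->; rewrite normrM (gtr0_norm x0) ler_piMl ?(ltW x0)//.
  by rewrite ler_norml cos_geN1 cos_le1.
move=> h0; split; first exact: sin_le.
move: h0; rewrite le_eqVlt => /orP[/eqP<-|h0]; first by rewrite sin0 subrr normr0 expr0n.
pose g (x : R) := x - sin x.
have dg (x : R) : x \in `]0, h[ -> is_derive x 1 g (1 - cos x) by move=> _; exact: is_deriveB.
have cg : {within `[0, h], continuous g}.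
  by apply: continuous_subspaceT => x; apply: cvgB => //; exact: cs.
have [c] := MVT h0 dg cg; rewrite in_itv /= => /andP[c0 ch].
rewrite /g sin0 !subr0 => ->; rewrite normrM (gtr0_norm h0) exprSr ler_wpM2r ?(ltW h0)//.
have -> : 1 - cos c = 2 * sin (c / 2) ^+ 2.
  rewrite {1}(_ : c = c / 2 + c / 2) ?cosD; last by field.
  have := cos2Dsin2 (c / 2); rewrite !expr2; lra.
have c2 : 0 <= c / 2 by pos.
have s2 : sin (c / 2) ^+ 2 <= (c / 2) ^+ 2.
  by rewrite -(real_normK (num_real (sin _))) ler_pXn2r ?nnegrE// sin_le.
rewrite ger0_norm; last by apply: mulr_ge0 => //; exact: sqr_ge0.
have : c ^+ 2 <= h ^+ 2 by rewrite ler_pXn2r ?nnegrE ?(ltW c0) ?(ltW h0) ?(ltW ch).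
move: s2; rewrite expr_div_n; have := sqr_ge0 c; set a := sin _ ^+ 2; set d := c ^+ 2; set e := h ^+ 2; lra.
Qed.

Lemma exp_div_le (u : R) : 0 <= u -> expR (u / (1 + u)) <= 1 + u <= expR u.
Proof.
move=> u0; have u1 : 0 < 1 + u by rewrite ltr_wpDr.
rewrite expR_ge1Dx andbT; have := expR_ge1Dx (- (u / (1 + u))).
have -> : 1 + - (u / (1 + u)) = (1 + u)^-1 by field; rewrite lt0r_neq0.
by rewrite expRN lef_pV2// posrE expR_gt0.
Qed.
(** Squeezed by [e^(u / (1 + u)) <= 1 + u <= e^u] with [u = x_ n / (n + 1)], raised to the power
    [n + 1]. *)
Lemma cvg_pow_exp (x_ : nat -> R) (x : R) : (forall n, 0 <= x_ n) -> x_ n @[n --> \oo] --> x ->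
  (1 + x_ n / n.+1%:R) ^+ n.+1 @[n --> \oo] --> expR x.
Proof.
move=> x0 cx.
have un n : 0 <= x_ n / n.+1%:R by pos.
apply: (@squeeze_cvgr _ _ _ _ (fun n => expR (x_ n / (1 + x_ n * epsn R n))) (fun n => expR (x_ n))).
- apply: nearW => n; have /andP[h1 h2] := exp_div_le (un n).
  have n0 : 0 <= 1 + x_ n / n.+1%:R by pos.
  apply/andP; split.
    rewrite (_ : x_ n / _ = x_ n / n.+1%:R / (1 + x_ n / n.+1%:R) * n.+1%:R).
      by rewrite expRM_natr ler_pXn2r ?nnegrE ?expR_ge0.
    by rewrite /epsn [RHS]mulrAC divfK.
  rewrite (_ : expR (x_ n) = expR (x_ n / n.+1%:R * n.+1%:R)); last by rewrite divfK.
  by rewrite expRM_natr ler_pXn2r ?nnegrE ?expR_ge0.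
- apply: continuous_cvg; first exact: continuous_expR.
  rewrite -[X in _ --> X]divr1; apply: cvgM => //; apply: cvgV; first exact: oner_neq0.
  rewrite -[X in _ --> X]addr0; apply: cvgD; first exact: cvg_cst.
  by rewrite -(mulr0 x); apply: cvgM => //; exact: epsn_cvg.
- by apply: continuous_cvg => //; exact: continuous_expR.
Qed.

(* [(2m sin(k/2m))^2] is a trigonometric polynomial in [k], bounded by [k^2] and
   tending to it, so [(1 + c (2m sin(k/2m))^2 / m)^m] tends to [exp(c k^2)]
   from below: multiplying by it narrows the Gaussian. *)
Lemma gaussian_class (K : (R -> R[i]) -> Prop) :
  (forall w w' c, K w -> K w' -> K (fun k => w k + c * w' k)) ->
  (forall (w_ : nat -> R -> R[i]) w d, 0 < d -> (forall n, K (w_ n)) ->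
    (forall n k, cabs (w_ n k) <= rgauss d k) -> (forall k, ccvg_seq (fun n => w_ n k) (w k)) -> K w) ->
  (forall y, K (egauss (cR 4^-1) y)) ->
  forall r y, 0 < r <= 4^-1 -> K (egauss (cR r) y).
Proof.
move=> Klin Klim K0 r y /andP[r0 r4].
pose c := 4^-1 - r; have c0 : 0 <= c by rewrite subr_ge0.
pose s (m : nat) (k : R) : R := 2 * m.+1%:R * sin (k / (2 * m.+1%:R)).
pose p (m : nat) (k : R) : R := 1 + c * s m k ^+ 2 / m.+1%:R.
have sE m k : cR (s m k ^+ 2) = cR (m.+1%:R ^+ 2) * (2 - expi (k / m.+1%:R) - expi (- (k / m.+1%:R))) :> R[i].
  rewrite (_ : k / m.+1%:R = k / (2 * m.+1%:R) + k / (2 * m.+1%:R)); last by have : m.+1%:R != 0 :> R by []; move: (m.+1%:R) => N N0; field.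
  rewrite /s; set t := k / _; rewrite opprD !expiD exprMn cRM exprMn [cR (_ * _)]cRM -mulrA mulrCA; congr (_ * _).
  apply: cP; rewrite ?(creE, cimE) /= ?cosN ?sinN.
    have := cos2Dsin2 t; rewrite !expr2 /=; set a := cos t; set b := sin t => h.
    by lra.
  by ring.
(* Multiplying [egauss] by [e^(i k x)] moves its centre [y] by [x], so multiplication by the
   trigonometric polynomial [p m] is a combination of three translates and keeps within [K]. *)
have Kpow m j : forall y, K (fun k => egauss (cR 4^-1) y k * cR (p m k ^+ j)).
  elim: j => [|j IH] z.
    rewrite (_ : (fun _ => _) = egauss (cR 4^-1) z)//.
    by apply/funext => k; rewrite expr0 cR1 mulr1.
  pose M : R[i] := cR (c * m.+1%:R).
  have := Klin _ _ (- M) (Klin _ _ (- M) (Klin _ _ (2 * M) (IH z) (IH z)) (IH (z + m.+1%:R^-1))) (IH (z - m.+1%:R^-1)).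
  congr K; apply/funext => k.
  have ez x : egauss (cR 4^-1) (z + x) k = egauss (cR 4^-1) z k * expi (k * x).
    by rewrite /egauss mulrDl cRD mulrDr addrA cexpD; congr (_ * _); rewrite cexp_im mulrC.
  have pE : cR (p m k) = 1 + M * (2 - expi (k / m.+1%:R) - expi (- (k / m.+1%:R))).
    rewrite /p cRD cR1 -[c * _ / _]mulrAC cRM sE.
    rewrite mulrA -cRM; congr (_ + cR _ * _); rewrite expr2 mulrA mulfVK ?pnatr_eq0//.
  by rewrite !ez exprSr [cR (p m k ^+ j * _)]cRM pE mulrN; ring.
have sle m k : s m k ^+ 2 <= k ^+ 2.
  have m0 : 0 < 2 * m.+1%:R :> R by [].
  rewrite -(real_normK (num_real (s m k))) -(real_normK (num_real k)) ler_pXn2r ?nnegrE//.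
  have sab : `|sin (k / (2 * m.+1%:R))| = `|sin (`|k| / (2 * m.+1%:R))|.
    by case: (ger0P k) => // _; rewrite mulNr sinN normrN.
  rewrite /s normrM (gtr0_norm m0) sab.
  have [h _] := @sin_near0 (`|k| / (2 * m.+1%:R)) (divr_ge0 (normr_ge0 _) (ltW m0)).
  by apply: le_trans (ler_wpM2l (ltW m0) h) _; rewrite mulrC divfK// lt0r_neq0.
have slim k : s m k ^+ 2 @[m --> \oo] --> k ^+ 2.
  pose u (m : nat) : R := 2 * m.+1%:R * sin (`|k| / (2 * m.+1%:R)).
  have -> : (fun m => s m k ^+ 2) = (fun m => u m ^+ 2).
    apply/funext => m; rewrite /s /u; case: (ger0P k) => // _.
    by rewrite mulNr sinN mulrN sqrrN.
  rewrite -(real_normK (num_real k)).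
  suff cu : u m @[m --> \oo] --> `|k| by rewrite expr2; apply: cvgM.
  have w0 : `|k| ^+ 3 * epsn R m @[m --> \oo] --> 0.
    by rewrite -[X in _ --> X](mulr0 (`|k| ^+ 3)); apply: cvgM; [exact: cvg_cst|exact: epsn_cvg].
  apply: cvg_sub0; apply: cvg0_le w0 => m; have m0 : 0 < 2 * m.+1%:R :> R by [].
  have [_ h] := @sin_near0 (`|k| / (2 * m.+1%:R)) (divr_ge0 (normr_ge0 _) (ltW m0)).
  have -> : u m - `|k| = - (2 * m.+1%:R * (`|k| / (2 * m.+1%:R) - sin (`|k| / (2 * m.+1%:R)))).
    by rewrite /u mulrBr opprB mulrC [X in _ = _ - X]mulrC divfK ?lt0r_neq0// mulrC.
  rewrite normrN normrM (gtr0_norm m0); apply: le_trans (ler_wpM2l (ltW m0) h) _.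
  rewrite expr_div_n mulrCA ler_wpM2l ?exprn_ge0//.
  have m1 : 1 <= m.+1%:R :> R by rewrite ler1n.
  rewrite /epsn exprS invfM mulrA divff ?lt0r_neq0// mul1r lef_pV2 ?posrE ?exprn_gt0//.
  move: m1; set q : R := m.+1%:R => q1; rewrite exprMn expr2; have : q * 1 <= q * q by rewrite ler_wpM2l//; lra.
  by rewrite expr2; lra.
apply: (Klim (fun m k => egauss (cR 4^-1) y k * cR (p m k ^+ m.+1)) _ r r0).
- by [].
- move=> n k; have s0 : 0 <= s n k ^+ 2 by exact: sqr_ge0.
  have cs0 : 0 <= c * s n k ^+ 2 / n.+1%:R by pos.
  rewrite cabsM cabs_egauss cabs_cRp; last by pos.
  have -> : rgauss r k = rgauss (cre (cR 4^-1)) k * expR (c * k ^+ 2).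
    by rewrite /rgauss -expRD cre_cR; congr expR; rewrite /c; ring.
  rewrite ler_wpM2l ?expR_ge0//; apply: (@le_trans _ _ (expR (c * s n k ^+ 2))).
    have -> : c * s n k ^+ 2 = c * s n k ^+ 2 / n.+1%:R * n.+1%:R by rewrite divfK.
    rewrite expRM_natr ler_pXn2r ?nnegrE ?expR_ge0 ?addr_ge0//.
    exact: expR_ge1Dx.
  by rewrite ler_expR ler_wpM2l.
- move=> k; rewrite (_ : egauss (cR r) y k = egauss (cR 4^-1) y k * cR (expR (c * k ^+ 2))).
    apply: ccvgZ; apply: ccvg_cR; apply: cvg_pow_exp => [n|]; first by rewrite mulr_ge0 ?sqr_ge0.
    by apply: cvgM; [exact: cvg_cst|exact: slim].
  by rewrite /egauss -cexp_cR -cexpD; congr cexp; rewrite [cR (c * _)]cRM /c [cR (_ - r)]cRB; ring.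
Qed.
End GaussianClass.

(** * Closed subspaces of L2 and a density criterion *)

Section ClosedSubspace.
Variable R : realType.
Context {d} {T : measurableType d} (mu : {measure set T -> \bar R}).
Implicit Types f g : T -> R[i].

Definition Nm f : \bar R := nint mu (fun x => cabs2 (f x)).
Definition inL2 f := cmeas f /\ (Nm f < +oo)%E.
(** A predicate on functions rather than on classes; closedness includes invariance under almost
    everywhere equality among square integrable functions, see [closed_subspace_eq]. *)
Definition closed_subspace (S : (T -> R[i]) -> Prop) :=
  (forall f g c, S f -> S g -> S (fun x => f x + c * g x)) /\
  (forall f, inL2 f -> (forall e : R, 0 < e -> exists2 g, S g & (Nm (fun x => (f x - g x)%R) <= e%:E)%E) -> S f).

Lemma Nm_ge0 f : (0 <= Nm f)%E. Proof. by apply: nint_ge0 => x; exact: cabs2_ge0. Qed.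
Lemma Nm_dom f (G : T -> R) : cmeas f -> mfun G -> (forall x, cabs (f x) <= G x) ->
  (Nm f <= nint mu (fun x => (G x ^+ 2)%R))%E.
Proof.
move=> mf mG fG; apply: le_nint; [exact: cmeas_cabs2|exact: measurable_funX|by move=> x; exact: cabs2_ge0|].
by move=> x; rewrite cabs2E ler_pXn2r ?nnegrE ?cabs_ge0// (le_trans (cabs_ge0 _) (fG x)).
Qed.

Lemma NmZ c f : cmeas f -> Nm (fun x => c * f x) = ((cabs2 c)%:E * Nm f)%E.
Proof.
move=> mf; rewrite /Nm -nintZ ?cabs2_ge0//; last by meas.
by apply: eq_nint => x; rewrite cabs2M.
Qed.
Lemma NmD f g : cmeas f -> cmeas g -> (Nm (fun x => (f x + g x)%R) <= 2%:E * Nm f + 2%:E * Nm g)%E.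
Proof.
move=> mf mg; have mf2 := cmeas_cabs2 mf; have mg2 := cmeas_cabs2 mg.
rewrite /Nm -!nintZ// -nintD//; [|exact: measurable_funM|exact: measurable_funM|by move=> x; rewrite mulr_ge0 ?cabs2_ge0..].
apply: le_nint; [exact: cmeas_cabs2 (cmeasD mf mg)|by apply: measurable_funD; exact: measurable_funM|by move=> x; exact: cabs2_ge0|].
by move=> x; exact: cabs2D.
Qed.

Lemma inL2Dz f g c : inL2 f -> inL2 g -> inL2 (fun x => f x + c * g x).
Proof.
move=> [mf f2] [mg g2]; have mcg : cmeas (fun x => c * g x) by meas.
split; first exact: cmeasD.
apply: le_lt_trans (NmD mf mcg) _; rewrite NmZ//.
by apply: lte_add_pinfty; do ?apply: lte_mul_pinfty; rewrite ?lee_fin ?cabs2_ge0 ?Nm_ge0//=.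
Qed.
Lemma inL2_dom f (G : T -> R) : cmeas f -> mfun G -> (forall x, cabs (f x) <= G x) ->
  (nint mu (fun x => (G x ^+ 2)%R) < +oo)%E -> inL2 f.
Proof. by move=> mf mG fG G2; split=> //; apply: le_lt_trans G2; exact: Nm_dom. Qed.

Lemma Nm_dct (f_ : nat -> T -> R[i]) f (G : T -> R) : (forall n, cmeas (f_ n)) ->
  (forall x, ccvg_seq (fun n => f_ n x) (f x)) -> mfun G ->
  (forall n x, cabs (f_ n x) <= G x) -> (nint mu (fun x => (G x ^+ 2)%R) < +oo)%E ->
  inL2 f /\ forall e : R, 0 < e -> \forall n \near \oo, (Nm (fun x => (f x - f_ n x)%R) <= e%:E)%E.
Proof.
move=> mf_ cf mG fG G2; have mf := cmeas_lim mf_ cf.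
have fG' x : cabs (f x) <= G x.
  by apply: (cvgr_to_le (ccvg_cabs (cf x))); apply: nearW.
split=> [|e e0]; first exact: inL2_dom fG' G2.
apply: (@nint_dct _ _ _ mu (fun n x => cabs2 (f x - f_ n x)) (fun x => 4 * G x ^+ 2)).
- by move=> n; apply: cmeas_cabs2; exact: cmeasB.
- pos.
- move=> x; rewrite -[X in _ --> X](@cabs20 R); apply: ccvg_cabs2.
  by rewrite -(subrr (f x)); apply: ccvgB => //; exact: ccvg_cst.
- meas.
- rewrite nintZ//; [exact: lte_mul_pinfty|exact: measurable_funX|by move=> x; exact: sqr_ge0].
- move=> n x; apply: le_trans (cabs2B _ _) _; rewrite !cabs2E.
  have h1 : cabs (f x) ^+ 2 <= G x ^+ 2 by rewrite ler_pXn2r ?nnegrE ?cabs_ge0// (le_trans (cabs_ge0 _) (fG' x)).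
  have h2 : cabs (f_ n x) ^+ 2 <= G x ^+ 2 by rewrite ler_pXn2r ?nnegrE ?cabs_ge0// (le_trans (cabs_ge0 _) (fG n x)).
  lra.
- exact: e0.
Qed.

Variable S : (T -> R[i]) -> Prop.
Hypothesis cS : closed_subspace S.

Lemma closed_dct (f_ : nat -> T -> R[i]) f (G : T -> R) : (forall n, S (f_ n)) -> (forall n, cmeas (f_ n)) ->
  (forall x, ccvg_seq (fun n => f_ n x) (f x)) -> mfun G ->
  (forall n x, cabs (f_ n x) <= G x) -> (nint mu (fun x => (G x ^+ 2)%R) < +oo)%E -> S f.
Proof.
move=> Sf mf cf mG fG G2; have [lf c0] := Nm_dct mf cf mG fG G2.
apply: (cS.2) => // e e0.
by have [N _ /(_ N (leqnn _)) h] := c0 e e0; exists (f_ N).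
Qed.

Lemma closed_subspace_eq f g : inL2 f -> S g -> Nm (fun x => f x - g x) = 0%E -> S f.
Proof. by move=> lf Sg N0; apply: (cS.2) => // e e0; exists g => //; rewrite N0 lee_fin ltW. Qed.
Lemma closed_subspace0 f : S f -> S (fun=> 0).
Proof.
move=> Sf; have := cS.1 f f (-1) Sf Sf; congr S; apply/funext => x; by rewrite mulN1r subrr.
Qed.

Lemma closedZ c f : S f -> S (fun x => c * f x).
Proof.
move=> Sf; have := cS.1 _ _ c (closed_subspace0 Sf) Sf; congr S; apply/funext => x; by rewrite add0r.
Qed.
Lemma closed_sum (f0 : T -> R[i]) (I : Type) (l : seq I) (F : I -> T -> R[i]) : S f0 -> (forall i, S (F i)) ->
  S (fun x => \sum_(i <- l) F i x).
Proof.
move=> S0 SF; elim: l => [|i l IH].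
  by have := closed_subspace0 S0; congr S; apply/funext => x; rewrite big_nil.
have := cS.1 _ _ 1 (SF i) IH; congr S; apply/funext => x; by rewrite big_cons mul1r.
Qed.

Lemma nint_indic (A : set T) : measurable A -> nint mu \1_A = mu A.
Proof. by move=> mA; rewrite /nint integral_indic// setIT. Qed.

Variables (G : set (set T)) (E : nat -> set T).
Hypothesis GI : setI_closed G.
Hypothesis GE : @measurable d T = <<s G >>.
Hypothesis mE : forall n, measurable (E n).
Hypothesis E_fin : forall n, (mu (E n) < +oo)%E.
Hypothesis E_nd : nondecreasing_seq E.
Hypothesis E_cover : \bigcup_n E n = setT.
Hypothesis SE : forall n, S (fun x => cR (\1_(E n) x)).
Hypothesis SGE : forall A n, G A -> S (fun x => cR (\1_(A `&` E n) x)).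

Let cvg_indic (F : nat -> set T) x : nondecreasing_seq F ->
  (\1_(F n) x : R) @[n --> \oo] --> (\1_(\bigcup_n F n) x : R).
Proof.
move=> ndF; have [[N _ FN]|nF] := pselect ((\bigcup_n F n) x).
  rewrite [X in _ --> X]indicE mem_set; last by exists N.
  apply: cvg_near_cst; exists N => // n /= Nn.
  by rewrite indicE mem_set//; have /subsetPset := ndF _ _ Nn; apply.
rewrite [X in _ --> X]indicE memNset//.
apply: cvg_near_cst; apply: nearW => n.
by rewrite indicE memNset// => Fn; apply: nF; exists n.
Qed.

Let indic_le1 (A : set T) x : 0 <= (\1_A x : R) <= 1.
Proof. by rewrite indicE; case: (_ \in _); rewrite ?lexx ?ler01. Qed.
(** Dynkin's argument from an intersection-stable generator to the sigma-algebra, carried out inside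
    the sets [E n] of finite measure so that every indicator involved is square integrable. *)
Lemma closed_measurable n A : measurable A -> S (fun x => cR (\1_(A `&` E n) x)).
Proof.
move=> mA; pose H := [set A | measurable A /\ S (fun x => cR (\1_(A `&` E n) x))].
suff /(_ A) [] : @measurable _ T `<=` H by [].
rewrite {1}GE; apply: lambda_system_subset => //; last first.
  by move=> B GB; split; [rewrite GE; exact: sub_sigma_algebra|exact: SGE].
split => //.
- by split=> //; rewrite setTI.
- move=> B C CB [mB SB] [mC SC]; split; first exact: measurableD.
  have := cS.1 _ _ (-1) SB SC; congr S; apply/funext => x.
  rewrite mulN1r -cRB !indicE; congr cR.
  have [Ex|Ex] := boolP (x \in E n); last first.
    by rewrite !memNset ?subrr// => -[_ /mem_set]; rewrite (negPf Ex).
  have iE (D : set T) : (x \in D `&` E n) = (x \in D) by rewrite in_setI Ex andbT.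
  rewrite !iE in_setD; have := CB x.
  by case: (boolP (x \in B)) => xB; case: (boolP (x \in C)) => xC; rewrite ?subr0 ?subrr// => /(_ (set_mem xC)) /mem_set; rewrite (negPf xB).
- move=> F ndF FH; split; first by apply: bigcup_measurable => k _; case: (FH k).
  apply: (@closed_dct (fun k x => cR (\1_(F k `&` E n) x)) _ \1_(E n)).
  + by move=> k; case: (FH k).
  + by move=> k; apply: cmeas_cR; apply: measurable_indic; apply: measurableI => //; case: (FH k).
  + move=> x; apply: ccvg_cR; rewrite setI_bigcupl; apply: cvg_indic => i j ij.
    by apply/subsetPset; apply: setSI; apply/subsetPset; exact: ndF.
  + meas.
  + move=> k x; rewrite cabs_cRp; last by [].
    rewrite !indicE in_setI; case: (_ \in F k); case: (_ \in E n) => //=.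
  + rewrite (eq_nint \1_(E n)) ?nint_indic// => x.
    by rewrite indicE; case: (_ \in _); rewrite ?expr0n// expr1n.
Qed.

Lemma closed_nonneg (f : T -> R) : mfun f -> (forall x, 0 <= f x) ->
  (nint mu (fun x => (f x ^+ 2)%R) < +oo)%E -> S (fun x => cR (f x)).
Proof.
move=> mf f0 f2.
pose mF := EFin_meas mf.
pose h := nnsfun_approx measurableT mF.
have hf n x : h n x <= f x.
  by rewrite -lee_fin /h nnsfun_approxE; apply: le_approx => // y _; rewrite lee_fin.
apply: (@closed_dct (fun n x => cR (h n x * \1_(E n) x)) _ f) => //.
- move=> n.
  have SE' (y : R) : S (fun x => cR (\1_(h n @^-1` [set y] `&` E n) x)).
    by apply: closed_measurable; meas.
  have := closed_sum (finmap.enum_fset (fset_set (range (h n)))) (SE n) (fun y : R => closedZ (cR y) (SE' y)).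
  congr S; apply/funext => x; rewrite (fimfunE (h n) x) fsbig_finite//=.
  rewrite mulr_suml cR_sum; apply: eq_bigr => y _; rewrite -cRM -mulrA; congr (cR (_ * _)).
  by rewrite !indicE in_setI; case: (x \in E n); rewrite ?andbT ?andbF ?mulr1 ?mulr0.
- by move=> n; apply: cmeas_cR; apply: measurable_funM => //; meas.
- move=> x; apply: ccvg_cR; rewrite -[X in _ --> X]mulr1; apply: cvgM.
    by have := @cvg_nnsfun_approx _ _ _ _ measurableT _ mF (fun x _ => f0 x) x I => /fine_cvgP[].
  by have := @cvg_indic E x E_nd; rewrite E_cover indicT.
- move=> n x; have /andP[i0 i1] := indic_le1 (E n) x.
  by rewrite cabs_cRp ?mulr_ge0//; apply: le_trans (hf n x); rewrite ler_piMr.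
Qed.

Theorem closed_subspace_full f : inL2 f -> S f.
Proof.
move=> [[mr mi] f2].
have part (r : T -> R) : mfun r -> (forall x, `|r x| <= cabs (f x)) -> S (fun x => cR (r x)).
  move=> mr' rf.
  have half (s : T -> R) : mfun s -> (forall x, 0 <= s x <= cabs (f x)) -> S (fun x => cR (s x)).
    move=> ms sf; have s0 x : 0 <= s x by case/andP: (sf x).
    apply: closed_nonneg => //; apply: le_lt_trans f2; apply: le_nint.
    - meas.
    - meas.
    - by move=> x; exact: sqr_ge0.
    - by move=> x; rewrite cabs2E ler_pXn2r ?nnegrE ?cabs_ge0//; case/andP: (sf x).
  have Sp : S (fun x => cR ((`|r x| + r x) / 2)).
    apply: half; first by apply: measurable_funM => //; apply: measurable_funD => //; exact: measurableT_comp.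
    move=> x; have := rf x; have := ler_norm (r x); have := ler_norm (- r x); rewrite normrN; lra.
  have Sn : S (fun x => cR ((`|r x| - r x) / 2)).
    apply: half; first by apply: measurable_funM => //; apply: measurable_funB => //; exact: measurableT_comp.
    move=> x; have := rf x; have := ler_norm (r x); have := ler_norm (- r x); rewrite normrN; lra.
  have := cS.1 _ _ (-1) Sp Sn; congr S; apply/funext => x; rewrite mulN1r -cRB; congr cR; lra.
have := cS.1 _ _ (iC R) (part _ mr (fun x => cre_le_cabs (f x))) (part _ mi (fun x => cim_le_cabs (f x))).
by congr S; apply/funext => x; apply: cP; rewrite !(creE, cimE); ring.
Qed.
End ClosedSubspace.

Lemma inL2_indic {R : realType} {d} {T : measurableType d} (m : {measure set T -> \bar R}) (A E : set T) :
  measurable A -> measurable E -> (m E < +oo)%E -> inL2 m (fun x => cR (\1_(A `&` E) x)).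
Proof.
move=> mA mE Ef; apply: (inL2_dom (G := \1_(A `&` E))).
- by apply: cmeas_cR; apply: measurable_indic; meas.
- by apply: measurable_indic; meas.
- by move=> x; rewrite cabs_cRp// indicE; case: (_ \in _); rewrite ?ler01.
rewrite (eq_nint \1_(A `&` E)); last by move=> x; rewrite indicE; case: (_ \in _); rewrite ?expr0n// expr1n.
rewrite nint_indic; last by meas.
by apply: le_lt_trans Ef; apply: (@le_measure _ _ _ m); rewrite ?inE//; meas.
Qed.

(** * Density of tensor products *)

Section TensorDensity.
Variable R : realType.
Context {d1 d2} {T1 : measurableType d1} {T2 : measurableType d2}.
Variables (m1 : {sigma_finite_measure set T1 -> \bar R})
  (m2 : {sigma_finite_measure set T2 -> \bar R}).

Lemma Nm_tensor (f : T1 -> R[i]) (g : T2 -> R[i]) : cmeas f -> cmeas g ->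
  Nm (prodm m1 m2) (fun z => f z.1 * g z.2) = (Nm m1 f * Nm m2 g)%E.
Proof.
move=> mf mg; rewrite -(nint_tensor m1 m2 (a := fun x => cabs2 (f x)) (b := fun x => cabs2 (g x))); last first.
- pos.
- pos.
- meas.
- meas.
by apply: eq_nint => z; rewrite cabs2M.
Qed.

(** Rectangles are stable under intersection and generate the product sigma-algebra, and the
    indicator of a rectangle of finite measure is a tensor product. *)
Lemma tensor_full (S : (T1 * T2 -> R[i]) -> Prop) : closed_subspace (prodm m1 m2) S ->
  (forall f g, inL2 m1 f -> inL2 m2 g -> S (fun z => f z.1 * g z.2)) -> forall f, inL2 (prodm m1 m2) f -> S f.
Proof.
move=> cS Sfg.
have /sigma_finiteP[E1 [E1T E1nd E1m]] := sigma_finiteT m1.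
have /sigma_finiteP[E2 [E2T E2nd E2m]] := sigma_finiteT m2.
have Srect (A : set T1) (B : set T2) n : measurable A -> measurable B ->
    S (fun z => cR (\1_((A `*` B) `&` (E1 n `*` E2 n)) z)).
  move=> mA mB; have [e1 e1f] := E1m n; have [e2 e2f] := E2m n.
  have := Sfg _ _ (inL2_indic mA e1 e1f) (inL2_indic mB e2 e2f).
  congr S; apply/funext => z; rewrite -cRM; congr cR; rewrite -setXI !indicE -natrM mulnb; congr ((nat_of_bool _)%:R).
  by rewrite in_setX.
apply: (@closed_subspace_full _ _ _ (prodm m1 m2) S cS
  [set A `*` B | A in measurable & B in measurable] (fun n => E1 n `*` E2 n)).
- move=> X Y [X1 mX1 [X2 mX2 <-{X}]] [Y1 mY1 [Y2 mY2 <-{Y}]].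
  exists (X1 `&` Y1); first by meas.
  by exists (X2 `&` Y2); [exact: measurableI|rewrite setXI].
- exact: measurable_prod_measurableType.
- by move=> n; apply: measurableX; [case: (E1m n)|case: (E2m n)].
- move=> n; have [e1 e1f] := E1m n; have [e2 e2f] := E2m n.
  suff : ((m1 \x m2)%E (E1 n `*` E2 n) < +oo)%E by [].
  rewrite product_measure1E//; apply: lte_mul_pinfty => //; rewrite ?ge0_fin_numE ?measure_ge0//.
- move=> i j ij; apply/subsetPset => -[x y] /= [h1 h2]; split.
    by have /subsetPset := E1nd _ _ ij; apply.
  by have /subsetPset := E2nd _ _ ij; apply.
- apply/seteqP; split => // -[x y] _.
  have : (\bigcup_i E1 i) x by rewrite -E1T.
  have : (\bigcup_i E2 i) y by rewrite -E2T.
  move=> [j _ jy] [i _ ix]; exists (maxn i j) => //; split => /=.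
    by have /subsetPset := E1nd _ _ (leq_maxl i j); apply.
  by have /subsetPset := E2nd _ _ (leq_maxr i j); apply.
- move=> n; have := Srect setT setT n measurableT measurableT.
  by congr S; apply/funext => z; rewrite setXTT setTI.
- by move=> _ n [A mA [B mB <-]]; exact: Srect.
Qed.
End TensorDensity.

(** * Density of unit Gaussians on the line *)

Section GaussianDensity1.
Variable R : realType.
Local Notation lam := (@lam R).
Variable S : (R -> R[i]) -> Prop.
Hypothesis cS : closed_subspace lam S.
Hypothesis Sgauss : forall b, S (fun x => cR (rgauss 1 (x - b))).

Lemma rgauss_sqr (c x : R) : rgauss c x ^+ 2 = rgauss (2 * c) x.
Proof. by rewrite /rgauss expr2 -expRD; congr expR; ring. Qed.
Lemma inL2_rgauss (C c : R) (f : R -> R[i]) : 0 <= C -> 0 < c -> cmeas f -> (forall k, cabs (f k) <= C * rgauss c k) ->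
  inL2 lam f.
Proof.
move=> C0 c0 mf fc; apply: (inL2_dom mf _ fc).
  meas.
rewrite (eq_nint (fun x => C ^+ 2 * rgauss (2 * c) x)); last by move=> x; rewrite exprMn rgauss_sqr.
rewrite nintZ ?sqr_ge0//; first by apply: lte_mul_pinfty; rewrite ?lee_fin ?sqr_ge0// nint_rgauss_lty// mulr_gt0.
- meas.
- by move=> x; exact: expR_ge0.
Qed.

(** The translates of the unit Gaussian are, up to a constant, the transforms of [egauss (1 / 4) y].
    Plancherel carries convergence from symbols to transforms, so [gaussian_class] applies, and its
    width [1 / (4 c)] corresponds to [rgauss c]. *)
Lemma gaussian_narrow (c b : R) : 1 <= c -> S (fun x => cR (rgauss c (x - b))).
Proof.
move=> c1; have c0 : 0 < c by apply: lt_le_trans c1.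
pose K (w : R -> R[i]) := [/\ cL1 lam w, inL2 lam w & S (ft w)].
have Klin w w' a : K w -> K w' -> K (fun k => w k + a * w' k).
  move=> [l1 l2 s] [l1' l2' s']; have la := cL1Z a l1'.
  split; [exact: cL1D|exact: inL2Dz|].
  have := cS.1 _ _ a s s'; congr S; apply/funext => x.
  by rewrite -ftZ// -ftD.
have Klim (w_ : nat -> R -> R[i]) w e : 0 < e -> (forall n, K (w_ n)) ->
    (forall n k, cabs (w_ n k) <= rgauss e k) -> (forall k, ccvg_seq (fun n => w_ n k) (w k)) -> K w.
  move=> e0 Kn wn wc; have mn n : cmeas (w_ n) by case: (Kn n) => -[].
  have G2 : (nint lam (fun x => (rgauss e x ^+ 2)%R) < +oo)%E.
    by rewrite (eq_nint (rgauss (2 * e))) ?nint_rgauss_lty ?mulr_gt0// => x; rewrite rgauss_sqr.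
  have [l2 N0] := Nm_dct mn wc (mfun_rgauss e) wn G2.
  have l1 : cL1 lam w by exact: (cL1_dct mn wc (mfun_rgauss e) (nint_rgauss_lty e0) wn).
  split=> //; apply: cS.2.
    split; first exact: cmeas_ft.
    by apply: le_lt_trans (plancherel_le l1) _; apply: lte_mul_pinfty; rewrite ?lee_fin ?mulr_ge0 ?pi_ge0//; case: l2.
  have p0 : 0 < 2 * pi :> R by rewrite mulr_gt0 ?pi_gt0.
  move=> d d0; have [N _ /(_ N (leqnn _)) h] := N0 (d / (2 * pi)) (divr_gt0 d0 p0).
  have [l1N _ SN] := Kn N; exists (ft (w_ N)) => //.
  have lN := cL1N l1N.
  have -> : Nm lam (fun x => ft w x - ft (w_ N) x) = Nm lam (ft (fun k => w k - w_ N k)).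
    apply: eq_nint => x; congr cabs2; rewrite ftD//; congr (_ + _).
    by rewrite /ft -cintN; [apply: eq_cint => t; rewrite mulNr|exact: cL1_expi].
  apply: le_trans (plancherel_le (cL1D l1 lN)) _.
  apply: le_trans (lee_wpmul2l _ h) _; first by rewrite lee_fin ltW.
  by rewrite -EFinM mulrC divfK// lt0r_neq0.
have hzft (r y x : R) : ft (egauss (cR r) y) x = hz (cR r) (x + y).
  by apply: eq_cint => k; rewrite /egauss -cexp_im -cexpD -addrA -mulrDr -cRD; congr cexp; congr (_ + _ * cR _); ring.
have K0 y : K (egauss (cR 4^-1) y).
  have q0 : 0 < 4^-1 :> R by [].
  split; first exact: cL1_egauss.
    apply: (inL2_rgauss (C := 1) (c := 4^-1)) => //; first by meas.
    by move=> k; rewrite cabs_egauss mul1r.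
  have := closedZ cS (cR (Num.sqrt (pi / 4^-1))) (Sgauss (- y)); congr S; apply/funext => x.
  have e1 : (4 * 4^-1)^-1 = 1 :> R by rewrite divff// invr1.
  by rewrite hzft hz_real// e1 -cRM opprK.
have c40 : 0 < (4 * c)^-1 by pos.
have cr : 0 < (4 * c)^-1 <= 4^-1.
  by rewrite c40 lef_pV2 ?posrE ?mulr_gt0//; rewrite ler_peMr.
have [_ _] := gaussian_class Klin Klim K0 (- b) cr.
have s0 : Num.sqrt (pi / (4 * c)^-1) != 0 by rewrite sqrtr_eq0 -ltNge divr_gt0 ?pi_gt0.
move=> /(closedZ cS (cR (Num.sqrt (pi / (4 * c)^-1))^-1)); congr S; apply/funext => x.
have e2 : (4 * (4 * c)^-1)^-1 = c by rewrite invfM invrK mulrA mulVf// mul1r.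
by rewrite hzft hz_real// e2 -cRM mulrA mulVf// mul1r.
Qed.
(** A power of a Gaussian is a narrower Gaussian with the same centre, so [S] contains every
    polynomial in it without constant term. The factor with exponent [i] is there for the induction
    on [N]. *)
Lemma pow_gaussian (c b : R) (i n N : nat) : 1 <= c -> (0 < n)%N ->
  S (fun x => cR (rgauss c (x - b) ^+ i * (1 - (1 - rgauss c (x - b) ^+ n) ^+ N))).
Proof.
move=> c1 n0.
have Spow m : (0 < m)%N -> S (fun x => cR (rgauss c (x - b) ^+ m)).
  move=> m0; have m1 : 1 <= m%:R :> R by rewrite ler1n.
  have mc : 1 <= m%:R * c by apply: (le_trans c1); rewrite ler_peMl// (le_trans ler01 c1).
  have := gaussian_narrow b mc; congr S; apply/funext => x; congr cR.
  by rewrite /rgauss -expRM_natl; congr expR; ring.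
elim: N i => [|N IH] i.
  have := closed_subspace0 cS (Sgauss b); congr S; apply/funext => x.
  by rewrite expr0 subrr mulr0 cR0.
have := cS.1 _ _ 1 (cS.1 _ _ (-1) (IH i) (IH (i + n)%N)) (Spow (i + n)%N _).
rewrite addn_gt0 n0 orbT => /(_ isT); congr S; apply/funext => x.
by rewrite mulN1r mul1r -cRB -cRD; congr cR; rewrite exprD [in RHS]exprS; ring.
Qed.

Lemma pow_le_half (n : nat) : n.+1%:R * 2^-1 ^+ n <= 1 :> R.
Proof.
elim: n => [|n IH]; first by rewrite expr0 mulr1.
apply: le_trans IH; rewrite exprS mulrA ler_wpM2r ?exprn_ge0 ?invr_ge0//.
by rewrite ler_pdivrMr// -natrM ler_nat mulnC mul2n -addnn addnS ltnS leq_addr.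
Qed.
Lemma n_pow_le (q : R) n : 0 <= q -> q < 1 -> n%:R * q ^+ n <= (1 - q)^-1.
Proof.
move=> q0 q1; have p0 : 0 < 1 - q by rewrite subr_gt0.
have h1 : q ^+ n <= expR (- (n%:R * (1 - q))).
  rewrite -mulrN expRM_natl; have := expR_ge1Dx (- (1 - q)).
  rewrite opprB addrC subrK => h; case: n => [|n]; first by [].
  by rewrite ler_pXn2r ?nnegrE ?expR_ge0.
have h2 := expR_ge1Dx (n%:R * (1 - q)).
rewrite -[leRHS]mul1r ler_pdivlMr// mulrAC.
have x0 : 0 <= n%:R * (1 - q) by rewrite mulr_ge0// ltW.
apply: (@le_trans _ _ (expR (n%:R * (1 - q)) * expR (- (n%:R * (1 - q))))).
  by rewrite ler_pM ?exprn_ge0//; apply: le_trans h2; rewrite lerDr.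
by rewrite -expRD subrr expR0.
Qed.

Lemma bernoulli (u : R) N : 0 <= u <= 1 -> 1 - (1 - u) ^+ N <= N%:R * u.
Proof.
move=> /andP[u0 u1]; elim: N => [|N IH]; first by rewrite expr0 subrr mul0r.
have h : (1 - u) ^+ N <= 1 by rewrite exprn_ile1 ?subr_ge0 ?gerBl.
have : u * (1 - u) ^+ N <= u by rewrite ler_piMr.
rewrite exprS -natr1; move: IH; set p := (1 - u) ^+ N.
have -> : (1 - u) * p = p - u * p by ring.
have -> : (N%:R + 1) * u = N%:R * u + u by ring.
by move: (u * p) (N%:R * u) => q w; lra.
Qed.

(* [1 - (1 - t^n)^(n K^n)] tends to the indicator of [t >= 1/K]; the factor [n]
   in the exponent settles the boundary point. *)
Lemma threshold_cvg (K : nat) (t : R) : (0 < K)%N -> 0 <= t <= 1 ->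
  1 - (1 - t ^+ n.+1) ^+ (n.+1 * K ^ n.+1) @[n --> \oo] --> ((K%:R^-1 <= t)%R%:R : R).
Proof.
move=> K0 /andP[t0 t1]; have Kp : 0 < K%:R :> R by rewrite ltr0n.
have tn n : 0 <= t ^+ n <= 1 by rewrite exprn_ge0 ?exprn_ile1.
have [Kt|tK] := leP.
  rewrite -[X in _ --> X]subr0; apply: cvgB; first exact: cvg_cst.
  apply: (cvg0_le (w := fun n => expR (- n.+1%:R))); last first.
    have -> : (fun n : nat => expR (- n.+1%:R : R)) = (fun n => expR (-1) ^+ n.+1).
      by apply/funext => n; rewrite -expRM_natl mulrN1.
    have e1 : `|expR (-1) : R| < 1 by rewrite ger0_norm ?expR_ge0// -expR0 ltr_expR ltrN10.
    have := cvg_expr e1 => h; rewrite -(cvg_shiftS (fun n => expR (-1) ^+ n)) in h; exact: h.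
  move=> n; have /andP[h0 h1] := tn n.+1.
  have u0 : 0 <= 1 - t ^+ n.+1 by rewrite subr_ge0.
  rewrite ger0_norm ?exprn_ge0//.
  apply: (@le_trans _ _ (expR (- t ^+ n.+1) ^+ (n.+1 * K ^ n.+1))).
    by rewrite ler_pXn2r ?nnegrE ?expR_ge0 ?muln_gt0 ?expn_gt0 ?K0// expR_ge1Dx.
  rewrite -expRM_natl ler_expR mulrN lerN2 natrM -mulrA -[leLHS]mulr1 ler_wpM2l// natrX -exprMn.
  by apply: exprn_ege1; rewrite mulrC -ler_pdivrMr// div1r.
set r := K%:R * t; have r0 : 0 <= r by pos.
have r1 : r < 1 by rewrite /r mulrC -ltr_pdivlMr// div1r.
pose q := Num.sqrt r; have q0 : 0 <= q by pos.
have q1 : q < 1 by rewrite /q -[ltRHS]sqrtr1 ltr_sqrt.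
have w0 : (1 - q)^-1 * q ^+ n.+1 @[n --> \oo] --> 0.
  rewrite -[X in _ --> X](mulr0 (1 - q)^-1); apply: cvgM; first exact: cvg_cst.
  have e1 : `|q| < 1 by rewrite ger0_norm.
  by have := cvg_expr e1 => h; rewrite -(cvg_shiftS (fun n => q ^+ n)) in h; exact: h.
apply: cvg0_le w0 => n; have /andP[h0 h1] := tn n.+1.
have p1 : (1 - t ^+ n.+1) ^+ (n.+1 * K ^ n.+1) <= 1 by rewrite exprn_ile1 ?subr_ge0 ?gerBl.
rewrite ger0_norm ?subr_ge0//; apply: le_trans (bernoulli _ (tn n.+1)) _.
rewrite natrM natrX -mulrA -exprMn -/r -{1}[r]sqr_sqrtr// -/q -exprM mulnC exprM expr2 mulrA.
by rewrite ler_wpM2r ?exprn_ge0//; apply: n_pow_le.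
Qed.

(** A majorant uniform in [n]: if [K t >= 1 / 2] the right side is at least [1]; otherwise
    Bernoulli's inequality gives [(n + 1) (K t)^(n + 1)], and [(n + 1) 2^(- n) <= 1]. *)
Lemma threshold_le (K : nat) (t : R) n : (0 < K)%N -> 0 <= t <= 1 ->
  0 <= 1 - (1 - t ^+ n.+1) ^+ (n.+1 * K ^ n.+1) <= 2 * K%:R * t.
Proof.
move=> K0 /andP[t0 t1]; have Kp : 0 < K%:R :> R by rewrite ltr0n.
have tn : 0 <= t ^+ n.+1 <= 1 by rewrite exprn_ge0 ?exprn_ile1.
have /andP[h0 h1] := tn.
rewrite subr_ge0 exprn_ile1 ?subr_ge0 ?gerBl//=.
have [Kt|Kt] := leP 2^-1 (K%:R * t).
  apply: (@le_trans _ _ 1); first by rewrite gerBl exprn_ge0 ?subr_ge0.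
  by rewrite -mulrA mulrC -ler_pdivrMr// div1r.
apply: le_trans (bernoulli _ tn) _.
have Kt0 : 0 <= K%:R * t by pos.
rewrite natrM natrX -mulrA -exprMn exprSr; apply: (@le_trans _ _ (1 * (K%:R * t))).
  rewrite [leLHS]mulrA ler_wpM2r//; apply: le_trans (pow_le_half n).
  by rewrite ler_wpM2l// lerXn2r ?nnegrE ?invr_ge0// ltW.
by rewrite -[leRHS]mulrA ler_wpM2r// ler1n.
Qed.

(** The interval is a superlevel set of a Gaussian about its midpoint, at height [1 / K] with
    [c = ln K / del^2]. [K] is taken so large that [c >= 1], the range of [gaussian_narrow]; the
    polynomials of [threshold_cvg] then converge to the indicator. *)
Lemma closed_itv (a b : R) : a < b -> S (fun x => cR (\1_`[a, b] x)).
Proof.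
move=> ab; pose m := (a + b) / 2; pose del := (b - a) / 2.
have d0 : 0 < del by rewrite divr_gt0// subr_gt0.
pose K := (Num.truncn (expR (del ^+ 2))).+1.
have lnKd : del ^+ 2 <= ln K%:R.
  by rewrite -[leLHS]expRK ler_ln ?posrE ?expR_gt0// ltW// /K truncnS_gt.
pose c := ln K%:R / del ^+ 2.
have c1 : 1 <= c by rewrite /c ler_pdivlMr ?exprn_gt0// mul1r.
have c0 : 0 < c by apply: lt_le_trans c1.
have g01 x : 0 <= rgauss c (x - m) <= 1.
  by rewrite expR_ge0/= -expR0 ler_expR oppr_le0 mulr_ge0 ?sqr_ge0// ltW.
apply: (@closed_dct _ _ _ lam S cS (fun n x => cR (1 - (1 - rgauss c (x - m) ^+ n.+1) ^+ (n.+1 * K ^ n.+1))) _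
  (fun x => 2 * K%:R * rgauss c (x - m))).
- move=> n; have := @pow_gaussian c m 0 n.+1 (n.+1 * K ^ n.+1) c1 isT.
  by congr S; apply/funext => x; rewrite expr0 mul1r.
- move=> n; apply: cmeas_cR; apply: measurable_funB => //; apply: measurable_funX.
  by apply: measurable_funB => //; apply: measurable_funX; exact: mfun_rgauss_sub.
- move=> x; apply: ccvg_cR.
  rewrite (_ : \1_`[a, b] x = (K%:R^-1 <= rgauss c (x - m))%R%:R); first exact: threshold_cvg.
  rewrite indicE; congr ((nat_of_bool _)%:R); rewrite mem_setE in_itv /=.
  have eK : expR (- ln K%:R) = K%:R^-1 :> R by rewrite expRN lnK// posrE.
  have -> : (K%:R^-1 <= rgauss c (x - m)) = ((x - m) ^+ 2 <= del ^+ 2).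
    rewrite -eK /rgauss ler_expR lerN2 /c -mulrA -[leRHS]mulr1 ler_pM2l; last first.
      by apply: lt_le_trans lnKd; rewrite exprn_gt0.
    by rewrite mulrC ler_pdivrMr ?exprn_gt0// mul1r.
  rewrite -(real_normK (num_real (x - m))).
  rewrite ler_pXn2r ?nnegrE ?(ltW d0)// ler_distl; congr (_ && _).
    by congr (_ <= _); rewrite /m /del; field.
  by congr (_ <= _); rewrite /m /del; field.
- by apply: measurable_funM => //; exact: mfun_rgauss_sub.
- move=> n x; have /andP[h0 h1] := @threshold_le K (rgauss c (x - m)) n isT (g01 x).
  by rewrite cabs_cRp.
rewrite (eq_nint (fun x : R => (2 * K%:R) ^+ 2 * rgauss (2 * c) (x - m))); last first.
  by move=> x; rewrite exprMn rgauss_sqr.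
by apply: nint_rgauss_sub_lty; rewrite ?sqr_ge0// mulr_gt0.
Qed.

(** Half-open intervals form the intersection-stable generator required by the density criterion;
    they differ from closed ones by a null set. *)
Lemma closed_ocitv (a b : R) : S (fun x => cR (\1_`]a, b] x)).
Proof.
have [ba|ab] := leP b a.
  have := closed_subspace0 cS (Sgauss 0); congr S; apply/funext => x.
  by rewrite set_itv_ge ?indic0 ?cR0// bnd_simp -leNgt.
suff [h1 h2] : inL2 lam (fun x : R => cR (\1_`]a, b] x)) /\
    Nm lam (fun x : R => cR (\1_`]a, b] x) - cR (\1_`[a, b] x)) = 0%E.
  exact: (closed_subspace_eq cS h1 (closed_itv ab) h2).
split.
  rewrite -[X in inL2 _ X]/(fun x : R => cR (\1_`]a, b] x)) -[`]a, b]%classic]setTI.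
  apply: (@inL2_indic _ _ _ lam setT _ measurableT (mfun_lam_itv _)).
  by rewrite /= /lam lebesgue_measure_itv; case: ifP => // _; exact: ltry.
have z0 : nint lam (fun=> 0 : R) = 0%E by rewrite /nint integral0.
rewrite -z0; apply: (nint_eq_ne (a := a)).
- meas.
- meas.
- move=> t ta; rewrite -cRB !indicE !mem_setE !in_itv /= (lt_neqAle a) eq_sym ta /=.
  by rewrite subrr cabs2_cR expr0n.
Qed.

Theorem gaussians_dense1 f : inL2 lam f -> S f.
Proof.
have EI A n : @ocitv R A -> @ocitv R (A `&` `](- n%:R), n%:R]).
  by move=> oA; apply: ocitvI => //; exists (- n%:R, n%:R).
apply: (@closed_subspace_full _ _ _ lam S cS (@ocitv R) (fun n => `](- n%:R), n%:R]%classic)).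
- exact: ocitvI.
- by [].
- meas.
- by move=> n; rewrite /= /lam lebesgue_measure_itv; case: ifP => // _; exact: ltry.
- move=> i j ij; apply/subsetPset => x /=; rewrite !in_itv /= => /andP[h1 h2].
  have ij' : i%:R <= j%:R :> R by rewrite ler_nat.
  by rewrite (le_lt_trans _ h1) ?lerN2// (le_trans h2).
- apply/seteqP; split => // x _; exists (Num.truncn `|x|).+1 => //=; rewrite in_itv /=.
  have h : `|x| < (Num.truncn `|x|).+1%:R by exact: truncnS_gt.
  by move: h; rewrite ltr_norml => /andP[-> /ltW].
- by move=> n; exact: closed_ocitv.
- move=> A n /(EI _ n) [[a b] _ <-]; exact: closed_ocitv.
Qed.
End GaussianDensity1.

(** * Density of unit Gaussians in three dimensions *)

Section GaussianDensity3.
Variable R : realType.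
Local Notation lam := (@lam R).
Local Notation lam3 := (@lam3 R).
Variable S : (pt R -> R[i]) -> Prop.
Hypothesis cS : closed_subspace lam3 S.
Hypothesis Sgauss : forall b, S (gauss b).

Let rg (b x : R) : R[i] := cR (rgauss 1 (x - b)).
Let rg_L2 b : inL2 lam (rg b).
Proof.
have m : cmeas (rg b) by apply: cmeas_cR; exact: mfun_rgauss_sub.
apply: (inL2_dom m (mfun_rgauss_sub 1 b)).
  by move=> x; rewrite /rg cabs_cRp// expR_ge0.
rewrite (eq_nint (fun x : R => 1 * rgauss (2 * 1) (x - b))); last by move=> x; rewrite rgauss_sqr mul1r.
by apply: nint_rgauss_sub_lty => //; rewrite mulr_gt0.
Qed.

Lemma Nm_tens3 (f g h : R -> R[i]) : cmeas f -> cmeas g -> cmeas h ->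
  Nm lam3 (tens3 f g h) = (Nm lam f * Nm lam g * Nm lam h)%E.
Proof.
move=> mf mg mh; rewrite /Nm -nint_tens3//; try exact: cmeas_cabs2; try by [].
by apply: eq_nint => x; rewrite /tens3 !cabs2M.
Qed.
Let lim (p : \bar R) (e : R) : (0 <= p)%E -> (p < +oo)%E -> 0 < e -> exists2 d : R, 0 < d &
  forall x : \bar R, (0 <= x)%E -> (x <= d%:E)%E -> (x * p <= e%:E)%E.
Proof.
case: p => [p| |]//; rewrite lee_fin => p0 _ e0; exists (e / (p + 1)); first by rewrite divr_gt0// ltr_wpDl.
move=> x x0 xd; apply: le_trans (lee_wpmul2r _ xd) _; first by [].
rewrite -EFinM lee_fin mulrAC ler_pdivrMr ?ltr_wpDl// ler_wpM2l ?(ltW e0)//.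
by rewrite lerDl.
Qed.

Lemma inL2_tens3 f g h : inL2 lam f -> inL2 lam g -> inL2 lam h -> inL2 lam3 (tens3 f g h).
Proof.
move=> [mf f2] [mg g2] [mh h2]; split; first exact: cmeas_tens3.
have fin (x : \bar R) : (0 <= x)%E -> (x < +oo)%E -> x \is a fin_num by move=> x0 xoo; rewrite ge0_fin_numE.
rewrite Nm_tens3//; apply: lte_mul_pinfty => //; first by apply: mule_ge0; exact: Nm_ge0.
by rewrite fin_numM// fin// Nm_ge0.
Qed.

(* Density of the Gaussians in each variable separately: the set of [f] for
   which [S] contains all the products with [f] in one given slot is a closed
   subspace of L2 of the line. *)
Let slot (A : (R -> R[i]) -> pt R -> R[i]) (p : \bar R) : (0 <= p)%E -> (p < +oo)%E ->
  (forall f g c x, A (fun t => f t + c * g t) x = A f x + c * A g x) ->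
  (forall f, inL2 lam f -> inL2 lam3 (A f)) ->
  (forall f, inL2 lam f -> Nm lam3 (A f) = (Nm lam f * p)%E) ->
  (forall b, S (A (rg b))) -> forall f, inL2 lam f -> S (A f).
Proof.
move=> p0 pf Alin AL2 AN Ab f lf.
suff [] : inL2 lam f /\ S (A f) by [].
apply: (gaussians_dense1 (S := fun f => inL2 lam f /\ S (A f))) => //.
split.
  move=> g h c [lg Sg] [lh Sh]; split; first exact: inL2Dz.
  by have := cS.1 _ _ c Sg Sh; congr S; apply/funext => x; rewrite Alin.
move=> g lg H; split => //; apply: cS.2; first exact: AL2.
move=> e e0; have [d d0 hd] := lim p0 pf e0; have [h [lh Sh] Nh] := H d d0.
exists (A h) => //.
have lgh : inL2 lam (fun x => g x - h x).
  have := inL2Dz (-1) lg lh; congr (inL2 _ _); apply/funext => x; by rewrite mulN1r.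
rewrite (_ : Nm lam3 (fun x => A g x - A h x) = Nm lam3 (A (fun x => g x - h x))).
  by rewrite AN//; apply: hd => //; exact: Nm_ge0.
  apply: eq_nint => x; congr cabs2.
  rewrite -mulN1r -Alin; congr (A _ x); apply/funext => t; by rewrite mulN1r.
by move=> b; split; [exact: rg_L2|exact: Ab].
Qed.

Theorem gaussians_dense3 f : inL2 lam3 f -> S f.
Proof.
have fin (x y : \bar R) : (0 <= x)%E -> (x < +oo)%E -> (y < +oo)%E -> (x * y < +oo)%E.
  by move=> x0 xoo yoo; apply: lte_mul_pinfty => //; rewrite ge0_fin_numE.
have S1 b c f1 : inL2 lam f1 -> S (tens3 f1 (rg b) (rg c)).
  have [mb b2] := rg_L2 b; have [mc c2] := rg_L2 c.
  apply: (slot (A := fun f => tens3 f (rg b) (rg c)) (p := (Nm lam (rg b) * Nm lam (rg c))%E)).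
  - by apply: mule_ge0; exact: Nm_ge0.
  - by apply: fin; [exact: Nm_ge0|exact: b2|exact: c2].
  - by move=> g h k x; rewrite /tens3; ring.
  - by move=> g lg; apply: inL2_tens3.
  - by move=> g [mg _]; rewrite Nm_tens3// muleA.
  - move=> a; have := Sgauss ((a, b), c); congr S; apply/funext => x; exact: gaussE.
have S2 f1 f2 c : inL2 lam f1 -> inL2 lam f2 -> S (tens3 f1 f2 (rg c)).
  move=> l1; have [m1 n1] := l1; have [mc c2] := rg_L2 c.
  apply: (slot (A := fun f => tens3 f1 f (rg c)) (p := (Nm lam f1 * Nm lam (rg c))%E)).
  - by apply: mule_ge0; exact: Nm_ge0.
  - by apply: fin; [exact: Nm_ge0|exact: n1|exact: c2].
  - by move=> g h k x; rewrite /tens3; ring.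
  - by move=> g lg; apply: inL2_tens3.
  - by move=> g [mg _]; rewrite Nm_tens3// muleAC muleC muleA.
  - by move=> b; exact: S1.
have S3 f1 f2 f3 : inL2 lam f1 -> inL2 lam f2 -> inL2 lam f3 -> S (tens3 f1 f2 f3).
  move=> l1 l2; have [m1 n1] := l1; have [m2 n2] := l2.
  apply: (slot (A := fun f => tens3 f1 f2 f) (p := (Nm lam f1 * Nm lam f2)%E)).
  - by apply: mule_ge0; exact: Nm_ge0.
  - by apply: fin; [exact: Nm_ge0|exact: n1|exact: n2].
  - by move=> g h k x; rewrite /tens3; ring.
  - by move=> g lg; apply: inL2_tens3.
  - by move=> g [mg _]; rewrite Nm_tens3// muleC.
  - by move=> c; exact: S2.
apply: (tensor_full cS) => F f3 lF l3.
suff [] : inL2 (prodm lam lam) F /\ S (fun z => F z.1 * f3 z.2) by [].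
have [m3 n3] := l3.
apply: (tensor_full (m1 := lam) (m2 := lam) (S := fun F => inL2 (prodm lam lam) F /\ S (fun z => F z.1 * f3 z.2))) => //.
  split.
    move=> g h c [lg Sg] [lh Sh]; split; first exact: inL2Dz.
    by have := cS.1 _ _ c Sg Sh; congr S; apply/funext => x; ring.
  have tL2 g : inL2 (prodm lam lam) g -> inL2 lam3 (fun z => g z.1 * f3 z.2).
    move=> [mg g2]; split; last by rewrite (Nm_tensor (prodm lam lam) lam)//; apply: fin; [exact: Nm_ge0|exact: g2|exact: n3].
    by apply: cmeasM; [exact: (cmeas_comp mg)|exact: (cmeas_comp m3)].
  move=> g lg H; split => //; apply: cS.2; first exact: tL2.
  move=> e e0; have [d d0 hd] := lim (Nm_ge0 lam f3) n3 e0; have [h [lh Sh] Nh] := H d d0.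
  exists (fun z => h z.1 * f3 z.2) => //.
  have [mg _] := lg; have [mh _] := lh.
  rewrite (_ : Nm lam3 _ = Nm lam3 (fun z => (g z.1 - h z.1) * f3 z.2)).
    rewrite (Nm_tensor (prodm lam lam) lam (cmeasB mg mh) m3).
    by apply: hd => //; exact: Nm_ge0.
  by apply: eq_nint => x; rewrite mulrBl.
move=> f1 f2 l1 l2; split; last exact: S3.
have [m1 n1] := l1; have [m2 n2] := l2; split.
  by apply: cmeasM; [exact: (cmeas_comp m1)|exact: (cmeas_comp m2)].
by rewrite (Nm_tensor lam lam)//; apply: fin; [exact: Nm_ge0|exact: n1|exact: n2].
Qed.
End GaussianDensity3.

(** * Pairings of square integrable functions *)

Section L2Products.
Variable R : realType.
Context {d} {T : measurableType d} (mu : {measure set T -> \bar R}).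
Implicit Types f g : T -> R[i].

Lemma NmE f : inL2 mu f -> (fine (Nm mu f))%:E = Nm mu f.
Proof. by move=> [_ f2]; rewrite fineK// ge0_fin_numE// Nm_ge0. Qed.
Lemma nint_youngL2 f g (l : R) : inL2 mu f -> inL2 mu g -> 0 < l ->
  (nint mu (fun x => cabs (f x * g x)%R) <= (2^-1 * l * fine (Nm mu f) + 2^-1 * l^-1 * fine (Nm mu g))%:E)%E.
Proof.
move=> lf lg l0; have [mf f2] := lf; have [mg g2] := lg.
have mf2 := cmeas_cabs2 mf; have mg2 := cmeas_cabs2 mg.
have h1 : 0 <= 2^-1 * l by pos.
have h2 : 0 <= 2^-1 * l^-1 by pos.
rewrite EFinD !(EFinM (2^-1 * _)) !NmE// /Nm -!nintZ//; [|by move=> x; exact: cabs2_ge0..].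
rewrite -nintD; [|exact: measurable_funM|exact: measurable_funM|by move=> x; rewrite mulr_ge0 ?cabs2_ge0..].
apply: le_nint; [by apply: cmeas_cabs; exact: cmeasM|by apply: measurable_funD; exact: measurable_funM|by move=> x; exact: cabs_ge0|].
by move=> x; exact: young_cabs.
Qed.

Lemma cL1_inL2M f g : inL2 mu f -> inL2 mu g -> cL1 mu (fun x => f x * g x).
Proof.
move=> lf lg; split; first by apply: cmeasM; [case: lf|case: lg].
by apply: le_lt_trans (nint_youngL2 lf lg ltr01) _; exact: ltry.
Qed.
Lemma cabs_cint_L2 f g (l : R) : inL2 mu f -> inL2 mu g -> 0 < l ->
  cabs (cint mu (fun x => f x * g x)) <= 2^-1 * l * fine (Nm mu f) + 2^-1 * l^-1 * fine (Nm mu g).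
Proof.
move=> lf lg l0; rewrite -lee_fin; apply: le_trans (nint_youngL2 lf lg l0).
exact: cabs_cint (cL1_inL2M lf lg).
Qed.

Lemma cint_L2_continuous g (e : R) : inL2 mu g -> 0 < e -> exists2 del : R, 0 < del &
  forall f, inL2 mu f -> (Nm mu f <= del%:E)%E -> cabs (cint mu (fun x => f x * g x)) <= e.
Proof.
move=> lg e0; pose n := fine (Nm mu g); have n0 : 0 <= n by rewrite fine_ge0// Nm_ge0.
pose l := (n + 1) / e; have l0 : 0 < l by rewrite divr_gt0// ltr_wpDl.
exists (e / l); first by pos.
move=> f lf fd; apply: le_trans (cabs_cint_L2 lf lg l0) _.
have h : fine (Nm mu f) <= e / l by rewrite -lee_fin NmE.
have h1 : l * fine (Nm mu f) <= e by rewrite mulrC -ler_pdivlMr.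
have h2 : l^-1 * n <= e.
  rewrite /l invf_div mulrAC ler_pdivrMr ?ltr_wpDl// ler_wpM2l ?(ltW e0)//.
  by rewrite lerDl.
rewrite -!(mulrA 2^-1) -mulrDr -/n; have := lerD h1 h2.
by move: (_ + _) => S hS; lra.
Qed.
End L2Products.

(** * Extending the Duhamel identity in one coordinate *)

Section SlotIdentity.
Variable R : realType.
Local Notation lam := (@lam R).
Local Notation lam3 := (@lam3 R).

(** For [w = egauss r y] this is [hz] at time [r + z]: the evolution at time [z] of a Gaussian whose
    Fourier weight is [w]. The form is linear in [w]. *)
Definition Jk (w : R -> R[i]) (z : R[i]) (y : R) : R[i] := cint lam (fun k => w k * egauss z y k).
Lemma cabs_egauss_le1 (z : R[i]) (y k : R) : 0 <= cre z -> cabs (egauss z y k) <= 1.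
Proof. by move=> z0; rewrite cabs_egauss -expR0 ler_expR oppr_le0 mulr_ge0 ?sqr_ge0. Qed.

Lemma cL1_Jk w z y : 0 <= cre z -> cL1 lam w -> cL1 lam (fun k => w k * egauss z y k).
Proof. by move=> z0 lw; apply: (cL1_Mb lw (cmeas_egauss z y)) => k; exact: cabs_egauss_le1. Qed.
Lemma JkD w w' (c : R[i]) z y : 0 <= cre z -> cL1 lam w -> cL1 lam w' ->
  Jk (fun k => w k + c * w' k) z y = Jk w z y + c * Jk w' z y.
Proof.
move=> z0 lw lw'; have l1 := cL1_Jk y z0 lw; have l2 := cL1_Jk y z0 lw'.
rewrite /Jk -(cintZ c l2) -(cintD l1 (cL1Z c l2)).
by apply: eq_cint => k; rewrite mulrDl mulrA.
Qed.

Lemma Jk_dct (w_ : nat -> R -> R[i]) w e z y : 0 <= cre z -> 0 < e -> (forall n, cmeas (w_ n)) ->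
  (forall n k, cabs (w_ n k) <= rgauss e k) -> (forall k, ccvg_seq (fun n => w_ n k) (w k)) ->
  ccvg_seq (fun n => Jk (w_ n) z y) (Jk w z y).
Proof.
move=> z0 e0 mw we wc; apply: (@cint_dct _ _ _ lam (fun n k => w_ n k * egauss z y k) _ (rgauss e)).
- by move=> n; apply: cmeasM => //; meas.
- by move=> k; apply: ccvgM => //; exact: ccvg_cst.
- meas.
- exact: nint_rgauss_lty.
- move=> n k; rewrite cabsM -[leRHS]mulr1.
  by apply: ler_pM; rewrite ?cabs_ge0//; exact: cabs_egauss_le1.
Qed.

Lemma cabs_Jk w e z y : 0 <= cre z -> 0 < e -> cmeas w -> (forall k, cabs (w k) <= rgauss e k) ->
  cabs (Jk w z y) <= Num.sqrt (pi / e).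
Proof.
move=> z0 e0 mw we; apply: (cabs_cint_le (r := rgauss e)).
- meas.
- meas.
- move=> k; rewrite cabsM -[leRHS]mulr1.
  by apply: ler_pM; rewrite ?cabs_ge0//; exact: cabs_egauss_le1.
- by rewrite nint_rgauss.
Qed.

Lemma cmeas_Jk w (t : R) : cmeas w -> cmeas (fun s : R => Jk w (cz 0 (t - s)) 0).
Proof.
move=> mw; pose F (p : R * R) := w p.2 * egauss (cz 0 (t - p.1)) 0 p.2.
suff mF : cmeas F by exact: (cmeas_cint1 lam mF).
apply: cmeasM; first exact: (cmeas_comp mw).
apply: cmeas_cexp; apply: cmeasD.
  apply: cmeasM; last by meas.
  apply: cmeasN; split; first by meas.
  meas.
apply: cmeasM; first by meas.
meas.
Qed.

Variables (A : (R -> R[i]) -> pt R -> R[i]) (p : \bar R) (Psi : pt R -> R[i]).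
Variables (C0 z : R[i]) (b t : R) (Q Y : R -> R[i]) (BY : R).
Hypothesis p0 : (0 <= p)%E.
Hypothesis pf : (p < +oo)%E.
Hypothesis Alin : forall f g c x, A (fun t => f t + c * g t) x = A f x + c * A g x.
Hypothesis AL2 : forall f, inL2 lam f -> inL2 lam3 (A f).
Hypothesis AN : forall f, inL2 lam f -> Nm lam3 (A f) = (Nm lam f * p)%E.
Hypothesis LPsi : inL2 lam3 Psi.
Hypothesis z0 : 0 <= cre z.
Hypothesis LQ : cL1 lam Q.
Hypothesis mY : cmeas Y.
Hypothesis bY : forall s, cabs (Y s) <= BY.

(** The Duhamel formula tested with [ft w] in one coordinate, the functions in the other two being
    frozen in [A], [C0] and [Y]. *)
Definition slot_ident (w : R -> R[i]) := cint lam3 (fun x => A (ft w) x * Psi x) =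
  C0 * Jk w z b + iC R * cint lam (fun s => Q s * (Y s * Jk w (cz 0 (t - s)) 0)).
Let LQY w e : cmeas w -> 0 < e -> (forall k, cabs (w k) <= rgauss e k) ->
  cL1 lam (fun s => Q s * (Y s * Jk w (cz 0 (t - s)) 0)).
Proof.
move=> mw e0 we; apply: (cL1_Mb (k := BY * Num.sqrt (pi / e)) LQ).
  by apply: cmeasM => //; exact: cmeas_Jk.
by move=> s; rewrite cabsM; apply: ler_pM; rewrite ?cabs_ge0//; exact: cabs_Jk.
Qed.

Let inL2_ft w : cL1 lam w -> inL2 lam w -> inL2 lam (ft w).
Proof.
move=> l1 l2; split; first exact: cmeas_ft.
by apply: le_lt_trans (plancherel_le l1) _; apply: lte_mul_pinfty; rewrite ?lee_fin ?mulr_ge0 ?pi_ge0//; case: l2.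
Qed.
Let ftDz w w' c x : cL1 lam w -> cL1 lam w' -> ft (fun k => w k + c * w' k) x = ft w x + c * ft w' x.
Proof. by move=> lw lw'; rewrite ftD ?ftZ//; exact: cL1Z. Qed.

(** Both sides are linear in [w] and continuous under limits dominated by a Gaussian, so the weights
    for which the identity holds form a class to which [gaussian_class] applies. *)
Lemma slot_identity : (forall y, slot_ident (egauss (cR 4^-1) y)) ->
  forall r y, 0 < r <= 4^-1 -> slot_ident (egauss (cR r) y).
Proof.
move=> H0.
have [f f0 pE] : exists2 f : R, 0 <= f & p = f%:E.
  by exists (fine p); rewrite ?fine_ge0 ?fineK ?ge0_fin_numE.
pose K w := [/\ cL1 lam w, inL2 lam w, cL1 lam (fun s => Q s * (Y s * Jk w (cz 0 (t - s)) 0)) & slot_ident w].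
have Klin w w' c : K w -> K w' -> K (fun k => w k + c * w' k).
  move=> [l1 l2 lQ i1] [l1' l2' lQ' i1']; have lc := cL1Z c l1'.
  have JD s : Jk (fun k => w k + c * w' k) (cz 0 (t - s)) 0 = Jk w (cz 0 (t - s)) 0 + c * Jk w' (cz 0 (t - s)) 0.
    exact: JkD.
  have lQc := cL1Z c lQ'.
  split; [exact: cL1D|exact: inL2Dz| |].
    by apply: (eq_cL1 _ (cL1D lQ lQc)) => s; rewrite JD; ring.
  have JDb : Jk (fun k => w k + c * w' k) z b = Jk w z b + c * Jk w' z b by exact: JkD.
  rewrite /slot_ident JDb.
  have -> : A (ft (fun k => w k + c * w' k)) = (fun x => A (ft w) x + c * A (ft w') x).
    by apply/funext => x; rewrite -Alin; congr (A _ x); apply/funext => u; exact: ftDz.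
  have la := cL1_inL2M (AL2 (inL2_ft l1 l2)) LPsi.
  have la' := cL1_inL2M (AL2 (inL2_ft l1' l2')) LPsi.
  rewrite (eq_cint _ (g := fun x => A (ft w) x * Psi x + c * (A (ft w') x * Psi x))); last by move=> x; ring.
  rewrite (cintD la (cL1Z c la')) (cintZ c la') i1 i1'.
  rewrite [in RHS](eq_cint _ (g := fun s => Q s * (Y s * Jk w (cz 0 (t - s)) 0) + c * (Q s * (Y s * Jk w' (cz 0 (t - s)) 0)))); last first.
    by move=> s; rewrite JD; ring.
  have comb (u v u' S1 S2 i : R[i]) : u * v + i * S1 + c * (u * u' + i * S2) = u * (v + c * u') + i * (S1 + c * S2) by ring.
  by rewrite (cintD lQ lQc) (cintZ _ lQ') comb.
have Klim (w_ : nat -> R -> R[i]) w e : 0 < e -> (forall n, K (w_ n)) ->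
    (forall n k, cabs (w_ n k) <= rgauss e k) -> (forall k, ccvg_seq (fun n => w_ n k) (w k)) -> K w.
  move=> e0 Kn wn wc; have mn n : cmeas (w_ n) by case: (Kn n) => -[].
  have G2 : (nint lam (fun x => (rgauss e x ^+ 2)%R) < +oo)%E.
    rewrite (eq_nint (rgauss (2 * e))) ?nint_rgauss_lty ?mulr_gt0// => x.
    by rewrite /rgauss expr2 -expRD; congr expR; ring.
  have [l2 N0] := Nm_dct mn wc (mfun_rgauss e) wn G2.
  have l1 : cL1 lam w by exact: (cL1_dct mn wc (mfun_rgauss e) (nint_rgauss_lty e0) wn).
  have mw := cmeas_lim mn wc.
  have we k : cabs (w k) <= rgauss e k by apply: (cvgr_to_le (ccvg_cabs (wc k))); apply: nearW.
  split => //; first exact: LQY we.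
  have lA := AL2 (inL2_ft l1 l2).
  (* On the left, convergence comes from the L2 norm and Plancherel, since [Psi] is only square
     integrable; the right side is treated by dominated convergence. *)
  have L1 : ccvg_seq (fun n => cint lam3 (fun x => A (ft (w_ n)) x * Psi x)) (cint lam3 (fun x => A (ft w) x * Psi x)).
    apply/ccvgP; apply/cvgrPdist_le => eps eps0.
    have [del del0 Hdel] := cint_L2_continuous LPsi eps0.
    have P0 : 0 < 2 * pi * (f + 1) :> R by rewrite !mulr_gt0 ?pi_gt0// ltr_wpDl.
    have [N _ HN] := N0 _ (divr_gt0 del0 P0).
    exists N => // n Nn; have [l1n l2n _ _] := Kn n.
    have lwn : inL2 lam (fun k => w_ n k + (-1) * w k) by exact: inL2Dz.
    have l1wn : cL1 lam (fun k => w_ n k + (-1) * w k) by apply: cL1D => //; exact: cL1Z.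
    rewrite sub0r normrN ger0_norm ?cabs_ge0//.
    have la := cL1_inL2M (AL2 (inL2_ft l1n l2n)) LPsi.
    have la' := cL1_inL2M lA LPsi.
    rewrite -cintB//.
    rewrite (eq_cint _ (g := fun x => A (ft (fun k => w_ n k + (-1) * w k)) x * Psi x)); last first.
      move=> x; rewrite -mulrBl -mulN1r -Alin; congr (A _ x * _); apply/funext => u.
      by rewrite ftDz.
    apply: Hdel; first by apply: AL2; exact: inL2_ft.
    rewrite AN; last exact: inL2_ft.
    have h : (Nm lam (ft (fun k => (w_ n k + (-1) * w k)%R)) <= (2 * pi * (del / (2 * pi * (f + 1))))%:E)%E.
      apply: le_trans (plancherel_le l1wn) _; rewrite (EFinM (2 * pi)); apply: lee_wpmul2l; first by rewrite lee_fin mulr_ge0 ?pi_ge0.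
      apply: le_trans (HN n Nn); apply: le_of_eq.
      by apply: eq_nint => k; rewrite mulN1r -cabs2N opprB addrC.
    apply: le_trans (lee_wpmul2r p0 h) _; rewrite pE -EFinM lee_fin.
    have -> : 2 * pi * (del / (2 * pi * (f + 1))) * f = del * (f / (f + 1)).
      by have := pi_gt0 R; move: (@pi R) => pp pp0; field; rewrite !gt_eqF// ltr_wpDl.
    by rewrite ler_piMr ?(ltW del0)// ler_pdivrMr ?ltr_wpDl// mul1r lerDl.
  apply: (ccvg_uniq L1).
  apply: (ccvg_eq (u := fun n => C0 * Jk (w_ n) z b + iC R * cint lam (fun s => Q s * (Y s * Jk (w_ n) (cz 0 (t - s)) 0)))).
    by move=> n; case: (Kn n).
  apply: ccvgD; first by apply: ccvgZ; exact: (Jk_dct b z0 e0 mn wn wc).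
  apply: ccvgZ.
  have [mQ Q1] := LQ; have maQ := cmeas_cabs mQ.
  have BY0 : 0 <= BY by exact: le_trans (bY 0).
  apply: (@cint_dct _ _ _ lam _ _ (fun s => BY * Num.sqrt (pi / e) * cabs (Q s))).
  - by move=> n; have [_ _ [] ] := Kn n.
  - move=> s; apply: ccvgZ; apply: ccvgZ; exact: (Jk_dct 0 _ e0 mn wn wc).
  - meas.
  - rewrite nintZ//; last by pos.
    by apply: lte_mul_pinfty => //; rewrite ?lee_fin ?mulr_ge0 ?sqrtr_ge0.
  - move=> n s; rewrite cabsM mulrC ler_wpM2r ?cabs_ge0// cabsM.
    by apply: ler_pM; rewrite ?cabs_ge0//; exact: (cabs_Jk 0 _ e0 (mn n) (wn n)).
have K0 y : K (egauss (cR 4^-1) y).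
  have q0 : 0 < 4^-1 :> R by [].
  have le (k : R) : cabs (egauss (cR 4^-1) y k) <= rgauss 4^-1 k by rewrite cabs_egauss.
  split => //; first exact: cL1_egauss.
    apply: (inL2_rgauss (C := 1) (c := 4^-1)) => //; first by meas.
    by move=> k; rewrite mul1r.
  by exact: (LQY (cmeas_egauss _ y) q0).
by move=> r y ry; have [] := gaussian_class Klin Klim K0 y ry.
Qed.
End SlotIdentity.

(** * The propagator tested against narrow heat kernels *)

Section SmoothedPropagator.
Variable R : realType.
Local Notation lam := (@lam R).
Local Notation lam3 := (@lam3 R).
Variables (q : R -> R[i]) (b : pt R) (t : R).
Hypothesis l2q : cL2 q.
Hypothesis q0 : forall s, s <= 0 -> q s = 0.
Hypothesis t0 : 0 < t.

Let mq : cmeas q. Proof. by case: l2q. Qed.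
Lemma inL2_itv (a c : R) : inL2 lam (fun x : R => cR (\1_`[a, c] x)).
Proof.
rewrite -[`[a, c]%classic]setTI.
apply: (@inL2_indic _ _ _ lam setT _ measurableT (mfun_lam_itv _)).
by rewrite /= /lam lebesgue_measure_itv; case: ifP => // _; exact: ltry.
Qed.

Lemma cL1_trunc (e : R) : cL1 lam (fun s => cR (\1_`[0, t - e] s) * q s).
Proof. by apply: cL1_inL2M; [exact: inL2_itv|exact: l2q]. Qed.
Lemma cL1_hvq : cL1 lam (fun s => cR (hv (t - s)) * q s).
Proof.
have mh : cmeas (fun s : R => cR (hv (t - s)) : R[i]).
  by apply: cmeas_cR; apply: (measurableT_comp (@mfun_hv R)); meas.
have h1 s : cabs (cR (hv (t - s)) : R[i]) <= 1 by have /andP[? ?] := hv01 (t - s); rewrite cabs_cRp.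
apply: (eq_cL1 _ (cL1_bM (cL1_trunc 0) mh h1)) => s; rewrite subr0.
rewrite indicE mem_setE in_itv /=; have [s0|s0] := leP s 0; first by rewrite q0// !mulr0.
rewrite ltW//=; have [st|st] := leP s t; first by rewrite mul1r.
by rewrite /hv ltNge subr_le0 (ltW st) /= cR0 !mul0r.
Qed.

Let k3 (s : R) := tens3 (fk s) (fk s) (fk s).
Let Qe (e s : R) := cR (\1_`[0, t - e] s) * q s.
Let Qe_out e s : 0 < e -> t - s <= 0 -> Qe e s = 0.
Proof.
move=> e0 ts; rewrite /Qe indicE mem_setE in_itv /= andbC leNgt (_ : t - e < s) ?mul0r//.
by rewrite ltrBlDr (le_lt_trans _ (_ : s < s + e)) ?ltrDl//; rewrite -subr_le0.
Qed.

Lemma duhamel_truncE e x : 0 < e -> duhamel_trunc q t e x = cint lam (fun s => Qe e s * k3 (t - s) x).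
Proof.
move=> e0; rewrite /duhamel_trunc (@eq_cint1 _ _ _ (fun s => q s * k3 (t - s) x)).
  rewrite cint1E; first by apply: eq_cint => s; rewrite mulrA.
    meas.
  apply: cmeasM => //.
  have mf (y : R) : cmeas (fun s : R => fk (t - s) y).
    apply: (cmeas_comp (@cmeas_fk2 R) (g := fun s : R => (t - s, y))).
    meas.
  by apply: cmeasM; [apply: cmeasM|]; exact: mf.
move=> s /=; rewrite in_itv /= => /andP[s0 se]; rewrite U0kerE// subr_gt0.
by apply: le_lt_trans se _; rewrite gtrBl.
Qed.

Let P3 : R[i] := cR (Num.sqrt pi) ^+ 3.
Lemma cint_gauss_hz3 (g : pt R) (r : R) : 0 < r ->
  cL1 lam3 (fun x => gauss g x * hz3 (cz r t) (ptsub x b)) /\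
  cint lam3 (fun x => gauss g x * hz3 (cz r t) (ptsub x b)) = P3 * hz3 (cz (4^-1 + r) t) (ptsub g b).
Proof.
move=> r0; pose h (g b : R) := fun x => cR (rgauss 1 (x - g)) * hz (cz r t) (x - b).
have E x : tens3 (h g.1.1 b.1.1) (h g.1.2 b.1.2) (h g.2 b.2) x = gauss g x * hz3 (cz r t) (ptsub x b).
  by rewrite gaussE /tens3 /h /hz3 /=; ring.
have H (u v : R) := @cint_rgauss_hz R 1 (cz r t) u v ltr01 r0.
have L (u v : R) : cL1 lam (h u v) by case: (H u v).
split; first by apply: (eq_cL1 E); apply: cL1_tens3; exact: L.
rewrite -(eq_cint _ E) cint_tens3; [|exact: L..].
have zE : cR (4 * 1)^-1 + cz r t = cz (4^-1 + r) t by rewrite mulr1 !czE cRD addrA.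
have V (u v : R) : cint lam (h u v) = cR (Num.sqrt pi) * hz (cz (4^-1 + r) t) (u - v).
  by have [_ ->] := H u v; rewrite zE divr1.
by rewrite !V /hz3 /P3; ring.
Qed.

Lemma cL1_gauss (g : pt R) : cL1 lam3 (gauss g).
Proof.
have L (u : R) : cL1 lam (fun x : R => cR (rgauss 1 (x - u))).
  apply: cL1_cR; first exact: mfun_rgauss_sub.
    by move=> x; exact: expR_ge0.
  rewrite (eq_nint (fun x : R => 1 * rgauss 1 (x - u))); last by move=> x; rewrite mul1r.
  exact: nint_rgauss_sub_lty.
apply: (eq_cL1 (f := tens3 (fun x => cR (rgauss 1 (x - g.1.1))) (fun x => cR (rgauss 1 (x - g.1.2))) (fun x => cR (rgauss 1 (x - g.2))))).
  by move=> x; rewrite gaussE.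
by apply: cL1_tens3; exact: L.
Qed.

(** The cut-off keeps [t - s >= e], where the kernel is bounded by [(4 pi e)^(-3/2)], so the
    integrals in space and time can be exchanged. The Gaussian test function then gives the kernel
    time the real part [1 / 4]. *)
Lemma pairing_trunc e g : 0 < e ->
  pairing (gauss g) (fun x => U0app t (gauss b) x + iC R * duhamel_trunc q t e x) =
  cR (d1 R) ^+ 3 * (P3 * hz3 (cz 2^-1 t) (ptsub g b) +
    iC R * cint lam (fun s => Qe e s * hz3 (cz 4^-1 (t - s)) g)).
Proof.
move=> e0; have qr0 : 0 < 4^-1 :> R by [].
pose F (p : pt R * R) := gauss g p.1 * (Qe e p.2 * k3 (t - p.2) p.1).
have mg : cmeas (gauss g) by case: (cL1_gauss g).
have mQ : cmeas (Qe e) by case: (cL1_trunc e).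
have mF : cmeas F.
  apply: cmeasM; first exact: (cmeas_comp mg).
  apply: cmeasM; first exact: (cmeas_comp mQ).
  have mf (c : pt R -> R) : mfun c -> cmeas (fun p : pt R * R => fk (t - p.2) (c p.1)).
    move=> mc; apply: (cmeas_comp (@cmeas_fk2 R) (g := fun p : pt R * R => (t - p.2, c p.1))).
    apply: measurable_fun_pair; first by meas.
    exact: (measurableT_comp mc).
  apply: cmeasM; last exact: (mf _ (@mfun_pt3 R)).
  by apply: cmeasM; [exact: (mf _ (@mfun_pt1 R))|exact: (mf _ (@mfun_pt2 R))].
pose Ke := (Num.sqrt (4 * pi * e))^-1 ^+ 3.
have Ke0 : 0 <= Ke by pos.
have bF x s : cabs (F (x, s)) <= cabs (gauss g x) * (Ke * cabs (Qe e s)).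
  rewrite /F cabsM ler_wpM2l ?cabs_ge0// cabsM [leRHS]mulrC /=.
  have [se|se] := leP e (t - s); last first.
    suff -> : Qe e s = 0 by rewrite cabs0 !mul0r.
    rewrite /Qe indicE mem_setE in_itv /= andbC leNgt (_ : t - e < s) ?mul0r//.
    by rewrite ltrBlDr -ltrBlDl.
  rewrite ler_wpM2l ?cabs_ge0//; have ts : 0 < t - s by apply: lt_le_trans se.
  rewrite /k3 /tens3 cabsM [cabs (_ * _)]cabsM !cabs_fk// /Ke !exprS expr0 mulr1 mulrA.
  have h : (Num.sqrt (4 * pi * (t - s)))^-1 <= (Num.sqrt (4 * pi * e))^-1.
    rewrite lef_pV2 ?posrE ?sqrtr_gt0 ?mulr_gt0 ?pi_gt0//.
    by rewrite ler_sqrt ?mulr_ge0 ?pi_ge0 ?(ltW ts)// ler_wpM2l// mulr_ge0 ?pi_ge0.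
  by apply: ler_pM; rewrite ?mulr_ge0//; apply: ler_pM.
have lF : cL1 (prodm lam3 lam) F.
  have [_ G1] := cL1_gauss g; have [_ Q1] := cL1_trunc e.
  have mcQ := cmeas_cabs mQ.
  apply: (@cL1_prod_dom _ _ _ _ _ lam3 lam F (fun x => cabs (gauss g x)) (fun s => Ke * cabs (Qe e s)) mF) => //.
  - meas.
  - meas.
  - by move=> s; rewrite mulr_ge0 ?cabs_ge0.
  - by rewrite nintZ//; apply: lte_mul_pinfty.
have lQk x : cL1 lam (fun s => Qe e s * k3 (t - s) x).
  have gx : cabs (gauss g x) != 0 by rewrite /gauss cabs_cR gt_eqF// normr_gt0 gt_eqF// expR_gt0.
  have [_ Q1] := cL1_trunc e; have mcQ := cmeas_cabs mQ.
  apply: (cL1_dom (r := fun s => Ke * cabs (Qe e s))).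
  - have := cmeas_sec1 x mF; rewrite /F /= => h.
    have hg : gauss g x != 0 by rewrite -cabs_eq0.
    apply: (cmeas_eq (f := fun s => (gauss g x)^-1 * (gauss g x * (Qe e s * k3 (t - s) x)))).
      by move=> s; exact: mulKf.
    by apply: cmeasM => //; meas.
  - meas.
  - move=> s; have := bF x s; rewrite /F /= cabsM ler_pM2l// lt_def gx; exact: cabs_ge0.
  - by rewrite nintZ//; apply: lte_mul_pinfty.
have E x : gauss g x * (U0app t (gauss b) x + iC R * duhamel_trunc q t e x) =
   cR (d1 R) ^+ 3 * (gauss g x * hz3 (cz 4^-1 t) (ptsub x b)) + iC R * cint lam (fun s => F (x, s)).
  rewrite U0app_gauss// duhamel_truncE// /F /= cintZ//; move: (cint _ _) => D; ring.
have [lg eg] := cint_gauss_hz3 g qr0.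
have lgd := cL1Z (cR (d1 R) ^+ 3) lg.
have lD := cL1Z (iC R) (cL1_cint1 lF).
rewrite /pairing cint3E; last by apply: (cmeas_eq (fun x => esym (E x))); case: (cL1D lgd lD).
rewrite (eq_cint _ E) (cintD lgd lD) (cintZ _ lg) eg (cintZ _ (cL1_cint1 lF)) (cFubini lF).
have -> : 4^-1 + 4^-1 = 2^-1 :> R by field.
have -> : cint lam (fun s => cint lam3 (fun x => F (x, s))) =
    cint lam (fun s => cR (d1 R) ^+ 3 * (Qe e s * hz3 (cz 4^-1 (t - s)) g)).
  apply: eq_cint => s; have [ts|ts] := leP (t - s) 0.
    rewrite /F /= Qe_out// mul0r mulr0 -[RHS](cint0 lam3); apply: eq_cint => x.
    by rewrite mul0r mulr0.
  have [l ev] := cint_gauss_U0ker g (origin R) ts.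
  have po (x : pt R) : ptsub x (origin R) = x by rewrite /ptsub /= !subr0; case: x => -[].
  have EE x : F (x, s) = Qe e s * (gauss g x * U0ker (t - s) (ptsub x (origin R))).
    by rewrite /F /= po U0kerE// mulrCA.
  by rewrite (eq_cint _ EE) cintZ// ev po; ring.
rewrite cintZ; first by move: (cint _ _) => D; ring.
have bz s : cabs (hz3 (cz 4^-1 (t - s)) g) <= Num.sqrt (pi / 4^-1) ^+ 3 by exact: cabs_hz3_le.
apply: (cL1_Mb (cL1_trunc e) _ bz).
apply: (cmeas_comp (cmeas_hz3 4^-1) (g := fun s : R => (t - s, g))).
meas.
Qed.
(** Up to the factor [(2 pi)^3], the kernel of [e^(- (r + i s) H_0)] at [y], cut off to positive
    times. *)
Definition Hr (r : R) (y : pt R) (s : R) : R[i] := cR (hv s) * hz3 (cz r s) y.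
Lemma cmeas_hz3_sub (r : R) (y : pt R) : cmeas (fun s : R => hz3 (cz r (t - s)) y).
Proof.
apply: (cmeas_comp (cmeas_hz3 r) (g := fun s : R => (t - s, y))).
meas.
Qed.

Lemma cmeas_hz_sub (r y : R) : cmeas (fun s : R => hz (cz r (t - s)) y).
Proof.
apply: (cmeas_comp (cmeas_hz2 r) (g := fun s : R => (t - s, y))).
meas.
Qed.

Variables (Psi : pt R -> R[i]).
Hypothesis LPsi : inL2 lam3 Psi.
Hypothesis weak : forall g, ccvg_right0
  (fun e => pairing (gauss g) (fun x => U0app t (gauss b) x + iC R * duhamel_trunc q t e x))
  (pairing (gauss g) Psi).

(** After pairing, the singularity of the kernel at [s = t] has disappeared, since [hz3] with real
    part [1 / 4] is bounded. The limit of the truncations is thus an absolutely convergent integral,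
    and it is identified along one sequence. *)
Lemma pairing_gauss g : pairing (gauss g) Psi = cR (d1 R) ^+ 3 * (P3 * hz3 (cz 2^-1 t) (ptsub g b) +
    iC R * cint lam (fun s => (cR (hv (t - s)) * q s) * hz3 (cz 4^-1 (t - s)) g)).
Proof.
pose u (n : nat) := t / 2 * epsn R n.
have u0 n : 0 < u n by pos.
have ucv : u n @[n --> \oo] --> 0.
  by rewrite -[X in _ --> X](mulr0 (t / 2)); apply: cvgM; [exact: cvg_cst|exact: epsn_cvg].
have C1 : ccvg_seq (fun n => pairing (gauss g) (fun x => U0app t (gauss b) x + iC R * duhamel_trunc q t (u n) x))
    (pairing (gauss g) Psi).
  have [wr wi] := weak g.
  have h : (forall n, u n > 0) /\ u n @[n --> \oo] --> (0 : R) by [].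
  split.
    by have := (cvg_at_rightP _ _ _).1 wr u h.
  by have := (cvg_at_rightP _ _ _).1 wi u h.
apply: (ccvg_uniq C1).
apply: (ccvg_eq (fun n => esym (pairing_trunc g (u0 n)))).
apply: ccvgZ; apply: ccvgD; first exact: ccvg_cst.
apply: ccvgZ.
have bz s : cabs (hz3 (cz 4^-1 (t - s)) g) <= Num.sqrt (pi / 4^-1) ^+ 3.
  by apply: cabs_hz3_le; rewrite invr_gt0.
have [mQ Q1] := cL1_trunc 0; have mcQ := cmeas_cabs mQ.
apply: (@cint_dct _ _ _ lam _ _ (fun s => Num.sqrt (pi / 4^-1) ^+ 3 * cabs (cR (\1_`[0, t - 0] s) * q s))).
- by move=> n; apply: cmeasM; [case: (cL1_trunc (u n))|exact: cmeas_hz3_sub].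
- move=> s; have [s0|s0] := leP s 0.
    rewrite q0// mulr0 mul0r; apply: (ccvg_eq (u := fun=> 0)); last exact: ccvg_cst.
    by move=> n; rewrite /Qe q0 ?mulr0 ?mul0r.
  apply: ccvgM; last exact: ccvg_cst.
  apply: ccvgM; last exact: ccvg_cst.
  apply: ccvg_cR; have [st|ts] := ltP s t.
    rewrite /hv subr_gt0 st; apply: cvg_near_cst.
    have ts0 : 0 < t - s by rewrite subr_gt0.
    have [N _ HN] := (cvgr_lt _ ucv) _ ts0; exists N => // n Nn; have un : u n < t - s by exact: HN.
    by rewrite indicE mem_setE in_itv /= (ltW s0) /= ltW// ltrBrDl -ltrBrDr.
  rewrite /hv ltNge subr_le0 ts; apply: cvg_near_cst; apply: nearW => n.
  rewrite indicE mem_setE in_itv /= (ltW s0) /= leNgt (_ : t - u n < s)//.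
  by apply: lt_le_trans ts; rewrite gtrBl.
- meas.
- by rewrite nintZ ?exprn_ge0 ?sqrtr_ge0//; apply: lte_mul_pinfty => //; rewrite lee_fin exprn_ge0 ?sqrtr_ge0.
- move=> n s; rewrite cabsM mulrC; apply: ler_pM; rewrite ?cabs_ge0//.
  rewrite !cabsM ler_wpM2r ?cabs_ge0// !cabs_cRp// !indicE !mem_setE !in_itv /=.
  case: (boolP (0 <= s <= t - u n)) => [/andP[h1 h2]|_]; last exact: ler0n.
  by rewrite h1 /= subr0 (le_trans h2)// gerBl ltW.
Qed.

Lemma inL2_hz (r y : R) : 0 < r -> inL2 lam (fun x => hz (cR r) (x + y)).
Proof.
move=> r0; have c0 : 0 < (4 * r)^-1 by pos.
pose G (x : R) := Num.sqrt (pi / r) * rgauss (4 * r)^-1 (x - (- y)).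
have mG : mfun G by apply: measurable_funM => //; exact: mfun_rgauss_sub.
have G0 x : 0 <= G x by pos.
have E x : hz (cR r) (x + y) = cR (G x) by rewrite hz_real// /G opprK.
apply: (inL2_dom (G := G)) => //.
- by apply: (cmeas_eq (fun x => esym (E x))); meas.
- by move=> x; rewrite E cabs_cRp.
rewrite (eq_nint (fun x : R => (pi / r) * rgauss (2 * (4 * r)^-1) (x - (- y)))).
  by apply: nint_rgauss_sub_lty; rewrite ?divr_ge0 ?pi_ge0 ?(ltW r0)// mulr_gt0.
move=> x; rewrite /G exprMn sqr_sqrtr ?divr_ge0 ?pi_ge0 ?(ltW r0)//.
by rewrite /rgauss expr2 -expRD; congr (_ * expR _); ring.
Qed.

Let Q s := cR (hv (t - s)) * q s.
(** Widths and centres are independent in the three coordinates, so that they can be changed one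
    coordinate at a time. *)
Definition smooth_ident (r1 y1 r2 y2 r3 y3 : R) :=
  cint lam3 (fun x => tens3 (fun u => hz (cR r1) (u + y1)) (fun u => hz (cR r2) (u + y2)) (fun u => hz (cR r3) (u + y3)) x * Psi x) =
  P3 * (hz (cz (r1 + 4^-1) t) (y1 + b.1.1) * hz (cz (r2 + 4^-1) t) (y2 + b.1.2) * hz (cz (r3 + 4^-1) t) (y3 + b.2)) +
  iC R * cint lam (fun s => Q s * (hz (cz r1 (t - s)) y1 * hz (cz r2 (t - s)) y2 * hz (cz r3 (t - s)) y3)).

Let ft_egauss (r y : R) : ft (egauss (cR r) y) = (fun x => hz (cR r) (x + y)).
Proof.
apply/funext => x; apply: eq_cint => k.
by rewrite /egauss -cexp_im -cexpD -addrA -mulrDr -cRD; congr cexp; congr (_ + _ * cR _); ring.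
Qed.
Let Jk_egauss (r y a s c : R) : Jk (egauss (cR r) y) (cz a s) c = hz (cz (r + a) s) (y + c).
Proof.
apply: eq_cint => k; rewrite /egauss -cexpD; congr cexp.
by rewrite [cR ((y + c) * k)]cRM [cR (y + c)]cRD (cRM y) (cRM c) !czE [cR (r + a)]cRD; ring.
Qed.

Let q40 : 0 < 4^-1 :> R. Proof. pos. Qed.
(** At width [1 / 4] the test functions are multiples of the unit Gaussians of the hypothesis; the
    relation [K * d1 = 1] cancels the normalisations. *)
Lemma smooth_ident0 y1 y2 y3 : smooth_ident 4^-1 y1 4^-1 y2 4^-1 y3.
Proof.
pose g : pt R := ((- y1, - y2), - y3).
have p0 := pi_gt0 R.
have sp0 : Num.sqrt pi != 0 :> R by rewrite sqrtr_eq0 -ltNge.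
pose K := Num.sqrt (pi / 4^-1) : R.
have KE : K * d1 R = 1.
  rewrite /K invrK sqrtrM ?ltW// (_ : 4 = 2 ^+ 2) ?sqrtr_sqr ?ger0_norm//; last by rewrite -natrX.
  by rewrite /d1 mulrC; field.
have hK x y : hz (cR 4^-1) (x + y) = cR K * cR (rgauss 1 (x - - y)).
  by rewrite hz_real// -cRM opprK divff// invr1.
have E x : tens3 (fun u => hz (cR 4^-1) (u + y1)) (fun u => hz (cR 4^-1) (u + y2)) (fun u => hz (cR 4^-1) (u + y3)) x * Psi x =
    cR K ^+ 3 * (gauss g x * Psi x).
  by rewrite gaussE /tens3 !hK /g /=; ring.
have mgP : cmeas (fun x => gauss g x * Psi x).
  by apply: cmeasM; [case: (cL1_gauss g)|case: LPsi].
have lgP : cL1 lam3 (fun x => gauss g x * Psi x).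
  apply: cL1_inL2M => //.
  have lh := inL2_tens3 (inL2_hz y1 q40) (inL2_hz y2 q40) (inL2_hz y3 q40).
  have := inL2Dz (cR (d1 R) ^+ 3 - 1) lh lh; congr (inL2 _ _); apply/funext => x.
  have -> : gauss g x = cR (d1 R) ^+ 3 * tens3 (fun u => hz (cR 4^-1) (u + y1)) (fun u => hz (cR 4^-1) (u + y2)) (fun u => hz (cR 4^-1) (u + y3)) x.
    rewrite gaussE /tens3 !hK /g /=.
    have := congr1 (@cR R) KE; rewrite cRM cR1 => kd.
    set A := cR (rgauss _ _); set B := cR (rgauss _ _); set D := cR (rgauss _ _).
    transitivity ((cR K * cR (d1 R)) ^+ 3 * (A * B * D)); first by rewrite kd expr1n mul1r.
    ring.
  by ring.
rewrite /smooth_ident (eq_cint _ E) cintZ// -(cint3E mgP) -[cint3 _ _]/(pairing (gauss g) Psi).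
rewrite pairing_gauss mulrA -exprMn -cRM KE cR1 expr1n mul1r.
have e2 : 4^-1 + 4^-1 = 2^-1 :> R by field.
have half0 : 0 < 2^-1 :> R by [].
have h1 : hz3 (cz 2^-1 t) (ptsub g b) =
    hz (cz 2^-1 t) (y1 + b.1.1) * hz (cz 2^-1 t) (y2 + b.1.2) * hz (cz 2^-1 t) (y3 + b.2).
  rewrite /hz3 /ptsub /g /= -!opprD.
  by rewrite !(hzN _ (half0 : 0 < cre (cz 2^-1 t))).
have h2 s : hz3 (cz 4^-1 (t - s)) g = hz (cz 4^-1 (t - s)) y1 * hz (cz 4^-1 (t - s)) y2 * hz (cz 4^-1 (t - s)) y3.
  by rewrite /hz3 /g /= !(hzN _ (q40 : 0 < cre (cz 4^-1 (t - s)))).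
have eC : cz (4^-1 + 4^-1) t = cz 2^-1 t by rewrite e2.
have h3 : cint lam (fun s => (cR (hv (t - s)) * q s) * hz3 (cz 4^-1 (t - s)) g) =
    cint lam (fun s => Q s * (hz (cz 4^-1 (t - s)) y1 * hz (cz 4^-1 (t - s)) y2 * hz (cz 4^-1 (t - s)) y3)).
  by apply: eq_cint => s; rewrite h2.
by rewrite eC h1 h3.
Qed.

Let mulfin (x y : \bar R) : (0 <= x)%E -> (x < +oo)%E -> (y < +oo)%E -> (x * y < +oo)%E.
Proof. by move=> x0 xoo yoo; apply: lte_mul_pinfty => //; rewrite ge0_fin_numE. Qed.
Let LQ : cL1 lam Q. Proof. exact: cL1_hvq. Qed.

Let bhz (r y s : R) : 0 < r -> cabs (hz (cz r s) y) <= Num.sqrt (pi / r).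
Proof. exact: cabs_hz_le. Qed.
Lemma smooth_ident1 r1 y1 y2 y3 : 0 < r1 <= 4^-1 -> smooth_ident r1 y1 4^-1 y2 4^-1 y3.
Proof.
move=> r1q.
pose Y s := hz (cz 4^-1 (t - s)) y2 * hz (cz 4^-1 (t - s)) y3.
pose C0 := P3 * (hz (cz (4^-1 + 4^-1) t) (y2 + b.1.2) * hz (cz (4^-1 + 4^-1) t) (y3 + b.2)).
pose g2 u := hz (cR 4^-1) (u + y2); pose g3 u := hz (cR 4^-1) (u + y3).
have l2 : inL2 lam g2 by exact: inL2_hz.
have l3 : inL2 lam g3 by exact: inL2_hz.
have HE r y : smooth_ident r y 4^-1 y2 4^-1 y3 <->
    slot_ident (fun f => tens3 f g2 g3) Psi C0 (cz 4^-1 t) b.1.1 t Q Y (egauss (cR r) y).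
  rewrite /smooth_ident /slot_ident ft_egauss Jk_egauss /C0.
  rewrite (eq_cint _ (f := fun s => Q s * (Y s * _)) (g := fun s => Q s * (hz (cz r (t - s)) y * hz (cz 4^-1 (t - s)) y2 * hz (cz 4^-1 (t - s)) y3))).
    rewrite -/g2 -/g3; move: (cint lam3 _) (cint lam _) => X1 X2.
    by split=> ->; congr (_ + _); ring.
  by move=> s; rewrite Jk_egauss !addr0 /Y; congr (_ * _); ring.
apply: (HE r1 y1).2; apply: (@slot_identity R _ (Nm lam g2 * Nm lam g3)%E Psi C0 _ _ _ _ _ (Num.sqrt (pi / 4^-1) * Num.sqrt (pi / 4^-1))) => //.
- by apply: mule_ge0; exact: Nm_ge0.
- by apply: mulfin; [exact: Nm_ge0|case: l2|case: l3].
- by move=> f g c x; rewrite /tens3; ring.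
- by move=> f lf; exact: (inL2_tens3 lf l2 l3).
- by move=> f [mf _]; rewrite Nm_tens3 ?muleA//; [case: l2|case: l3].
- by pos.
- by apply: cmeasM; exact: cmeas_hz_sub.
- by move=> s; rewrite cabsM; apply: ler_pM; rewrite ?cabs_ge0 ?bhz.
- by move=> y; exact: (HE 4^-1 y).1 (smooth_ident0 y y2 y3).
Qed.

Lemma smooth_ident2 r1 r2 y1 y2 y3 : 0 < r1 <= 4^-1 -> 0 < r2 <= 4^-1 -> smooth_ident r1 y1 r2 y2 4^-1 y3.
Proof.
move=> r1q r2q.
have r1p : 0 < r1 by case/andP: r1q.
pose Y s := hz (cz r1 (t - s)) y1 * hz (cz 4^-1 (t - s)) y3.
pose C0 := P3 * (hz (cz (r1 + 4^-1) t) (y1 + b.1.1) * hz (cz (4^-1 + 4^-1) t) (y3 + b.2)).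
pose g1 u := hz (cR r1) (u + y1); pose g3 u := hz (cR 4^-1) (u + y3).
have l1 : inL2 lam g1 by exact: inL2_hz.
have l3 : inL2 lam g3 by exact: inL2_hz.
have HE r y : smooth_ident r1 y1 r y 4^-1 y3 <->
    slot_ident (fun f => tens3 g1 f g3) Psi C0 (cz 4^-1 t) b.1.2 t Q Y (egauss (cR r) y).
  rewrite /smooth_ident /slot_ident ft_egauss Jk_egauss /C0.
  rewrite (eq_cint _ (f := fun s => Q s * (Y s * _)) (g := fun s => Q s * (hz (cz r1 (t - s)) y1 * hz (cz r (t - s)) y * hz (cz 4^-1 (t - s)) y3))).
    rewrite -/g1 -/g3; move: (cint lam3 _) (cint lam _) => X1 X2.
    by split=> ->; congr (_ + _); ring.
  by move=> s; rewrite Jk_egauss !addr0 /Y; congr (_ * _); ring.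
apply: (HE r2 y2).2; apply: (@slot_identity R _ (Nm lam g1 * Nm lam g3)%E Psi C0 _ _ _ _ _ (Num.sqrt (pi / r1) * Num.sqrt (pi / 4^-1))) => //.
- by apply: mule_ge0; exact: Nm_ge0.
- by apply: mulfin; [exact: Nm_ge0|case: l1|case: l3].
- by move=> f g c x; rewrite /tens3; ring.
- by move=> f lf; exact: (inL2_tens3 l1 lf l3).
- by move=> f [mf _]; rewrite Nm_tens3 //; [rewrite muleAC muleC muleA|case: l1|case: l3].
- by pos.
- by apply: cmeasM; exact: cmeas_hz_sub.
- by move=> s; rewrite cabsM; apply: ler_pM; rewrite ?cabs_ge0 ?bhz.
- by move=> y; exact: (HE 4^-1 y).1 (smooth_ident1 y1 y y3 r1q).
Qed.

Lemma smooth_ident3 r1 r2 r3 y1 y2 y3 : 0 < r1 <= 4^-1 -> 0 < r2 <= 4^-1 -> 0 < r3 <= 4^-1 -> smooth_ident r1 y1 r2 y2 r3 y3.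
Proof.
move=> r1q r2q r3q.
have r1p : 0 < r1 by case/andP: r1q.
have r2p : 0 < r2 by case/andP: r2q.
pose Y s := hz (cz r1 (t - s)) y1 * hz (cz r2 (t - s)) y2.
pose C0 := P3 * (hz (cz (r1 + 4^-1) t) (y1 + b.1.1) * hz (cz (r2 + 4^-1) t) (y2 + b.1.2)).
pose g1 u := hz (cR r1) (u + y1); pose g2 u := hz (cR r2) (u + y2).
have l1 : inL2 lam g1 by exact: inL2_hz.
have l2 : inL2 lam g2 by exact: inL2_hz.
have HE r y : smooth_ident r1 y1 r2 y2 r y <->
    slot_ident (fun f => tens3 g1 g2 f) Psi C0 (cz 4^-1 t) b.2 t Q Y (egauss (cR r) y).
  rewrite /smooth_ident /slot_ident ft_egauss Jk_egauss /C0.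
  rewrite (eq_cint _ (f := fun s => Q s * (Y s * _)) (g := fun s => Q s * (hz (cz r1 (t - s)) y1 * hz (cz r2 (t - s)) y2 * hz (cz r (t - s)) y))).
    rewrite -/g1 -/g2; move: (cint lam3 _) (cint lam _) => X1 X2.
    by split=> ->; congr (_ + _); ring.
  by move=> s; rewrite Jk_egauss !addr0 /Y; congr (_ * _); ring.
apply: (HE r3 y3).2; apply: (@slot_identity R _ (Nm lam g1 * Nm lam g2)%E Psi C0 _ _ _ _ _ (Num.sqrt (pi / r1) * Num.sqrt (pi / r2))) => //.
- by apply: mule_ge0; exact: Nm_ge0.
- by apply: mulfin; [exact: Nm_ge0|case: l1|case: l2].
- by move=> f g c x; rewrite /tens3; ring.
- by move=> f lf; exact: (inL2_tens3 l1 l2 lf).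
- by move=> f [mf _]; rewrite Nm_tens3 //; [rewrite muleC|case: l1|case: l2].
- by pos.
- by apply: cmeasM; exact: cmeas_hz_sub.
- by move=> s; rewrite cabsM; apply: ler_pM; rewrite ?cabs_ge0 ?bhz.
- by move=> y; exact: (HE 4^-1 y).1 (smooth_ident2 y1 y2 y r1q r2q).
Qed.

Theorem smoothed_propagator (r : R) (y : pt R) : 0 < r <= 4^-1 ->
  cint lam3 (fun x => hz3 (cR r) (ptsub x y) * Psi x) =
  P3 * hz3 (cz (r + 4^-1) t) (ptsub y b) + iC R * cconv q (Hr r y) t.
Proof.
move=> rq; have r0 : 0 < r by case/andP: rq.
have r40 : 0 < r + 4^-1 by pos.
have := @smooth_ident3 r r r (- y.1.1) (- y.1.2) (- y.2) rq rq rq.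
rewrite /smooth_ident => h.
rewrite [LHS](eq_cint _ (g := fun x => tens3 (fun u => hz (cR r) (u - y.1.1)) (fun u => hz (cR r) (u - y.1.2)) (fun u => hz (cR r) (u - y.2)) x * Psi x)); last by [].
rewrite h.
have h1 : hz3 (cz (r + 4^-1) t) (ptsub y b) = hz (cz (r + 4^-1) t) (- y.1.1 + b.1.1) *
    hz (cz (r + 4^-1) t) (- y.1.2 + b.1.2) * hz (cz (r + 4^-1) t) (- y.2 + b.2).
  rewrite (@hz3N _ (cz (r + 4^-1) t))// /hz3 /ptsub /=.
  by rewrite ![- _ + _]addrC.
rewrite h1; congr (_ + iC R * _); apply: eq_cint => s.
by rewrite /Hr /hz3 !(hzN _ (r0 : 0 < cre (cz r (t - s)))) /Q; move: (hz _ _ * _ * _) => X; rewrite -mulrA mulrCA.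
Qed.
End SmoothedPropagator.

(** * Kato smoothing for the charge *)

Section KatoSmoothing.
Variable R : realType.
Local Notation lam := (@lam R).

(** The product of three one-dimensional kernels depends on [|y|] only and equals [pi / z] times the
    one-dimensional kernel at [|y|]; integration by parts absorbs [|y| / z] into a factor [k]. This
    factor makes the energy integral below bounded uniformly. *)
Lemma hz3_radial z (y : pt R) : 0 < cre z ->
  cR (nrm y) * hz3 z y = - (cR (2 * pi) * iC R * cint lam (fun k => cR k * egauss z (nrm y) k)).
Proof.
move=> z0; have zn : z != 0 by apply: contraTneq z0 => ->; rewrite cre0 ltxx.
have k1 := cint_k_egauss (nrm y) z0; rewrite -/(hz z (nrm y)) in k1.
have g2 : gauss0 z * gauss0 z = cR pi / z.
  by rewrite -(gauss0_sqr z0) mulrAC divff// mul1r.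
have nn : nrm y ^+ 2 = nrm2 y by rewrite /nrm sqr_sqrtr// /nrm2 !addr_ge0 ?sqr_ge0.
have E : hz3 z y = cR pi / z * hz z (nrm y).
  rewrite /hz3 !hzE// nn -g2.
  have -> : cexp (- cR (nrm2 y) / (4 * z)) = cexp (- cR (y.1.1 ^+ 2) / (4 * z)) *
      cexp (- cR (y.1.2 ^+ 2) / (4 * z)) * cexp (- cR (y.2 ^+ 2) / (4 * z)).
    by rewrite -!cexpD; congr cexp; rewrite /nrm2 !cRD !mulNr !mulrDl !opprD.
  by ring.
rewrite E; move: k1; move: (cint _ _) (hz _ _) => M h k1.
have k2 : cR (nrm y) * h = - (iC R * (2 * z * M)) by rewrite k1 mulrA mulrA iC2; ring.
rewrite mulrCA k2 cRM cR_nat; field; exact: zn.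
Qed.

(** Write the resolvent factor as the integral over [u > 0] of [e^(- i (k - kap) u)]. The
    [k]-integral becomes a Gaussian in [x - u] of total mass [2 pi], and [|e^(i kap u)| <= 1]; the
    bound is independent of [r], [x] and [kap]. *)
Lemma cabs_half_line (r x : R) (kap : R[i]) : 0 < r -> 0 < cim kap ->
  cL1 lam (fun k => egauss (cR r) x k * (iC R * (cR k - kap))^-1) /\
  cabs (cint lam (fun k => egauss (cR r) x k * (iC R * (cR k - kap))^-1)) <= 2 * pi.
Proof.
move=> r0 k0; have rz k : cre (iC R * (cR k - kap)) = cim kap.
  by rewrite !(creE, cimE) /=; ring.
pose F (p : R * R) := egauss (cR r) x p.1 * exz (iC R * (cR p.1 - kap)) p.2.
have mF : cmeas F.
  apply: cmeasM; first exact: (cmeas_comp (cmeas_egauss (cR r) x) measurable_fst).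
  apply: cmeasM; first by apply: cmeas_cR; exact: (measurableT_comp (@mfun_hv R)).
  apply: cmeas_cexp; apply: cmeasM; last by meas.
  apply: cmeasN; apply: cmeasM; first by meas.
  meas.
have lF : cL1 (prodm lam lam) F.
  apply: (@cL1_prod_dom _ _ _ _ _ lam lam F (rgauss r) (rexp (cim kap)) mF).
  - meas.
  - meas.
  - by move=> k; exact: expR_ge0.
  - by move=> u; rewrite -(rz 0) -cabs_exz cabs_ge0.
  - exact: nint_rgauss_lty.
  - exact: nint_rexp_lty.
  - by move=> k u; rewrite /F /= cabsM cabs_egauss cabs_exz rz.
have E1 k : cint lam (fun u => F (k, u)) = egauss (cR r) x k * (iC R * (cR k - kap))^-1.
  by rewrite /F /= cintZ ?cint_exz ?rz//; apply: cL1_exz; rewrite rz.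
split; first by apply: (eq_cL1 E1); exact: cL1_cint1 lF.
rewrite -(eq_cint _ E1) (cFubini lF).
have E2 u : cint lam (fun k => F (k, u)) = cR (hv u) * cexp (iC R * kap * cR u) * hz (cR r) (x - u).
  rewrite -cintZ; last by apply: cL1_egauss.
  apply: eq_cint => k; rewrite /F /exz /= /egauss mulrCA -[in RHS]mulrA; congr (_ * _).
  rewrite -!cexpD; congr cexp; rewrite !cRM cRB; ring.
have c0 : 0 < (4 * r)^-1 by pos.
pose G (u : R) := Num.sqrt (pi / r) * rgauss (4 * r)^-1 (u - x).
apply: (cabs_cint_le (r := G)).
- exact: cmeas_cint2.
- by apply: measurable_funM => //; exact: mfun_rgauss_sub.
- move=> u; rewrite E2 hz_real// cabsM [cabs (_ * cexp _)]cabsM cabs_cexp -[leRHS]mul1r.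
  have -> : rgauss (4 * r)^-1 (x - u) = rgauss (4 * r)^-1 (u - x) by rewrite /rgauss -sqrrN opprB.
  rewrite [cabs (cR (_ * _))]cabs_cRp; last by pos.
  rewrite ler_wpM2r ?mulr_ge0 ?sqrtr_ge0 ?expR_ge0//.
  rewrite /hv; case: ltP => u0; last by rewrite cR0 cabs0 mul0r.
  rewrite cR1 cabs1 mul1r -expR0 ler_expR !(creE, cimE) /= !(mul0r, mul1r, mulr0, subr0, add0r, sub0r).
  by rewrite mulNr oppr_le0 mulr_ge0 ?ltW.
- rewrite /G (nintZ lam (sqrtr_ge0 _) (mfun_rgauss_sub _ _)); last by move=> u; exact: expR_ge0.
  rewrite (nint_shift (- x) (mfun_rgauss _)); last by move=> u; exact: expR_ge0.
  rewrite nint_rgauss// -EFinM lee_fin -sqrtrM; last by rewrite divr_ge0 ?pi_ge0 ?ltW.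
  rewrite (_ : pi / r * (pi / (4 * r)^-1) = (2 * pi) ^+ 2).
    by rewrite sqrtr_sqr ger0_norm// mulr_ge0 ?pi_ge0.
  by rewrite invrK; move: (@pi R) => p; field; rewrite gt_eqF.
Qed.

Lemma complex_sqrt (w : R[i]) : 0 < cim w -> exists2 kap : R[i], kap * kap = w & 0 < cim kap.
Proof.
move=> w0; pose k := sqrtC w; have kk : k * k = w by rewrite -expr2 sqrtCK.
have [k0|k0|k0] := ltgtP 0 (cim k); first by exists k.
  by exists (- k); rewrite ?mulrNN// cimN oppr_gt0.
by move: w0; rewrite -kk cimM -k0 mulr0 mul0r addr0 ltxx.
Qed.

Variables (r : R) (y : pt R) (q : R -> R[i]).
Hypothesis r0 : 0 < r.
Hypothesis y0 : 0 < nrm y.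
Hypothesis l2q : cL2 q.
Hypothesis q0 : forall s, s <= 0 -> q s = 0.

Let H := Hr r y.
Let mH : cmeas H.
Proof.
apply: cmeasM; first by meas.
exact: (cmeas_comp (cmeas_hz3 r) (measurable_pair2 y)).
Qed.

Let bH s : cabs (H s) <= Num.sqrt (pi / r) ^+ 3.
Proof.
have /andP[h0 h1] := hv01 s.
rewrite /H /Hr cabsM cabs_cRp// -[leRHS]mul1r; apply: ler_pM => //.
exact: cabs_hz3_le.
Qed.
Let Hs (sg : R) s := ewt sg s * H s.

Let lHs sg : 0 < sg -> cL1 lam (Hs sg).
Proof.
move=> sg0; apply: (cL1_dom (r := fun s => Num.sqrt (pi / r) ^+ 3 * rexp sg s)).
- by apply: cmeasM => //; exact: cmeas_ewt.
- meas.
- move=> s; rewrite /Hs /H /Hr /rexp mulrCA cabsM [cabs (ewt _ _ * _)]cabsM.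
  have /andP[h0 h1] := hv01 s; rewrite (cabs_cRp h0) cabs_ewt [leRHS]mulrC -[leRHS]mulrA ler_wpM2l//.
  rewrite ler_wpM2l ?expR_ge0//; exact: cabs_hz3_le.
- rewrite nintZ ?exprn_ge0 ?sqrtr_ge0//.
  + by apply: lte_mul_pinfty; rewrite ?lee_fin ?exprn_ge0 ?sqrtr_ge0 ?nint_rexp_lty.
  + meas.
  + by move=> s; rewrite mulr_ge0 ?expR_ge0//; case/andP: (hv01 s).
Qed.

(** Time integration turns the damped kernel into the resolvent [1 / (i (k^2 - w))] at
    [w = E + i sg], integrated against [k] times a Gaussian. The square root [kap] of [w] in the
    upper half plane splits it into two half-line integrals. *)
Lemma ft_Hs_bound sg E : 0 < sg -> nrm y * cabs (ft (Hs sg) E) <= (2 * pi) ^+ 2.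
Proof.
move=> sg0; pose w : R[i] := cR E + iC R * cR sg.
have wi : 0 < cim w by rewrite !(creE, cimE) /= mul0r mul1r !add0r.
have [kap kk kp] := complex_sqrt wi.
pose zs : R[i] := cR sg - iC R * cR E.
pose F (p : R * R) := (cR p.2 * egauss (cR r) (nrm y) p.2) * exz (zs + iC R * cR (p.2 ^+ 2)) p.1.
have rz k : cre (zs + iC R * cR (k ^+ 2)) = sg.
  by rewrite /zs !(creE, cimE) /=; ring.
have mk : cmeas (fun k : R => cR k : R[i]) by meas.
have lk : cL1 lam (fun k => cR k * egauss (cR r) (nrm y) k).
  apply: (@cL1_poly_egauss R (cR r) (nrm y) (@cR R) 1) => // k.
  by rewrite cabs_cR mul1r; exact: norm_le_one_sqr.
have mF : cmeas F.
  apply: cmeasM; first by apply: (cmeas_comp (g := snd) (proj1 lk)).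
  apply: cmeasM; first by apply: cmeas_cR; exact: (measurableT_comp (@mfun_hv R)).
  apply: cmeas_cexp; apply: cmeasM; last by meas.
  apply: cmeasN; apply: cmeasD; first by meas.
  meas.
have lF : cL1 (prodm lam lam) F.
  have [m1 n1] := lk.
  apply: (@cL1_prod_dom _ _ _ _ _ lam lam F (rexp sg) (fun k => cabs (cR k * egauss (cR r) (nrm y) k)) mF) => //.
  - meas.
  - meas.
  - by move=> s; rewrite mulr_ge0 ?expR_ge0//; case/andP: (hv01 s).
  - exact: nint_rexp_lty.
  - by move=> s k; rewrite /F /= cabsM cabs_exz rz mulrC.
have E1 s : cint lam (fun k => F (s, k)) * - (cR (2 * pi) * iC R) = cR (nrm y) * (Hs sg s * expi (E * s)).
  have ezs k : F (s, k) = (cR (hv s) * cexp (- zs * cR s)) * (cR k * egauss (cz r s) (nrm y) k).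
    rewrite /F /exz /= /egauss.
    transitivity (cR (hv s) * cR k * (cexp (- cR r * cR (k ^+ 2) + iC R * cR (nrm y * k)) * cexp (- (zs + iC R * cR (k ^+ 2)) * cR s))); first by ring.
    transitivity (cR (hv s) * cR k * (cexp (- zs * cR s) * cexp (- cz r s * cR (k ^+ 2) + iC R * cR (nrm y * k)))); last by ring.
    congr (_ * _); rewrite -!cexpD; congr cexp; rewrite czE; ring.
  have lz : cL1 lam (fun k => cR k * egauss (cz r s) (nrm y) k).
    apply: (@cL1_poly_egauss R (cz r s) (nrm y) (@cR R) 1) => // k.
    by rewrite cabs_cR mul1r; exact: norm_le_one_sqr.
  have rad := hz3_radial y (r0 : 0 < cre (cz r s)).
  rewrite (eq_cint _ ezs) (cintZ _ lz); move: rad; move: (cint _ _) => M rad.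
  transitivity (cR (hv s) * cexp (- zs * cR s) * - (cR (2 * pi) * iC R * M)); first by ring.
  rewrite -rad.
  have -> : cexp (- zs * cR s) = ewt sg s * expi (E * s).
    rewrite /ewt -cexp_cR -cexp_im -cexpD; congr cexp; rewrite /zs cRN !cRM; ring.
  by rewrite /Hs /H /Hr; ring.
(* Partial fractions: [k / (k^2 - kap^2)] is half the sum of [1 / (k - kap)] and [1 / (k + kap)];
   the second term is brought to the form of the first by [k -> - k] and [x -> - x]. *)
have E2 k : cint lam (fun s => F (s, k)) = cR 2^-1 * (egauss (cR r) (nrm y) k * (iC R * (cR k - kap))^-1) -
    cR 2^-1 * (egauss (cR r) (nrm y) k * (- iC R * (cR k + kap))^-1).
  rewrite /F /= cintZ ?cint_exz ?rz//; last by apply: cL1_exz; rewrite rz.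
  have ii : iC R != 0 by rewrite -cabs_eq0 cabs_iC oner_eq0.
  have n1 : cR k - kap != 0.
    apply: contraTneq kp => /(congr1 (@cim R)); rewrite cimD cimN cim_cR cim0 add0r => /eqP.
    by rewrite oppr_eq0 => /eqP ->; rewrite ltxx.
  have n2 : cR k + kap != 0.
    by apply: contraTneq kp => /(congr1 (@cim R)); rewrite cimD cim_cR cim0 add0r => ->; rewrite ltxx.
  have -> : zs + iC R * cR (k ^+ 2) = iC R * ((cR k - kap) * (cR k + kap)).
    have -> : (cR k - kap) * (cR k + kap) = cR k * cR k - kap * kap by ring.
    rewrite kk /zs /w expr2 cRM; have := iC2 R; move: (iC R) (cR k) => i x i2.
    rewrite !mulrDr mulrN mulrDr [i * (i * _)]mulrA i2; ring.
  rewrite cRV cR_nat; move: (cR k) (egauss _ _ _) n1 n2 ii => x g n1 n2 ii.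
  by field; rewrite n1 n2 ii.
have [l1 b1] := cabs_half_line (nrm y) r0 kp.
have [l2' b2'] := cabs_half_line (- nrm y) r0 kp.
have [l2 e2] := opp_cint l2'.
have E3 k : egauss (cR r) (nrm y) k * (- iC R * (cR k + kap))^-1 = egauss (cR r) (- nrm y) (- k) * (iC R * (cR (- k) - kap))^-1.
  congr (_ * _^-1); first by rewrite /egauss sqrrN mulrNN.
  by rewrite cRN; ring.
have b2 : cabs (cint lam (fun k => egauss (cR r) (nrm y) k * (- iC R * (cR k + kap))^-1)) <= 2 * pi.
  by rewrite (eq_cint _ E3) e2.
have l2n : cL1 lam (fun k => egauss (cR r) (nrm y) k * (- iC R * (cR k + kap))^-1).
  by apply: (eq_cL1 (fun k => esym (E3 k))).
have B : cabs (cint lam (fun k => cint lam (fun s => F (s, k)))) <= 2 * pi.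
  rewrite (eq_cint _ E2) cintB; [|exact: cL1Z..].
  rewrite !cintZ//; apply: le_trans (cabsB _ _) _.
  by rewrite !cabsM cabs_cRp ?invr_ge0//; move: b1 b2; lra.
have -> : nrm y * cabs (ft (Hs sg) E) = cabs (cR (nrm y) * ft (Hs sg) E).
  by rewrite cabsM cabs_cRp// ltW.
rewrite /ft -cintZ; last exact: cL1_expi (lHs sg0).
rewrite -(eq_cint _ E1).
have lc := cL1_cint1 lF.
rewrite (eq_cint _ (g := fun s => - (cR (2 * pi) * iC R) * cint lam (fun k => F (s, k)))); last by move=> s; rewrite mulrC.
rewrite cintZ// (cFubini lF) cabsM cabsN cabsM cabs_iC mulr1 cabs_cRp ?mulr_ge0 ?pi_ge0//.
by rewrite expr2 ler_wpM2l// mulr_ge0 ?pi_ge0.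
Qed.

Let B := Num.sqrt (pi / r) ^+ 3.
Let bHs sg s : 0 < sg -> cabs (Hs sg s) <= B.
Proof.
move=> sg0; rewrite /Hs; have [s0|s0] := leP s 0.
  by rewrite /H /Hr /hv ltNge s0 cR0 mul0r mulr0 cabs0 exprn_ge0 ?sqrtr_ge0.
rewrite cabsM -[leRHS]mul1r; apply: ler_pM; [exact: cabs_ge0|exact: cabs_ge0| |exact: bH].
by apply: cabs_ewt_le1; exact: ltW.
Qed.

Let u (sg s : R) := ewt sg s * q s.
Let u_le sg s : 0 < sg -> cabs (u sg s) <= cabs (q s).
Proof.
move=> sg0; rewrite /u; have [s0|s0] := leP s 0; first by rewrite q0// mulr0.
by rewrite cabsM ler_piMl ?cabs_ge0//; apply: cabs_ewt_le1; exact: ltW.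
Qed.

Let mu_ sg : cmeas (u sg).
Proof. by apply: cmeasM; [exact: cmeas_ewt|case: l2q]. Qed.
Let l1u sg : 0 < sg -> cL1 lam (u sg).
Proof.
move=> sg0.
have l2r : cL2 (fun s => cR (rexp sg s)).
  split; first by meas.
  rewrite (_ : N2 _ = nint lam (rexp (2 * sg))); first by apply: nint_rexp_lty; rewrite mulr_gt0.
  apply: eq_nint => s; rewrite cabs2_cR /rexp exprMn /hv; case: (0 < s); last by rewrite expr0n !mul0r.
  by rewrite expr1n !mul1r expr2 -expRD; congr expR; ring.
apply: (eq_cL1 _ (cL1_L2M l2r l2q)) => s; rewrite /u /rexp.
have [s0|s0] := leP s 0; first by rewrite q0// !mulr0.
by rewrite /hv s0 mul1r.
Qed.

Let N2u sg : 0 < sg -> (N2 (u sg) <= N2 q)%E.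
Proof.
move=> sg0; have [mq _] := l2q; apply: le_nint.
- meas.
- meas.
- pos.
- by move=> s; rewrite !cabs2E ler_pXn2r ?nnegrE ?cabs_ge0// u_le.
Qed.

Let cH sg t : t != 0 -> ccont_at (Hs sg) t.
Proof.
move=> t0; apply: ccont_M; first exact: ccont_ewt.
by apply: ccont_M; [exact: ccont_hv|exact: hz3_continuous].
Qed.
Let convE sg t : 0 < sg -> cconv (u sg) (Hs sg) t = ewt sg t * cconv q H t.
Proof.
move=> sg0; have [mHs _] := lHs sg0.
have E s : u sg s * Hs sg (t - s) = ewt sg t * (q s * H (t - s)).
  by rewrite /u /Hs -(ewtB sg t s); ring.
have l := cL1_conv_bounded t (l1u sg0) mHs (fun s => bHs s sg0).
have l2 : cL1 lam (fun s => q s * H (t - s)).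
  apply: (eq_cL1 _ (cL1Z (ewt (- sg) t) l)) => s.
  by rewrite E mulrA -ewtD addNr ewt0 mul1r.
by rewrite /cconv (eq_cint _ E) cintZ.
Qed.

Let damped sg : 0 < sg -> ((nrm y ^+ 2)%:E * N2 (fun t => (ewt sg t * cconv q H t)%R) <= ((2 * pi) ^+ 4)%:E * N2 q)%E.
Proof.
move=> sg0; have lv := lHs sg0; have lu := l1u sg0; have [mHs _] := lv.
pose w := cconv (u sg) (Hs sg).
have -> : N2 (fun t => (ewt sg t * cconv q H t)%R) = N2 w by apply: eq_nint => t; rewrite /w convE.
have lw : cL1 lam w by exact: cL1_conv.
have cw t : t != 0 -> ccont_at w t.
  by move=> _; apply: (cconv_continuous lu mHs (fun s => bHs s sg0)) => s; exact: cH.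
have P0 : 0 < 2 * pi :> R by rewrite mulr_gt0 ?pi_gt0.
have n0 : 0 <= nrm y ^+ 2 by pos.
have ge := plancherel_ge lw cw.
have mfu := cmeas_cabs2 (cmeas_ft lu).
rewrite -(@lee_pmul2l _ (2 * pi)%:E) ?lte_fin// muleCA.
apply: le_trans (lee_wpmul2l _ ge) _; first by [].
rewrite -nintZ//; last by apply: cmeas_cabs2; exact: cmeas_ft.
apply: (@le_trans _ _ (nint lam (fun E => ((2 * pi) ^+ 4 * cabs2 (ft (u sg) E))%R))).
  apply: le_nint.
  - by apply: measurable_funM => //; apply: cmeas_cabs2; exact: cmeas_ft.
  - meas.
  - by move=> E; rewrite mulr_ge0 ?cabs2_ge0.
  move=> E; rewrite /w (ft_conv _ lu lv (fun s => bHs s sg0)) cabs2M mulrCA [leRHS]mulrC ler_wpM2l ?cabs2_ge0//.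
  rewrite cabs2E -exprMn (_ : (2 * pi) ^+ 4 = ((2 * pi) ^+ 2) ^+ 2); last by rewrite -exprM.
  have hb := ft_Hs_bound E sg0.
  by apply: lerXn2r => //; rewrite nnegrE ?exprn_ge0 ?(ltW P0)// mulr_ge0 ?cabs_ge0 ?(ltW y0).
rewrite (nintZ lam (exprn_ge0 4 (ltW P0)) mfu); last by [].
rewrite muleCA; apply: lee_wpmul2l; first by rewrite lee_fin exprn_ge0// ltW.
apply: le_trans (plancherel_le lu) _; apply: lee_wpmul2l; first by rewrite lee_fin ltW.
exact: N2u.
Qed.

Lemma cmeas_conv_H : cmeas (cconv q H).
Proof. by apply: cmeas_conv => //; case: l2q. Qed.

(* The time Fourier transform of the kernel is, up to damping, the Gaussian
   average of the resolvent kernel, so it is bounded by [1/|y|] uniformly in the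
   energy and in the width [r]; Plancherel in time does the rest. *)
Theorem kato_smoothing : ((nrm y ^+ 2)%:E * N2 (cconv q H) <= ((2 * pi) ^+ 4)%:E * N2 q)%E.
Proof.
have mc := cmeas_conv_H.
have n0 : 0 <= nrm y ^+ 2 by pos.
rewrite /N2 -nintZ//; last by meas.
apply: (@nint_fatou _ _ _ lam (fun n t => nrm y ^+ 2 * cabs2 (ewt (epsn R n) t * cconv q H t))).
- move=> n; apply: measurable_funM => //; apply: cmeas_cabs2; apply: cmeasM => //; exact: cmeas_ewt.
- by move=> n t; rewrite mulr_ge0 ?cabs2_ge0.
- move=> t; apply: cvgM; first exact: cvg_cst.
  apply: ccvg_cabs2; rewrite -[X in ccvg_seq _ X]mul1r; apply: ccvgM; last exact: ccvg_cst.
  rewrite -(ewt0 t); apply: ccvg_cR; apply: continuous_cvg; first exact: continuous_expR.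
  by apply: cvgN; apply: cvgM; [exact: epsn_cvg|exact: cvg_cst].
- move=> n; have e0 : 0 < epsn R n by pos.
  rewrite nintZ//; first exact: damped.
  by apply: cmeas_cabs2; apply: cmeasM => //; exact: cmeas_ewt.
Qed.
End KatoSmoothing.

(** * The heat semigroup on L2 *)

Section HeatSemigroup.
Variable R : realType.
Local Notation lam := (@lam R).
Local Notation lam3 := (@lam3 R).

(** The heat kernel normalised to mass one; the integral [hz] carries an additional factor
    [2 pi]. *)
Definition gk (r u : R) : R := (2 * pi)^-1 * (Num.sqrt (pi / r) * rgauss (4 * r)^-1 u).
Definition gk3 (r : R) (x : pt R) : R := gk r x.1.1 * gk r x.1.2 * gk r x.2.
Definition heat (r : R) (Psi : pt R -> R[i]) (y : pt R) : R[i] :=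
  cint lam3 (fun x => cR (gk3 r (ptsub x y)) * Psi x).
Lemma gk_ge0 r u : 0 <= gk r u.
Proof. by rewrite mulr_ge0 ?invr_ge0 ?mulr_ge0 ?pi_ge0 ?sqrtr_ge0 ?expR_ge0. Qed.
Lemma gk3_ge0 r x : 0 <= gk3 r x.
Proof. by apply: mulr_ge0; [apply: mulr_ge0|]; exact: gk_ge0. Qed.
Lemma mfun_gk r : mfun (gk r).
Proof.
apply: measurable_funM => //; apply: measurable_funM => //; meas.
Qed.
Lemma mfun_gk3 r : mfun (gk3 r).
Proof.
have mg := mfun_gk r.
by apply: measurable_funM; [apply: measurable_funM|]; apply: (measurableT_comp mg);
  [exact: mfun_pt1|exact: mfun_pt2|exact: mfun_pt3].
Qed.
Lemma mfun_ptsub : mfun (fun z : pt R * pt R => ptsub z.1 z.2).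
Proof.
have P (p : pt R -> R) : mfun p ->
    mfun (fun z : pt R * pt R => p z.1 - p z.2).
  by move=> mp; apply: measurable_funB; apply: (measurableT_comp mp).
by apply: measurable_fun_pair; [apply: measurable_fun_pair|];
  [exact: P _ (@mfun_pt1 R)|exact: P _ (@mfun_pt2 R)|exact: P _ (@mfun_pt3 R)].
Qed.
Lemma mfun_ptsubl y : mfun (fun x : pt R => ptsub x y).
Proof. meas. Qed.
Lemma nint_gk r : 0 < r -> nint lam (gk r) = 1%E.
Proof.
move=> r0; have p0 := pi_gt0 R; have r4 : 0 < (4 * r)^-1 by pos.
rewrite nintZ; last 3 first.
- by rewrite invr_ge0 mulr_ge0 ?ltW.
- meas.
- by move=> x; rewrite mulr_ge0 ?sqrtr_ge0 ?expR_ge0.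
rewrite nintZ ?sqrtr_ge0//; last 2 first.
- meas.
- by move=> x; exact: expR_ge0.
rewrite nint_rgauss// -!EFinM -sqrtrM ?divr_ge0 ?ltW//.
have -> : pi / r * (pi / (4 * r)^-1) = (2 * pi) ^+ 2 by field; rewrite gt_eqF.
by rewrite sqrtr_sqr ger0_norm ?mulVf// ?mulr_ge0 ?ltW// gt_eqF// mulr_gt0.
Qed.

Lemma nint_gk_sub r (y : R) : 0 < r -> nint lam (fun x => gk r (x - y)) = 1%E.
Proof.
move=> r0; rewrite -(nint_gk r0) (nint_shift (- y) (mfun_gk r))//.
by move=> x; exact: gk_ge0.
Qed.
Lemma gkN r u : gk r (- u) = gk r u.
Proof. by rewrite /gk /rgauss sqrrN. Qed.
Lemma gk3N r (x y : pt R) : gk3 r (ptsub x y) = gk3 r (ptsub y x).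
Proof. by rewrite /gk3 /ptsub /= -[in LHS]gkN -[X in _ * X * _ = _]gkN -[X in _ * _ * X = _]gkN !opprB. Qed.
Lemma nint_gk3 r y : 0 < r -> nint lam3 (fun x => gk3 r (ptsub x y)) = 1%E.
Proof.
move=> r0; have M (c : R) : mfun (fun x : R => gk r (x - c)).
  by apply: (measurableT_comp (mfun_gk r)); meas.
rewrite /gk3 /ptsub /= (nint_tens3 (M y.1.1) (M y.1.2) (M y.2)); try by move=> x; exact: gk_ge0.
by rewrite !nint_gk_sub// !mule1.
Qed.

Lemma gk3_hz3 r x : 0 < r -> cR (gk3 r x) = cR (2 * pi)^-1 ^+ 3 * hz3 (cR r) x.
Proof. by move=> r0; rewrite /gk3 /hz3 !hz_real// /gk !cRM; ring. Qed.
Lemma inL2_gk3 r y : 0 < r -> inL2 lam3 (fun x => cR (gk3 r (ptsub x y))).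
Proof.
move=> r0.
have L (c : R) : inL2 lam (fun u => hz (cR r) (u + - c)) by exact: inL2_hz.
have T := inL2_tens3 (L y.1.1) (L y.1.2) (L y.2).
have := inL2Dz (cR (2 * pi)^-1 ^+ 3 - 1) T T; congr (inL2 _ _); apply/funext => x.
rewrite gk3_hz3// /hz3 /tens3 /ptsub /=.
by move: (cR (2 * pi)^-1) (hz _ _) (hz _ _) (hz _ _) => k u v w; ring.
Qed.

Lemma cL1_heat r y Psi : 0 < r -> inL2 lam3 Psi -> cL1 lam3 (fun x => cR (gk3 r (ptsub x y)) * Psi x).
Proof. by move=> r0 L; exact: cL1_inL2M (inL2_gk3 y r0) L. Qed.
Lemma cmeas_heat2 r Psi : cmeas Psi ->
  cmeas (fun z : pt R * pt R => cR (gk3 r (ptsub z.2 z.1)) * Psi z.2).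
Proof.
move=> mP; apply: cmeasM; last exact: (cmeas_comp mP).
apply: cmeas_cR; apply: (measurableT_comp (mfun_gk3 r)).
exact: (measurableT_comp mfun_ptsub (measurable_fun_pair _ _)).
Qed.

Lemma cmeas_heat r Psi : cmeas Psi -> cmeas (heat r Psi).
Proof. by move=> mP; exact: (cmeas_cint1 lam3 (cmeas_heat2 r mP)). Qed.
Lemma heatDz r f g c y : 0 < r -> inL2 lam3 f -> inL2 lam3 g ->
  heat r (fun x => f x + c * g x) y = heat r f y + c * heat r g y.
Proof.
move=> r0 lf lg; have l1 := cL1_heat y r0 lf; have l2 := cL1_heat y r0 lg.
rewrite /heat (eq_cint _ (g := fun x => cR (gk3 r (ptsub x y)) * f x + c * (cR (gk3 r (ptsub x y)) * g x))).
  by rewrite (cintD l1 (cL1Z c l2)) (cintZ c l2).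
by move=> x; ring.
Qed.

Lemma Nm_heat r Psi : 0 < r -> cmeas Psi -> (Nm lam3 (heat r Psi) <= Nm lam3 Psi)%E.
Proof.
move=> r0 mP.
have mc : mfun (fun x => cabs (Psi x)) by meas.
have ma : mfun (fun z : pt R * pt R => gk3 r (ptsub z.2 z.1)).
  apply: (measurableT_comp (mfun_gk3 r)).
  exact: (measurableT_comp mfun_ptsub (measurable_fun_pair _ _)).
have := @schur_test R _ _ _ _ lam3 lam3 _ _ (fun x => cabs (Psi x)) 1 1 (cmeas_heat2 r mP) ma mc.
have E : nint lam3 (fun y => (cabs (Psi y) ^+ 2)%R) = Nm lam3 Psi by apply: eq_nint => x; rewrite cabs2E.
rewrite mulr1 mul1e E; apply => //.
- by move=> z; exact: gk3_ge0.
- by move=> x y /=; rewrite cabsM cabs_cRp// gk3_ge0.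
- by move=> y /=; rewrite nint_gk3.
- move=> y /=; rewrite (eq_nint (fun x => gk3 r (ptsub x y))) ?nint_gk3//.
  by move=> x; rewrite gk3N.
Qed.

Lemma heat_gauss r b y : 0 < r -> heat r (gauss b) y =
  cR ((Num.sqrt (1 + 4 * r))^-1 ^+ 3 * expR (- ((1 + 4 * r)^-1 * nrm2 (ptsub b y)))).
Proof.
move=> r0; have [l e] := @cint_gauss_hz3 R y 0 b r r0.
have p0 := pi_gt0 R.
have z0 : cz r 0 = cR r by [].
rewrite /heat (eq_cint _ (g := fun x => cR (2 * pi)^-1 ^+ 3 * (gauss b x * hz3 (cz r 0) (ptsub x y)))).
  rewrite cintZ// e {l e}.
  have -> : cz (4^-1 + r) 0 = cR (4^-1 + r) by [].
  have q0 : 0 < 4^-1 + r by pos.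
  have s0 : 0 < 1 + 4 * r by pos.
  rewrite /hz3 !hz_real// -!cRX -!cRM; congr cR.
  have -> : 4 * (4^-1 + r) = 1 + 4 * r by field.
  have -> : expR (- ((1 + 4 * r)^-1 * nrm2 (ptsub b y))) =
    rgauss (1 + 4 * r)^-1 (ptsub b y).1.1 * rgauss (1 + 4 * r)^-1 (ptsub b y).1.2 * rgauss (1 + 4 * r)^-1 (ptsub b y).2.
    by rewrite /rgauss -!expRD; congr expR; rewrite /nrm2; ring.
  have -> : (Num.sqrt (1 + 4 * r))^-1 = (2 * pi)^-1 * Num.sqrt pi * Num.sqrt (pi / (4^-1 + r)).
    rewrite -mulrA -sqrtrM ?ltW//.
    have -> : pi * (pi / (4^-1 + r)) = (2 * pi) ^+ 2 * (1 + 4 * r)^-1.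
      by field; rewrite gt_eqF//= gt_eqF//; lra.
    rewrite sqrtrM ?sqr_ge0// sqrtr_sqr ger0_norm ?mulr_ge0 ?ltW// mulrA mulVf ?mul1r ?sqrtrV ?ltW//.
    by rewrite gt_eqF// mulr_gt0.
  by move: (rgauss _ _) (rgauss _ _) (rgauss _ _) (Num.sqrt _) (Num.sqrt _) => A B D E F; ring.
by move=> x; rewrite gk3_hz3// z0; ring.
Qed.

(** Heat times tending to zero inside []0, 1 / 4]], the range covered by [smoothed_propagator]. *)
Definition rn (n : nat) : R := 4^-1 * epsn R n.
Lemma rn_gt0 n : 0 < rn n. Proof. pos. Qed.
Lemma rn_le n : rn n <= 4^-1.
Proof. by rewrite ler_piMr ?invr_ge0// invf_le1 ?ltr0n// ler1n. Qed.
Lemma rn_cvg : 1 + 4 * rn n @[n --> \oo] --> (1 : R).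
Proof.
rewrite -[X in _ --> X]addr0; apply: cvgD; first exact: cvg_cst.
rewrite (_ : (fun n => 4 * rn n) = epsn R); first exact: epsn_cvg.
by apply/funext => n; rewrite /rn mulrA mulfV ?mul1r.
Qed.
(** The states with this property form a closed subspace, because the heat operators are
    contractions; on Gaussians the explicit formula [heat_gauss] allows dominated convergence. *)
Lemma heat_approximates Psi : inL2 lam3 Psi -> forall e : R, 0 < e ->
  \forall n \near \oo, (Nm lam3 (fun x => (Psi x - heat (rn n) Psi x)%R) <= e%:E)%E.
Proof.
pose S (Psi : pt R -> R[i]) := inL2 lam3 Psi /\ forall e : R, 0 < e ->
  \forall n \near \oo, (Nm lam3 (fun x => (Psi x - heat (rn n) Psi x)%R) <= e%:E)%E.
suff H : forall f, inL2 lam3 f -> S f by move=> /H[].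
have N3 (u v w : pt R -> R[i]) : cmeas u -> cmeas v -> cmeas w ->
    (Nm lam3 (fun x => (u x + (v x + w x))%R) <= 2%:E * Nm lam3 u + (4%:E * Nm lam3 v + 4%:E * Nm lam3 w))%E.
  move=> mu mv mw; apply: le_trans (NmD lam3 mu (cmeasD mv mw)) _.
  apply: leeD2l; apply: (@le_trans _ _ (2%:E * (2%:E * Nm lam3 v + 2%:E * Nm lam3 w))%E).
    by apply: lee_wpmul2l => //; exact: NmD.
  by rewrite ge0_muleDr ?mule_ge0 ?Nm_ge0// !muleA -!EFinM -natrM.
have small (X : \bar R) (k d : R) : 0 <= k -> (X <= d%:E)%E -> (k%:E * X <= (k * d)%:E)%E.
  by move=> k0 Xd; rewrite EFinM; apply: lee_wpmul2l; rewrite ?lee_fin.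
apply: gaussians_dense3.
  split.
    move=> f g c [lf Hf] [lg Hg]; split; first exact: inL2Dz.
    move=> e e0; pose k := 1 + cabs2 c; have k0 : 0 < k by rewrite ltr_wpDr ?cabs2_ge0.
    have d0 : 0 < e / (4 * k) by pos.
    have [mf _] := lf; have [mg _] := lg.
    apply: filterS2 (Hf _ d0) (Hg _ d0) => n h1 h2.
    have mhf := cmeas_heat (rn n) mf; have mhg := cmeas_heat (rn n) mg.
    rewrite (_ : Nm lam3 _ = Nm lam3 (fun x => (f x - heat (rn n) f x) + c * (g x - heat (rn n) g x))); last first.
      by apply: eq_nint => x; rewrite (heatDz c x (rn_gt0 n) lf lg); congr cabs2; ring.
    apply: le_trans (NmD lam3 (cmeasB mf mhf) (cmeasM (cmeas_cst c) (cmeasB mg mhg))) _.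
    rewrite (NmZ lam3 c (cmeasB mg mhg)).
    have b2 := small _ _ _ (cabs2_ge0 c) h2.
    apply: le_trans (leeD (small _ 2 _ _ h1) (small _ 2 _ _ b2)) _ => //.
    rewrite -EFinD lee_fin.
    have -> : 2 * (e / (4 * k)) + 2 * (cabs2 c * (e / (4 * k))) = e / 2.
      by rewrite -mulrDr -[X in X + _]mul1r -mulrDl -/k; field; rewrite gt_eqF.
    by lra.
  move=> f lf H; split => // e e0.
  have d0 : 0 < e / 10 by pos.
  have [g [lg Sg] Nfg] := H _ d0; have [mf _] := lf; have [mg _] := lg.
  apply: filterS (Sg _ d0) => n hn.
  have mhf := cmeas_heat (rn n) mf; have mhg := cmeas_heat (rn n) mg.
  have Hd x : heat (rn n) (fun x => f x + (-1) * g x) x = heat (rn n) f x + (-1) * heat (rn n) g x.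
    by exact: heatDz (rn_gt0 n) lf lg.
  have Nh : (Nm lam3 (fun x => (heat (rn n) g x - heat (rn n) f x)%R) <= (e / 10)%:E)%E.
    apply: le_trans Nfg.
    rewrite (_ : Nm lam3 _ = Nm lam3 (heat (rn n) (fun x => f x + (-1) * g x))).
      apply: le_trans (Nm_heat (rn_gt0 n) _) _.
        meas.
      by apply: le_of_eq; apply: eq_nint => x; rewrite mulN1r.
    by apply: eq_nint => x; rewrite Hd -cabs2N; congr cabs2; ring.
  rewrite (_ : Nm lam3 _ = Nm lam3 (fun x => (f x - g x) + ((g x - heat (rn n) g x) + (heat (rn n) g x - heat (rn n) f x)))); last first.
    by apply: eq_nint => x; congr cabs2; ring.
  apply: le_trans (N3 _ _ _ (cmeasB mf mg) (cmeasB mg mhg) (cmeasB mhg mhf)) _.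
  apply: le_trans (leeD (small _ 2 _ _ Nfg) (leeD (small _ 4 _ _ hn) (small _ 4 _ _ Nh))) _ => //.
  by rewrite -!EFinD lee_fin; lra.
move=> b; have [mb _] := cL1_gauss b.
pose G (x : pt R) := expR (- (2^-1 * nrm2 (ptsub b x))).
have mn : mfun (fun x : pt R => nrm2 (ptsub b x)).
  have M (p : pt R -> R) (c : R) : mfun p -> mfun (fun x => (c - p x) ^+ 2).
    by move=> mp; apply: measurable_funX; meas.
  by apply: measurable_funD; [apply: measurable_funD|]; apply: M;
    [exact: mfun_pt1|exact: mfun_pt2|exact: mfun_pt3].
have mG : mfun G.
  by apply: (measurableT_comp (@measurable_expR R)); apply: measurableT_comp => //; meas.
have n0 x : 0 <= nrm2 (ptsub b x) by rewrite !addr_ge0 ?sqr_ge0.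
have nC x : nrm2 (ptsub x b) = nrm2 (ptsub b x) by rewrite /nrm2 /ptsub /=; ring.
have G2 : (nint lam3 (fun x => (G x ^+ 2)%R) < +oo)%E.
  have [_] := cL1_gauss b; congr (_ < _)%E; apply: eq_nint => x.
  by rewrite cabs_cRp ?expR_ge0// /G expr2 -expRD nC; congr expR; lra.
have hG n x : cabs (heat (rn n) (gauss b) x) <= G x.
  have r0 := rn_gt0 n; have r1 := rn_le n.
  have s1 : 1 <= Num.sqrt (1 + 4 * rn n) by rewrite -[leLHS]sqrtr1 ler_wsqrtr//; lra.
  rewrite (heat_gauss b x r0) cabs_cRp; last first.
    pos.
  rewrite -[leRHS]mul1r; apply: ler_pM; rewrite ?expR_ge0 ?exprn_ge0 ?invr_ge0 ?sqrtr_ge0//.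
    by rewrite exprn_ile1 ?invr_ge0 ?sqrtr_ge0// invf_le1// (lt_le_trans ltr01).
  rewrite ler_expR lerN2; apply: ler_wpM2r => //.
  by rewrite lef_pV2 ?posrE; lra.
apply: (Nm_dct (f_ := fun n => heat (rn n) (gauss b)) (G := G)) => //.
- by move=> n; exact: cmeas_heat.
- move=> x; apply: (ccvg_eq (fun n => esym (heat_gauss b x (rn_gt0 n)))).
  rewrite /gauss nC; apply: ccvg_cR.
  have c1 := rn_cvg.
  have c2 : (Num.sqrt (1 + 4 * rn n))^-1 @[n --> \oo] --> (1 : R).
    rewrite -[X in _ --> X]invr1; apply: cvgV; first exact: oner_neq0.
    rewrite -[X in _ --> X]sqrtr1; apply: continuous_cvg => //; exact: sqrt_continuous.
  have c3 : (1 + 4 * rn n)^-1 @[n --> \oo] --> (1 : R).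
    by rewrite -[X in _ --> X]invr1; apply: cvgV; first exact: oner_neq0.
  rewrite -[X in _ --> X]mul1r; apply: cvgM.
    rewrite -[X in _ --> X]mul1r; apply: cvgM => //.
    by rewrite -[X in _ --> X]mul1r; apply: cvgM.
  apply: continuous_cvg; first exact: continuous_expR.
  apply: cvgN; rewrite -[X in _ --> X]mul1r; apply: cvgM => //; exact: cvg_cst.
Qed.
End HeatSemigroup.

(** * Space-time integrability with a Gaussian weight *)

Section WeightedDecay.
Variable R : realType.
Local Notation lam := (@lam R).
Local Notation lam3 := (@lam3 R).

Definition gauss3 (a : R) (y : pt R) : R := expR (- (a * nrm2 y)).
Lemma gauss3E a y : gauss3 a y = rgauss a y.1.1 * rgauss a y.1.2 * rgauss a y.2.
Proof. by rewrite /gauss3 /rgauss -!expRD; congr expR; rewrite /nrm2; ring. Qed.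
Lemma gauss3_ge0 a y : 0 <= gauss3 a y. Proof. exact: expR_ge0. Qed.
Lemma nrm2_ge0 (y : pt R) : 0 <= nrm2 y. Proof. by rewrite !addr_ge0 ?sqr_ge0. Qed.
Lemma mfun_nrm2 : measurable_fun [set: pt R] (@nrm2 R).
Proof.
by apply: measurable_funD; [apply: measurable_funD|]; apply: measurable_funX;
  [exact: mfun_pt1|exact: mfun_pt2|exact: mfun_pt3].
Qed.
Lemma mfun_gauss3 a : mfun (gauss3 a).
Proof.
apply: (measurableT_comp (@measurable_expR R)); apply: measurableT_comp => //.
by apply: measurable_funM => //; exact: mfun_nrm2.
Qed.
Lemma nint_gauss3 a : 0 < a -> nint lam3 (gauss3 a) = (Num.sqrt (pi / a) ^+ 3)%:E.
Proof.
move=> a0; have m := mfun_rgauss a; have p := @rgauss_ge0 R a.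
rewrite (eq_nint _ (fun y => gauss3E a y)) (nint_tens3 m m m p p p) nint_rgauss//.
by rewrite -!EFinM; congr _%:E; ring.
Qed.
Lemma mfun_absgauss (rho : R) : mfun (fun u : R => `|u| * rgauss rho u).
Proof. meas. Qed.

(** On [[c, 2 c]] with [c = rho^(-1/2)] one has [rho u^2 <= 4], and the interval contributes
    [c * c = 1 / rho]. With [rho = |y|^2] this replaces the singular weight [|y|^(-2)] by a mixture
    of Gaussians, which factorises over the coordinates. *)
Lemma inv_le_gaussians (rho : R) : 0 < rho ->
  ((expR (- 4) * rho^-1)%:E <= nint lam (fun u : R => (`|u| * rgauss rho u)%R))%E.
Proof.
move=> r0; pose c := (Num.sqrt rho)^-1; have c0 : 0 < c by pos.
have cc : c * c = rho^-1 by rewrite /c -invfM -expr2 sqr_sqrtr ?ltW.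
have mA : measurable (`[c, 2 * c] : set R) by [].
have Ac : lam `[c, 2 * c] = c%:E.
  rewrite /lam lebesgue_measure_itv /= lte_fin ifT -?EFinB; last by lra.
  by congr _%:E; lra.
have k0 : 0 <= c * expR (- 4) by pos.
apply: (@le_trans _ _ (nint lam (fun u : R => c * expR (- 4) * \1_`[c, 2 * c] u)%R)).
  have m1 : mfun (\1_`[c, 2 * c] : R -> R) by [].
  have p1 (x : R) : 0 <= (\1_`[c, 2 * c] x : R) by [].
  rewrite (nintZ lam k0 m1 p1).
  have -> : nint lam (\1_`[c, 2 * c] : R -> R) = c%:E by rewrite (nint_indic lam mA); exact: Ac.
  rewrite -EFinM lee_fin -cc.
  by apply: le_of_eq; ring.
apply: le_nint.
- meas.
- meas.
- by move=> u; rewrite mulr_ge0.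
move=> u; rewrite indicE mem_setE in_itv /=; case: andP => [[u1 u2]|_]; last first.
  by rewrite mulr0 mulr_ge0// expR_ge0.
have u0 : 0 <= u by apply: le_trans u1; exact: ltW.
rewrite mulr1 ger0_norm//; apply: ler_pM; rewrite ?expR_ge0 ?(ltW c0)//.
rewrite /rgauss ler_expR lerN2.
have -> : 4 = rho * (2 * c) ^+ 2 by rewrite expr2 mulrACA cc mulrCA mulrA mulfK ?gt_eqF//; lra.
by rewrite ler_pM2l// lerXn2r ?nnegrE// mulr_ge0// ltW.
Qed.

Variables (q : R -> R[i]) (b : pt R).
Hypothesis l2q : cL2 q.
Hypothesis q0 : forall s, s <= 0 -> q s = 0.

Let K : R := (2 * pi) ^+ 4 * expR 4 * (n2 q + 1).
Let n2q0 : 0 <= n2 q. Proof. by rewrite -lee_fin n2E//; exact: nint_ge0 (fun x => cabs2_ge0 _). Qed.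
Let K0 : 0 < K.
Proof. by rewrite !mulr_gt0 ?expR_gt0 ?exprn_gt0 ?mulr_gt0 ?pi_gt0 ?ltr_wpDl. Qed.
Lemma N2_conv_le (r : R) (y : pt R) : 0 < r ->
  (N2 (cconv q (Hr r y)) <= K%:E * nint lam (fun u : R => (`|u| * rgauss (nrm2 y) u)%R))%E.
Proof.
(* At [y = 0] Kato smoothing gives nothing, but there the integral on the right is infinite. *)
move=> r0; have [y0|y0] := eqVneq (nrm2 y) 0.
  suff -> : nint lam (fun u : R => (`|u| * rgauss (nrm2 y) u)%R) = +oo%E by rewrite gt0_muley ?leey// lte_fin.
  apply: eq_infty => m; rewrite y0.
  have d0 : 0 < expR (- 4) / (`|m| + 1) :> R by [].
  apply: (@le_trans _ _ (`|m| + 1)%:E); first by rewrite lee_fin (le_trans (ler_norm m))// lerDl.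
  apply: (@le_trans _ _ (expR (- 4) * (expR (- 4) / (`|m| + 1))^-1)%:E).
    by rewrite lee_fin invf_div mulrCA mulfV ?mulr1// gt_eqF// expR_gt0.
  apply: le_trans (inv_le_gaussians d0) _; apply: le_nint.
  - meas.
  - meas.
  - by move=> u; rewrite mulr_ge0// expR_ge0.
  move=> u; apply: ler_wpM2l => //; rewrite /rgauss ler_expR lerN2 mul0r.
  by rewrite mulr_ge0 ?sqr_ge0// ltW.
have p0 : 0 < nrm2 y by rewrite lt_neqAle eq_sym y0 nrm2_ge0.
have s0 : 0 < nrm y by pos.
have := kato_smoothing r0 s0 l2q q0; rewrite /nrm sqr_sqrtr ?nrm2_ge0// -(n2E l2q) -EFinM => k1.
have -> : N2 (cconv q (Hr r y)) = ((nrm2 y)^-1%:E * ((nrm2 y)%:E * N2 (cconv q (Hr r y))))%E.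
  by rewrite muleA -EFinM mulVf// mul1e.
apply: (@le_trans _ _ (K%:E * (expR (- 4) * (nrm2 y)^-1)%:E)%E); last first.
  by apply: lee_wpmul2l; [rewrite lee_fin ltW|exact: inv_le_gaussians].
apply: le_trans (lee_wpmul2l _ k1) _; first by rewrite lee_fin invr_ge0 ltW.
rewrite -!EFinM lee_fin.
have -> : K * (expR (- 4) * (nrm2 y)^-1) = (nrm2 y)^-1 * ((2 * pi) ^+ 4 * (n2 q + 1)).
  have e4 : expR 4 * expR (- 4) = 1 :> R by rewrite -expRD subrr expR0.
  transitivity ((expR 4 * expR (- 4)) * ((nrm2 y)^-1 * ((2 * pi) ^+ 4 * (n2 q + 1)))).
    by rewrite /K; ring.
  by rewrite e4 mul1r.
apply: ler_wpM2l; first by rewrite invr_ge0 ltW.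
by apply: ler_wpM2l; rewrite ?lerDl// exprn_ge0// mulr_ge0// pi_ge0.
Qed.

Lemma cmeas_conv2 (r : R) : cmeas (fun z : pt R * R => cconv q (Hr r z.1) z.2).
Proof.
have mq : cmeas q by case: l2q.
apply: (cmeas_cint1 lam (f := fun w : (pt R * R) * R => q w.2 * Hr r w.1.1 (w.1.2 - w.2))).
have ms : mfun (fun w : (pt R * R) * R => w.1.2 - w.2).
  by apply: measurable_funB => //; apply: (measurableT_comp measurable_snd).
apply: cmeasM; first exact: (cmeas_comp mq).
apply: cmeasM; first by apply: cmeas_cR; exact: (measurableT_comp (@mfun_hv R)).
apply: (cmeas_comp (cmeas_hz3 r) (g := fun w : (pt R * R) * R => (w.1.2 - w.2, w.1.1))).
apply: measurable_fun_pair => //; exact: (measurableT_comp measurable_fst).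
Qed.

Definition smoothed (r : R) (y : pt R) (t : R) : R[i] :=
  cR (Num.sqrt pi) ^+ 3 * hz3 (cz (r + 4^-1) t) (ptsub y b) + iC R * cconv q (Hr r y) t.
Lemma cmeas_smoothed r : cmeas (fun z : pt R * R => smoothed r z.1 z.2).
Proof.
apply: cmeasD; apply: cmeasM; [exact: cmeas_cst| |exact: cmeas_cst|exact: cmeas_conv2].
apply: (cmeas_comp (cmeas_hz3 _) (g := fun z : pt R * R => (z.2, ptsub z.1 b))).
apply: measurable_fun_pair => //; exact: (measurableT_comp (mfun_ptsubl b)).
Qed.

Lemma weighted_conv (r : R) : 0 < r ->
  (\int[lam3]_y ((gauss3 1 y)%:E * N2 (cconv q (Hr r y))) <=
   (K * Num.sqrt pi ^+ 3)%:E * nint lam (fun x : R => (1 + x ^+ 2)^-1)%R)%E.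
Proof.
move=> r0; pose h (z : pt R * R) := K * (gauss3 1 z.1 * (`|z.2| * rgauss (nrm2 z.1) z.2)).
have h0 z : 0 <= h z by apply: mulr_ge0; [exact: ltW|apply: mulr_ge0; [exact: expR_ge0|rewrite mulr_ge0// expR_ge0]].
have mh : mfun h.
  apply: measurable_funM => //; apply: measurable_funM.
    exact: (measurableT_comp (mfun_gauss3 1)).
  apply: measurable_funM; first by apply: (measurableT_comp (@normr_measurable R setT)).
  apply: (measurableT_comp (@measurable_expR R)); apply: measurableT_comp => //.
  apply: measurable_funM; first exact: (measurableT_comp mfun_nrm2).
  meas.
have mN : mfun (fun y => N2 (cconv q (Hr r y))).
  have mc := cmeas_cabs2 (cmeas_conv2 r).
  by apply: (mfun_nint1 lam mc) => z; exact: cabs2_ge0.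
have hE y : (nint lam (fun u => h (y, u)) =
    (gauss3 1 y)%:E * (K%:E * nint lam (fun u : R => (`|u| * rgauss (nrm2 y) u)%R)))%E.
  have mu := mfun_absgauss (nrm2 y).
  have u0 (u : R) : 0 <= `|u| * rgauss (nrm2 y) u by pos.
  rewrite /h /= nintZ ?(ltW K0)//; last 2 first.
  - meas.
  - by move=> u; rewrite mulr_ge0// expR_ge0.
  by rewrite (nintZ lam (gauss3_ge0 1 y) mu u0) muleCA.
apply: (@le_trans _ _ (\int[lam3]_y nint lam (fun u => h (y, u)))%E).
  apply: ge0_le_integral => //.
  - by move=> y _; rewrite mule_ge0 ?lee_fin ?expR_ge0//; apply: nint_ge0 => x; exact: cabs2_ge0.
  - by apply: emeasurable_funM => //; apply/measurable_EFinP; exact: mfun_gauss3.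
  - exact: (mfun_nint1 lam mh).
  - move=> y _; rewrite hE; apply: lee_wpmul2l; first by pos.
    exact: N2_conv_le.
rewrite (nint_tonelli lam3 lam mh h0).
have mI : mfun (fun x : R => (1 + x ^+ 2)^-1).
  apply: mfun_invr_ge0 => [|x]; last by rewrite addr_ge0 ?sqr_ge0.
  meas.
have c0 : 0 <= K * Num.sqrt pi ^+ 3 by rewrite mulr_ge0 ?exprn_ge0 ?sqrtr_ge0// ltW.
rewrite -(nintZ lam c0 mI); last by move=> x; rewrite invr_ge0 addr_ge0 ?sqr_ge0.
apply: ge0_le_integral => //.
- by move=> u _; exact: nint_ge0.
- exact: (mfun_nint2 lam3 mh).
- by apply/measurable_EFinP; meas.
move=> u _; have u1 : 0 < 1 + u ^+ 2 by rewrite ltr_wpDr ?sqr_ge0.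
have ku : 0 <= K * `|u| by rewrite mulr_ge0// ltW.
rewrite (eq_nint (fun y => K * `|u| * gauss3 (1 + u ^+ 2) y)); last first.
  move=> y; have -> : gauss3 (1 + u ^+ 2) y = gauss3 1 y * rgauss (nrm2 y) u.
    by rewrite /rgauss /gauss3 -expRD; congr expR; ring.
  by rewrite /h /=; ring.
rewrite (nintZ lam3 ku (mfun_gauss3 _) (@gauss3_ge0 _)) nint_gauss3// -EFinM lee_fin.
rewrite sqrtrM ?pi_ge0// exprMn mulrACA; apply: ler_wpM2l; first exact: c0.
rewrite sqrtrV ?(ltW u1)//; set w := Num.sqrt (1 + u ^+ 2).
have w0 : 0 < w by pos.
have ww : w * w = 1 + u ^+ 2 by rewrite -expr2 sqr_sqrtr ?ltW.
have uw : `|u| <= w by rewrite -sqrtr_sqr ler_wsqrtr// lerDr.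
have -> : `|u| * w^-1 ^+ 3 = w^-1 * w^-1 * (`|u| * w^-1) by ring.
rewrite -ww invfM; apply: ler_piMr; first by pos.
by rewrite ler_pdivrMr// mul1r.
Qed.

(** The bound is uniform in the heat time [r]: [weighted_conv] does not see [r], and in the free
    term the real part of the time is [r + 1 / 4], so [cabs2_hz3_quarter] applies. *)
Theorem weighted_smoothing : exists M : R, forall r : R, 0 < r <= 4^-1 ->
  (\int[lam]_t nint lam3 (fun y => (gauss3 1 y * cabs2 (smoothed r y t))%R) <= M%:E)%E.
Proof.
pose I := nint lam (fun x : R => (1 + x ^+ 2)^-1).
have If : (I < +oo)%E by exact: nint_cauchy_lty.
have I0 : (0 <= I)%E by apply: nint_ge0 => x; rewrite invr_ge0 addr_ge0 ?sqr_ge0.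
have IE : I = (fine I)%:E by rewrite fineK// ge0_fin_numE.
pose A : R := 2 * (Num.sqrt pi ^+ 6 * (64 * pi ^+ 3)).
have A0 : 0 <= A by rewrite !mulr_ge0 ?exprn_ge0 ?sqrtr_ge0 ?pi_ge0.
exists (Num.sqrt (pi / 1) ^+ 3 * (A * fine I) + 2 * (K * Num.sqrt pi ^+ 3 * fine I)) => r /andP[r0 r4].
have mI : mfun (fun x : R => (1 + x ^+ 2)^-1).
  apply: mfun_invr_ge0 => [|x]; last by rewrite addr_ge0 ?sqr_ge0.
  meas.
have mg := mfun_gauss3 1.
pose f1 (z : pt R * R) := gauss3 1 z.1 * (A * (1 + z.2 ^+ 2)^-1).
pose f2 (z : pt R * R) := 2 * (gauss3 1 z.1 * cabs2 (cconv q (Hr r z.1) z.2)).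
have mS : mfun (fun z : pt R * R => gauss3 1 z.1 * cabs2 (smoothed r z.1 z.2)).
  by apply: measurable_funM; [exact: (measurableT_comp mg)|exact: (cmeas_cabs2 (cmeas_smoothed r))].
have mf1 : mfun f1.
  apply: measurable_funM; first exact: (measurableT_comp mg).
  by apply: measurable_funM => //; exact: (measurableT_comp mI).
have mc : mfun (fun z : pt R * R => gauss3 1 z.1 * cabs2 (cconv q (Hr r z.1) z.2)).
  by apply: measurable_funM; [exact: (measurableT_comp mg)|exact: (cmeas_cabs2 (cmeas_conv2 r))].
have mf2 : mfun f2 by meas.
have i0 (x : R) : 0 <= (1 + x ^+ 2)^-1 by rewrite invr_ge0 addr_ge0 ?sqr_ge0.
have f10 z : 0 <= f1 z by pos.
have c0 z : 0 <= gauss3 1 z.1 * cabs2 (cconv q (Hr r z.1) z.2) by pos.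
have f20 z : 0 <= f2 z by pos.
rewrite -(nint_prod2 lam3 lam mS); last by move=> z; rewrite mulr_ge0 ?gauss3_ge0 ?cabs2_ge0.
apply: (@le_trans _ _ (nint (prodm lam3 lam) (fun z => f1 z + f2 z))).
  apply: le_nint => //.
  - meas.
  - by move=> z; rewrite mulr_ge0 ?gauss3_ge0 ?cabs2_ge0.
  move=> [y t]; rewrite /f1 /f2 /=.
  have -> : gauss3 1 y * (A * (1 + t ^+ 2)^-1) + 2 * (gauss3 1 y * cabs2 (cconv q (Hr r y) t)) =
    gauss3 1 y * (A * (1 + t ^+ 2)^-1 + 2 * cabs2 (cconv q (Hr r y) t)) by ring.
  apply: ler_wpM2l; first exact: gauss3_ge0.
  apply: le_trans (cabs2D _ _) _; apply: lerD; last by rewrite [in leLHS]cabs2M cabs2E cabs_iC expr1n mul1r.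
  have r5 : 4^-1 <= r + 4^-1 by rewrite lerDr ltW.
  rewrite /A -[leRHS]mulrA ler_pM2l// [cabs2 (_ * _)]cabs2M -cRX cabs2_cR -exprM -[leRHS]mulrA.
  apply: ler_wpM2l; first by [].
  exact: cabs2_hz3_quarter.
rewrite nintD// EFinD; apply: leeD.
  have -> : nint (prodm lam3 lam) f1 = (nint lam3 (gauss3 1) * nint lam (fun x : R => (A * (1 + x ^+ 2)^-1)%R))%E.
    apply: (nint_tensor lam3 lam (a := gauss3 1) (b := fun x : R => A * (1 + x ^+ 2)^-1)) => //.
      meas.
      exact: gauss3_ge0.
    by move=> x; exact: mulr_ge0.
  by rewrite nint_gauss3// (nintZ lam A0 mI i0) -/I IE -!EFinM.
rewrite nintZ// EFinM; apply: lee_wpmul2l => //.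
rewrite (nint_prod1 lam3 lam mc c0) EFinM -IE; apply: le_trans (weighted_conv r0).
apply: le_of_eq; apply: eq_integral => y _.
have mt := cmeas_cabs2 (cmeas_sec1 y (cmeas_conv2 r)).
by rewrite (nintZ lam (gauss3_ge0 1 y) mt) => // t; exact: cabs2_ge0.
Qed.
End WeightedDecay.

(** * Integrability in time of the mass in a ball *)

Section LocalDecay.
Variable R : realType.
Local Notation lam := (@lam R).
Local Notation lam3 := (@lam3 R).
Variable Rad : R.
Hypothesis Rad0 : 0 < Rad.

Definition cball : set (pt R) := [set x | nrm x <= Rad].
Definition Fb (Psi : pt R -> R[i]) : \bar R := nint lam3 (fun x => \1_cball x * cabs2 (Psi x)).
Lemma mfun_cball : measurable cball.
Proof.
have m : measurable_fun [set: pt R] (@nrm R).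
  exact: (measurableT_comp (@mfun_sqrt R) (@mfun_nrm2 R)).
rewrite (_ : cball = setT `&` (@nrm R) @^-1` `]-oo, Rad]); last first.
  by apply/seteqP; split => x /=; rewrite in_itv /=; [move=> h|move=> []].
by apply: m => //; meas.
Qed.
Lemma mfun_ball_indic : mfun (\1_cball : pt R -> R).
Proof. by apply: measurable_indic; exact: mfun_cball. Qed.
Lemma ball_indic01 x : 0 <= (\1_cball x : R) <= 1.
Proof. by rewrite indicE; case: (_ \in _); rewrite ?lexx ?ler01. Qed.
Lemma mfun_Fb (Psi : pt R -> R[i]) : cmeas Psi -> mfun (fun x => \1_cball x * cabs2 (Psi x)).
Proof. by move=> mP; apply: measurable_funM; [exact: mfun_ball_indic|exact: cmeas_cabs2]. Qed.
Lemma Fb_int_ge0 (Psi : pt R -> R[i]) x : 0 <= \1_cball x * cabs2 (Psi x).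
Proof. pos. Qed.
Lemma Fb_le Psi : cmeas Psi -> (Fb Psi <= Nm lam3 Psi)%E.
Proof.
move=> mP; apply: le_nint.
- exact: mfun_Fb.
- meas.
- exact: Fb_int_ge0.
by move=> x; have /andP[_ h] := ball_indic01 x; rewrite ler_piMl ?cabs2_ge0.
Qed.

Lemma FbDz f g (c : R[i]) : cmeas f -> cmeas g ->
  (Fb (fun x => (f x + c * g x)%R) <= 2%:E * Fb f + (2 * cabs2 c)%:E * Fb g)%E.
Proof.
move=> mf mg; have c0 := cabs2_ge0 c.
rewrite /Fb -!nintZ ?mulr_ge0//; try exact: mfun_Fb; try exact: Fb_int_ge0.
have mF := mfun_Fb mf; have mG := mfun_Fb mg.
rewrite -nintD; last 4 first.
- meas.
- meas.
- by move=> x; apply: mulr_ge0 => //; exact: Fb_int_ge0.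
- by move=> x; rewrite mulr_ge0 ?Fb_int_ge0// mulr_ge0.
apply: le_nint.
- by apply: mfun_Fb; apply: cmeasD => //; apply: cmeasM => //; meas.
- meas.
- exact: Fb_int_ge0.
move=> x; have /andP[h _] := ball_indic01 x.
have -> : 2 * (\1_cball x * cabs2 (f x)) + 2 * cabs2 c * (\1_cball x * cabs2 (g x)) =
  \1_cball x * (2 * cabs2 (f x) + 2 * (cabs2 c * cabs2 (g x))) by ring.
by apply: ler_wpM2l => //; apply: le_trans (cabs2D _ _) _; rewrite [cabs2 (c * _)]cabs2M.
Qed.

(** The majorant is the lower limit, as the heat time goes to zero, of the weighted norms of the
    regularised states. Fatou bounds its integral by the uniform constant of [weighted_smoothing],
    and for each fixed time the heat approximation shows that it dominates the mass in the ball. *)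
Lemma local_decay (q : R -> R[i]) (b : pt R) (Ps : R -> pt R -> R[i]) :
  cL2 q -> (forall s, s <= 0 -> q s = 0) -> (forall t, 0 < t -> inL2 lam3 (Ps t)) ->
  (forall t r y, 0 < t -> 0 < r <= 4^-1 ->
     cint lam3 (fun x => hz3 (cR r) (ptsub x y) * Ps t x) = smoothed q b r y t) ->
  exists M : R -> \bar R, [/\ mfun M, forall t, (0 <= M t)%E,
    (\int[lam]_t M t < +oo)%E & forall t, 0 < t -> (Fb (Ps t) <= M t)%E].
Proof.
move=> l2q q0 LP smE; have [K HK] := weighted_smoothing b l2q q0.
(* The factor [2] comes from squaring a sum, [e^(Rad^2)] from the lower bound of the Gaussian weight
   on the ball, and [p^6] from the normalisation of [heat] against [smoothed]. *)
pose p : R := (2 * pi)^-1; pose k : R := 2 * (expR (Rad ^+ 2) * p ^+ 6).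
have p0 : 0 < p by rewrite invr_gt0 mulr_gt0 ?pi_gt0.
have k0 : 0 <= k by rewrite !mulr_ge0 ?expR_ge0 ?exprn_ge0 ?ltW.
pose fr n (z : pt R * R) := gauss3 1 z.1 * cabs2 (smoothed q b (rn R n) z.1 z.2).
have mfr n : mfun (fr n).
  apply: measurable_funM; first exact: (measurableT_comp (mfun_gauss3 1)).
  exact: (cmeas_cabs2 (cmeas_smoothed b l2q _)).
have fr0 n z : 0 <= fr n z by pos.
pose m n t := (k%:E * nint lam3 (fun y => fr n (y, t)))%E.
have m0 n t : (0 <= m n t)%E by rewrite mule_ge0 ?lee_fin//; apply: nint_ge0 => y; exact: fr0.
have mn n : mfun (fun t => nint lam3 (fun y => fr n (y, t))).
  exact: (mfun_nint2 lam3 (mfr n)).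
have mm n : mfun (m n) by apply: emeasurable_funM.
have mint n : (\int[lam]_t m n t <= (k * K)%:E)%E.
  rewrite /m ge0_integralZl//; last 1 first.
    by move=> t _; apply: nint_ge0 => y; exact: fr0.
  by rewrite (EFinM k K); apply: lee_wpmul2l; rewrite ?lee_fin//; apply: HK; rewrite rn_gt0 rn_le.
have heatE n t y : 0 < t -> heat (rn R n) (Ps t) y = cR p ^+ 3 * smoothed q b (rn R n) y t.
  move=> t0; have rn0 := rn_gt0 R n; have pC0 : cR p ^+ 3 != 0 :> R[i] by rewrite expf_neq0// cR_eq0 gt_eqF.
  have e x : cR (gk3 (rn R n) (ptsub x y)) * Ps t x = cR p ^+ 3 * (hz3 (cR (rn R n)) (ptsub x y) * Ps t x).
    by rewrite gk3_hz3// mulrA.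
  have l1 : cL1 lam3 (fun x => hz3 (cR (rn R n)) (ptsub x y) * Ps t x).
    apply: (eq_cL1 _ (cL1Z (cR p ^+ 3)^-1 (cL1_heat y rn0 (LP t t0)))) => x.
    by rewrite e mulrA mulVf ?mul1r.
  by rewrite /heat (eq_cint _ e) cintZ// smE// rn0 rn_le.
exists (fun t => limn_einf (m^~ t)); split.
- rewrite -[X in measurable_fun _ X]/(-%E \o (fun t => limn_esup (-%E \o m^~ t))).
  have mo : mfun (-%E : \bar R -> \bar R) by [].
  apply: (measurableT_comp mo).
  by apply: (measurable_fun_limn_esup (f := fun n t => (- m n t)%E)) => n; exact: (measurableT_comp mo).
- by move=> t; rewrite limn_einf_lim; apply: lime_ge; [exact: is_cvg_einfs|apply: nearW => n; apply: le_ereal_inf_tmp => _ [i _ <-]].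
- apply: (@le_lt_trans _ _ (k * K)%:E); last exact: ltry.
  apply: le_trans (fatou _ _ _ _) _ => //.
  rewrite limn_einf_lim; apply: lime_le; first exact: is_cvg_einfs.
  by apply: nearW => n; apply: ge_ereal_inf; exists (\int[lam]_t m n t)%E => //; exists n => //=.
move=> t t0; have [mP fP] := LP t t0.
apply/lee_addgt0Pr => e e0.
have e20 : 0 < e / 2 by pos.
rewrite -leeBlDr// limn_einf_lim; apply: lime_ge; first exact: is_cvg_einfs.
have [N _ HN] := heat_approximates (LP t t0) e20.
exists N => // n Nn; apply: le_ereal_inf_tmp => _ [i ni <-].
have hi := HN i (leq_trans Nn ni).
rewrite leeBlDr//; apply: (@le_trans _ _ (m i t + 2%:E * (e / 2)%:E)%E); last first.
  by rewrite -EFinM mulrCA mulfV ?mulr1.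
have mh := cmeas_heat (rn R i) mP; have md := cmeasB mP mh.
have mft : mfun (fun y => fr i (y, t)).
  exact: (measurableT_comp (mfr i) (pair2_measurable t)).
apply: (@le_trans _ _ (m i t + 2%:E * Nm lam3 (fun x => (Ps t x - heat (rn R i) (Ps t) x)%R))%E); last first.
  by apply: leeD2l; apply: lee_wpmul2l => //; exact: hi.
have mcd := cmeas_cabs2 md.
rewrite /m /Nm -(nintZ lam3 k0 mft (fun y => fr0 i (y, t))) -(nintZ lam3 (ler0n R 2) mcd); last first.
  pos.
rewrite -nintD; last 4 first.
- meas.
- meas.
- by move=> y; apply: mulr_ge0.
- by move=> y; rewrite mulr_ge0 ?cabs2_ge0.
apply: le_nint.
- exact: mfun_Fb.
- meas.
- exact: Fb_int_ge0.
move=> x; have := fr0 i (x, t); rewrite indicE; case: (boolP (x \in cball)) => [|_] fx0; last first.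
  by rewrite mul0r addr_ge0// mulr_ge0 ?cabs2_ge0.
rewrite mul1r => _; move: fx0; rewrite inE /cball /= => xB.
have -> : Ps t x = heat (rn R i) (Ps t) x + (Ps t x - heat (rn R i) (Ps t) x) by rewrite addrC subrK.
apply: le_trans (cabs2D _ _) _; apply: lerD; last by rewrite [in leRHS]addrAC subrr add0r.
rewrite heatE// [cabs2 (_ * _)]cabs2M -cRX cabs2_cR -exprM.
set S := cabs2 _; have S0 : 0 <= S by exact: cabs2_ge0.
have -> : k * fr i (x, t) = 2 * (p ^+ 6 * S * (expR (Rad ^+ 2) * gauss3 1 x)) by rewrite /k /fr /= -/S; ring.
rewrite ler_pM2l//.
apply: ler_peMr; first by rewrite mulr_ge0// exprn_ge0// ltW.
rewrite /gauss3 mul1r -expRD -expR0 ler_expR subr_ge0.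
have -> : nrm2 x = nrm x ^+ 2 by rewrite sqr_sqrtr ?nrm2_ge0.
by rewrite lerXn2r// nnegrE ?sqrtr_ge0// ltW.
Qed.
End LocalDecay.

(** * Transfer to the integrals of the statement *)

Section Bridges.
Variable R : realType.
Local Notation lam := (@lam R).
Local Notation lam3 := (@lam3 R).
Local Notation mR := (measurableTypeR R).
Local Notation mR3 := (mR * mR * mR)%type.

(** A nonnegative integral is a supremum over simple functions below the integrand, hence monotone
    for arbitrary functions. This form serves the time average, since [is_propagator] asserts no
    measurability in [t]. *)
Lemma le_integral_any d (T : measurableType d) (mu : {measure set T -> \bar R}) (D : set T) (f g : T -> \bar R) :
  (forall x, D x -> (0 <= f x)%E) -> (forall x, D x -> (f x <= g x)%E) ->
  (\int[mu]_(x in D) f x <= \int[mu]_(x in D) g x)%E.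
Proof.
move=> f0 fg; have g0 x : D x -> (0 <= g x)%E by move=> Dx; exact: le_trans (f0 x Dx) (fg x Dx).
rewrite !ge0_integralE//; apply: ereal_sup_le => _ [h hf <-]; exists h => // x.
by apply: le_trans (hf x) _; rewrite !patchE; case: ifPn => // /[!inE] Dx; exact: fg.
Qed.

Let l3 : {measure set mR3 -> \bar R} :=
  ((@lebesgue_measure R \x @lebesgue_measure R) \x @lebesgue_measure R)%E.
Lemma L2_inL2 (f : pt R -> R[i]) : L2 f <-> inL2 lam3 f.
Proof.
have E : (@integral _ (R * R * R)%type R (@leb3 R) setT (fun x => (cabs2 (f x))%:E) = Nm lam3 f)%E.
  exact: leb3_integral_prod.
split=> [[mr [mi fi]]|[[mr mi] fi]].
  have mf : cmeas f by [].
  by split; [exact: mf|rewrite -E; exact: fi].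
split; [exact: mr|split; [exact: mi|]].
by move: fi; rewrite -E.
Qed.

Lemma norm2_Nm (f : pt R -> R[i]) : inL2 lam3 f -> (norm2 f)%:E = Nm lam3 f.
Proof.
move=> [mf fi]; have mc := cmeas_cabs2 mf.
rewrite /Nm -(nint_Rintegral mc (fun x => cabs2_ge0 _) fi); congr _%:E.
exact: (leb3_Rintegral measurableT mc).
Qed.
Lemma nint_ae_eq (f g : pt R -> R) : mfun f -> mfun g ->
  (forall x, 0 <= f x) -> (forall x, 0 <= g x) ->
  {ae leb3 (R := R), forall x, f x = g x} -> nint lam3 f = nint lam3 g.
Proof.
move=> mf mg f0 g0 fg.
have mfE : mfun (fun x => (f x)%:E) by apply/measurable_EFinP.
have mgE : mfun (fun x => (g x)%:E) by apply/measurable_EFinP.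
rewrite /nint -(leb3_integral measurableT mfE) -(leb3_integral measurableT mgE).
apply: (@ge0_ae_eq_integral _ mR3 R l3 setT (fun x => (f x)%:E) (fun x => (g x)%:E)) => //.
- by move=> x _; rewrite lee_fin.
- by move=> x _; rewrite lee_fin.
- by case: fg => N [mN N0 HN]; exists N; split => // x /= nfg; apply: HN => /= e; apply: nfg => _; rewrite e.
Qed.
End Bridges.

(** * Decaying states: Gaussians and their closed span *)

Section GaussianDecay.
Variable R : realType.
Local Notation lam := (@lam R).
Local Notation lam3 := (@lam3 R).
Variables (alpha : R -> R) (U : R -> (pt R -> R[i]) -> pt R -> R[i]) (Rad : R).
Hypothesis HU : is_propagator alpha U.
Hypothesis Rad0 : 0 < Rad.

(** A measurable integrable majorant stands in for integrability in [t] of the mass itself. The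
    constant [e] is what makes the property stable under L2 limits: [M] may depend on it. *)
Definition decays (Psi : pt R -> R[i]) := inL2 lam3 Psi /\ forall e : R, 0 < e ->
  exists M : R -> \bar R, [/\ mfun M, forall t, (0 <= M t)%E,
    (\int[lam]_t M t < +oo)%E & forall t, 0 <= t -> (Fb Rad (U t Psi) <= e%:E + M t)%E].
Lemma inL2_U t Psi : 0 <= t -> inL2 lam3 Psi -> inL2 lam3 (U t Psi).
Proof. by have [UL _] := HU; move=> t0 /(L2_inL2 Psi).2 L; apply: (L2_inL2 _).1; exact: UL. Qed.

Lemma Nm_U t Psi : 0 <= t -> inL2 lam3 Psi -> Nm lam3 (U t Psi) = Nm lam3 Psi.
Proof.
have [_ [_ [_ [UN _]]]] := HU; move=> t0 L.
by rewrite -norm2_Nm; [rewrite UN// ?norm2_Nm//; exact: (L2_inL2 Psi).2|exact: inL2_U].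
Qed.
Lemma Fb_U t f g (c : R[i]) : 0 <= t -> inL2 lam3 f -> inL2 lam3 g ->
  (Fb Rad (U t (fun x => (f x + c * g x)%R)) <= 2%:E * Fb Rad (U t f) + (2 * cabs2 c)%:E * Fb Rad (U t g))%E.
Proof.
have [_ [Ulin _]] := HU; move=> t0 lf lg.
have [m1 _] := inL2_U t0 lf; have [m2 _] := inL2_U t0 lg; have [m3 _] := inL2_U t0 (inL2Dz c lf lg).
apply: le_trans (FbDz Rad c m1 m2); apply: le_of_eq.
apply: nint_ae_eq.
- exact: mfun_Fb.
- by apply: mfun_Fb; apply: cmeasD => //; apply: cmeasM => //; meas.
- exact: Fb_int_ge0.
- by move=> x; exact: (Fb_int_ge0 Rad (fun x => U t f x + c * U t g x)).
case: (Ulin t f g c t0 ((L2_inL2 f).2 lf) ((L2_inL2 g).2 lg)) => N [mN N0 HN].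
by exists N; split => // x /= n; apply: HN => /= e; apply: n; rewrite e.
Qed.

Lemma inL2_gauss b : inL2 lam3 (gauss b).
Proof.
have [mg fg] := cL1_gauss b; split => //; apply: le_lt_trans fg; apply: le_nint.
- meas.
- meas.
- pos.
move=> x; rewrite cabs2E expr2; apply: ler_piMl; first exact: cabs_ge0.
by rewrite cabs_cRp ?expR_ge0// -expR0 ler_expR oppr_le0 nrm2_ge0.
Qed.

Lemma decays_gauss (T : R) (a : int -> R[i]) (b : pt R) :
  continuous alpha -> 0 < T -> (exists B : R, forall N : nat, abs_partial a N <= B) ->
  (forall t : R, ccvg_seq (fourier_partial a (2 * pi / T) t) (cR (alpha t))) -> generic a ->
  decays (gauss b).
Proof.
move=> ca T0 sa fa ga; have lg := inL2_gauss b; split => // e e0.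
have [q [l2q cq q0 vq]] := volterra_gauss b ca T0 sa fa ga.
have [cre_q cim_q] := ccont_re cq.
have [_ [_ [_ [_ [_ Uvol]]]]] := HU.
have LP t : 0 < t -> inL2 lam3 (U t (gauss b)) by move=> /ltW t0; exact: inL2_U.
have smE t r y : 0 < t -> 0 < r <= 4^-1 ->
    cint lam3 (fun x => hz3 (cR r) (ptsub x y) * U t (gauss b) x) = smoothed q b r y t.
  move=> t0 r0.
  have W g := Uvol t b q t0 (continuous_subspaceT cre_q) (continuous_subspaceT cim_q) vq g.
  exact: (smoothed_propagator l2q q0 t0 (LP t t0) W y r0).
have [M [mM M0 MI HM]] := local_decay Rad0 l2q q0 LP smE.
pose c := fine (Nm lam3 (gauss b)); have c0 : 0 <= c by apply: fine_ge0; exact: Nm_ge0.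
have mr : mfun (fun t : R => c * rgauss 1 t) by meas.
have r0 t : 0 <= c * rgauss 1 t by pos.
(* [local_decay] covers positive times only; the added Gaussian in [t] equals the full squared norm
   at [t = 0]. *)
exists (fun t => M t + (c * rgauss 1 t)%:E)%E; split.
- by apply: emeasurable_funD => //; apply/measurable_EFinP.
- by move=> t; rewrite adde_ge0 ?lee_fin.
- rewrite ge0_integralD//; last by apply/measurable_EFinP.
    apply: lte_add_pinfty => //.
    rewrite -/(nint lam (fun t => c * rgauss 1 t)) nintZ//; first by rewrite nint_rgauss// -EFinM ltry.
      meas.
    by move=> t; exact: expR_ge0.
  by move=> t _; rewrite lee_fin.
move=> t; rewrite le_eqVlt => /orP[/eqP <-|t0]; last first.
  by apply: le_trans (HM t t0) _; rewrite addeCA -[leLHS]adde0 leeD2l// adde_ge0// lee_fin// ltW.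
apply: (@le_trans _ _ (c * rgauss 1 0)%:E).
  rewrite /rgauss expr0n /= mulr0 oppr0 expR0 mulr1 /c NmE// -(Nm_U (lexx 0) lg).
  by apply: Fb_le; case: (inL2_U (lexx 0) lg).
by rewrite addeA -[leLHS]add0e; apply: leeD => //; rewrite adde_ge0// lee_fin ltW.
Qed.

(** [U t] is an isometry, so replacing the state by an approximant costs a constant independent of
    time, which is charged to [e]; linear combinations rescale the constants and the majorants. *)
Lemma decays_closed : closed_subspace lam3 decays.
Proof.
have scale (k d : R) (X M : \bar R) : 0 <= k -> (0 <= M)%E -> (X <= d%:E + M)%E ->
    (k%:E * X <= (k * d)%:E + k%:E * M)%E.
  move=> k0 M0 XM; rewrite EFinM -muleDr// ?fin_num_adde_defr//.
  by apply: lee_wpmul2l; rewrite ?lee_fin.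
have Mscale (M : R -> \bar R) (k : R) : 0 <= k -> mfun M -> (forall t, (0 <= M t)%E) ->
    (\int[lam]_t M t < +oo)%E -> [/\ mfun (fun t => (k%:E * M t)%E),
      forall t, (0 <= k%:E * M t)%E & (\int[lam]_t (k%:E * M t) < +oo)%E].
  move=> k0 mM M0 MI; split.
  - exact: emeasurable_funM.
  - by move=> t; rewrite mule_ge0.
  by rewrite ge0_integralZl//; exact: lte_mul_pinfty.
split.
  move=> f g c [lf Hf] [lg Hg]; split; first exact: inL2Dz.
  move=> e e0; pose k := 2 * cabs2 c; have k0 : 0 <= k by pos.
  have d0 : 0 < e / (2 + k) by rewrite divr_gt0// ltr_wpDr.
  have [M1 [m1 p1 i1 h1]] := Hf _ d0; have [M2 [m2 p2 i2 h2]] := Hg _ d0.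
  have [m1' p1' i1'] := Mscale _ 2 (ler0n _ _) m1 p1 i1; have [m2' p2' i2'] := Mscale _ k k0 m2 p2 i2.
  exists (fun t => 2%:E * M1 t + k%:E * M2 t)%E; split.
  - exact: emeasurable_funD.
  - by move=> t; rewrite adde_ge0.
  - by rewrite ge0_integralD//; exact: lte_add_pinfty.
  move=> t t0; apply: le_trans (Fb_U c t0 lf lg) _.
  apply: le_trans (leeD (scale 2 _ _ _ (ler0n _ _) (p1 t) (h1 t t0)) (scale k _ _ _ k0 (p2 t) (h2 t t0))) _.
  rewrite addeACA -EFinD -mulrDl mulrCA mulfV ?mulr1//.
  by rewrite gt_eqF// ltr_wpDr.
move=> f lf H; split => // e e0; have d0 : 0 < e / 4 by pos.
have [g [lg Hg] Nfg] := H _ d0; have [M [mM pM iM hM]] := Hg _ d0.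
have [m1 p1 i1] := Mscale _ 2 (ler0n _ _) mM pM iM.
exists (fun t => 2%:E * M t)%E; split => // t t0.
have ld : inL2 lam3 (fun x => f x - g x).
  by have := inL2Dz (-1) lf lg; congr (inL2 _ _); apply/funext => x; rewrite mulN1r.
have -> : U t f = U t (fun x => g x + 1 * (f x - g x)).
  by congr (U t _); apply/funext => x; rewrite mul1r addrC subrK.
apply: le_trans (Fb_U 1 t0 lg ld) _.
have -> : cabs2 (1 : R[i]) = 1 by rewrite cabs2E cabs1 expr1n.
rewrite mulr1; have [md _] := inL2_U t0 ld.
have b2 : (2%:E * Fb Rad (U t (fun x => (f x - g x)%R)) <= (2 * (e / 4))%:E)%E.
  rewrite EFinM; apply: lee_wpmul2l => //; apply: le_trans (Fb_le Rad md) _.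
  by rewrite Nm_U.
apply: le_trans (leeD (scale 2 _ _ _ (ler0n _ _) (pM t) (hM t t0)) b2) _.
by rewrite addeAC -EFinD; apply: leeD2r; rewrite lee_fin; lra.
Qed.
End GaussianDecay.

(** * Time averages *)

Section Cesaro.
Variable R : realType.
Local Notation lam := (@lam R).
Local Notation lam3 := (@lam3 R).
Local Notation mR := (measurableTypeR R).
Local Notation mR3 := (mR * mR * mR)%type.

Lemma Rintegral_ball (Rad : R) (Psi : pt R -> R[i]) : inL2 lam3 Psi ->
  (@Rintegral _ mR3 R (@leb3 R) [set x | nrm x <= Rad] (fun x => cabs2 (Psi x)))%:E = Fb Rad Psi.
Proof.
move=> [mP fP]; have mc := cmeas_cabs2 mP.
have -> : @Rintegral _ mR3 R (@leb3 R) [set x | nrm x <= Rad] (fun x => cabs2 (Psi x)) =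
    Rintegral lam3 (cball Rad) (fun x => cabs2 (Psi x)).
  exact: (leb3_Rintegral (mfun_cball Rad) mc).
rewrite /Fb -(nint_Rintegral (mfun_Fb Rad mP) (Fb_int_ge0 Rad Psi)); last exact: le_lt_trans (Fb_le Rad mP) fP.
congr _%:E; rewrite Rintegral_mkcond; apply: eq_Rintegral => x _.
by rewrite /patch indicE; case: ifP; rewrite ?mul1r ?mul0r.
Qed.

Lemma cesaro_le (g : R -> R) (M : R -> \bar R) (e t : R) : 0 < t -> 0 <= e ->
  mfun M -> (forall s, (0 <= M s)%E) -> (\int[lam]_s M s < +oo)%E ->
  (forall s, 0 <= g s) -> (forall s, 0 <= s -> ((g s)%:E <= e%:E + M s)%E) ->
  0 <= t^-1 * @Rintegral _ mR R (@leb1 R) `[0, t] g <= e + t^-1 * fine (\int[lam]_s M s)%E.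
Proof.
move=> t0 e0 mM M0 MI g0 gM; pose A := @integral _ mR R (@leb1 R) `[0, t]%classic (EFin \o g).
have A0 : (0 <= A)%E.
  by apply: (@integral_ge0 _ mR R lebesgue_measure) => x _; rewrite lee_fin.
have IE : (\int[lam]_s M s)%E = (fine (\int[lam]_s M s))%:E by rewrite fineK// ge0_fin_numE// integral_ge0.
set I := fine _ in IE *.
have AI : (A <= (e * t + I)%:E)%E.
  apply: (@le_trans _ _ (@integral _ mR R lebesgue_measure `[0%R, t] (fun s => e%:E + M s)%E)).
    apply: (@le_integral_any R _ mR lebesgue_measure) => x; rewrite /= in_itv /= => /andP[x0 _].
      by rewrite lee_fin.
    exact: gM.
  rewrite leb_integral//; last by apply: emeasurable_funD.
  rewrite ge0_integralD//; last exact: measurable_funTS.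
  rewrite integral_cst// EFinD; apply: leeD.
    have Lt : lam `[0%R, t]%classic = t%:E by rewrite /lam lebesgue_measure_itv /= lte_fin t0 -EFinB subr0.
    rewrite EFinM; apply: lee_wpmul2l; first by [].
    by apply: le_of_eq; exact: Lt.
  rewrite -IE; apply: ge0_subset_integral => //.
have t1 : 0 <= t^-1 by pos.
rewrite mulr_ge0//=; last exact: fine_ge0.
have fA : fine A <= e * t + I.
  rewrite -lee_fin fineK// ge0_fin_numE//; exact: le_lt_trans AI (ltry _).
apply: le_trans (ler_wpM2l t1 fA) _.
by rewrite mulrDr mulrCA mulVf ?mulr1// gt_eqF.
Qed.
End Cesaro.

Theorem mainTheorem11 (R : realType) (alpha : R -> R) (T : R) (a : int -> C R)
  (U : R -> (pt R -> C R) -> (pt R -> C R)) :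
  continuous alpha ->
  0 < T ->
  (forall t, alpha (t + T) = alpha t) ->
  (exists B : R, forall N : nat, abs_partial a N <= B) ->
  (forall t : R, ccvg_seq (fourier_partial a (2 * pi / T) t) (cR (alpha t))) ->
  (forall n : int, a n = (a (- n))^*) ->
  alpha 0 < 0 ->
  a 0 < 0 ->
  generic a ->
  is_propagator alpha U ->
  forall Psi : pt R -> C R, L2 Psi ->
  forall Rad : R, 0 < Rad ->
    (t^-1 * Rintegral (@leb1 R) `[0, t]
       (fun tau => Rintegral (@leb3 R) [set x | nrm x <= Rad]
                     (fun x => cabs2 (U tau Psi x))))
      @[t --> +oo] --> 0.
Proof.
move=> ca T0 _ sa fa _ _ _ ga HU Psi LPsi Rad Rad0.
have lP := (L2_inL2 Psi).1 LPsi.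
have [_ HP] : decays U Rad Psi.
  apply: (gaussians_dense3 (S := decays U Rad)) => // [|b]; first exact: decays_closed HU.
  exact: (decays_gauss HU Rad0 b ca T0 sa fa ga).
apply/cvgrPdist_le => e e0; have e20 : 0 < e / 2 by pos.
have [M [mM M0 MI HM]] := HP _ e20.
pose I := fine (\int[@lam R]_s M s)%E; have I0 : 0 <= I by apply: fine_ge0; exact: integral_ge0.
near=> t.
have t0 : 0 < t by [].
have tI : 2 * I / e <= t by [].
rewrite sub0r normrN.
have := @cesaro_le R (fun s => Rintegral (@leb3 R) [set x | nrm x <= Rad] (fun x => cabs2 (U s Psi x)))
  M (e / 2) t t0 (ltW e20) mM M0 MI.
case/(_ _ _)/andP.
- by move=> s; apply: fine_ge0; apply: integral_ge0 => x _; rewrite lee_fin cabs2_ge0.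
- by move=> s s0; rewrite (Rintegral_ball Rad (inL2_U HU s0 lP)); exact: HM.
move=> h1 h2; rewrite ger0_norm//; apply: le_trans h2 _.
have : t^-1 * I <= e / 2.
  by rewrite mulrC ler_pdivrMr//; move: tI; rewrite ler_pdivrMr//; lra.
by rewrite -/I; lra.
Unshelve. all: by end_near. Qed.
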